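(* Let $\ell\in\mathbb{N}_0$. If $\ell=0$, let $M$ be a $\sigma$-compact, locally compact rough $C^\infty$-manifold; if $\ell>0$, let $M$ be a $\sigma$-compact, locally compact $C^\infty$-manifold with corners. Let $\pi\colon N\to M$ be a locally trivial smooth fibre bundle over $M$ whose fibres are smooth manifolds modelled on locally convex spaces. Let $\sigma\in\Gamma_{C^\ell}(M\leftarrow N)$, $\Omega\subseteq\Gamma_{C^\ell}(M\leftarrow N)$ be a neighbourhood of $\sigma$ in the Whitney $C^\ell$-topology, $U\subseteq M$ be open and $A\subseteq M$ be a closed subset such that $\sigma$ is smooth on an open neighbourhood of $A\setminus U$ in $M$. Let $V_{\mathrm{reg}}$ be the largest open subset of $M$ on which $\sigma$ is smooth. Then there exists a section $\tau\in\Omega$ and a homotopy $H\colon[0,1]\times M\to N$ from $\sigma=H(0,\cdot)$ to $\tau=H(1,\cdot)$ such that $H_t:=H(t,\cdot)\in\Omega$ for all $t\in[0,1]$ and the following holds: (a) $\sigma|_{M\setminus U}=H_t|_{M\setminus U}$ for all $t\in[0,1]$; (b) $H_t$ is smooth on $V_{\mathrm{reg}}$, for all $t\in[0,1]$; (c) There exists an open neighbourhood $W$ of $A$ in $M$ such that $H_t|_W$ is smooth for all $t\in\,]0,1]$. Moreover, one can achieve that $H$ is $RC^{0,\ell}$, the restriction $H|_{]0,1]\times M}$ is $RC^{\infty,\ell}$, and the restriction of $H$ to a map $]0,1]\times(V_{\mathrm{reg}}\cup W)\to N$ is smooth.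
   Context: ''Locally convex space'' (lcs) means a real, Hausdorff locally convex topological vector space. A subset of a topological space is regular if its interior (denoted ${}^0$) is dense in it. Calculus. For lcs $E,F$ and regular $R\subseteq E$, $f\colon R\to F$ is $C^\ell$ if it is continuous and for all $j\in\mathbb{N}$, $j\le\ell$, the iterated directional derivatives $(D_{y_j}\cdots D_{y_1}f)(x)$ exist for $x\in R^0$, $y_i\in E$ and extend to a continuous map $R\times E^j\to F$. For regular $R_1\subseteq E_1$, $R_2\subseteq E_2$ and $k,\ell\in\mathbb{N}_0\cup\{\infty\}$, a continuous map $f\colon R_1\times R_2\to F$ is $C^{k,\ell}$ if for all $i,j\in\mathbb{N}_0$ with $i\le k$, $j\le\ell$ the derivatives $(D_{(v_i,0)}\cdots D_{(v_1,0)}D_{(0,w_j)}\cdots D_{(0,w_1)}f)(x,y)$ exist for $x\in R_1^0$, $y\in R_2^0$, $v_a\in E_1$, $w_b\in E_2$, and extend to a continuous map $R_1\times R_2\times E_1^i\times E_2^j\to F$. Rough manifolds. A rough $C^\ell$-manifold is a Hausdorff space $M$ with a maximal set of homeomorphisms (charts) $\phi\colon U_\phi\to V_\phi$ from open sets covering $M$ onto regular subsets $V_\phi$ of lcs $E_\phi$ whose transition maps $\phi\circ\psi^{-1}$ are $C^\ell$ and take the interior of $\psi(U_\phi\cap U_\psi)$ in $E_\psi$ into the interior of $\phi(U_\phi\cap U_\psi)$ in $E_\phi$. $C^\ell$-manifolds with corners are the special case where the $V_\phi$ are relatively open subsets of sets $[0,\infty[^m\times\mathbb{R}^{d-m}$.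 The formal interior $M^\circ$ is the set of $x$ with $\phi(x)\in V_\phi^0$ for all charts $\phi$ around $x$. An $RC^\ell$-map between rough $C^\ell$-manifolds is a continuous map $f\colon M\to N$ with $f(M^\circ)\subseteq N^\circ$ which is $C^\ell$ in charts; an $RC^{k,\ell}$-map $f\colon M_1\times M_2\to N$ is a continuous map with $f(M_1^\circ\times M_2^\circ)\subseteq N^\circ$ which is $C^{k,\ell}$ in charts of $M_1$, $M_2$, $N$. ''Smooth'' for sections of $N$ and for maps into $N$ means $RC^\infty$. Fibre bundles. A smooth fibre bundle over $M$ is a rough $C^\infty$-manifold $N$ (modelled on lcs) with a surjective $RC^\infty$-map $\pi\colon N\to M$ such that for each $x\in M$ there are an open neighbourhood $U$ of $x$, a smooth manifold $N_x$ (without boundary) modelled on lcs, and an $RC^\infty$-diffeomorphism $\theta\colon\pi^{-1}(U)\to U\times N_x$ with first component $\pi|_{\pi^{-1}(U)}$. $\Gamma_{C^\ell}(M\leftarrow N)$ is the set of $RC^\ell$-maps $\sigma\colon M\to N$ with $\pi\circ\sigma=\mathrm{id}_M$. Whitney topology. For $\ell\in\mathbb{N}_0$, the compact-open $C^\ell$-topology on a set $RC^\ell(M,N)$ of $RC^\ell$-maps is the initial topology with respect to the maps $\gamma\mapsto T^j\gamma\in C(T^jM,T^jN)$, $0\le j\le\ell$ (iterated tangent maps), with compact-open topologies. For $M$ $\sigma$-compact and locally compact, the Whitney $C^\ell$-topology on $RC^\ell(M,N)$ is the initial topology with respect to $\gamma\mapsto(\gamma|_{M_n})_{n\in\mathbb{N}}\in\prod_{n\in\mathbb{N}}RC^\ell(M_n,N)$,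 where $(M_n)_{n\in\mathbb{N}}$ is a locally finite sequence of (possibly empty) relatively compact, regular subsets of $M$ whose interiors cover $M$, each factor carries the compact-open $C^\ell$-topology and the product carries the box topology (independent of the choice of $(M_n)$). $\Gamma_{C^\ell}(M\leftarrow N)$ carries the induced topology. *)

(* Defs.v *)
From HB Require Import structures.
From mathcomp Require Import all_boot all_order all_algebra.
From mathcomp Require Import all_classical all_reals all_analysis.
Import Order.TTheory GRing.Theory Num.Theory.
Import numFieldNormedType.Exports.

Set Implicit Arguments.
Unset Strict Implicit.
Unset Printing Implicit Defensive.

Local Open Scope classical_set_scope.
Local Open Scope ring_scope.

(* Orders of differentiability in N u {oo}: [Some l] is l, [None] is oo. *)
Definition order := option nat.
Definition le_order (j : nat) (l : order) : bool :=
  if l is Some k then (j <= k)%N else true.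

Definition regular_set (T : topologicalType) (A : set T) := A `<=` closure A°.

(* Calculus in locally convex spaces. A locally convex space is a [tvsType R]
   (local convexity is part of that structure) which is Hausdorff; the Hausdorff
   property is required of model spaces in [rough_manifold] below. A function
   defined on a subset R of E is represented by a total function E -> F of which
   only the values on R are used. *)
Section calculus.
Context {R : realType}.
Implicit Types E F : tvsType R.

(* [tvsType]s are not pointed, hence [lim] is not available. *)
Definition tvs_lim E (G : set_system E) : E := xget 0 [set l | G --> l].

(* The library's [derivable] and ['D_v f] are restricted to normed modules;
   these are the same difference quotients. *)
Definition diff_quot E F (f : E -> F) (x v : E) : R -> F :=
  fun h => h^-1 *: (f (x + h *: v) - f x).

Definition dir_derivable E F (f : E -> F) (x v : E) :=
  exists l : F, diff_quot f x v h @[h --> 0^'] --> l.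

Definition dir_derive E F (f : E -> F) (x v : E) : F :=
  tvs_lim (diff_quot f x v h @[h --> 0^']).

(* For ys = [:: y_1; ...; y_j] this is D_(y_j) ... D_(y_1) f. *)
Fixpoint iter_derive E F (f : E -> F) (ys : seq E) : E -> F :=
  if ys is y :: ys' then iter_derive (fun x => dir_derive f x y) ys' else f.

Fixpoint iter_derivable E F (O : set E) (f : E -> F) (ys : seq E) : Prop :=
  if ys is y :: ys' then
    (forall x, O x -> dir_derivable f x y) /\
    iter_derivable O (fun x => dir_derive f x y) ys'
  else True.

Definition is_C (l : order) E F (D : set E) (f : E -> F) : Prop :=
  {within D, continuous f} /\
  forall j : nat, le_order j l ->
    exists g : E * {ptws 'I_j -> E} -> F,
      {within [set p | D p.1], continuous g} /\
      forall y : 'I_j -> E,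
        iter_derivable D° f (codom y) /\
        forall x, D° x -> g (x, y) = iter_derive f (codom y) x.

Definition is_C2 (k l : order) E1 E2 F (D1 : set E1) (D2 : set E2)
    (f : E1 * E2 -> F) : Prop :=
  {within D1 `*` D2, continuous f} /\
  forall i j : nat, le_order i k -> le_order j l ->
    exists g : (E1 * E2) * ({ptws 'I_i -> E1} * {ptws 'I_j -> E2}) -> F,
      {within [set p | (D1 `*` D2) p.1], continuous g} /\
      forall (v : 'I_i -> E1) (w : 'I_j -> E2),
        let dirs : seq (E1 * E2) :=
          [seq (0, w b) | b <- enum 'I_j] ++ [seq (v a, 0) | a <- enum 'I_i] in
        iter_derivable (D1° `*` D2°) f dirs /\
        forall z, (D1° `*` D2°) z -> g (z, (v, w)) = iter_derive f dirs z.

(* The differential df(x, v) of a C^1-map f on D at a possibly non-interior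
   point x of D: the value at (x, v) of the continuous extension of
   (x', v) |-> D_v f(x') from D° x E to D x E. *)
Definition ext_derive E F (D : set E) (f : E -> F) (x v : E) : F :=
  tvs_lim (dir_derive f x' v @[x' --> within D° (nbhs x)]).

End calculus.

(* Raw data of a space with an atlas of charts [chart i : dom i -> V_i], where
   V_i = chart i @` dom i; all axioms are in [rough_manifold]. The atlas need
   not be maximal: it stands for the unique maximal atlas containing it, and
   the notions below do not depend on which atlas represents it. *)
Record charted_space (R : realType) := ChartedSpace {
  carrier :> topologicalType;
  idx : Type;
  model : idx -> tvsType R;
  dom : idx -> set carrier;
  chart : forall i : idx, carrier -> model i }.

Arguments idx {R} _.
Arguments model {R} _ _.
Arguments dom {R} _ _.
Arguments chart {R} _ _ _.

Section charted_spaces.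
Context {R : realType}.
Implicit Types M N : charted_space R.

Definition chart_im M (i : idx M) : set (model M i) := chart M i @` dom M i.
Arguments chart_im : clear implicits.

(* The map (chart j) o f o (chart i)^-1, on its natural domain [rep_dom f i j],
   and 0 elsewhere. *)
Definition rep_dom M N (f : M -> N) (i : idx M) (j : idx N) : set (model M i) :=
  chart M i @` (dom M i `&` f @^-1` dom N j).

Definition chart_rep M N (f : M -> N) (i : idx M) (j : idx N) :
    model M i -> model N j :=
  fun y => xget 0 [set z | exists x, [/\ dom M i x, dom N j (f x),
                                        chart M i x = y & chart N j (f x) = z]].
Arguments rep_dom {M N} f i j _.
Arguments chart_rep {M N} f i j _.

Definition rough_manifold (l : order) M : Prop :=
  [/\ hausdorff_space M,
      (forall i, hausdorff_space (model M i)),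
      (forall i, open (dom M i)) /\ \bigcup_i dom M i = setT,
      forall i,
        [/\ {within dom M i, continuous (chart M i)},
            {in dom M i &, injective (chart M i)},
            (forall O, open O -> O `<=` dom M i ->
               exists2 P, open P & chart M i @` O = chart_im M i `&` P)
          & regular_set (chart_im M i)]
    & forall i j,
        is_C l (rep_dom (@id M) i j) (chart_rep (@id M) i j) /\
        forall x, dom M i x -> dom M j x ->
          (rep_dom (@id M) i j)° (chart M i x) ->
          (rep_dom (@id M) j i)° (chart M j x)].

Definition quadrant (d m : nat) : set 'rV[R]_d :=
  [set x | forall i : 'I_d, (i < m)%N -> 0 <= x ord0 i].
Arguments quadrant : clear implicits.

Inductive corner_set : forall E : tvsType R, set E -> Prop :=
  CornerSet (d m : nat) (O : set 'rV[R]_d) :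
    (m <= d)%N -> open O -> @corner_set 'rV[R]_d (O `&` quadrant d m).

Definition manifold_with_corners M : Prop :=
  rough_manifold None M /\ forall i, corner_set (chart_im M i).

Definition smooth_manifold M : Prop :=
  rough_manifold None M /\ forall i, open (chart_im M i).

Definition formal_interior M : set M :=
  [set x | forall i, dom M i x -> (chart_im M i)° (chart M i x)].

Definition RC (l : order) M N (f : M -> N) : Prop :=
  [/\ continuous f,
      forall x, formal_interior x -> formal_interior (f x)
    & forall i j, is_C l (rep_dom f i j) (chart_rep f i j)].

(* The subset A of M with the charts of M restricted to A. *)
Definition restr M (A : set M) : charted_space R :=
  @ChartedSpace R (set_type A) (idx M) (model M)
    (fun i => set_val @^-1` dom M i) (fun i x => chart M i (set_val x)).

Arguments restr : clear implicits.

Definition restr_map M N (f : M -> N) (A : set M) : restr M A -> N :=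
  fun x => f (set_val x).
Arguments restr_map {M N} f A _.

Definition prod_space M N : charted_space R :=
  @ChartedSpace R (M * N)%type (idx M * idx N)%type
    (fun i => (model M i.1 * model N i.2)%type)
    (fun i => dom M i.1 `*` dom N i.2)
    (fun i x => (chart M i.1 x.1, chart N i.2 x.2)).

Definition real_line : charted_space R :=
  @ChartedSpace R R unit (fun _ => R^o) (fun _ => setT) (fun _ x => x).

(* C^{k,l}-maps are only defined on products; the open sets O1 and O2 restrict
   the charts of M1 and M2 so that f is defined on a product in the charts
   (restricted charts belong to the maximal atlas). *)
Definition RC2 (k l : order) M1 M2 N (f : M1 * M2 -> N) : Prop :=
  [/\ continuous f,
      forall x y, formal_interior x -> formal_interior y ->
        formal_interior (f (x, y))
    & forall (i1 : idx M1) (i2 : idx M2) (j : idx N)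
        (O1 : set M1) (O2 : set M2),
        open O1 -> open O2 -> O1 `<=` dom M1 i1 -> O2 `<=` dom M2 i2 ->
        O1 `*` O2 `<=` f @^-1` dom N j ->
        is_C2 k l (chart M1 i1 @` O1) (chart M2 i2 @` O2)
          (@chart_rep (prod_space M1 M2) N f (i1, i2) j)].

Definition smooth_fibre_bundle M N (pi : N -> M) : Prop :=
  [/\ rough_manifold None N, RC None pi, (forall x, exists z, pi z = x) &
      forall x : M, exists U : set M, [/\ open U, U x &
        exists F : charted_space R, smooth_manifold F /\
        exists theta : restr N (pi @^-1` U) -> prod_space (restr M U) F,
        exists theta' : prod_space (restr M U) F -> restr N (pi @^-1` U),
          [/\ cancel theta theta', cancel theta' theta,
              RC None theta, RC None theta' &
              forall z, set_val (theta z).1 = pi (set_val z)]]].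

Definition sections (l : order) M N (pi : N -> M) : set (M -> N) :=
  [set s | RC l s /\ forall x, pi (s x) = x].

Definition smooth_on M N (f : M -> N) (A : set M) : Prop :=
  RC None (restr_map f A).

(* Smoothness being local, this is the largest open set on which f is smooth. *)
Definition smooth_locus M N (f : M -> N) : set M :=
  \bigcup_(W in [set W | open W /\ smooth_on f W]) W.

End charted_spaces.

Arguments chart_im {R} M i _.
Arguments rep_dom {R M N} f i j _.
Arguments chart_rep {R M N} f i j _.
Arguments restr {R} M A.
Arguments restr_map {R M N} f A _.
Arguments prod_space {R} M N.
Arguments formal_interior {R} M _.
Arguments real_line R : clear implicits.
Arguments smooth_fibre_bundle {R M N} pi.
Arguments sections {R} l {M N} pi _.
Arguments smooth_on {R M N} f A.
Arguments smooth_locus {R M N} f _.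
Arguments RC {R} l {M N} f.
Arguments RC2 {R} k l {M1 M2 N} f.

(* A tangent vector at x is given by its coordinates v i in all charts i around
   x, related by the differentials of the transition maps; the coordinates for
   the other charts are set to 0. In a rough manifold, the family v = 0 satisfies
   these relations; admitting it in any case provides a zero section also for raw
   charted spaces, which serves as default value in [tangent_map]. *)
Definition tangent_vector (R : realType) (M : charted_space R) (x : M)
    (v : forall i, model M i) : Prop :=
  ((forall i, ~ dom M i x -> v i = 0) /\
   forall i j, dom M i x -> dom M j x ->
     v j = ext_derive (rep_dom (@id M) i j) (chart_rep (@id M) i j)
             (chart M i x) (v i))
  \/ v = (fun _ => 0).

Definition tangent_bundle (R : realType) (M : charted_space R) : Type :=
  {p : M * (forall i, model M i) | tangent_vector p.1 p.2}.

Section tangent_topology.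
Context (R : realType) (M : charted_space R).

HB.instance Definition _ := gen_eqMixin (tangent_bundle M).
HB.instance Definition _ := gen_choiceMixin (tangent_bundle M).

(* The topology which makes the charts of [tangent] homeomorphisms onto their
   images, with open domains. *)
Definition tangent_subbase : set (set (tangent_bundle M)) :=
  [set W | exists (i : idx M) (P : set (model M i * model M i)), open P /\
     W = [set p | dom M i (sval p).1 /\
                  P (chart M i (sval p).1, (sval p).2 i)]].

HB.instance Definition _ :=
  isSubBaseTopological.Build (tangent_bundle M) tangent_subbase id.

End tangent_topology.

Section tangent.
Context {R : realType}.
Implicit Types M N : charted_space R.

Definition tangent M : charted_space R :=
  @ChartedSpace R (tangent_bundle M) (idx M)
    (fun i => (model M i * model M i)%type)
    (fun i => [set p | dom M i (sval p).1])
    (fun i p => (chart M i (sval p).1, (sval p).2 i)).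

Definition zero_vector M (x : M) : tangent M :=
  exist _ (x, fun _ => 0) (or_intror erefl).

Definition tangent_map M N (f : M -> N) : tangent M -> tangent N :=
  fun p => xget (zero_vector (f (sval p).1))
    [set q | (sval q).1 = f (sval p).1 /\
       forall i j, dom M i (sval p).1 -> dom N j (f (sval p).1) ->
         (sval q).2 j = ext_derive (rep_dom f i j) (chart_rep f i j)
                          (chart M i (sval p).1) ((sval p).2 i)].

Fixpoint iter_tangent (j : nat) M : charted_space R :=
  if j is j'.+1 then tangent (iter_tangent j' M) else M.

Fixpoint iter_tangent_map (j : nat) M N (f : M -> N) :
    iter_tangent j M -> iter_tangent j N :=
  if j is j'.+1 then tangent_map (@iter_tangent_map j' M N f) else f.

End tangent.

Arguments tangent_map {R M N} f _.
Arguments iter_tangent_map {R} j {M N} f _.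

Definition box_topology (I : Type) (T : I -> Type) : Type := forall i, T i.

Section box_topology.
Context (I : Type) (T : I -> topologicalType).

Definition box_open : set_system (box_topology T) :=
  [set O | forall x, O x -> exists W : forall i, set (T i),
     (forall i, open (W i) /\ W i (x i)) /\
     (forall y : box_topology T, (forall i, W i (y i)) -> O y)].

Let box_openT : box_open setT.
Proof.
by move=> x _; exists (fun=> setT); split => // i; split; [exact: openT|].
Qed.

Let box_openI : setI_closed box_open.
Proof.
move=> A B oA oB x [/oA[V [Vx VA]] /oB[W [Wx WB]]].
exists (fun i => V i `&` W i); split=> [i|y yVW].
  by have [? ?] := Vx i; have [? ?] := Wx i; split; [exact: openI|split].
by split; [apply: VA|apply: WB] => i; case: (yVW i).
Qed.

Let box_open_bigU (J : Type) (f : J -> set (box_topology T)) :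
  (forall j, box_open (f j)) -> box_open (\bigcup_j f j).
Proof.
move=> of_ x [j _ /of_[W [Wx Wf]]]; exists W; split=> // y yW.
by exists j => //; exact: Wf.
Qed.

HB.instance Definition _ := gen_eqMixin (box_topology T).
HB.instance Definition _ := gen_choiceMixin (box_topology T).
HB.instance Definition _ := isOpenTopological.Build (box_topology T)
  box_openT box_openI box_open_bigU.

End box_topology.

(* The topologies are defined on all functions M -> N; sets of RC^l-maps carry
   the subspace topology. *)
Section function_topologies.
Context {R : realType}.
Implicit Types M N : charted_space R.

Definition jets (l : nat) M N (f : M -> N) :
    prod_topology (fun j : 'I_l.+1 =>
      {compact-open, iter_tangent j M -> iter_tangent j N}) :=
  fun j => iter_tangent_map j f.

Definition compact_open_C (l : nat) M N : topologicalType :=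
  initial_topology (@jets l M N).

Definition whitney_cover M (Mn : nat -> set M) : Prop :=
  [/\ forall n, regular_set (Mn n),
      forall n, precompact (Mn n),
      \bigcup_n (Mn n)° = setT &
      forall x : M, exists2 W, nbhs x W & finite_set [set n | W `&` Mn n !=set0]].

Definition restrictions (l : nat) M N (Mn : nat -> set M) (f : M -> N) :
    box_topology (fun n => compact_open_C l (restr M (Mn n)) N) :=
  fun n => restr_map f (Mn n).

Definition whitney (l : nat) M N (Mn : nat -> set M) : topologicalType :=
  initial_topology (@restrictions l M N Mn).

(* Omega is a neighbourhood of sigma in the space S of RC^l-maps with the
   topology induced by the Whitney C^l-topology, which does not depend on the
   choice of Mn. *)
Definition whitney_nbhd (l : nat) M N (S : set (M -> N)) (sigma : M -> N)
    (Omega : set (M -> N)) : Prop :=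
  Omega `<=` S /\
  exists2 Mn, whitney_cover Mn &
    within S (nbhs (sigma : whitney l N Mn)) Omega.

End function_topologies.

Arguments whitney_nbhd {R} l {M N} S sigma Omega.

Definition sigma_compact (T : topologicalType) : Prop :=
  exists2 K : nat -> set T, (forall n, compact (K n)) & \bigcup_n K n = setT.

(* Main.v *)
Require Import Defs.
From mathcomp Require Import all_boot all_order all_algebra.
From mathcomp Require Import finmap.
From mathcomp Require Import all_classical all_reals all_analysis.
From mathcomp Require Import ring lra.
Import Order.TTheory GRing.Theory Num.Theory.
Import numFieldNormedType.Exports.
Set Implicit Arguments.
Unset Strict Implicit.
Unset Printing Implicit Defensive.
Local Open Scope classical_set_scope.
Local Open Scope ring_scope.

(* In a chart of M and a local trivialization of N, a section is a function g with values
   in a locally convex space. It is smoothed by finite-rank operators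
   g |-> \sum_j beta_j g(nu_j) with smooth beta_j: Bernstein operators on a box if l > 0,
   and partitions of unity on a compact set of a finite-dimensional space if l = 0. These
   operators converge to the identity in C^l. Interpolating between consecutive ones, one
   obtains S_s g which is smooth for s > 0, and C^{0,l} in (s, x) up to s = 0 where S_0 g = g.
   With a cut-off function h, the family g + h (S_{e t} g - g) deforms the section near a
   point and makes it smooth for t > 0 where h = 1.
   No estimates are needed to remain in Omega: along a family which is C^{0,l} in its
   parameter, membership in an open set of the C^l-topology is an open condition, so that by
   compactness of the range of t it holds if e is small enough. Locally finitely many such
   deformations are performed one after the other.
   The parameter t ranges over [0,2], such that ]0,1] lies in the open set ]0,2[. *)

(** * Directional calculus in topological vector spaces *)

(** The model spaces may be neither normed nor complete and the domains are merely regular sets, so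
    integrals and norm estimates are not at hand. This is why smoothing uses finitely many point
    values instead of convolutions, and why the calculus rests on a mean value theorem for convex
    sets. Its consequence [quot_near] bounds difference quotients uniformly near a point, even a
    point where nothing is differentiable; the chain rule, linearity of differentials and the
    extension of derivatives from dense parts all come from it. Each deformation starts from a
    family that already depends on t. The induction therefore carries C^{0,l} on [0,2] together with
    C^{oo,l} on ]0,2[: with finitely many nodes, smoothness in t of the smoothed map follows from
    that of t |-> g(t, nu_j). To treat C^l, C^{k,l} and C^oo at once, differentiability is indexed
    by words in two letters, each letter standing for a space of admissible directions. Convergence
    of the operators is regularity in directions that leave the parameter s fixed, so the same
    calculus proves it. *)

Section tvs_basics.
Context {R : realType}.
Implicit Types E F G : tvsType R.

Lemma tvs_cvgD E (T : Type) (A : set_system T) {FA : Filter A} (f g : T -> E) a b :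
  f @ A --> a -> g @ A --> b -> (fun x => f x + g x) @ A --> a + b.
Proof. by move=> fa gb; apply: continuous2_cvg fa gb; exact: (add_continuous (a, b)). Qed.

Lemma tvs_cvgZ E (T : Type) (A : set_system T) {FA : Filter A} (k : T -> R^o) (f : T -> E) (c : R^o) (a : E) :
  k @ A --> c -> f @ A --> a -> (fun x => k x *: f x) @ A --> c *: a.
Proof. by move=> kc fa; apply: continuous2_cvg kc fa; exact: (scale_continuous (c, a)). Qed.

Lemma tvs_cvgN E (T : Type) (A : set_system T) {FA : Filter A} (f : T -> E) a :
  f @ A --> a -> (fun x => - f x) @ A --> - a.
Proof. by move=> fa; apply: (cvg_comp _ _ fa); exact: opp_continuous. Qed.

Lemma tvs_cvgB E (T : Type) (A : set_system T) {FA : Filter A} (f g : T -> E) a b :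
  f @ A --> a -> g @ A --> b -> (fun x => f x - g x) @ A --> a - b.
Proof. by move=> fa gb; apply: tvs_cvgD => //; exact: tvs_cvgN. Qed.

Lemma nbhs_shift E (x : E) (U : set E) : nbhs x U <-> nbhs 0 [set u | U (x + u)].
Proof.
split=> h.
  have : (fun u => x + u) @ (0 : E) --> x + 0.
    by apply: tvs_cvgD; [exact: cvg_cst|exact: cvg_id].
  by rewrite addr0 => /(_ U h).
have : (fun u => u - x) @ x --> x - x.
  by apply: tvs_cvgB; [exact: cvg_id|exact: cvg_cst].
rewrite subrr => /(_ _ h); rewrite nbhs_filterE /=; apply: filterS => u /=.
by rewrite addrC subrK.
Qed.

Definition cvx E (C : set E) :=
  forall x y (t : R), C x -> C y -> 0 <= t <= 1 -> C (t *: x + (1 - t) *: y).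

Lemma cvx_nbhs E (x : E) (U : set E) :
  nbhs x U -> exists C, [/\ open C, C x, cvx C & C `<=` U].
Proof.
move=> xU; have [B Bc [Bo Bb]] := @locally_convex R E.
have [C [BC Cx] CU] := Bb x U xU.
exists C; split => //; first exact: Bo.
move=> y z t Cy Cz /andP[t0 t1].
by have /set_mem := Bc C (mem_set BC) y z (Itv01 t0 t1) (mem_set Cy) (mem_set Cz).
Qed.

(** [C] is a translate x + C0 with C0 convex and x + (C0 - B) inside U for some neighbourhood B of
    0; a closure point of x + C0 differs from it by an element of B. *)
Lemma cvx_nbhs_closure E (x : E) (U : set E) :
  nbhs x U -> exists C, [/\ open C, C x, cvx C & closure C `<=` U].
Proof.
move=> xU.
have : (fun p : E * E => x + (p.1 - p.2)) @ nbhs (0 : E, 0 : E) --> x + (0 - 0).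
  by apply: tvs_cvgD; [exact: cvg_cst|apply: tvs_cvgB; [exact: cvg_fst|exact: cvg_snd]].
rewrite subrr addr0 => /(_ _ xU) [[A B] [/= A0 B0] AB].
have [C0 [oC0 C00 cC0 C0A]] := cvx_nbhs A0.
exists [set x + u | u in C0]; split.
- have -> : [set x + u | u in C0] = (fun u => u - x) @^-1` C0.
    apply/seteqP; split => [_ [u Cu <-]|u Cu] /=; first by rewrite addrC addKr.
    by exists (u - x) => //; rewrite addrC subrK.
  apply: (open_comp _ oC0) => u _; apply: tvs_cvgB; [exact: cvg_id|exact: cvg_cst].
- by exists 0 => //; rewrite addr0.
- move=> _ _ t [u Cu <-] [v Cv <-] t01; exists (t *: u + (1 - t) *: v); first exact: cC0.
  by rewrite !scalerDr addrACA -scalerDl addrC [t + _]addrC subrK scale1r addrC.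
- move=> y /= yC.
  have yB : nbhs y [set z | B (z - y)].
    have : (fun z => z - y) @ y --> y - y.
      by apply: tvs_cvgB; [exact: cvg_id|exact: cvg_cst].
    by rewrite subrr => /(_ _ B0).
  have [_ [[u Cu <-] /= By]] := yC _ yB.
  by have := AB (u, x + u - y) (conj (C0A _ Cu) By); rewrite /= opprB addrA addrC subrK.
Qed.

(** A slope over an interval is a convex combination of the slopes over two adjacent subintervals
    ([qcomb]), and slopes over short intervals at any s lie in C ([qstep]). A supremum argument over
    the b such that all slopes from 0 to some r <= b lie in C then reaches 1. Staying inside a
    convex set replaces the integral form of the mean value theorem. *)
Lemma mvt F (C : set F) (g : R -> F) : cvx C ->
  (forall s, 0 <= s <= 1 -> \forall h \near (0 : R)^', C (h^-1 *: (g (s + h) - g s))) ->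
  C (g 1 - g 0).
Proof.
move=> cC gC.
pose q (a b : R) := (b - a)^-1 *: (g b - g a).
have qcomb a s b : a < s -> s < b -> C (q a s) -> C (q s b) -> C (q a b).
  move=> as_ sb Cas Csb; pose t := (s - a) / (b - a).
  have ba0 : 0 < b - a by rewrite subr_gt0 (lt_trans as_).
  have -> : q a b = t *: q a s + (1 - t) *: q s b.
    have -> : 1 - t = (b - s) / (b - a).
      rewrite /t -[X in X - _](@divff _ (b - a)) ?gt_eqF// -mulrBl.
      by congr (_ / _); rewrite opprB addrA subrK.
    rewrite /q !scalerA mulrAC divff ?subr_eq0 ?gt_eqF// mul1r.
    rewrite [_ / (b - a) / _]mulrAC divff ?subr_eq0 ?gt_eqF// mul1r -scalerDr.
    by congr (_ *: _); rewrite [RHS]addrC addrA subrK.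
  apply: cC => //; apply/andP; split; first by apply: divr_ge0; lra.
  by rewrite /t ler_pdivrMr//; lra.
have qstep s : 0 <= s <= 1 -> exists2 e, 0 < e &
    (forall b, s < b -> b < s + e -> C (q s b)) /\ (forall a, s - e < a -> a < s -> C (q a s)).
  move=> /gC; rewrite near_withinE /= => -[e /= e0 he]; exists e => //; split => [b sb be|a ae as_].
    have := he (b - s); rewrite /= sub0r normrN [s + _]addrC subrK; apply.
      by rewrite gtr0_norm ?subr_gt0// ltrBlDl.
    by rewrite subr_eq0 gt_eqF.
  have -> : q a s = (a - s)^-1 *: (g a - g s).
    by rewrite /q -[in RHS]opprB invrN -[in RHS](opprB (g s)) scalerN scaleNr opprK.
  have := he (a - s); rewrite /= sub0r normrN [s + _]addrC subrK; apply.
    by rewrite ltr0_norm ?subr_lt0//; lra.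
  by rewrite subr_eq0 lt_eqF.
pose A : set R := [set b | 0 < b <= 1 /\ forall r, 0 < r <= b -> C (q 0 r)].
have [e0 e00 [he0 _]] := qstep 0 (ltac:(by rewrite lexx ler01)).
have A0 : A (Num.min 1 (e0 / 2)).
  have m0 : 0 < Num.min 1 (e0 / 2) by rewrite lt_min ltr01 divr_gt0.
  split; first by rewrite m0 ge_min lexx.
  move=> r /andP[r0 rb]; apply: he0 => //; rewrite add0r (le_lt_trans rb)//.
  rewrite gt_min; apply/orP; right; lra.
have Aub : ubound A 1 by move=> b [/andP[]].
have supA : has_sup A by split; [exists (Num.min 1 (e0/2))|exists 1].
set m := sup A.
have m0 : 0 < m.
  by have [/andP[h _] _] := A0; apply: (lt_le_trans h); apply: ub_le_sup A0; exists 1.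
have m1 : m <= 1 by apply: ge_sup => //; case: supA.
have [e e0' [heR heL]] := qstep m (ltac:(by rewrite (ltW m0) m1)).
have Cm : C (q 0 m).
  have [b Ab mb] : exists2 b, A b & Num.max (m - e) (m/2) < b.
    apply: sup_gt; first by case: supA.
    by rewrite gt_max -/m; apply/andP; split; lra.
  have [/andP[b0 b1] hb] := Ab.
  have bm : b <= m by apply: ub_le_sup Ab; exists 1.
  have [->|bnm] := eqVneq m b; first by apply: hb; rewrite b0 lexx.
  have bm' : b < m by rewrite lt_neqAle eq_sym bnm.
  apply: (qcomb _ b) => //; first by apply: hb; rewrite b0 lexx.
  by apply: heL => //; move: mb; rewrite gt_max => /andP[].
have Am b : m < b -> b < m + e -> C (q 0 b).
  by move=> mb be; apply: (qcomb _ m) => //; exact: heR.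
have Cr r : 0 < r < m -> C (q 0 r).
  move=> /andP[r0 rm]; have [b Ab rb] : exists2 b, A b & r < b by apply: sup_gt => //; case: supA.
  by case: Ab => _; apply; rewrite r0 ltW.
have [m1'|m1'] := eqVneq m 1.
  by move: Cm; rewrite m1' /q subr0 invr1 scale1r.
exfalso; have {m1'} m1' : m < 1 by rewrite lt_neqAle m1'.
pose b := Num.min 1 (m + e / 2).
have mb : m < b by rewrite lt_min m1' /=; lra.
have : A b.
  split; first by rewrite (lt_trans m0 mb) ge_min lexx.
  move=> r /andP[r0 rb]; case: (ltgtP r m) => [rm|mr|->//].
    by apply: Cr; rewrite r0.
  apply: Am => //; apply: (le_lt_trans rb); rewrite gt_min; apply/orP; right; lra.
by move=> /(ub_le_sup (ex_intro _ 1 Aub)); rewrite leNgt mb.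
Qed.

End tvs_basics.

Section derivatives.
Context {R : realType}.
Implicit Types E F G : tvsType R.

Definition cw E F (D : set E) (f : E -> F) :=
  forall x, D x -> f @ within D (nbhs x) --> f x.

Lemma cwP E F (D : set E) (f : E -> F) : {within D, continuous f} <-> cw D f.
Proof. exact: subspace_continuousP. Qed.

Definition isd E F (f : E -> F) (x v : E) (l : F) :=
  diff_quot f x v h @[h --> 0^'] --> l.

Definition pd E F (V O : set E) (f : E -> F) (df : E * E -> F) :=
  forall x v, O x -> V v -> isd f x v (df (x, v)).

(* Short segments of D in direction V near x are limits of segments of O. *)
Definition lappr E (V O D : set E) (x : E) := exists2 N, nbhs (0 : E) N &
  forall x' u, D x' -> N (x' - x) -> V u -> N u -> D (x' + u) ->
  forall W, nbhs (0 : E) W -> exists x1 u1, [/\ W (x1 - x'), W (u1 - u), V u1 &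
    forall s : R, 0 <= s <= 1 -> O (x1 + s *: u1)].

Lemma cw_cvg E F (D : set E) (f : E -> F) (T : Type) (A : set_system T) {FA : Filter A}
    (g : T -> E) y :
  cw D f -> D y -> (\forall t \near A, D (g t)) -> g @ A --> y -> (f \o g) @ A --> f y.
Proof.
move=> cf Dy Dg gy B hB; have : nbhs y (fun z => D z -> B (f z)) := cf y Dy B hB.
by move=> /gy hg; apply: filterS2 Dg hg => t /= ?; exact.
Qed.

Lemma nbhs_sub E (x : E) (N : set E) : nbhs 0 N -> nbhs x [set y | N (y - x)].
Proof.
move=> N0; have : (fun z => z - x) @ x --> x - x.
  by apply: tvs_cvgB; [exact: cvg_id|exact: cvg_cst].
by rewrite subrr => /(_ _ N0).
Qed.

Lemma scale_small E (u : E) (N : set E) : nbhs 0 N ->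
  \forall h \near (0 : R), N (h *: u).
Proof.
move=> N0; have : (fun h : R^o => h *: u) @ (0 : R^o) --> 0 *: u.
  by apply: tvs_cvgZ; [exact: cvg_id|exact: cvg_cst].
by rewrite scale0r => /(_ _ N0).
Qed.

Lemma dnbhs0_mulr (c : R) (P : set R) : c != 0 ->
  (\forall h \near 0^', P h) -> \forall t \near (0 : R)^', P (t * c).
Proof.
move=> c0; rewrite !near_withinE => -[e /= e0 he]; exists (e / `|c|) => /=.
  by rewrite divr_gt0 ?normr_gt0.
move=> t /=; rewrite sub0r normrN ltr_pdivlMr ?normr_gt0// => te t0.
by apply: he; rewrite /= ?sub0r ?normrN ?normrM// mulf_neq0.
Qed.

(** Difference quotients stay near df(x, q) uniformly in base point, direction and step. The segment
    from x' to x' + h q' may miss O, so it is first replaced by a segment inside O ([lappr]), to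
    which [mvt] applies with a convex set C0 around df(x, q). Continuity of f then puts the original
    quotient into the closure of C0, hence into C. *)
Lemma quot_near E F (V O D : set E) (f : E -> F) (df : E * E -> F) (x q : E) (C : set F) :
  (forall a u, V u -> V (a *: u)) -> O `<=` D -> D x -> V q ->
  cw D f -> cw (D `*` V) df -> pd V O f df -> lappr V O D x ->
  nbhs (df (x, q)) C ->
  exists N M, exists2 r : R, 0 < r & [/\ nbhs x N, nbhs q M &
    forall x' q' (h : R), D x' -> N x' -> V q' -> M q' -> h != 0 -> `|h| < r ->
      D (x' + h *: q') -> C (h^-1 *: (f (x' + h *: q') - f x'))].
Proof.
move=> VZ OD Dx Vq cf cdf hp [N1 N10 happ] /cvx_nbhs_closure[C0 [oC0 C00 cC0 C0C]].
have : nbhs (x, q) [set p | (D `*` V) p -> C0 (df p)].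
  exact: (cdf (x, q) (conj Dx Vq) C0 (open_nbhs_nbhs (conj oC0 C00))).
move=> -[[N0 M0] [/= xN0 qM0] NM0].
have df0 y u : N0 y -> D y -> M0 u -> V u -> C0 (df (y, u)).
  by move=> ? ? ? ?; apply: (NM0 (y, u)).
have /nbhs_shift xN0' := xN0; rewrite /= in xN0'.
(* Room for the four terms by which a point of the approximating segment differs from x: x' - x, s
   u, x1 - x' and s (u1 - u). *)
have [P [oP P0 cP PN0]] : exists P, [/\ open P, P 0, cvx P & forall u v w z, P u -> P v -> P w -> P z -> N0 (x + (u + v + (w + z)))].
  have : (fun p : E * E * (E * E) => x + (p.1.1 + p.1.2 + (p.2.1 + p.2.2))) @
      nbhs ((0 : E, 0 : E), (0 : E, 0 : E)) --> x + (0 + 0 + (0 + 0)).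
    apply: tvs_cvgD; first exact: cvg_cst.
    by apply: tvs_cvgD; apply: tvs_cvgD;
      [apply: (cvg_comp _ _ cvg_fst cvg_fst)|apply: (cvg_comp _ _ cvg_fst cvg_snd)|
       apply: (cvg_comp _ _ cvg_snd cvg_fst)|apply: (cvg_comp _ _ cvg_snd cvg_snd)].
  rewrite !addr0 => /(_ _ xN0) [[A B] [/= [[A1 A2] [/= A10 A20] A12] [[B1 B2] [/= B10 B20] B12]] AB].
  have [P [oP P0 cP PA]] := cvx_nbhs (filterI (filterI A10 A20) (filterI B10 B20)).
  exists P; split => // u v w z /PA[[? _] _] /PA[[_ ?] _] /PA[_ [? _]] /PA[_ [_ ?]].
  by apply: (AB ((u, v), (w, z))); split => //; [apply: A12|apply: B12].
have /nbhs_shift qM0' := qM0; rewrite /= in qM0'.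
have P0n : nbhs 0 P by apply: open_nbhs_nbhs.
have [M [r r0 [qM PM NM]]] : exists M, exists2 r : R, 0 < r & [/\ nbhs q M,
    (forall q' h, M q' -> `|h| < r -> P (h *: q')) & (forall q' h, M q' -> `|h| < r -> N1 (h *: q'))].
  have : (fun p : R^o * E => p.1 *: p.2) @ nbhs ((0 : R^o), q) --> (0 : R^o) *: q.
    by apply: tvs_cvgZ; [exact: cvg_fst|exact: cvg_snd].
  rewrite scale0r => /(_ _ (filterI P0n N10)) [[A B] [/= A0 B0] AB].
  move: A0 => /nbhs_ballP[r /= r0 rA]; exists B, r => //; split => // q' h Bq hr;
    by have [] := AB (h, q') (conj (rA _ _) Bq) => //; rewrite /= /ball /= sub0r normrN.
pose M1 := (M `&` M0°).
exists [set y | (P `&` N1) (y - x)], M1, r => //; split.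
- by apply: nbhs_sub; apply: filterI.
- by apply: filterI => //; exact: nbhs_interior.
move=> x' q' h Dx' [Px' Nx'] Vq' [Mq' M0q'] h0 hr Dxh.
set u := h *: q'.
have Vu : V u by exact: VZ.
(* It is enough to find quotients in C0 arbitrarily close to the given one. *)
apply: C0C.
move=> B hB.
have c0 : (fun p : E * E => h^-1 *: (f (p.1 + p.2) - f p.1)) @
    within [set p | D p.1 /\ D (p.1 + p.2)] (nbhs (x', u)) --> h^-1 *: (f (x' + u) - f x').
  apply: (tvs_cvgZ (k := fun _ => h^-1)); first exact: cvg_cst.
  apply: tvs_cvgB; [apply: (cw_cvg (g := fun p => p.1 + p.2) cf Dxh)|
    apply: (cw_cvg (g := fun p => p.1) cf Dx')].
  - by rewrite near_withinE; apply: nearW => p [].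
  - by apply: cvg_within_filter; apply: tvs_cvgD; [exact: cvg_fst|exact: cvg_snd].
  - by rewrite near_withinE; apply: nearW => p [].
  - by apply: cvg_within_filter; exact: cvg_fst.
have [[W1 W2] [/= xW1 uW2] W12] := c0 _ hB.
have hM0 : nbhs 0 [set w | (M0°) (q' + h^-1 *: w)].
  have : (fun w : E => q' + h^-1 *: w) @ (0 : E) --> q' + h^-1 *: 0.
    apply: tvs_cvgD; first exact: cvg_cst.
    by apply: (tvs_cvgZ (k := fun _ => h^-1)); [exact: cvg_cst|exact: cvg_id].
  by rewrite scaler0 addr0; apply; apply: open_nbhs_nbhs; split => //; exact: open_interior.
move: xW1 uW2 => /nbhs_shift xW1 /nbhs_shift uW2.
have [W [oW W0 cW Ws]] := cvx_nbhs (filterI (filterI xW1 uW2) (filterI hM0 P0n)).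
have [x1 [u1 [Wx1 Wu1 Vu1 hO]]] := happ x' u Dx' Nx' Vu (NM _ _ Mq' hr) Dxh W (open_nbhs_nbhs (conj oW W0)).
have Dx1 : D x1 by have := hO 0; rewrite scale0r addr0 => hh; apply/OD/hh; rewrite lexx ler01.
have Dx1u : D (x1 + u1) by have := hO 1; rewrite scale1r => hh; apply/OD/hh; rewrite lexx ler01.
exists (h^-1 *: (f (x1 + u1) - f x1)); split; last first.
  apply: (W12 (x1, u1)) => //; split => /=.
    by have [[+ _] _] := Ws _ Wx1; rewrite /= addrC subrK.
  by have [[_ +] _] := Ws _ Wu1; rewrite /= addrC subrK.
pose g (s : R) := h^-1 *: f (x1 + s *: u1).
have -> : h^-1 *: (f (x1 + u1) - f x1) = g 1 - g 0.
  by rewrite /g scale1r scale0r addr0 -scalerBr.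
apply: (mvt cC0) => s s01.
set y := x1 + s *: u1.
have Oy := hO _ s01.
pose q1 := h^-1 *: u1.
have Vq1 : V q1 by exact: VZ.
have Pz z : W z -> P z by move=> /Ws[_ []].
have M0q1 : M0 q1.
  apply: interior_subset; have [_ []] := Ws _ Wu1; rewrite /= /q1 => + _.
  by rewrite /u scalerBr scalerA mulVf// scale1r addrC subrK.
have N0y : N0 y.
  have -> : y = x + ((x' - x) + (s *: u) + ((x1 - x') + s *: (u1 - u))).
    rewrite scalerBr [(_ - x + _) + _]addrACA [s *: u + _]addrC subrK.
    by rewrite addrA; congr (_ + _); rewrite addrA [x + _]addrC subrK addrC subrK.
  apply: PN0 => //; last 2 first.
  - exact: Pz.
  - by apply: Pz; have := cW _ _ s Wu1 W0 s01; rewrite scaler0 addr0.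
  have -> : s *: u = (s * h) *: q' by rewrite /u scalerA.
  apply: PM => //; rewrite normrM (le_lt_trans _ hr)// ler_piMl//.
  by move: s01 => /andP[s0 s1]; rewrite ger0_norm.
have C0y : C0 (df (y, q1)) by apply: df0 => //; exact: OD.
have h1 : \forall t \near (0 : R)^', C0 ((t * h)^-1 *: (f (y + (t * h) *: q1) - f y)).
  exact: (dnbhs0_mulr h0 (hp y q1 Oy Vq1 C0 (open_nbhs_nbhs (conj oC0 C0y)))).
near=> t.
have tn0 : t != 0 by near: t; exact: nbhs_dnbhs_neq.
rewrite /g -scalerBr scalerA -invfM scalerDl addrA.
have -> : t *: u1 = (t * h) *: q1 by rewrite /q1 scalerA mulfK.
by near: t.
Unshelve. all: by end_near.
Qed.

End derivatives.

Section CW_def.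
Context {R : realType}.
Implicit Types E F G : tvsType R.

Definition subsp E (V : set E) := V 0 /\ forall (a : R) u v, V u -> V v -> V (a *: u + v).

Lemma subspZ E (V : set E) a u : subsp V -> V u -> V (a *: u).
Proof. by move=> [V0 hV] Vu; rewrite -[_ *: _]addr0; exact: hV. Qed.

Lemma subspD E (V : set E) u v : subsp V -> V u -> V v -> V (u + v).
Proof. by move=> [V0 hV] Vu Vv; rewrite -[u]scale1r; exact: hV. Qed.

Lemma subspB E (V : set E) u v : subsp V -> V u -> V v -> V (u - v).
Proof. by move=> hV Vu Vv; apply: subspD => //; rewrite -scaleN1r; exact: subspZ. Qed.

Lemma subspX E F (V : set E) (W : set F) : subsp V -> subsp W -> subsp (V `*` W).
Proof. by move=> [V0 hV] [W0 hW]; split => // a [u1 u2] [v1 v2] [? ?] [? ?]; split; [exact: hV|exact: hW]. Qed.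

(* O is open in the directions of V, locally uniformly *)
Definition vopen E (V O : set E) := forall x, O x -> exists2 N, nbhs 0 N &
  forall x' u, O x' -> N (x' - x) -> N u -> V u -> O (x' + u).

Lemma lappr_vopen E (V O : set E) x : subsp V -> vopen V O -> O x -> lappr V O O x.
Proof.
move=> hV hO /hO[N N0 hN]; have [C [oC C0 cC CN]] := cvx_nbhs N0.
exists C; first exact: open_nbhs_nbhs.
move=> x' u Ox' Cx' Vu Cu Oxu W W0; exists x', u; split => //; rewrite ?subrr; try exact: nbhs_singleton.
move=> s s01; apply: hN => //; [exact: CN| |exact: subspZ].
by apply: CN; rewrite -[_ *: u]addr0 -(scaler0 _ (1 - s)); exact: cC.
Qed.

Lemma vopen_near E (V O : set E) x v : subsp V -> vopen V O -> O x -> V v ->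
  \forall h \near (0 : R), O (x + h *: v).
Proof.
move=> hV hO Ox Vv; have [N N0 hN] := hO _ Ox.
have := scale_small v N0; apply: filterS => h Nh; apply: hN => //; last exact: subspZ.
by rewrite subrr; exact: nbhs_singleton.
Qed.

Lemma isd_ext E F (f g : E -> F) x v l :
  (\forall h \near (0 : R), f (x + h *: v) = g (x + h *: v)) -> isd f x v l -> isd g x v l.
Proof.
move=> fg; have fx := nbhs_singleton fg; rewrite /= scale0r addr0 in fx.
apply: cvg_trans; apply: near_eq_cvg; apply: nbhs_dnbhs.
by apply: filterS fg => h fgh; rewrite /diff_quot fgh fx.
Qed.

Lemma isd_unique E F (f : E -> F) x v l l' : hausdorff_space F ->
  isd f x v l -> isd f x v l' -> l = l'.
Proof. by move=> hF; apply: cvg_unique. Qed.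

Lemma isd_pair E F G (f : E -> F) (g : E -> G) x v l m :
  isd f x v l -> isd g x v m -> isd (fun y => (f y, g y)) x v (l, m).
Proof. by move=> fl gm; apply: cvg_pair fl gm. Qed.

Lemma isdD E F (f g : E -> F) x v l m :
  isd f x v l -> isd g x v m -> isd (fun y => f y + g y) x v (l + m).
Proof.
move=> fl gm; rewrite /isd.
have -> : (fun h => diff_quot (fun y => f y + g y) x v h) =
   (fun h => diff_quot f x v h + diff_quot g x v h).
  by apply/funext => h; rewrite /diff_quot -scalerDr opprD addrACA.
exact: tvs_cvgD.
Qed.

Definition lincont E F (L : E -> F) :=
  (forall (a : R) x y, L (a *: x + y) = a *: L x + L y) /\ continuous L.

Lemma linZ E F (L : E -> F) a x : lincont L -> L (a *: x) = a *: L x.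
Proof.
move=> [hL _]; have L0 : L 0 = 0.
  by have := hL 1 0 0; rewrite !scale1r addr0 => /eqP; rewrite -subr_eq0 opprD addrA subrr sub0r oppr_eq0 => /eqP.
by rewrite -[_ *: x]addr0 hL L0 addr0.
Qed.

Lemma linD E F (L : E -> F) x y : lincont L -> L (x + y) = L x + L y.
Proof. by move=> [hL _]; rewrite -[x]scale1r hL !scale1r. Qed.

Lemma lincont_comp E F G (L : E -> F) (L' : F -> G) :
  lincont L -> lincont L' -> lincont (fun x => L' (L x)).
Proof.
move=> [h c] [h' c']; split => [a x y|x]; first by rewrite h h'.
by apply: continuous_comp; [exact: c|exact: c'].
Qed.

Lemma lincont_pair E F G (L : E -> F) (L' : E -> G) :
  lincont L -> lincont L' -> lincont (fun x => (L x, L' x)).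
Proof.
move=> [h c] [h' c']; split => [a x y|x]; first by rewrite h h'.
by apply: cvg_pair; [exact: c|exact: c'].
Qed.

Lemma lincont_fst E F : lincont (@fst E F).
Proof. by split => // x; exact: cvg_fst. Qed.

Lemma lincont_snd E F : lincont (@snd E F).
Proof. by split => // x; exact: cvg_snd. Qed.

Lemma lincont_id E : lincont (@id E).
Proof. by split => // x; exact: cvg_id. Qed.

Lemma lincont0 E F : lincont (fun _ : E => 0 : F).
Proof. by split => [a x y|x]; [rewrite scaler0 addr0|exact: cvg_cst]. Qed.

Lemma lincont_p1 E F G (L : E -> F * G) : lincont L -> lincont (fun x => (L x).1).
Proof. by move=> h; apply: lincont_comp h _; exact: lincont_fst. Qed.

Lemma lincont_p2 E F G (L : E -> F * G) : lincont L -> lincont (fun x => (L x).2).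
Proof. by move=> h; apply: lincont_comp h _; exact: lincont_snd. Qed.

Lemma isd_complin E E' F (L : E' -> E) (f : E -> F) x v l : lincont L ->
  isd f (L x) (L v) l -> isd (fun y => f (L y)) x v l.
Proof.
move=> hL; rewrite /isd /diff_quot.
have -> // : (fun h => h^-1 *: (f (L (x + h *: v)) - f (L x))) =
  (fun h => h^-1 *: (f (L x + h *: L v) - f (L x))).
by apply/funext => h; rewrite (linD _ _ hL) (linZ _ _ hL).
Qed.

Lemma isd_lin E F (L : E -> F) x v : lincont L -> isd L x v (L v).
Proof.
move=> hL; rewrite /isd /diff_quot.
apply: cvg_trans (@cvg_cst _ (L v) _ (0 : R)^' _); apply: near_eq_cvg.
apply: filterS (nbhs_dnbhs_neq _) => h h0.
by rewrite (linD _ _ hL) (linZ _ _ hL) addrC addKr scalerA mulVf// scale1r.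
Qed.

Lemma isd_cst E F (c : F) (x v : E) : isd (fun _ => c) x v 0.
Proof.
rewrite /isd; have -> : diff_quot (fun _ : E => c) x v = fun=> 0.
  by apply/funext => h; rewrite /diff_quot subrr scaler0.
exact: cvg_cst.
Qed.

(** Directions for a differential, which is a function of a point and of a vector of V b: the vector
    moves inside the linear space V b, so that the lifted directions are again linear. *)
Definition tgl E (V : bool -> set E) (b : bool) (c : bool) : set (E * E) := V c `*` V b.

(* Iterated differentiability of f on O in the directions V b, for b in the
   word w, with derivatives extending continuously to D; the differential of f
   in direction V b is a function of the point and the direction, and is again
   differentiated in both variables. *)
Fixpoint CW E F (w : seq bool) (V : bool -> set E) (O D : set E) (f : E -> F) : Prop :=
  if w is b :: w' then CW w' V O D f /\ exists df : E * E -> F,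
    pd (V b) O f df /\ CW w' (tgl V b) (O `*` V b) (D `*` V b) df
  else cw D f.

(** Density makes continuous extensions from O to D unique. Closedness of the direction spaces puts
    limits of difference quotients back into them. [vopen] asks for openness only along the
    directions in use, which allows parameters ranging over thin sets such as 0 and the numbers
    1/(n+1). The differential inherits all of this ([frame_lift]). *)
Record frame E (V : bool -> set E) (O D : set E) : Prop := Frame {
  fr_sub : O `<=` D;
  fr_dense : D `<=` closure O;
  fr_lin : forall b, subsp (V b);
  fr_cl : forall b, closed (V b);
  fr_open : forall b, vopen (V b) O }.

Lemma frame_lift E (V : bool -> set E) O D b :
  frame V O D -> frame (tgl V b) (O `*` V b) (D `*` V b).
Proof.
move=> [OD DO Vl Vc Vo]; split.
- by move=> [x v] [/OD].
- move=> [x v] [/= Dx Vv] S [[A B] [/= xA vB] AB].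
  have [y [Oy Ay]] := DO _ Dx _ xA.
  by exists (y, v); split => //; apply: AB; split => //; exact: nbhs_singleton.
- by move=> c; exact: subspX.
- move=> c; rewrite /tgl; apply: closedI; apply: closed_comp => // z _;
   [exact: cvg_fst|exact: cvg_snd].
- move=> c [x v] [/= Ox Vv]; have [N N0 hN] := Vo c x Ox.
  exists (N `*` setT).
    by exists (N, setT) => //; split => //; exact: filterT.
  move=> [x' v'] [u1 u2] [/= Ox' Vv'] [/= Nx _] [/= Nu _] [/= Vu1 Vu2].
  by split => /=; [exact: hN|exact: subspD].
Qed.

Lemma cw_sub E F (D D' : set E) (f : E -> F) : D' `<=` D -> cw D f -> cw D' f.
Proof.
move=> D'D cf x D'x B hB; have : nbhs x (fun z => D z -> B (f z)) := cf x (D'D _ D'x) B hB.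
by apply: filterS => z + /D'D; apply.
Qed.

Lemma cw_ext E F (D : set E) (f g : E -> F) : (forall x, D x -> f x = g x) -> cw D f -> cw D g.
Proof.
move=> fg cf x Dx; rewrite -fg// => B hB.
have : nbhs x (fun z => D z -> B (f z)) := cf x Dx B hB.
by apply: filterS => z + /[dup] Dz; rewrite fg//; apply.
Qed.

Lemma cw_pair E F G (D : set E) (f : E -> F) (g : E -> G) :
  cw D f -> cw D g -> cw D (fun x => (f x, g x)).
Proof. by move=> cf cg x Dx; apply: cvg_pair; [exact: cf|exact: cg]. Qed.

Lemma cw_comp E F G (D : set E) (D' : set F) (f : E -> F) (g : F -> G) :
  (forall x, D x -> D' (f x)) -> cw D f -> cw D' g -> cw D (fun x => g (f x)).
Proof.
move=> DD' cf cg x Dx; apply: (cw_cvg (g := f) cg) => //; [exact: DD'| |exact: cf].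
by rewrite near_withinE; apply: nearW => y; exact: DD'.
Qed.

Lemma cw_lin E F (D : set E) (L : E -> F) : lincont L -> cw D L.
Proof. by move=> [_ c] x Dx; apply: cvg_within_filter; exact: c. Qed.

Lemma cwD E F (D : set E) (f g : E -> F) : cw D f -> cw D g -> cw D (fun x => f x + g x).
Proof. by move=> cf cg x Dx; apply: tvs_cvgD; [exact: cf|exact: cg]. Qed.

Lemma cwZ E F (D : set E) (a : E -> R^o) (f : E -> F) :
  cw D a -> cw D f -> cw D (fun x => a x *: f x).
Proof. by move=> ca cf x Dx; apply: tvs_cvgZ; [exact: ca|exact: cf]. Qed.

Lemma CW_cw w E F V (O D : set E) (f : E -> F) : CW w V O D f -> cw D f.
Proof. by elim: w V O D f => //= b w IH V O D f [+ _]; exact: IH. Qed.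

Lemma CW_catl w w' E F V (O D : set E) (f : E -> F) : CW (w ++ w') V O D f -> CW w V O D f.
Proof.
elim: w E V O D f => [|b w IH] E V O D f /=; first exact: CW_cw.
by move=> [/IH h [df [hd /IH hdf]]]; split => //; exists df.
Qed.

Lemma CW_sub w E F V V' (O D O' D' : set E) (f : E -> F) :
  O' `<=` O -> D' `<=` D -> (forall b, V' b `<=` V b) -> CW w V O D f -> CW w V' O' D' f.
Proof.
elim: w E V V' O D O' D' f => [|b w IH] E V V' O D O' D' f OO DD VV /=; first exact: cw_sub.
move=> [hf [df [hd hdf]]]; split; first exact: IH hf.
exists df; split; first by move=> x v /OO Ox /VV Vv; exact: hd.
apply: IH hdf => [[x v] [/OO ? /VV ?]//|[x v] [/DD ? /VV ?]//|c [u v] [/VV ? /VV ?]//].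
Qed.

Lemma CW_ext w E F V (O D : set E) (f g : E -> F) : frame V O D ->
  (forall x, D x -> f x = g x) -> CW w V O D f -> CW w V O D g.
Proof.
elim: w f g => [|b w IH] f g fr fg /=; first exact: cw_ext.
move=> [hf [df [hd hdf]]]; split; first exact: IH hf.
exists df; split => // x v Ox Vv; apply: isd_ext (hd _ _ Ox Vv).
have := vopen_near (fr_lin fr b) (@fr_open _ _ _ _ fr b) Ox Vv.
by apply: filterS => h /(fr_sub fr) Oh; exact: fg.
Qed.

Lemma CW_pair w E F G V (O D : set E) (f : E -> F) (g : E -> G) :
  CW w V O D f -> CW w V O D g -> CW w V O D (fun x => (f x, g x)).
Proof.
elim: w E V O D f g => [|b w IH] E V O D f g /=; first exact: cw_pair.
move=> [hf [df [hd hdf]]] [hg [dg [hd' hdg]]]; split; first exact: IH.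
exists (fun p => (df p, dg p)); split; last exact: IH.
by move=> x v Ox Vv; apply: isd_pair; [exact: hd|exact: hd'].
Qed.

Lemma CWD w E F V (O D : set E) (f g : E -> F) :
  CW w V O D f -> CW w V O D g -> CW w V O D (fun x => f x + g x).
Proof.
elim: w E V O D f g => [|b w IH] E V O D f g /=; first exact: cwD.
move=> [hf [df [hd hdf]]] [hg [dg [hd' hdg]]]; split; first exact: IH.
exists (fun p => df p + dg p); split; last exact: IH.
by move=> x v Ox Vv; apply: isdD; [exact: hd|exact: hd'].
Qed.

Lemma CW_complin w E E' F V V' (O D : set E) (O' D' : set E') (L : E' -> E) (f : E -> F) :
  lincont L -> (forall x, O' x -> O (L x)) -> (forall x, D' x -> D (L x)) ->
  (forall b v, V' b v -> V b (L v)) -> CW w V O D f -> CW w V' O' D' (fun x => f (L x)).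
Proof.
elim: w E E' V V' O D O' D' L f => [|b w IH] E E' V V' O D O' D' L f hL hO hD hV /=.
  by move=> cf; apply: cw_comp cf => //; exact: cw_lin.
move=> [hf [df [hd hdf]]]; split; first exact: IH hf.
exists (fun p => df (L p.1, L p.2)); split.
  by move=> x v /hO Ox /hV Vv; apply: isd_complin => //; exact: hd.
apply: (IH _ _ _ _ _ _ _ _ (fun p => (L p.1, L p.2))) hdf.
- by apply: lincont_pair; apply: lincont_comp => //; [exact: lincont_fst|exact: lincont_snd].
- by move=> p [/hO ? /hV ?].
- by move=> p [/hD ? /hV ?].
- by move=> c p [/hV ? /hV ?].
Qed.

Lemma CW_lift_fst w b E F V (O D : set E) (f : E -> F) : CW w V O D f ->
  CW w (tgl V b) (O `*` V b) (D `*` V b) (fun p => f p.1).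
Proof.
by apply: CW_complin => [|p []|p []|c p []]//; exact: lincont_fst.
Qed.

Lemma CW_cst w E F V (O D : set E) (c : F) : CW w V O D (fun _ => c).
Proof.
elim: w E V O D c => [|b w IH] E V O D c /=; first by move=> x _; exact: cvg_cst.
by split => //; exists (fun _ => 0); split => // x v _ _; exact: isd_cst.
Qed.

Lemma CW_lin w E F V (O D : set E) (L : E -> F) : lincont L -> CW w V O D L.
Proof.
elim: w E V O D L => [|b w IH] E V O D L hL /=; first exact: cw_lin.
split; first exact: IH.
exists (fun p => L p.2); split; first by move=> x v _ _; exact: isd_lin.
by apply: IH; apply: lincont_comp => //; exact: lincont_snd.
Qed.

End CW_def.

Ltac lincont := lazymatch goal with
  | |- lincont (fun x => (@?f x, @?g x)) => apply: (@lincont_pair _ _ _ _ f g); lincont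
  | |- lincont (fun x => fst (@?f x)) => apply: (@lincont_p1 _ _ _ _ f); lincont
  | |- lincont (fun x => snd (@?f x)) => apply: (@lincont_p2 _ _ _ _ f); lincont
  | |- _ => first [exact: lincont_id | exact: lincont0 | exact: lincont_fst | exact: lincont_snd
    | apply: lincont_pair; lincont | apply: lincont_p1; lincont | apply: lincont_p2; lincont]
  end.

Section CW_theory.
Context {R : realType}.
Implicit Types E F G : tvsType R.

Lemma openX (X Y : topologicalType) (A : set X) (B : set Y) : open A -> open B -> open (A `*` B).
Proof.
move=> oA oB; rewrite openE => -[x y] [/= Ax By].
by exists (A, B) => //; split; apply: open_nbhs_nbhs.
Qed.

Lemma closed_cvg_in E (T : Type) (A : set_system T) {FA : ProperFilter A} (V : set E) (f : T -> E) l :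
  closed V -> (\forall t \near A, V (f t)) -> f @ A --> l -> V l.
Proof. move=> cV hV fl; apply: cV => B /fl hB.
by have [t [? ?]] := filter_ex (filterI hV hB); exists (f t). Qed.

Lemma cw_closure E F (O D : set E) (f : E -> F) (C : set F) : cw D f -> O `<=` D ->
  D `<=` closure O -> closed C -> (forall x, O x -> C (f x)) -> forall x, D x -> C (f x).
Proof.
move=> cf OD DO cC hC x Dx; apply: cC => B hB.
have : nbhs x (fun z => D z -> B (f z)) := cf x Dx B hB.
move=> /(DO _ Dx)[y [Oy /(_ (OD _ Oy)) By]].
by exists (f y); split => //; exact: hC.
Qed.

Lemma cw_eq_dense E F (O D : set E) (f g : E -> F) : hausdorff_space F -> cw D f -> cw D g ->
  O `<=` D -> D `<=` closure O -> (forall x, O x -> f x = g x) -> forall x, D x -> f x = g x.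
Proof.
move=> hF cf cg OD DO fg x Dx; apply: hF => A B hA hB.
have hA' : nbhs x (fun z => D z -> A (f z)) := cf x Dx A hA.
have hB' : nbhs x (fun z => D z -> B (g z)) := cg x Dx B hB.
have [y [Oy [/(_ (OD _ Oy)) Ay /(_ (OD _ Oy)) By]]] := DO _ Dx _ (filterI hA' hB').
by exists (f y); split => //; rewrite fg.
Qed.

Lemma isd_comp E E' F (V O : set E) (f : E -> F) (df : E * E -> F) (g : E' -> E) z v q :
  subsp V -> closed V -> vopen V O -> cw O f -> cw (O `*` V) df -> pd V O f df ->
  O (g z) -> isd g z v q ->
  (\forall h \near (0 : R)^', V (g (z + h *: v) - g z) /\ O (g (z + h *: v))) ->
  V q /\ isd (fun y => f (g y)) z v (df (g z, q)).
Proof.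
move=> lV cV oV cf cdf hp Ogz gq hg.
have hVq : \forall h \near (0 : R)^', V (diff_quot g z v h).
  by apply: filterS hg => h [+ _]; exact: subspZ.
have Vq : V q by apply: (closed_cvg_in cV _ gq).
split => // C hC.
have VZ a u : V u -> V (a *: u) by exact: subspZ.
have [N [M [r r0 [gN qM H]]]] := quot_near VZ (@subset_refl _ O) Ogz Vq cf cdf hp
  (lappr_vopen lV oV Ogz) hC.
have h1 : \forall h \near (0 : R)^', M (diff_quot g z v h) := gq M qM.
have h2 : \forall h \near (0 : R)^', `|h| < r.
  by apply: nbhs_dnbhs; apply/nbhs_ballP; exists r => // h; rewrite /ball /= sub0r normrN.
have h3 : \forall h \near (0 : R)^', h != 0 by exact: nbhs_dnbhs_neq.
suff : \forall h \near (0 : R)^', C (diff_quot (fun y => f (g y)) z v h) by [].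
near=> h.
have hn0 : h != 0 by near: h.
have e : g z + h *: diff_quot g z v h = g (z + h *: v).
  by rewrite /diff_quot scalerA divff// scale1r addrC subrK.
have : C (h^-1 *: (f (g z + h *: diff_quot g z v h) - f (g z))).
  apply: H => //; [exact: nbhs_singleton|near: h|near: h|near: h|rewrite e] => //.
  by have [] : V (g (z + h *: v) - g z) /\ O (g (z + h *: v)) by near: h.
by rewrite e.
Unshelve. all: by end_near.
Qed.

(** Induction on the word: the differential of the composite is df composed with (g, dg), to which
    the induction hypothesis applies. The condition on increments of g ensures that f is only
    differentiated along its own directions; as a condition on differences it lifts to (g, dg), once
    dg is known to take values in V b, on O' by [isd_comp] and on D' by closedness. *)
Lemma CW_comp w E E' F V V' (O D : set E) (O' D' : set E') (g : E' -> E) (f : E -> F) :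
  frame V O D -> frame V' O' D' ->
  (forall z, D' z -> D (g z)) -> (forall z, O' z -> O (g z)) ->
  (forall b z1 z2, D' z1 -> D' z2 -> V' b (z1 - z2) -> V b (g z1 - g z2)) ->
  CW w V' O' D' g -> CW w V O D f -> CW w V' O' D' (fun z => f (g z)).
Proof.
elim: w E E' V V' O D O' D' f g => [|b w IH] E E' V V' O D O' D' f g fr fr' hD hO hV /=.
  by move=> cg cf; exact: cw_comp cf.
move=> [hg [dg [pg hdg]]] [hf [df [pf hdf]]]; split; first exact: IH hf.
have key z v : O' z -> V' b v -> V b (dg (z, v)) /\ isd (fun y => f (g y)) z v (df (g z, dg (z, v))).
  move=> Oz Vv; apply: (@isd_comp _ _ _ (V b) O) => //.
  - exact: (@fr_lin _ _ _ _ _ fr _).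
  - exact: (@fr_cl _ _ _ _ _ fr _).
  - exact: (@fr_open _ _ _ _ _ fr _).
  - by apply: cw_sub (CW_cw hf); exact: fr_sub fr.
  - by apply: cw_sub (CW_cw hdf) => -[x u] [/(fr_sub fr)].
  - exact: hO.
  - exact: pg.
  - apply: nbhs_dnbhs; have := vopen_near (fr_lin fr' b) (@fr_open _ _ _ _ _ fr' b) Oz Vv.
    apply: filterS => h Ozh; split; last exact: hO.
    apply: hV; [exact: fr_sub fr' _ Ozh|exact: fr_sub fr' _ Oz|].
    by rewrite addrC addKr; apply: subspZ => //; exact: (@fr_lin _ _ _ _ _ fr' _).
have Vdg z v : D' z -> V' b v -> V b (dg (z, v)).
  move=> Dz Vv; have [frl1 frl2 _ _ _] := frame_lift b fr'.
  apply: (cw_closure (CW_cw hdg) frl1 frl2 (@fr_cl _ _ _ _ _ fr b) _ (x := (z, v))) => //.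
  by move=> [y u] [/= Oy Vu]; have [] := key y u Oy Vu.
exists (fun p => df (g p.1, dg p)); split.
  by move=> z v Oz Vv; have [] := key z v Oz Vv.
apply: (IH _ _ _ _ _ _ _ _ df (fun p => (g p.1, dg p)) (frame_lift b fr) (frame_lift b fr')) hdf.
- by move=> [z v] [/= Dz Vv]; split => /=; [exact: hD|exact: Vdg].
- by move=> [z v] [/= Oz Vv]; split => /=; [exact: hO|apply: Vdg => //; exact: fr_sub fr' _ Oz].
- move=> c [z1 v1] [z2 v2] [/= Dz1 Vv1] [/= Dz2 Vv2] [/= ? ?]; split => /=; first exact: hV.
  by apply: subspB; [exact: fr_lin fr _|exact: Vdg|exact: Vdg].
- by apply: CW_pair => //; exact: CW_lift_fst.
Qed.

Lemma lappr_lift E (V V' O1 O : set E) x v : subsp V' -> lappr V O1 O x ->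
  lappr (V `*` V') (O1 `*` V') (O `*` V') (x, v).
Proof.
move=> hV' [N N0 hN]; exists (N `*` setT).
  by exists (N, setT) => //; split => //; exact: filterT.
move=> [x' v'] [u1 u2] [/= Ox' Vv'] [/= Nx _] [/= Vu1 Vu2] [/= Nu _] [/= Oxu Vvu] W.
move=> [[W1 W2] [/= W10 W20] W12].
have [x1 [u' [Wx Wu Vu' hO]]] := hN x' u1 Ox' Nx Vu1 Nu Oxu W1 W10.
exists (x1, v'), (u', u2); split => /=.
- by apply: W12; split => //=; rewrite subrr; exact: nbhs_singleton.
- by apply: W12; split => //=; rewrite subrr; exact: nbhs_singleton.
- by split.
- move=> s s01; split => /=; first exact: hO.
  by apply: subspD => //; exact: subspZ.
Qed.

Lemma isd_dense E F (V O1 O : set E) (f : E -> F) (df : E * E -> F) x v :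
  subsp V -> vopen V O -> O1 `<=` O -> cw O f -> cw (O `*` V) df -> pd V O1 f df ->
  lappr V O1 O x -> O x -> V v -> isd f x v (df (x, v)).
Proof.
move=> hV oV O1O cf cdf hp ha Ox Vv C hC.
have VZ a u : V u -> V (a *: u) by exact: subspZ.
have [N [M [r r0 [gN qM H]]]] := quot_near VZ O1O Ox Vv cf cdf hp ha hC.
have h2 : \forall h \near (0 : R)^', `|h| < r.
  by apply: nbhs_dnbhs; apply/nbhs_ballP; exists r => // h; rewrite /ball /= sub0r normrN.
have h3 : \forall h \near (0 : R)^', h != 0 by exact: nbhs_dnbhs_neq.
have h4 := nbhs_dnbhs (vopen_near hV oV Ox Vv).
suff : \forall h \near (0 : R)^', C (diff_quot f x v h) by [].
near=> h; apply: H => //; [exact: nbhs_singleton|exact: nbhs_singleton|near: h|near: h|near: h] => //.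
Unshelve. all: by end_near.
Qed.

(** [quot_near] controls quotients at arbitrary points of the domain, so a derivative known on O1
    with a continuous extension is a derivative on all of O ([isd_dense]). This serves at nodes on
    the boundary and at the limit parameter s = 0. *)
Lemma CW_dense w E F V (O1 O D : set E) (f : E -> F) : frame V O D -> O1 `<=` O ->
  (forall b x, O x -> lappr (V b) O1 O x) -> CW w V O1 D f -> CW w V O D f.
Proof.
elim: w E V O1 O D f => [//|b w IH] E V O1 O D f fr O1O ha /= [hf [df [hd hdf]]].
split; first exact: IH hf.
have lV := fr_lin fr; have OD := fr_sub fr.
exists df; split.
  move=> x v Ox Vv; apply: (@isd_dense _ _ (V b) O1 O) => //; first exact: (@fr_open _ _ _ _ _ fr _).
  - by apply: cw_sub (CW_cw hf).
  - by apply: cw_sub (CW_cw hdf) => -[y u] [/OD].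
  - exact: ha.
apply: IH (frame_lift b fr) _ _ hdf; first by move=> [x v] [/O1O].
by move=> c [x v] [/= Ox Vv]; apply: lappr_lift => //; exact: ha.
Qed.

Lemma frame_open E V (O D N : set E) : frame V O D -> open N -> frame V (O `&` N) (D `&` N).
Proof.
move=> [OD DO Vl Vc Vo] oN; split => //; first by move=> x [/OD].
  move=> x [Dx Nx] B xB; have xN : nbhs x N by exact: open_nbhs_nbhs.
  by have [y [Oy [Ny By]]] := DO _ Dx _ (filterI xN xB); exists y.
move=> b x [Ox Nx]; have [M M0 hM] := Vo b x Ox.
have xN : nbhs x N by exact: open_nbhs_nbhs.
have : (fun p : E * E => x + (p.1 + p.2)) @ nbhs (0 : E, 0 : E) --> x + (0 + 0).
  by apply: tvs_cvgD; [exact: cvg_cst|apply: tvs_cvgD; [exact: cvg_fst|exact: cvg_snd]].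
rewrite !addr0 => /(_ _ xN) [[A B] [/= A0 B0] AB].
exists (M `&` (A `&` B)); first by apply: filterI => //; exact: filterI.
move=> x' u [Ox' Nx'] [Mx [Ax Bx]] [Mu [Au Bu]] Vu; split; first exact: hM.
have := AB (x' - x, u) (conj Ax Bu).
by rewrite /= addrA [x + _]addrC subrK.
Qed.

(** The differentials exist locally only up to choice, so one is chosen around each point. On
    overlaps two of them agree in O by uniqueness of limits, hence in D by density, and they
    glue. *)
Lemma CW_glue w E F V (O D : set E) (f : E -> F) : hausdorff_space F -> frame V O D ->
  (forall x, D x -> exists N, [/\ open N, N x & CW w V (O `&` N) (D `&` N) f]) ->
  CW w V O D f.
Proof.
move=> hF; elim: w E V O D f => [|b w IH] E V O D f fr /= hloc.
  move=> x Dx B hB; have [N [oN Nx cf]] := hloc x Dx.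
  have : nbhs x (fun z => (D `&` N) z -> B (f z)) := cf x (conj Dx Nx) B hB.
  have xN : nbhs x N by exact: open_nbhs_nbhs.
  by apply: filterS2 xN => z Nz h Dz; apply: h.
split; first by apply: IH => // x /hloc[N [oN Nx [hf _]]]; exists N.
have /choice[S hS] : forall x, exists S : set E * (E * E -> F), D x ->
    let N := S.1 in let df := S.2 in [/\ open N, N x, pd (V b) (O `&` N) f df &
     CW w (tgl V b) ((O `&` N) `*` V b) ((D `&` N) `*` V b) df].
  move=> x; have [Dx|nDx] := pselect (D x); last by exists (setT, fun=> 0).
  by have [N [oN Nx [hf [df [? ?]]]]] := hloc x Dx; exists (N, df).
have Seq x y v : D x -> D y -> (S x).1 y -> V b v -> (S y).2 (y, v) = (S x).2 (y, v).
  move=> Dx Dy Nxy Vv; have [oNx Nxx px cx] := hS x Dx; have [oNy Nyy py cy] := hS y Dy.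
  have fr1 := frame_open (frame_open fr oNx) oNy.
  have [frl1 frl2 _ _ _] := frame_lift b fr1.
  apply: (cw_eq_dense hF _ _ frl1 frl2 _ (x := (y, v))); last by [].
  - by apply: cw_sub (CW_cw cy) => -[z u] [/= [[? ?] ?] ?].
  - by apply: cw_sub (CW_cw cx) => -[z u] [/= [[? ?] ?] ?].
  - move=> [z u] [/= [[Oz Nxz] Nyz] Vu].
    by apply: (isd_unique hF); [exact: py|exact: px].
exists (fun p => (S p.1).2 p); split.
  by move=> x v Ox Vv; have [_ Nx px _] := hS x (fr_sub fr Ox); exact: px.
apply: IH; first exact: frame_lift.
move=> [x v] [/= Dx Vv]; have [oN Nx px cx] := hS x Dx.
exists ((S x).1 `*` setT); split => //.
  by apply: openX => //; exact: openT.
have e (Q : set E) : (Q `*` V b) `&` ((S x).1 `*` setT) = (Q `&` (S x).1) `*` V b.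
  by apply/seteqP; split => [[z u] [[? ?] [? _]]|[z u] [[? ?] ?]].
rewrite !e; apply: CW_ext cx; first by apply: frame_lift; exact: frame_open.
by move=> [z u] [/= [Dz Nz] Vu]; rewrite (Seq x z).
Qed.

(** The increment along h (u + v) is split at x + h u. The second part is a quotient in direction v
    at a moving base point, which [quot_near] controls. *)
Lemma isdDv E F (V O : set E) (f : E -> F) (df : E * E -> F) x u v :
  subsp V -> vopen V O -> cw O f -> cw (O `*` V) df -> pd V O f df ->
  O x -> V u -> V v -> isd f x (u + v) (df (x, u) + df (x, v)).
Proof.
move=> hV oV cf cdf hp Ox Vu Vv; rewrite [df _ + _]addrC.
pose q h := h^-1 *: (f (x + h *: u + h *: v) - f (x + h *: u)).
have e : diff_quot f x (u + v) = (fun h => q h + diff_quot f x u h).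
  by apply/funext => h; rewrite /q /diff_quot [h *: (u + v)]scalerDr [x + _]addrA -[in RHS]scalerDr [in RHS]addrA subrK.
rewrite /isd e; apply: tvs_cvgD; last exact: hp.
move=> C hC; have VZ a z : V z -> V (a *: z) by exact: subspZ.
have [N [M [r r0 [xN vM H]]]] := quot_near VZ (@subset_refl _ O) Ox Vv cf cdf hp (lappr_vopen hV oV Ox) hC.
have h2 : \forall h \near (0 : R)^', `|h| < r.
  by apply: nbhs_dnbhs; apply/nbhs_ballP; exists r => // h; rewrite /ball /= sub0r normrN.
have h3 : \forall h \near (0 : R)^', h != 0 by exact: nbhs_dnbhs_neq.
have h4 := nbhs_dnbhs (vopen_near hV oV Ox Vu).
have h5 := nbhs_dnbhs (vopen_near hV oV Ox (subspD hV Vu Vv)).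
have h6 := nbhs_dnbhs (scale_small u (iffLR (nbhs_shift _ _) xN)).
suff : \forall h \near (0 : R)^', C (q h) by [].
near=> h; apply: H => //; [near: h|near: h|exact: nbhs_singleton|near: h|near: h|] => //.
rewrite -addrA -scalerDr; near: h => //.
Unshelve. all: by end_near.
Qed.

Lemma isdZv E F (f : E -> F) x v l (a : R) : isd f x v l -> isd f x (a *: v) (a *: l).
Proof.
move=> h; have [->|a0] := eqVneq a 0.
  rewrite !scale0r /isd; have -> : diff_quot f x 0 = fun=> 0; last exact: cvg_cst.
  by apply/funext => k; rewrite /diff_quot scaler0 addr0 subrr scaler0.
have e : diff_quot f x (a *: v) = (fun k => a *: diff_quot f x v (k * a)).
  apply/funext => k; rewrite /diff_quot !scalerA invfM mulrCA divff// mulr1.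
  by [].
rewrite /isd e; apply: tvs_cvgZ; first exact: cvg_cst.
by move=> C hC; have := dnbhs0_mulr a0 (h C hC).
Qed.

Lemma pd_lin E F (V O : set E) (f : E -> F) (df : E * E -> F) x (a : R) u v :
  hausdorff_space F ->
  subsp V -> vopen V O -> cw O f -> cw (O `*` V) df -> pd V O f df ->
  O x -> V u -> V v -> df (x, a *: u + v) = a *: df (x, u) + df (x, v).
Proof.
move=> hF hV oV cf cdf hp Ox Vu Vv; apply: (isd_unique hF (f := f) (x := x) (v := a *: u + v)).
  by apply: hp => //; case: hV => _; apply.
have -> : a *: df (x, u) = df (x, a *: u).
  apply: (isd_unique hF); first by apply: isdZv; exact: hp.
  by apply: hp => //; exact: subspZ.
by apply: (isdDv hV oV) => //; exact: subspZ.
Qed.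

Lemma isdZ E F (a : E -> R^o) (f : E -> F) x v m l :
  isd a x v m -> isd f x v l -> isd (fun y => a y *: f y) x v (a x *: l + m *: f x).
Proof.
move=> ha hf; pose ax (h : R) : R^o := a x + h *: diff_quot a x v h.
have e : \forall h \near (0 : R)^', ax h *: diff_quot f x v h + diff_quot a x v h *: f x =
   diff_quot (fun y => a y *: f y) x v h.
  apply: filterS (nbhs_dnbhs_neq _) => h h0.
  have -> : ax h = a (x + h *: v) by rewrite /ax /diff_quot scalerA divff// scale1r addrC subrK.
  have -> : diff_quot a x v h *: f x = h^-1 *: ((a (x + h *: v) - a x) *: f x) by rewrite scalerA.
  rewrite /diff_quot scalerA [_ * h^-1]mulrC -scalerA -scalerDr scalerBr scalerBl.
  by congr (_ *: _); rewrite addrA subrK.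
apply: (cvg_trans (near_eq_cvg e)).
apply: tvs_cvgD; apply: tvs_cvgZ => //; last exact: cvg_cst.
rewrite -[X in _ --> X]addr0; apply: tvs_cvgD; first exact: cvg_cst.
have : (fun h : R => h *: diff_quot a x v h) @ (0 : R)^' --> (0 : R^o) *: m.
  by apply: tvs_cvgZ => //; apply: cvg_within_filter; exact: cvg_id.
by rewrite scale0r.
Qed.

Lemma CWZ w E F V (O D : set E) (a : E -> R^o) (f : E -> F) :
  CW w V O D a -> CW w V O D f -> CW w V O D (fun x => a x *: f x).
Proof.
elim: w E V O D a f => [|b w IH] E V O D a f /=; first exact: cwZ.
move=> [ha [da [pa hda]]] [hf [df [pf hdf]]]; split; first exact: IH.
exists (fun p => a p.1 *: df p + da p *: f p.1); split.
  by move=> x v Ox Vv; apply: isdZ; [exact: pa|exact: pf].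
by apply: CWD; apply: IH => //; exact: CW_lift_fst.
Qed.

End CW_theory.

(** * Comparison with iterated directional derivatives *)

Section iterated_derivatives.
Context {R : realType}.
Implicit Types E F G : tvsType R.

Lemma ptws_cvg (I : Type) (K : I -> topologicalType) (T : Type) (A : set_system T) {FA : Filter A}
    (f : T -> forall i, K i) (g : forall i, K i) :
  (forall i, (fun t => f t i) @ A --> g i) -> (f : T -> prod_topology K) @ A --> (g : prod_topology K).
Proof.
move=> h; apply/cvg_sup => i U [V [[W oW <-] Wg WU]].
by apply: (filterS WU); apply: h; apply: open_nbhs_nbhs.
Qed.

Lemma ptws_continuous (I : Type) (K : I -> topologicalType) (X : topologicalType)
    (f : X -> forall i, K i) :
  (forall i, continuous (fun x => f x i)) -> continuous (f : X -> prod_topology K).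
Proof. by move=> h x; apply: (@ptws_cvg _ _ _ (nbhs x)) => i; exact: h. Qed.

Lemma continuous_pair (X Y Z : topologicalType) (f : X -> Y) (g : X -> Z) :
  continuous f -> continuous g -> continuous (fun x => (f x, g x)).
Proof. by move=> cf cg x; apply: (@cvg_pair _ _ _ (nbhs x)); [exact: cf|exact: cg]. Qed.

Lemma continuousM (X Y Z : topologicalType) (f : X -> Y) (g : Y -> Z) :
  continuous f -> continuous g -> continuous (fun x => g (f x)).
Proof. by move=> cf cg x; apply: continuous_comp; [exact: cf|exact: cg]. Qed.

Lemma continuous_fst (X Y : topologicalType) : continuous (@fst X Y).
Proof. by move=> x; exact: cvg_fst. Qed.

Lemma continuous_snd (X Y : topologicalType) : continuous (@snd X Y).
Proof. by move=> x; exact: cvg_snd. Qed.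

Lemma continuous_proj (I : eqType) (K : I -> topologicalType) i :
  continuous (fun y : prod_topology K => y i).
Proof. exact: (@proj_continuous _ K). Qed.

Lemma within_comp (X Y Z : topologicalType) (S : X -> Y) (g : Y -> Z) (P : set X) (Q : set Y) (x : X) (l : Z) :
  continuous S -> (forall z, P z -> Q (S z)) ->
  g @ within Q (nbhs (S x)) --> l -> (fun z => g (S z)) @ within P (nbhs x) --> l.
Proof.
move=> cS PQ h B hB; have hN : nbhs (S x) (fun y => Q y -> B (g y)) := h B hB.
suff : nbhs x [set z | P z -> B (g (S z))] by [].
have : nbhs x [set z | Q (S z) -> B (g (S z))] := cS x _ hN.
by apply: filterS => z /= + Pz; apply; exact: PQ.
Qed.

Lemma dir_derive_isd E F (f : E -> F) x v l : hausdorff_space F -> isd f x v l ->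
  dir_derive f x v = l.
Proof.
move=> hF fl; rewrite /dir_derive /tvs_lim; case: xgetP => [y -> /= yl|/(_ l)//].
exact: (isd_unique hF yl fl).
Qed.

Lemma isd_dir_derive E F (f : E -> F) x v : dir_derivable f x v -> isd f x v (dir_derive f x v).
Proof.
move=> [l fl]; rewrite /dir_derive /tvs_lim; case: xgetP => [y -> //|/(_ l)].
by move=> /(_ fl).
Qed.

Definition vdir E (O : set E) (y : E) := forall x, O x -> \forall h \near (0 : R), O (x + h *: y).

Lemma iter_derive_param E F (O V : set E) (f : E * E -> F) (phi : E -> E -> F) (ys : seq E) v :
  (forall y, y \in ys -> vdir O y) -> (forall x, O x -> f (x, v) = phi v x) ->
  forall x, O x -> iter_derive f [seq (y, 0 : E) | y <- ys] (x, v) = iter_derive (phi v) ys x.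
Proof.
elim: ys f phi => [|y ys IH] f phi hys e x Ox /=; first exact: e.
have Vy : vdir O y by apply: hys; rewrite inE eqxx.
apply: (IH _ (fun v x => dir_derive (phi v) x y)) => //.
  by move=> z zys; apply: hys; rewrite inE zys orbT.
move=> z Oz; rewrite /dir_derive /tvs_lim; congr (xget _ _).
apply/seteqP; split => l /=; apply: cvg_trans; apply: near_eq_cvg; apply: nbhs_dnbhs;
  apply: filterS (Vy _ Oz) => h Oh; rewrite /diff_quot;
  by rewrite (_ : (z, v) + h *: (y, 0) = (z + h *: y, v)) ?e//; congr (_, _);
    rewrite /= scaler0 addr0.
Qed.

Lemma iter_derivable_param E F (O V : set E) (f : E * E -> F) (phi : E -> E -> F) (ys : seq E) :
  (forall y, y \in ys -> vdir O y) ->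
  (forall x v, O x -> V v -> f (x, v) = phi v x) ->
  iter_derivable (O `*` V) f [seq (y, 0 : E) | y <- ys] <->
  forall v, V v -> iter_derivable O (phi v) ys.
Proof.
elim: ys f phi => [|y ys IH] f phi hys e /=; first by split.
have Vy : vdir O y by apply: hys; rewrite inE eqxx.
have hys' z : z \in ys -> vdir O z by move=> zys; apply: hys; rewrite inE zys orbT.
have e1 x v (Q : set_system F) : O x -> V v ->
   (diff_quot f (x, v) (y, 0) h @[h --> 0^'] --> Q <-> diff_quot (phi v) x y h @[h --> 0^'] --> Q).
  move=> Ox Vv; split; apply: cvg_trans; apply: near_eq_cvg; apply: nbhs_dnbhs;
  apply: filterS (Vy _ Ox) => h Oh; rewrite /diff_quot;
  by rewrite (_ : (x, v) + h *: (y, 0) = (x + h *: y, v)) ?e//; congr (_, _);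
    rewrite /= scaler0 addr0.
have e2 x v : O x -> V v -> dir_derive f (x, v) (y, 0) = dir_derive (phi v) x y.
  move=> Ox Vv; rewrite /dir_derive /tvs_lim; congr (xget _ _).
  by apply/seteqP; split => l /=; have [h1 h2] := e1 x v (nbhs l) Ox Vv.
have IH' := IH (fun p => dir_derive f p (y, 0)) (fun v x => dir_derive (phi v) x y) hys' e2.
split=> [[h1 /IH' h2] v Vv|h]; split.
- move=> x Ox; have [l fl] := h1 (x, v) (conj Ox Vv); exists l.
  by have [+ _] := e1 x v (nbhs l) Ox Vv; apply.
- exact: h2.
- move=> [x v] [/= Ox Vv]; have [/(_ x Ox)[l fl] _] := h v Vv; exists l.
  by have [_] := e1 x v (nbhs l) Ox Vv; apply.
- by apply/IH' => v Vv; have [] := h v Vv.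
Qed.

Lemma codom_ordS (T : Type) n (y : 'I_n.+1 -> T) :
  codom y = y ord0 :: codom (fun i => y (lift ord0 i)).
Proof. by rewrite !codomE enum_ordSl /= -map_comp. Qed.

Lemma codom_map (T S : Type) n (y : 'I_n -> T) (g : T -> S) :
  codom (fun i => g (y i)) = map g (codom y).
Proof. by rewrite !codomE -map_comp. Qed.

Definition is_word E F (w : seq bool) (V : bool -> set E) (O D : set E) (f : E -> F) :=
  exists g : E * {ptws 'I_(size w) -> E} -> F,
    (forall p : E * {ptws 'I_(size w) -> E}, D p.1 -> (forall i : 'I_(size w), V (nth true w i) (p.2 i)) ->
      g @ within [set p | D p.1 /\ forall i : 'I_(size w), V (nth true w i) (p.2 i)] (nbhs p) --> g p) /\
    forall y : 'I_(size w) -> E, (forall i : 'I_(size w), V (nth true w i) (y i)) ->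
      iter_derivable O f (codom y) /\ forall x, O x -> g (x, y) = iter_derive f (codom y) x.

(** [CW] also differentiates the differential in its vector argument. The iterated derivatives of f
    only use the directions (y, 0) on it, whence the map T appending zeros. *)
Lemma CW_word E F w (V : bool -> set E) (O D : set E) (f : E -> F) : hausdorff_space F ->
  frame V O D -> CW w V O D f -> is_word w V O D f.
Proof.
move=> hF; elim: w E V O D f => [|b w IH] E V O D f fr /=.
  move=> cf; exists (fun p => f p.1); split=> [[x y] /= Dx _|y _]; last first.
    by rewrite codomE (size0nil (size_enum_ord 0)).
  apply: (cw_cvg (g := fst) cf) => //.
    by rewrite near_withinE; apply: nearW => p [].
  by apply: cvg_within_filter; exact: cvg_fst.
move=> [hf [df [hd hdf]]]; have [g [cg hg]] := IH _ _ _ _ _ (frame_lift b fr) hdf.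
have lV := fr_lin fr; have oV := fr_open fr; have OD := fr_sub fr.
pose T (y : {ptws 'I_(size w).+1 -> E}) : {ptws 'I_(size w) -> (E * E)%type} := fun i => (y (lift ord0 i), 0).
have Tc : continuous T.
  apply: ptws_continuous => i; apply: continuous_pair; last exact: cst_continuous.
  exact: continuous_proj.
pose S (p : E * {ptws 'I_(size w).+1 -> E}) := ((p.1, p.2 ord0), T p.2).
have Sc : continuous S.
  apply: continuous_pair; last exact: (continuousM (@continuous_snd _ _) Tc).
  apply: continuous_pair; first exact: continuous_fst.
  exact: (continuousM (@continuous_snd _ _) (@continuous_proj _ _ ord0)).
exists (fun p => g ((p.1, p.2 ord0), T p.2)); split.
  move=> p Dp Vp; apply: (@within_comp _ _ _ S g _ [set q | (D `*` V b) q.1 /\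
      forall i : 'I_(size w), (tgl V b (nth true w i)) (q.2 i)] p _ Sc).
    move=> q [Dq Vq]; split; first by split => //; exact: (Vq ord0).
    by move=> i; split => /=; [have := Vq (lift ord0 i)|case: (lV b)].
  apply: cg; first by split => //; exact: (Vp ord0).
  by move=> i; split => /=; [have := Vp (lift ord0 i)|case: (lV b)].
move=> y Vy; have Vy0 : V b (y ord0) := Vy ord0.
have Ty : forall i : 'I_(size w), (tgl V b (nth true w i)) (T y i).
  by move=> i; split => /=; [have := Vy (lift ord0 i)|case: (lV b)].
have [hT1 hT2] := hg (T y) Ty.
have eT : codom (T y) = [seq (z, 0 : E) | z <- codom (fun i => y (lift ord0 i))].
  by rewrite /T -codom_map.
have e x v : O x -> V b v -> df (x, v) = dir_derive f x v.
  by move=> Ox Vv; apply/esym/dir_derive_isd => //; exact: hd.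
have hys z : z \in codom (fun i => y (lift ord0 i)) -> vdir O z.
  move=> /codomP[i ->] x Ox; have := Vy (lift ord0 i); rewrite /= => Vi.
  exact: (vopen_near (lV _) (oV _) Ox Vi).
rewrite eT in hT1 hT2.
have P1 := iter_derivable_param (f := df) (phi := fun v x => dir_derive f x v) hys e.
rewrite codom_ordS /=; split; last first.
  move=> x Ox; rewrite -(@iter_derive_param _ _ O (V b) df (fun v x => dir_derive f x v) _ (y ord0) hys _ x Ox); last first.
    by move=> z Oz; exact: e.
  by rewrite -hT2.
split; last by have [+ _] := P1; move=> /(_ hT1); apply.
by move=> x Ox; exists (df (x, y ord0)); exact: hd.
Qed.

(* The reduced tower: differentials are only differentiated in the point. *)
Fixpoint RW E F (n : nat) (V O D : set E) (f : E -> F) : Prop :=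
  if n is m.+1 then RW m V O D f /\ exists df : E * E -> F,
    pd V O f df /\ RW m (V `*` [set 0]) (O `*` V) (D `*` V) df
  else cw D f.

Definition is_words E F (n : nat) (V O D : set E) (f : E -> F) := cw D f /\
  forall j, (j <= n)%N -> exists g : E * {ptws 'I_j -> E} -> F,
    (forall p : E * {ptws 'I_j -> E}, D p.1 -> (forall i, V (p.2 i)) ->
      g @ within [set p | D p.1 /\ forall i, V (p.2 i)] (nbhs p) --> g p) /\
    forall y : 'I_j -> E, (forall i, V (y i)) ->
      iter_derivable O f (codom y) /\ forall x, O x -> g (x, y) = iter_derive f (codom y) x.

(** The differential is the given function of one direction. Its derivatives in the point are the
    given derivatives of f with one more direction, which T inserts in front. *)
Lemma is_words_RW E F n (V O D : set E) (f : E -> F) : O `<=` D -> subsp V -> vopen V O ->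
  is_words n V O D f -> RW n V O D f.
Proof.
elim: n E V O D f => [|n IH] E V O D f OD lV oV; first by case.
move=> [cf h]; split; first by apply: IH => //; split => // j jn; apply: h; exact: leq_trans jn _.
have [g1 [cg1 hg1]] := h 1%N (ltac:(by [])).
pose df (p : E * E) := g1 (p.1, fun _ => p.2).
have hd : pd V O f df.
  move=> x v Ox Vv; have [] := hg1 (fun _ => v) (fun _ => Vv).
  rewrite codom_ordS codomE (size0nil (size_enum_ord 0)) /= => -[/(_ x Ox) h1 _] /(_ x Ox) h2; rewrite /df /= h2.
  exact: isd_dir_derive.
exists df; split => //; apply: IH.
- by move=> [x v] [/OD].
- apply: subspX => //; split => // a u v /= -> ->; by rewrite scaler0 addr0.
- move=> [x v] [/= Ox Vv]; have [N N0 hN] := oV _ Ox.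
  exists (N `*` setT); first by exists (N, setT) => //; split => //; exact: filterT.
  move=> [x' v'] [u1 u2] [/= Ox' Vv'] [/= Nx _] [/= Nu _] [/= Vu ->].
  by split => /=; [exact: hN|rewrite addr0].
have cdf : cw (D `*` V) df.
  pose S1 (p : E * E) : E * {ptws 'I_1 -> E} := (p.1, fun=> p.2).
  have Sc : continuous S1.
    by apply: continuous_pair; [exact: continuous_fst|apply: ptws_continuous => i; exact: continuous_snd].
  move=> p [/= Dx Vv]; apply: (@within_comp _ _ _ S1 g1 _ _ p _ Sc _ (cg1 (S1 p) Dx (fun=> Vv))).
  by move=> q [Dq Vq]; split.
split => // j jn; have [g [cg hg]] := h j.+1 jn.
pose T (p : (E * E) * {ptws 'I_j -> (E * E)%type}) : E * {ptws 'I_j.+1 -> E} :=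
  (p.1.1, fun i => oapp (fun i' => (p.2 i').1) p.1.2 (unlift ord0 i)).
have Tc : continuous T.
  apply: continuous_pair; first exact: (continuousM (@continuous_fst _ _) (@continuous_fst _ _)).
  apply: ptws_continuous => i; case: (unlift ord0 i) => [i'|] /=.
    have c1 : continuous (fun y : {ptws 'I_j -> (E * E)%type} => (y i').1).
      exact: (@continuousM _ _ _ _ _ (@continuous_proj 'I_j (fun=> (E * E)%type) i') (@continuous_fst E E)).
    exact: (continuousM (@continuous_snd _ _) c1).
  exact: (continuousM (@continuous_fst _ _) (@continuous_snd _ _)).
have VT (p : (E * E) * {ptws 'I_j -> (E * E)%type}) : V p.1.2 -> (forall i, (V `*` [set 0]) (p.2 i)) -> forall i, V ((T p).2 i).
  by move=> Vp Vi i; rewrite /T /=; case: (unlift ord0 i) => [i'|] //=; have [] := Vi i'.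
exists (fun p => g (T p)); split.
  move=> p [Dp Vp] Vi; apply: (@within_comp _ _ _ T g _ _ p _ Tc _ (cg (T p) Dp (VT p Vp Vi))).
  by move=> q [[Dq Vq] Vqi]; split => //; exact: VT.
move=> y Vy.
have ey : codom y = [seq (z, 0 : E) | z <- codom (fun i => (y i).1)].
  rewrite -codom_map; congr codom; apply/funext => i.
  by have [_ /= <-] := Vy i; case: (y i).
have hys z : z \in codom (fun i => (y i).1) -> vdir O z.
  by move=> /codomP[i ->] x Ox; apply: (vopen_near lV oV Ox); have [] := Vy i.
have e x v : O x -> V v -> df (x, v) = dir_derive f x v.
  move=> Ox Vv; have [_ /(_ x Ox)] := hg1 (fun _ => v) (fun _ => Vv).
  by rewrite codom_ordS codomE (size0nil (size_enum_ord 0)) /=.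
have hc v : V v -> codom (T ((0, v), y)).2 = v :: codom (fun i => (y i).1).
  move=> Vv; rewrite codom_ordS /T /= unlift_none /=; congr (_ :: _); congr codom.
  by apply/funext => i; rewrite liftK.
rewrite ey; split.
  apply/(iter_derivable_param (f := df) (phi := fun v x => dir_derive f x v) hys e) => v Vv.
  have [+ _] := hg _ (VT ((0, v), y) Vv Vy).
  by rewrite hc//= => -[].
move=> [x v] [/= Ox Vv].
rewrite (@iter_derive_param _ _ O V df (fun v x => dir_derive f x v) _ v hys _ x Ox); last first.
  by move=> z Oz; exact: e.
have [_ /(_ x Ox)] := hg _ (VT ((0, v), y) Vv Vy).
by rewrite hc.
Qed.

End iterated_derivatives.

Section directional_words.
Context {R : realType}.
Implicit Types E F G : tvsType R.

Lemma RW_cw n E F (V O D : set E) (f : E -> F) : RW n V O D f -> cw D f.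
Proof. by elim: n => //= n IH [/IH]. Qed.

Lemma RWD n E F (V O D : set E) (f g : E -> F) :
  RW n V O D f -> RW n V O D g -> RW n V O D (fun x => f x + g x).
Proof.
elim: n E V O D f g => [|n IH] E V O D f g /=; first exact: cwD.
move=> [hf [df [hd hdf]]] [hg [dg [hd' hdg]]]; split; first exact: IH.
exists (fun p => df p + dg p); split; last exact: IH.
by move=> x v Ox Vv; apply: isdD; [exact: hd|exact: hd'].
Qed.

Lemma RW_complin n E E' F V V' (O D : set E) (O' D' : set E') (L : E' -> E) (f : E -> F) :
  lincont L -> (forall x, O' x -> O (L x)) -> (forall x, D' x -> D (L x)) ->
  (forall v, V' v -> V (L v)) -> RW n V O D f -> RW n V' O' D' (fun x => f (L x)).
Proof.
elim: n E E' V V' O D O' D' L f => [|n IH] E E' V V' O D O' D' L f hL hO hD hV /=.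
  by move=> cf; apply: cw_comp cf => //; exact: cw_lin.
have L0 : L 0 = 0 by have := linZ 0 0 hL; rewrite !scale0r.
move=> [hf [df [hd hdf]]]; split; first exact: IH hf.
exists (fun p => df (L p.1, L p.2)); split.
  by move=> x v /hO Ox /hV Vv; apply: isd_complin => //; exact: hd.
apply: (IH _ _ _ _ _ _ _ _ (fun p => (L p.1, L p.2))) hdf.
- by apply: lincont_pair; apply: lincont_comp => //; [exact: lincont_fst|exact: lincont_snd].
- by move=> p [/hO ? /hV ?].
- by move=> p [/hD ? /hV ?].
- by move=> p [/hV ? /= ->].
Qed.

(** For f linear in a, the derivative at (x, a) in direction (y, u) is d_x f(x, a)(y) + f(x, u), and
    the first summand is again linear in a. So regularity in x alone yields joint regularity. *)
Lemma RW_lin n E G F (V O D : set E) (W : set G) (f : E * G -> F) : hausdorff_space F ->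
  O `<=` D -> D `<=` closure O -> subsp V -> vopen V O -> subsp W ->
  (forall x (c : R) a b, D x -> W a -> W b -> f (x, c *: a + b) = c *: f (x, a) + f (x, b)) ->
  RW n (V `*` [set 0]) (O `*` W) (D `*` W) f -> RW n (V `*` W) (O `*` W) (D `*` W) f.
Proof.
move=> hF; elim: n E G V O D W f => [//|n IH] E G V O D W f OD DO lV oV lW flin /= [hf [df [hd hdf]]].
split; first exact: IH.
have W0 : W 0 by case: lW.
have V0 : V 0 by case: lV.
have cf : cw (D `*` W) f := RW_cw hf.
pose L1 (q : (E * E) * G) : (E * G) * (E * G) := ((q.1.1, q.2), (q.1.2, 0)).
pose L2 (p : (E * G) * (E * G)) : (E * E) * G := ((p.1.1, p.2.1), p.1.2).
pose L3 (p : (E * G) * (E * G)) : E * G := (p.1.1, p.2.2).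
have [l1 [l2 l3]] : lincont L1 /\ lincont L2 /\ lincont L3.
  by split; [|split]; lincont.
pose f1 q := df (L1 q).
have vV0 : vopen (V `*` [set 0]) (O `*` V).
  move=> [x v] [/= Ox Vv]; have [N N0 hN] := oV _ Ox.
  exists (N `*` setT); first by exists (N, setT) => //; split => //; exact: filterT.
  move=> [x' v'] [u1 u2] [/= Ox' Vv'] [/= Nx _] [/= Nu _] [/= Vu ->].
  by split => /=; [exact: hN|rewrite addr0].
have s0 (T : tvsType R) : subsp [set (0 : T)].
  by split => // c a b /= -> ->; rewrite scaler0 addr0.
have f1lin q (c : R) a b : (D `*` V) q -> W a -> W b -> f1 (q, c *: a + b) = c *: f1 (q, a) + f1 (q, b).
  move: q => [x y] [/= Dx Vy] Wa Wb; rewrite /f1 /L1 /=.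
  have cdf z : W z -> cw D (fun x => df ((x, z), (y, 0))).
    move=> Wz; apply: cw_comp (RW_cw hdf) => [x' Dx'|]; first by split.
    apply: cw_pair; last by move=> ? _; exact: cvg_cst.
    by apply: cw_pair; [apply: cw_lin; exact: lincont_id|move=> ? _; exact: cvg_cst].
  apply: (cw_eq_dense (O := O) (D := D) hF (f := fun x => df ((x, c *: a + b), (y, 0)))
     (g := fun x => c *: df ((x, a), (y, 0)) + df ((x, b), (y, 0)))) => //.
  - by apply: cdf; case: lW => _; apply.
  - apply: cwD; last exact: cdf.
    by apply: (cwZ (a := fun=> c)); [move=> ? _; exact: cvg_cst|exact: cdf].
  move=> {Dx}x Ox.
  have h z : W z -> isd (fun x => f (x, z)) x y (df ((x, z), (y, 0))).
    move=> Wz; have := hd (x, z) (y, 0) (conj Ox Wz) (conj Vy erefl); rewrite /isd.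
    apply: cvg_trans; apply: near_eq_cvg; apply: nearW => h; rewrite /diff_quot.
    by congr (_ *: (f _ - _)); congr (_, _); rewrite /= scaler0 addr0.
  apply: (isd_unique hF (h _ _)); first by case: lW => _; apply.
  have e := isdD (isdZ (isd_cst (c : R^o) x y) (h _ Wa)) (h _ Wb).
  rewrite scale0r addr0 in e; apply: isd_ext e.
  apply: filterS (vopen_near lV oV Ox Vy) => k Ok; rewrite flin//; exact: OD.
have rf1 : RW n ((V `*` [set 0]) `*` W) ((O `*` V) `*` W) ((D `*` V) `*` W) f1.
  apply: (IH _ _ (V `*` [set 0]) (O `*` V) (D `*` V) W) => //.
  - by move=> [x v] [/OD].
  - move=> [x v] [/= Dx Vv] S [[A B] [/= xA vB] AB].
    have [y [Oy Ay]] := DO _ Dx _ xA.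
    by exists (y, v); split => //; apply: AB; split => //; exact: nbhs_singleton.
  - exact: subspX.
  apply: (RW_complin (L := L1)) hdf => //.
  - by move=> [[x y] a] [[/= ? ?] ?].
  - by move=> [[x y] a] [[/= ? ?] ?].
  - by move=> [[x y] a] [[/= ? ->] ->].
exists (fun p => f1 (L2 p) + f (L3 p)); split; last first.
  apply: RWD.
  - apply: (RW_complin (L := L2)) rf1 => //.
    + by move=> [[x a] [y b]] [[/= ? ?] [/= ? ?]].
    + by move=> [[x a] [y b]] [[/= ? ?] [/= ? ?]].
    + by move=> [[x a] [y b]] [[/= ? ?] [/= -> _]].
  - apply: (RW_complin (L := L3)) hf => //.
    + by move=> [[x a] [y b]] [[/= ? ?] [/= ? ?]].
    + by move=> [[x a] [y b]] [[/= ? ?] [/= ? ?]].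
    + by move=> [[x a] [y b]] [[/= ? ?] [/= _ ->]].
move=> [x a] [y u] [/= Ox Wa] [/= Vy Wu]; rewrite /f1 /L1 /L2 /L3 /=.
have h1 := hd (x, a) (y, 0) (conj Ox Wa) (conj Vy erefl).
have e : \forall h \near (0 : R)^', diff_quot f (x, a) (y, 0) h + f (x + h *: y, u) =
    diff_quot f (x, a) (y, u) h.
  have h3 : \forall h \near (0 : R)^', h != 0 by exact: nbhs_dnbhs_neq.
  apply: filterS2 h3 (nbhs_dnbhs (vopen_near lV oV Ox Vy)) => h h0 Oh.
  rewrite /diff_quot.
  rewrite (_ : (x, a) + h *: (y, u) = (x + h *: y, h *: u + a)); last by rewrite [h *: u + a]addrC.
  rewrite (_ : (x, a) + h *: (y, 0) = (x + h *: y, a)); last by congr (_, _); rewrite /= scaler0 addr0.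
  rewrite flin//; last exact: OD.
  by rewrite -[in RHS]addrA [in RHS]scalerDr scalerA mulVf// scale1r [RHS]addrC.
apply: (cvg_trans (near_eq_cvg e)).
apply: tvs_cvgD => //.
apply: (cw_cvg (g := fun h : R => (x + h *: y, u)) cf); first by split => //; exact: OD.
  by apply: filterS (nbhs_dnbhs (vopen_near lV oV Ox Vy)) => h /OD.
apply: cvg_within_filter; apply: cvg_pair; last exact: cvg_cst.
have : (fun h : R^o => x + h *: y) @ (0 : R^o) --> x + (0 : R^o) *: y.
  by apply: tvs_cvgD; [exact: cvg_cst|apply: tvs_cvgZ; [exact: cvg_id|exact: cvg_cst]].
by rewrite scale0r addr0.
Qed.

(** The differential is linear in its vector argument, on O by [pd_lin] and on D by density, so
    [RW_lin] supplies the derivatives in that argument. *)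
Lemma RW_CW n E F (V O D : set E) (f : E -> F) : hausdorff_space F -> frame (fun _ => V) O D ->
  RW n V O D f -> CW (nseq n true) (fun _ => V) O D f.
Proof.
move=> hF; elim: n E V O D f => [//|n IH] E V O D f fr /= [hf [df [hd hdf]]].
split; first exact: IH.
have [OD DO lV _ oV] := fr.
exists df; split => //; apply: (IH _ (V `*` V)); first exact: (frame_lift true fr).
apply: RW_lin => //; try exact: (lV true); try exact: (oV true).
move=> x c a b Dx Va Vb.
have cdf z : V z -> cw D (fun x => df (x, z)).
  move=> Wz; apply: cw_comp (RW_cw hdf) => [x' Dx'|]; first by split.
  by apply: cw_pair; [apply: cw_lin; exact: lincont_id|move=> ? _; exact: cvg_cst].
apply: (cw_eq_dense (O := O) (D := D) hF (f := fun x => df (x, c *: a + b))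
     (g := fun x => c *: df (x, a) + df (x, b))) => //.
- by apply: cdf; case: (lV true) => _; apply.
- apply: cwD; last exact: cdf.
  by apply: (cwZ (a := fun=> c)); [move=> ? _; exact: cvg_cst|exact: cdf].
move=> z Oz; apply: (pd_lin c hF (lV true) (oV true) _ _ hd) => //.
  exact: cw_sub (RW_cw hf).
by apply: cw_sub (RW_cw hdf) => -[y u] [/OD].
Qed.

Lemma vopenT E (O : set E) : open O -> forall V, vopen V O.
Proof.
move=> oO V x Ox; have xO : nbhs x O by exact: open_nbhs_nbhs.
have : (fun p : E * E => x + (p.1 + p.2)) @ nbhs (0 : E, 0 : E) --> x + (0 + 0).
  by apply: tvs_cvgD; [exact: cvg_cst|apply: tvs_cvgD; [exact: cvg_fst|exact: cvg_snd]].
rewrite !addr0 => /(_ _ xO) [[A B] [/= A0 B0] AB].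
exists (A `&` B); first exact: filterI.
move=> x' u Ox' [Ax _] [_ Bu] _; have := AB (x' - x, u) (conj Ax Bu).
by rewrite /= addrA [x + _]addrC subrK.
Qed.

Lemma frameT E (D : set E) : regular_set D -> frame (fun _ => setT) D° D.
Proof.
move=> rD; split => //; first exact: interior_subset.
by move=> b; apply: vopenT; exact: open_interior.
Qed.

Lemma is_C_CW (l : Defs.order) n E F (D : set E) (f : E -> F) : hausdorff_space F -> regular_set D ->
  is_C l D f -> le_order n l -> CW (nseq n true) (fun _ => setT) D° D f.
Proof.
move=> hF rD [/cwP cf h] nl; apply: RW_CW => //; first exact: frameT.
apply: is_words_RW => //; first exact: interior_subset.
  by apply: vopenT; exact: open_interior.
split => // j jn.
have jl : le_order j l by case: l nl {h} => //= k; exact: leq_trans.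
have [g [/subspace_continuousP cg hg]] := h j jl; exists g; split; last first.
  by move=> y _; have [? ?] := hg y; split.
move=> p Dp _.
have -> : [set p0 : E * {ptws 'I_j -> E} | D p0.1 /\ (forall i : 'I_j, [set: E] (p0.2 i))] = [set p | D p.1].
  by apply/seteqP; split => q => [[]|].
exact: cg.
Qed.

Lemma CW_is_C (l : Defs.order) E F (D : set E) (f : E -> F) : hausdorff_space F -> regular_set D ->
  (forall n, le_order n l -> CW (nseq n true) (fun _ => setT) D° D f) -> is_C l D f.
Proof.
move=> hF rD h; split.
  by apply/cwP; apply: (CW_cw (w := nseq 0 true)); apply: h; case: (l).
move=> j jl; have := CW_word hF (frameT rD) (h _ jl); rewrite /is_word size_nseq.
move=> [g [cg hg]]; exists g; split; last first.
  by move=> y; have [//|h1 h2] := hg y; split => // x Dx; exact: h2.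
apply/subspace_continuousP => p Dp; have := cg p Dp (fun _ => I).
have -> // : [set p0 : E * {ptws 'I_j -> E} | D p0.1 /\ (forall i : 'I_j, [set: E] (p0.2 i))] = [set p | D p.1].
by apply/seteqP; split => q => [[]|].
Qed.

Lemma size_map_enum (T : Type) n (f : 'I_n -> T) : size [seq f b | b <- enum 'I_n] = n.
Proof. by rewrite size_map size_enum_ord. Qed.

Lemma nth_map_enum (T : Type) (x0 : T) n (f : 'I_n -> T) m (mn : (m < n)%N) :
  nth x0 [seq f b | b <- enum 'I_n] m = f (Ordinal mn).
Proof.
rewrite (nth_map (Ordinal mn)) ?size_enum_ord//.
by congr f; apply: val_inj; rewrite /= nth_enum_ord.
Qed.

(** The letter true stands for the second factor because [is_C2] differentiates in that factor
    first, and words are read from the left. *)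
Definition Vprod (E1 E2 : tvsType R) (b : bool) : set (E1 * E2) :=
  if b then [set 0] `*` setT else setT `*` [set 0].

Lemma CW_is_C2 k l (E1 E2 : tvsType R) F (D1 : set E1) (D2 : set E2) (f : E1 * E2 -> F) :
  hausdorff_space F -> frame (@Vprod E1 E2) (D1° `*` D2°) (D1 `*` D2) ->
  (forall i j, le_order i k -> le_order j l ->
    CW (nseq j true ++ nseq i false) (@Vprod E1 E2) (D1° `*` D2°) (D1 `*` D2) f) ->
  is_C2 k l D1 D2 f.
Proof.
move=> hF fr h; split.
  apply/cwP; apply: (CW_cw (w := nseq 0 true ++ nseq 0 false)); apply: h; first by case: (k).
  by case: (l).
move=> i j ik jl; have := CW_word hF fr (h _ _ ik jl).
set w := nseq j true ++ nseq i false.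
have sw : size w = (j + i)%N by rewrite /w size_cat !size_nseq.
move=> [g [cg hg]].
pose dirs (q : {ptws 'I_i -> E1} * {ptws 'I_j -> E2}) : seq (E1 * E2) :=
  [seq (0, q.2 b) | b <- enum 'I_j] ++ [seq (q.1 a, 0) | a <- enum 'I_i].
have sd q : size (dirs q) = size w by rewrite /dirs size_cat !size_map_enum sw.
pose Y (q : {ptws 'I_i -> E1} * {ptws 'I_j -> E2}) : {ptws 'I_(size w) -> (E1 * E2)%type} :=
  fun m => nth 0 (dirs q) m.
have cY q : codom (Y q) = dirs q.
  rewrite codomE /Y.
  transitivity (map (nth 0 (dirs q)) (map val (enum 'I_(size w)))); first by rewrite -map_comp.
  rewrite val_enum_ord -(sd q).
  by rewrite map_nth_iota0 ?take_size.
have Ylt q (m : 'I_(size w)) (mj : (m < j)%N) : Y q m = (0, q.2 (Ordinal mj)).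
  rewrite /Y /dirs nth_cat size_map_enum mj; exact: nth_map_enum.
have Yge (m : 'I_(size w)) : (j <= m)%N -> exists a, forall q, Y q m = (q.1 a, 0).
  move=> jm; have mi : (m - j < i)%N by rewrite ltn_subLR// -sw.
  exists (Ordinal mi) => q; rewrite /Y /dirs nth_cat size_map_enum ltnNge jm /=; exact: nth_map_enum.
have Ycont : continuous Y.
  apply: ptws_continuous => m; case: (ltnP m j) => mj.
    have -> : (fun q => Y q m) = (fun q => (0, q.2 (Ordinal mj))) by apply/funext => q; exact: Ylt.
    apply: continuous_pair; first exact: cst_continuous.
    exact: (@continuousM _ _ _ _ _ (@continuous_snd _ _) (@continuous_proj 'I_j (fun=> E2) _)).
  have [a ha] := Yge m mj.
  have -> : (fun q => Y q m) = (fun q => (q.1 a, 0)) by apply/funext => q; exact: ha.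
  apply: continuous_pair; last exact: cst_continuous.
  exact: (@continuousM _ _ _ _ _ (@continuous_fst _ _) (@continuous_proj 'I_i (fun=> E1) _)).
have VY q (m : 'I_(size w)) : Vprod (nth true w m) (Y q m).
  rewrite /w nth_cat size_nseq; case: (ltnP m j) => mj.
    by rewrite (Ylt _ _ mj) nth_nseq mj.
  have [a ->] := Yge m mj.
  by rewrite nth_nseq ltn_subLR// -sw ltn_ord.
pose S (p : (E1 * E2) * ({ptws 'I_i -> E1} * {ptws 'I_j -> E2})) :
  (E1 * E2) * {ptws 'I_(size w) -> (E1 * E2)%type} := (p.1, Y p.2).
have Sc : continuous S.
  by apply: continuous_pair; [exact: continuous_fst|exact: (continuousM (@continuous_snd _ _) Ycont)].
exists (fun p => g (S p)); split.
  apply/subspace_continuousP => p Dp.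
  apply: (@within_comp _ _ _ S g [set p | (D1 `*` D2) p.1] _ p _ Sc _ (cg (S p) Dp (VY p.2))).
  by move=> q Dq; split => // m; exact: VY.
move=> v w'; have [h1 h2] := hg (Y (v, w')) (VY (v, w')).
by rewrite cY in h1 h2; split => // z Oz; rewrite /S /= h2.
Qed.

End directional_words.

Section CW_algebra.
Context {R : realType}.
Implicit Types E F G : tvsType R.

(** The counterpart of [RW_lin] for words whose letters have different direction spaces, based on
    the same formula for the derivative of a map linear in one argument. *)
Lemma CW_lin_param w E G F (V : bool -> set E) (O D : set E) (W : set G) (f : E * G -> F) :
  hausdorff_space F -> O `<=` D -> D `<=` closure O -> (forall b, subsp (V b)) ->
  (forall b, vopen (V b) O) -> subsp W ->
  (forall x (c : R) a b, D x -> W a -> W b -> f (x, c *: a + b) = c *: f (x, a) + f (x, b)) ->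
  CW w (fun b => V b `*` [set 0]) (O `*` W) (D `*` W) f ->
  CW w (fun b => V b `*` W) (O `*` W) (D `*` W) f.
Proof.
move=> hF; elim: w E G V O D W f => [//|b0 w IH] E G V O D W f OD DO lV oV lW flin /= [hf [df [hd hdf]]].
have hfW := IH _ _ V O D W f OD DO lV oV lW flin hf.
split; first exact: hfW.
have W0 : W 0 by case: lW.
have V0 b : V b 0 by case: (lV b).
have cf : cw (D `*` W) f := CW_cw hf.
pose L1 (q : (E * E) * G) : (E * G) * (E * G) := ((q.1.1, q.2), (q.1.2, 0)).
pose L2 (p : (E * G) * (E * G)) : (E * E) * G := ((p.1.1, p.2.1), p.1.2).
pose L3 (p : (E * G) * (E * G)) : E * G := (p.1.1, p.2.2).
have [l1 [l2 l3]] : lincont L1 /\ lincont L2 /\ lincont L3 by split; [|split]; lincont.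
pose f1 q := df (L1 q).
have vV0 b : vopen (V b `*` V b0) (O `*` V b0).
  move=> [x v] [/= Ox Vv]; have [N N0 hN] := oV b _ Ox.
  exists (N `*` setT); first by exists (N, setT) => //; split => //; exact: filterT.
  move=> [x' v'] [u1 u2] [/= Ox' Vv'] [/= Nx _] [/= Nu _] [/= Vu Vu2].
  by split => /=; [exact: hN|exact: subspD].
have f1lin q (c : R) a b : (D `*` V b0) q -> W a -> W b -> f1 (q, c *: a + b) = c *: f1 (q, a) + f1 (q, b).
  move: q => [x y] [/= Dx Vy] Wa Wb; rewrite /f1 /L1 /=.
  have cdf z : W z -> cw D (fun x => df ((x, z), (y, 0))).
    move=> Wz; apply: cw_comp (CW_cw hdf) => [x' Dx'|]; first by split.
    apply: cw_pair; last by move=> ? _; exact: cvg_cst.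
    by apply: cw_pair; [apply: cw_lin; exact: lincont_id|move=> ? _; exact: cvg_cst].
  apply: (cw_eq_dense (O := O) (D := D) hF (f := fun x => df ((x, c *: a + b), (y, 0)))
     (g := fun x => c *: df ((x, a), (y, 0)) + df ((x, b), (y, 0)))) => //.
  - by apply: cdf; case: lW => _; apply.
  - apply: cwD; last exact: cdf.
    by apply: (cwZ (a := fun=> c)); [move=> ? _; exact: cvg_cst|exact: cdf].
  move=> {Dx}x Ox.
  have h z : W z -> isd (fun x => f (x, z)) x y (df ((x, z), (y, 0))).
    move=> Wz; have := hd (x, z) (y, 0) (conj Ox Wz) (conj Vy erefl); rewrite /isd.
    apply: cvg_trans; apply: near_eq_cvg; apply: nearW => h; rewrite /diff_quot.
    by congr (_ *: (f _ - _)); congr (_, _); rewrite /= scaler0 addr0.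
  apply: (isd_unique hF (h _ _)); first by case: lW => _; apply.
  have e := isdD (isdZ (isd_cst (c : R^o) x y) (h _ Wa)) (h _ Wb).
  rewrite scale0r addr0 in e; apply: isd_ext e.
  apply: filterS (vopen_near (lV b0) (oV b0) Ox Vy) => k Ok; rewrite flin//; exact: OD.
have rf1 : CW w (fun b => (V b `*` V b0) `*` W) ((O `*` V b0) `*` W) ((D `*` V b0) `*` W) f1.
  apply: (IH _ _ (fun b => V b `*` V b0) (O `*` V b0) (D `*` V b0) W) => //.
  - by move=> [x v] [/OD].
  - move=> [x v] [/= Dx Vv] S [[A B] [/= xA vB] AB].
    have [y [Oy Ay]] := DO _ Dx _ xA.
    by exists (y, v); split => //; apply: AB; split => //; exact: nbhs_singleton.
  - by move=> b; exact: subspX.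
  apply: (CW_complin (L := L1)) hdf => //.
  - by move=> [[x y] a] [[/= ? ?] ?].
  - by move=> [[x y] a] [[/= ? ?] ?].
  - by move=> b [[x y] a] [[/= ? ?] ->].
exists (fun p => f1 (L2 p) + f (L3 p)); split; last first.
  apply: CWD.
  - apply: (CW_complin (L := L2)) rf1 => //.
    + by move=> [[x a] [y b]] [[/= ? ?] [/= ? ?]].
    + by move=> [[x a] [y b]] [[/= ? ?] [/= ? ?]].
    + by move=> c [[x a] [y b]] [[/= ? ?] [/= ? ?]].
  - apply: (CW_complin (L := L3)) hfW => //.
    + by move=> [[x a] [y b]] [[/= ? ?] [/= ? ?]].
    + by move=> [[x a] [y b]] [[/= ? ?] [/= ? ?]].
    + by move=> c [[x a] [y b]] [[/= ? ?] [/= ? ?]].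
move=> [x a] [y u] [/= Ox Wa] [/= Vy Wu]; rewrite /f1 /L1 /L2 /L3 /=.
have h1 := hd (x, a) (y, 0) (conj Ox Wa) (conj Vy erefl).
have e : \forall h \near (0 : R)^', diff_quot f (x, a) (y, 0) h + f (x + h *: y, u) =
    diff_quot f (x, a) (y, u) h.
  have h3 : \forall h \near (0 : R)^', h != 0 by exact: nbhs_dnbhs_neq.
  apply: filterS2 h3 (nbhs_dnbhs (vopen_near (lV b0) (oV b0) Ox Vy)) => h h0 Oh.
  rewrite /diff_quot.
  rewrite (_ : (x, a) + h *: (y, u) = (x + h *: y, h *: u + a)); last by rewrite [h *: u + a]addrC.
  rewrite (_ : (x, a) + h *: (y, 0) = (x + h *: y, a)); last by congr (_, _); rewrite /= scaler0 addr0.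
  rewrite flin//; last exact: OD.
  by rewrite -[in RHS]addrA [in RHS]scalerDr scalerA mulVf// scale1r [RHS]addrC.
apply: (cvg_trans (near_eq_cvg e)).
apply: tvs_cvgD => //.
apply: (cw_cvg (g := fun h : R => (x + h *: y, u)) cf); first by split => //; exact: OD.
  by apply: filterS (nbhs_dnbhs (vopen_near (lV b0) (oV b0) Ox Vy)) => h /OD.
apply: cvg_within_filter; apply: cvg_pair; last exact: cvg_cst.
have : (fun h : R^o => x + h *: y) @ (0 : R^o) --> x + (0 : R^o) *: y.
  by apply: tvs_cvgD; [exact: cvg_cst|apply: tvs_cvgZ; [exact: cvg_id|exact: cvg_cst]].
by rewrite scale0r addr0.
Qed.

Lemma isd0 E F (f : E -> F) x : isd f x 0 0.
Proof.
rewrite /isd; have -> : diff_quot f x 0 = fun=> 0; last exact: cvg_cst.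
by apply/funext => k; rewrite /diff_quot scaler0 addr0 subrr scaler0.
Qed.

Lemma CW_dlin b w E F (V : bool -> set E) (O D : set E) (f : E -> F) (df : E * E -> F) x (c : R) u v :
  hausdorff_space F -> frame V O D -> cw D f -> pd (V b) O f df ->
  CW w (tgl V b) (O `*` V b) (D `*` V b) df ->
  D x -> V b u -> V b v -> df (x, c *: u + v) = c *: df (x, u) + df (x, v).
Proof.
move=> hF fr cf hd /CW_cw cdf Dx Vu Vv; have [OD DO lV _ oV] := fr.
have cz z : V b z -> cw D (fun x => df (x, z)).
  move=> Wz; apply: cw_comp cdf => [x' Dx'|]; first by split.
  by apply: cw_pair; [apply: cw_lin; exact: lincont_id|move=> ? _; exact: cvg_cst].
apply: (cw_eq_dense (O := O) (D := D) hF (f := fun x => df (x, c *: u + v))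
     (g := fun x => c *: df (x, u) + df (x, v))) => //.
- by apply: cz; case: (lV b) => _; apply.
- apply: cwD; last exact: cz.
  by apply: (cwZ (a := fun=> c)); [move=> ? _; exact: cvg_cst|exact: cz].
move=> z Oz; apply: (pd_lin c hF (lV b) (oV b) _ _ hd) => //; first exact: cw_sub cf.
by apply: cw_sub cdf => -[y p] [/OD].
Qed.

(** Differentiating along the trivial space V false looks empty, but after a letter true the
    directions of false become {0} x V true. The differential is linear in that argument, so
    [CW_lin_param] leads back to trivial directions. This is what makes a C^l section a C^{oo,l}
    family constant in t. *)
Lemma CW_cst_dir l k E F (V : bool -> set E) (O D : set E) (f : E -> F) :
  hausdorff_space F -> frame V O D -> V false = [set 0] ->
  CW (nseq l true) V O D f -> CW (nseq l true ++ nseq k false) V O D f.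
Proof.
move=> hF; elim: l E V O D f => [|l IH] E V O D f fr V0 /=.
  elim: k => [//|k IHk] cf /=; split; first exact: IHk.
  exists (fun _ => 0); split; last exact: CW_cst.
  by move=> x v _; rewrite V0 => ->; exact: isd0.
move=> [hf [df [hd hdf]]]; split; first exact: IH.
exists df; split => //.
have [OD DO lV cV oV] := fr.
have frl := frame_lift true fr.
pose V1 b := if b then V true `*` V true else [set (0 : E * E)].
have h0 : subsp [set (0 : E * E)].
  by split => // a u v /= -> ->; rewrite scaler0 addr0.
have e0 : [set (0 : E * E)] = [set 0] `*` [set 0].
  by apply/seteqP; split => [p -> //|[a b] [/= -> ->]].
have c0 : closed [set (0 : E * E)].
  have c1 : closed [set (0 : E)] by rewrite -V0.
  rewrite e0; apply: closedI; apply: closed_comp => // z _; [exact: cvg_fst|exact: cvg_snd].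
have fr1 : frame V1 (O `*` V true) (D `*` V true).
  have [a1 a2 a3 a4 a5] := frl; split => //.
  - by case; [exact: a3 true|exact: h0].
  - by case; [exact: a4 true|exact: c0].
  - case; first exact: a5 true.
    move=> x Ox; exists setT; first exact: filterT.
    by move=> x' u Ox' _ _ ->; rewrite addr0.
have h1 : CW (nseq l true ++ nseq k false) V1 (O `*` V true) (D `*` V true) df.
  apply: IH => //; have : forall w, all id w -> forall E F (V V' : bool -> set E) O D (f : E -> F), V true = V' true ->
      CW w V O D f -> CW w V' O D f.
    elim=> [//|b w' IHw] /= /andP[bt /IHw hw] E1 F1 W W' O1 D1 f1 e [k1 [d1 [k2 k3]]]; rewrite bt in k2 k3 *.
    split; first exact: hw k1; exists d1; split; first by rewrite -e.
    by rewrite -e; apply: hw k3; rewrite /tgl e.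
  apply; last exact: hdf; last by [].
  by rewrite all_nseq orbT.
apply: (CW_lin_param (V := V) (W := V true) hF OD DO lV oV (lV true)).
  by move=> x c a b Dx Va Vb; apply: (CW_dlin c hF fr _ hd hdf) => //; exact: CW_cw hf.
apply: CW_sub h1 => //; case => [[u v] [/= Vu ->]|[u v] [/=]]; first by split => //; case: (lV true).
by rewrite V0 => -> ->.
Qed.

Lemma CW_sum w E F V (O D : set E) (I : Type) (r : seq I) (P : pred I) (f : I -> E -> F) :
  (forall i, P i -> CW w V O D (f i)) -> CW w V O D (fun x => \sum_(i <- r | P i) f i x).
Proof.
move=> h; elim: r => [|i r IH].
  by have -> : (fun x => \sum_(i <- [::] | P i) f i x) = fun=> 0; [apply/funext => x; rewrite big_nil|exact: CW_cst].
have [Pi|nPi] := boolP (P i).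
  have -> : (fun x => \sum_(j <- i :: r | P j) f j x) = (fun x => f i x + \sum_(j <- r | P j) f j x).
    by apply/funext => x; rewrite big_cons Pi.
  by apply: CWD => //; exact: h.
have -> // : (fun x => \sum_(j <- i :: r | P j) f j x) = (fun x => \sum_(j <- r | P j) f j x).
by apply/funext => x; rewrite big_cons (negbTE nPi).
Qed.

Lemma CWM w E V (O D : set E) (f g : E -> R^o) :
  CW w V O D f -> CW w V O D g -> CW w V O D (fun x => f x * g x : R^o).
Proof. exact: CWZ. Qed.

Lemma CW_prod w E V (O D : set E) (I : Type) (r : seq I) (P : pred I) (f : I -> E -> R^o) :
  (forall i, P i -> CW w V O D (f i)) -> CW w V O D (fun x => \prod_(i <- r | P i) f i x : R^o).
Proof.
move=> h; elim: r => [|i r IH].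
  by have -> : (fun x => \prod_(i <- [::] | P i) f i x) = fun=> 1; [apply/funext => x; rewrite big_nil|exact: CW_cst].
have [Pi|nPi] := boolP (P i).
  have -> : (fun x => \prod_(j <- i :: r | P j) f j x) = (fun x => f i x * \prod_(j <- r | P j) f j x).
    by apply/funext => x; rewrite big_cons Pi.
  by apply: CWM => //; exact: h.
have -> // : (fun x => \prod_(j <- i :: r | P j) f j x) = (fun x => \prod_(j <- r | P j) f j x).
by apply/funext => x; rewrite big_cons (negbTE nPi).
Qed.

Lemma hausdorff_R : hausdorff_space (R^o : tvsType R).
Proof. exact: (@Rhausdorff R). Qed.

Lemma isd_real_comp E (a : E -> R^o) (phi phi' : R^o -> R^o) x v m :
  isd a x v m -> isd phi (a x) 1 (phi' (a x)) -> isd (fun y => phi (a y)) x v (phi' (a x) * m : R^o).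
Proof.
move=> ha hp.
(* The quotient of phi gets its limit as value at 0, so that the factorization also covers the h
   with a(x + h v) = a(x). *)
pose q (h : R) : R^o := if h == 0 then phi' (a x) else diff_quot phi (a x) 1 h.
have qc : q @ (0 : R^o) --> phi' (a x).
  have : q @ (0 : R)^' --> phi' (a x).
    apply: cvg_trans hp; apply: near_eq_cvg; apply: filterS (nbhs_dnbhs_neq _) => h h0.
    by rewrite /q (negbTE h0).
  move=> h B hB; have hh : \forall h \near (0 : R), h != 0 -> B (q h) := h B hB.
  suff : \forall h \near (0 : R), B (q h) by [].
  apply: filterS hh => k hk; have [->|k0] := eqVneq k 0; last exact: hk.
  by rewrite /q eqxx; exact: nbhs_singleton.
have e : \forall h \near (0 : R)^', q (a (x + h *: v) - a x) * diff_quot a x v h = diff_quot (fun y => phi (a y)) x v h.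
  apply: filterS (nbhs_dnbhs_neq _) => h h0; rewrite /q /diff_quot.
  case: eqP => [e0|/eqP n0].
    have -> : a (x + h *: v) = a x by apply/eqP; rewrite -subr_eq0; apply/eqP.
    by rewrite !subrr !scaler0 mulr0.
  have -> : (a x : R) + (a (x + h *: v) - a x) *: (1 : R^o) = a (x + h *: v).
    by rewrite /GRing.scale /= mulr1 addrC subrK.
  rewrite /GRing.scale /=.
  have key (d P k : R) : d != 0 -> (d^-1 * P) * (k * d) = k * P.
    by move=> d0; rewrite mulrACA [d^-1 * k]mulrC -mulrA [d^-1 * _]mulrCA mulVf// mulr1.
  exact: key.
apply: (cvg_trans (near_eq_cvg e)).
apply: (tvs_cvgZ (k := fun h => q (a (x + h *: v) - a x))) => //.
apply: (cvg_comp (fun h : R => a (x + h *: v) - a x : R^o) q) qc.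
have : (fun h : R => h *: diff_quot a x v h) @ (0 : R)^' --> (0 : R^o) *: m.
  by apply: tvs_cvgZ => //; apply: cvg_within_filter; exact: cvg_id.
rewrite scale0r; apply: cvg_trans; apply: near_eq_cvg; apply: filterS (nbhs_dnbhs_neq _) => h h0.
by rewrite /diff_quot scalerA divff// scale1r.
Qed.

End CW_algebra.

(** * A smooth step function *)

Section real_functions.
Context {R : realType}.
Implicit Types E F G : tvsType R.

Lemma isd_derive (phi : R^o -> R^o) (x l : R) : is_derive x (1 : R) phi l -> isd phi x (1 : R^o) l.
Proof.
move=> [h1 h2]; have := h1; rewrite /derivable => /cvg_ex[m hm].
have lm : l = m by rewrite -h2 /derive; apply: cvg_lim hm.
rewrite /isd lm; apply: cvg_trans hm; apply: near_eq_cvg; apply: nearW => h.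
by rewrite /diff_quot /= [x + _]addrC.
Qed.

Lemma isd_continuous (phi : R^o -> R^o) (x l : R) : isd phi x (1 : R^o) l ->
  {for x, continuous phi}.
Proof.
move=> h.
have h1 : (fun h : R => phi x + h *: diff_quot phi x (1 : R^o) h) @ (0 : R)^' --> phi x + (0 : R^o) *: (l : R^o).
  apply: tvs_cvgD; first exact: cvg_cst.
  by apply: tvs_cvgZ => //; apply: cvg_within_filter; exact: cvg_id.
rewrite scale0r addr0 in h1.
have h2 : (fun h : R => phi (x + h)) @ (0 : R)^' --> phi x.
  apply: cvg_trans h1; apply: near_eq_cvg; apply: filterS (nbhs_dnbhs_neq _) => k k0.
  rewrite /diff_quot scalerA divff// scale1r.
  by rewrite addrC subrK /GRing.scale /= mulr1.
move=> B hB.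
have h3 : \forall k \near (0 : R), k != 0 -> B (phi (x + k)) := h2 B hB.
have h4 : \forall k \near (0 : R), B (phi (x + k)).
  apply: filterS h3 => k hk; have [->|] := eqVneq k 0; last exact: hk.
  by rewrite addr0; exact: nbhs_singleton.
exact/(nbhs_shift (x : R^o) (phi @^-1` B)).
Qed.

Lemma CW_inv w E (V : bool -> set E) (O D : set E) (a : E -> R^o) : O `<=` D ->
  (forall x, D x -> a x != 0) -> CW w V O D a -> CW w V O D (fun x => (a x)^-1 : R^o).
Proof.
elim: w E V O D a => [|b w IH] E V O D a OD a0 /=.
  move=> ca x Dx; apply: (@cvg_comp _ _ _ a (fun y : R => y^-1)); first exact: ca.
  by apply: inv_continuous; exact: a0.
move=> [ha [da [pa hda]]]; split; first exact: IH.
exists (fun p => (- ((a p.1)^-1 * (a p.1)^-1)) * da p); split.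
  move=> x v Ox Vv; apply: (isd_real_comp (phi := fun y => y^-1) (phi' := fun y => - (y^-1 * y^-1))).
    exact: pa.
  apply: isd_derive; have := @is_deriveV R id (a x) 1 1 (a0 _ (OD _ Ox)) (is_derive_id _ _).
  by move=> h; apply: is_derive_eq h _; rewrite /GRing.scale /= mulr1 -exprVn expr2.
have h : CW w (tgl V b) (O `*` V b) (D `*` V b) (fun p => (a p.1)^-1 : R^o).
  apply: IH; [by move=> [x v] [/OD]|by move=> [x v] [/a0]|exact: CW_lift_fst].
apply: CWM => //.
have -> : (fun p : E * E => - ((a p.1)^-1 * (a p.1)^-1) : R^o) = (fun p => (-1 : R^o) * ((a p.1)^-1 * (a p.1)^-1)).
  by apply/funext => p; rewrite mulN1r.
by apply: CWM; [exact: CW_cst|exact: CWM].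
Qed.

(** Differentiation leads from k to k + 1 and k + 2 ([isd_flat]), so all powers of 1/x are carried
    along to obtain a family closed under derivatives. *)
Definition flat (k : nat) (x : R^o) : R^o := if 0 < x then (x^-1) ^+ k * expR (- x^-1) else 0.

(** From exp t >= (t/(k+2))^(k+2) with t = 1/x. Two powers of x remain, and these make the
    derivative at 0 vanish. *)
Lemma flat_bound k (x : R) : 0 < x -> 0 <= flat k x <= k.+2%:R ^+ k.+2 * x ^+ 2.
Proof.
move=> x0; rewrite /flat x0; set t := x^-1; have t0 : 0 < t by rewrite invr_gt0.
apply/andP; split; first by rewrite mulr_ge0 ?exprn_ge0 ?expR_ge0// ltW.
rewrite expRN ler_pdivrMr ?expR_gt0//.
have h : (t / k.+2%:R) ^+ k.+2 <= expR t.
  rewrite -[in leRHS](@mulfVK _ k.+2%:R _ t)// [t / _ * _]mulrC expRM_natl lerXn2r ?nnegrE ?expR_ge0//.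
    by rewrite divr_ge0// ltW.
  by apply: le_trans (expR_ge1Dx _); rewrite lerDr.
rewrite -mulrA; apply: le_trans (ler_wpM2l _ (ler_wpM2l _ h)); last 2 first.
- by rewrite exprn_ge0.
- by rewrite exprn_ge0// ltW.
rewrite expr_div_n [x ^+ 2 * _]mulrA [_ ^+ k.+2 * (_ / _)]mulrC divfK ?expf_neq0//.
by rewrite -[k.+2]addn2 exprD mulrCA -exprMn /t mulfV ?expr1n ?mulr1// gt_eqF.
Qed.

Lemma near0_lt (e : R) : 0 < e -> \forall h \near (0 : R), `|h| < e.
Proof. by move=> e0; apply/nbhs_ballP; exists e => // h; rewrite /ball /= sub0r normrN. Qed.

Lemma isd_flat k (x : R) : isd (flat k) (x : R^o) (1 : R^o) (flat k.+2 x - k%:R * flat k.+1 x).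
Proof.
case: (ltgtP x 0) => [x0|x0|->].
- have -> : flat k.+2 x - k%:R * flat k.+1 x = 0 by rewrite /flat ltNge (ltW x0) mulr0 subr0.
  apply: isd_ext (isd_cst (0 : R^o) (x : R^o) (1 : R^o)).
  have nx : 0 < - x by rewrite oppr_gt0.
  apply: filterS (near0_lt nx) => h hx; rewrite /flat ltNge (_ : _ <= 0)//.
  by rewrite /GRing.scale /= mulr1 -lerBrDl sub0r ltW// (le_lt_trans (ler_norm _)).
- pose g (a : R^o) : R^o := a ^+ k * expR (- a).
  have hg : isd (fun y : R^o => g (y^-1)) (x : R^o) (1 : R^o)
      ((k%:R * (x^-1) ^+ k.-1 * expR (- x^-1) - x^-1 ^+ k * expR (- x^-1)) * (- (x^-1 * x^-1))).
    apply: (isd_real_comp (phi := g)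
        (phi' := fun a : R^o => k%:R * a ^+ k.-1 * expR (- a) - a ^+ k * expR (- a))
        (a := fun y : R^o => y^-1)).
      apply: isd_derive; have x0' : (x : R) != 0 by rewrite gt_eqF.
      have := @is_deriveV R id x 1 1 x0' (is_derive_id _ _).
      by move=> h; apply: is_derive_eq h _; rewrite /GRing.scale /= mulr1 -exprVn expr2.
    apply: isd_derive.
    have d1 : is_derive (x^-1) (1 : R) (fun a : R => expR (- a)) (- expR (- x^-1)).
      have h := @is_derive1_comp R expR (fun a : R => - a) (x^-1) (expR (- x^-1)) (- 1)
        (is_derive_expR _) (is_deriveN (is_derive_id _ _)).
      by apply: is_derive_eq h _; rewrite mulrN1.
    have d2 := is_deriveX k (is_derive_id (x^-1 : R) (1 : R)).
    have d3 := is_deriveM d2 d1.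
    have -> : g = ((id : R -> R) ^+ k * (fun a : R => expR (- a)))%R.
      by apply/funext => a; rewrite /g /= exprfctE.
    apply: is_derive_eq d3 _; rewrite /GRing.scale /= mulr1 exprfctE.
    by rewrite mulrN addrC; congr (_ - _); rewrite mulrC.
  have -> : flat k.+2 x - k%:R * flat k.+1 x =
     (k%:R * (x^-1) ^+ k.-1 * expR (- x^-1) - x^-1 ^+ k * expR (- x^-1)) * (- (x^-1 * x^-1)).
    rewrite /flat x0; case: k {g hg} => [|k] /=; first by rewrite !mul0r subr0 expr0 expr2; ring.
    by rewrite !exprS; ring.
  apply: isd_ext hg.
  apply: filterS (near0_lt x0) => h hx; rewrite /flat /g (_ : 0 < _)//.
  by rewrite /GRing.scale /= mulr1; move: hx; rewrite ltr_norml => /andP[? _]; lra.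
- have f0 j : flat j 0 = 0 by rewrite /flat ltxx.
  rewrite !f0 mulr0 subr0.
  apply/cvgrPdist_le => e e0.
  pose C : R := k.+2%:R ^+ k.+2; have C0 : 0 < C by rewrite exprn_gt0.
  have eC : 0 < e / C by rewrite divr_gt0.
  have hA : \forall h \near (0 : R)^', `|h| < e / C := nbhs_dnbhs (near0_lt eC).
  have hB : \forall h \near (0 : R)^', h != 0 by exact: nbhs_dnbhs_neq.
  near=> h; have hC : `|h| < e / C by near: h.
  have h0 : h != 0 by near: h.
  rewrite sub0r normrN /diff_quot f0 subr0 add0r /GRing.scale /= mulr1.
  case: (ltP 0 h) => hp; last by rewrite /flat ltNge hp mulr0 normr0 ltW.
  have /andP[b1 b2] := flat_bound k hp.
  rewrite ger0_norm ?mulr_ge0 ?invr_ge0 ?(ltW hp)// mulrC ler_pdivrMr//.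
  apply: (le_trans b2); rewrite expr2 mulrA ler_wpM2r ?(ltW hp)// mulrC -ler_pdivlMr//.
  by rewrite ltW// (le_lt_trans (ler_norm _)).
Unshelve. all: by end_near.
Qed.

Lemma CW_flat w k E (V : bool -> set E) (O D : set E) (a : E -> R^o) :
  CW w V O D a -> CW w V O D (fun x => flat k (a x)).
Proof.
elim: w k E V O D a => [|b w IH] k E V O D a /=.
  move=> ca x Dx; apply: (@cvg_comp _ _ _ a (flat k)); first exact: ca.
  by exact: (@isd_continuous (flat k) (a x) _ (@isd_flat k (a x))).
move=> [ha [da [pa hda]]]; split; first exact: IH.
exists (fun p => (flat k.+2 (a p.1) + (- k%:R : R^o) * flat k.+1 (a p.1)) * da p); split.
  move=> x v Ox Vv; apply: (isd_real_comp (phi := flat k) (phi' := fun y => flat k.+2 y + (- k%:R : R^o) * flat k.+1 y)).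
    exact: pa.
  by have := @isd_flat k (a x); rewrite mulNr.
apply: CWM => //; apply: CWD; first by apply: IH; exact: CW_lift_fst.
by apply: CWM; [exact: CW_cst|apply: IH; exact: CW_lift_fst].
Qed.

Definition smstep (x : R^o) : R^o := flat 0 x * (flat 0 x + flat 0 (1 - x))^-1.

Lemma flat_gt0 k x : 0 < x -> 0 < flat k x.
Proof. by move=> x0; rewrite /flat x0 mulr_gt0 ?expR_gt0// exprn_gt0// invr_gt0. Qed.

Lemma flat_ge0 k x : 0 <= flat k x.
Proof. by rewrite /flat; case: ifP => // x0; apply/ltW; have := flat_gt0 k x0; rewrite /flat x0. Qed.

Lemma smstep_den x : 0 < flat 0 x + flat 0 (1 - x).
Proof.
have [x0|x0] := ltP 0 x; first by rewrite ltr_wpDr ?flat_ge0// flat_gt0.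
by rewrite ltr_wpDl ?flat_ge0// flat_gt0//; lra.
Qed.

Lemma smstep01 x : 0 <= smstep x <= 1.
Proof.
have h := smstep_den x; rewrite /smstep mulr_ge0 ?flat_ge0 ?invr_ge0 ?(ltW h)//=.
by rewrite ler_pdivrMr// mul1r lerDl flat_ge0.
Qed.

Lemma smstep_le0 x : x <= 0 -> smstep x = 0.
Proof. by move=> x0; rewrite /smstep {1}/flat ltNge x0 mul0r. Qed.

Lemma smstep_ge1 x : 1 <= x -> smstep x = 1.
Proof.
move=> x1; rewrite /smstep [flat 0 (1 - x)]/flat ltNge subr_le0 x1 /= addr0 divff// gt_eqF// flat_gt0//.
by rewrite (lt_le_trans ltr01).
Qed.

Lemma CW_smstep w E (V : bool -> set E) (O D : set E) (a : E -> R^o) : O `<=` D ->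
  CW w V O D a -> CW w V O D (fun x => smstep (a x)).
Proof.
move=> OD ha; apply: CWM; first exact: CW_flat.
apply: CW_inv => // [x Dx|]; first by rewrite gt_eqF// smstep_den.
apply: CWD; first exact: CW_flat.
apply: CW_flat; apply: CWD; first exact: CW_cst.
have -> : (fun x => - a x : R^o) = (fun x => (-1 : R^o) * a x) by apply/funext => x; rewrite mulN1r.
by apply: CWM => //; exact: CW_cst.
Qed.

End real_functions.

(** * Smoothing operators *)

Section bernstein.
Context {R : realType}.

Definition bern (m k : nat) (r : R) : R := 'C(m, k)%:R * (r ^+ k * (1 - r) ^+ (m - k)).

Lemma bern_ge0 m k r : 0 <= r <= 1 -> 0 <= bern m k r.
Proof.
by move=> /andP[r0 r1]; rewrite /bern mulr_ge0// mulr_ge0// exprn_ge0// subr_ge0.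
Qed.

Lemma bern_sum m r : \sum_(k < m.+1) bern m k r = 1.
Proof.
rewrite -(expr1n _ m) -[in RHS](subrK r 1) exprDn; apply: eq_bigr => k _.
by rewrite /bern mulr_natl [_ ^+ _ * _]mulrC.
Qed.

Lemma bernS m k r : k.+1%:R * bern m.+1 k.+1 r = m.+1%:R * r * bern m k r.
Proof.
rewrite /bern mulrA -natrM -mul_bin_diag natrM subSS exprS; ring.
Qed.

Lemma bern_moment m (g : nat -> R) r :
  \sum_(k < m.+2) k%:R * bern m.+1 k r * g k = m.+1%:R * r * \sum_(k < m.+1) bern m k r * g k.+1.
Proof.
rewrite big_ord_recl /= !mul0r add0r mulr_sumr; apply: eq_bigr => k _.
by rewrite /bump /= add1n bernS -mulrA.
Qed.

Lemma bern_mean m r : \sum_(k < m.+1) k%:R * bern m k r = m%:R * r.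
Proof.
case: m => [|m]; first by rewrite big_ord1 !mul0r.
transitivity (\sum_(k < m.+2) k%:R * bern m.+1 k r * 1).
  by apply: eq_bigr => k _; rewrite mulr1.
rewrite (bern_moment m (fun=> 1)); under eq_bigr do rewrite mulr1.
by rewrite bern_sum mulr1.
Qed.

Lemma bern_sq m r : \sum_(k < m.+1) k%:R * bern m k r * k%:R = m%:R * r * (1 + (m%:R - 1) * r).
Proof.
case: m => [|m]; first by rewrite big_ord1 !mul0r.
rewrite (bern_moment m (fun k => k%:R)); congr (_ * _).
transitivity (\sum_(k < m.+1) (bern m k r + k%:R * bern m k r)).
  by apply: eq_bigr => k _; rewrite -[k.+1%:R]natr1; ring.
by rewrite big_split /= bern_sum bern_mean -[m.+1%:R]natr1; ring.
Qed.

Lemma bern_var m r : \sum_(k < m.+1) bern m k r * (k%:R - m%:R * r) ^+ 2 = m%:R * r * (1 - r).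
Proof.
transitivity (\sum_(k < m.+1) (k%:R * bern m k r * k%:R + (- (2 * m%:R * r)) * (k%:R * bern m k r) +
   (m%:R * r) ^+ 2 * bern m k r)).
  by apply: eq_bigr => k _; ring.
by rewrite !big_split /= -!mulr_sumr bern_sum bern_mean bern_sq; ring.
Qed.

(** Chebyshev's inequality for the binomial distribution, whose variance is [bern_var]; the factor r
    (1 - r) is bounded by 1. *)
Lemma bern_far m r eta : 0 <= r <= 1 -> 0 < eta ->
  \sum_(k < m.+2 | eta <= `|k%:R / m.+1%:R - r|) bern m.+1 k r <= (m.+1%:R * eta ^+ 2)^-1.
Proof.
move=> r01 eta0; have m0 : (0 : R) < m.+1%:R by rewrite ltr0n.
have h : \sum_(k < m.+2 | eta <= `|k%:R / m.+1%:R - r|) bern m.+1 k r * (m.+1%:R * eta) ^+ 2 <= m.+1%:R * r * (1 - r).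
  rewrite -(bern_var m.+1) [leRHS](bigID (fun k : 'I_m.+2 => eta <= `|k%:R / m.+1%:R - r|)) /=.
  rewrite -[leLHS]addr0 lerD//; last first.
    by apply: sumr_ge0 => k _; rewrite mulr_ge0 ?sqr_ge0 ?bern_ge0.
  apply: ler_sum => k hk; rewrite ler_wpM2l ?bern_ge0//.
  rewrite -[leRHS]real_normK ?num_real// lerXn2r ?nnegrE ?normr_ge0 ?mulr_ge0 ?(ltW eta0)//.
  have -> : k%:R - m.+1%:R * r = m.+1%:R * (k%:R / m.+1%:R - r).
    by rewrite mulrBr mulrCA divff ?mulr1// gt_eqF.
  by rewrite normrM ger0_norm// ler_wpM2l.
rewrite -mulr_suml -ler_pdivlMr ?exprn_gt0 ?mulr_gt0// in h.
apply: (le_trans h); have me : 0 < m.+1%:R * eta ^+ 2 by rewrite mulr_gt0// exprn_gt0.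
have -> : m.+1%:R * r * (1 - r) / (m.+1%:R * eta) ^+ 2 = (r * (1 - r)) * (m.+1%:R * eta ^+ 2)^-1.
  by rewrite exprMn; field; rewrite !gt_eqF.
rewrite -[leRHS]mul1r ler_wpM2r ?invr_ge0 ?(ltW me)//.
by move: r01 => /andP[r0 r1]; rewrite mulr_ile1 ?subr_ge0// gerBl.
Qed.

End bernstein.

Section bernstein_operator.
Context {R : realType}.
Implicit Types (X Y : tvsType R) (G : tvsType R).

Definition oint : set R^o := [set r | 0 < r < 1].
Definition cint : set R^o := [set r | 0 <= r <= 1].

Lemma isdZc X G (f : X -> G) x v l (a : R) : isd f x v l -> isd (fun y => a *: f y) x v (a *: l).
Proof.
move=> h; rewrite /isd.
have -> : diff_quot (fun y => a *: f y) x v = (fun k => a *: diff_quot f x v k).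
  by apply/funext => k; rewrite /diff_quot -scalerBr !scalerA mulrC.
by apply: tvs_cvgZ => //; exact: cvg_cst.
Qed.

(** A parameter space for a sequence of operators: s x = 1/(n+1) selects the operator of index n and
    s x = 0 the identity. Directions do not change s, so derivatives are taken within one operator,
    while continuity on DX includes s tending to 0. *)
Record bframe X (V OX DX : set X) (s : X -> R^o) : Prop := BFrame {
  bf_sub : OX `<=` DX;
  bf_dense : DX `<=` closure OX;
  bf_lin : subsp V;
  bf_cl : closed V;
  bf_open : vopen V OX;
  bf_pos : forall x, OX x -> 0 < s x;
  bf_val : forall x, DX x -> s x = 0 \/ exists n : nat, s x = n.+1%:R^-1;
  bf_cw : cw DX s;
  bf_inv : forall x u, V u -> s (x + u) = s x }.

Lemma bframe_prod X Y (V OX DX : set X) (s : X -> R^o) (W : set Y) :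
  bframe V OX DX s -> subsp W -> closed W ->
  bframe (V `*` W) (OX `*` W) (DX `*` W) (fun p => s p.1).
Proof.
move=> [OD DO lV cV oV sp sv sc si] lW cW; split.
- by move=> [x y] [/OD].
- move=> [x v] [/= Dx Vv] S [[A B] [/= xA vB] AB].
  have [y [Oy Ay]] := DO _ Dx _ xA.
  by exists (y, v); split => //; apply: AB; split => //; exact: nbhs_singleton.
- exact: subspX.
- by apply: closedI; apply: closed_comp => // z _; [exact: cvg_fst|exact: cvg_snd].
- move=> [x v] [/= Ox Vv]; have [N N0 hN] := oV x Ox.
  exists (N `*` setT).
    by exists (N, setT) => //; split => //; exact: filterT.
  move=> [x' v'] [u1 u2] [/= Ox' Vv'] [/= Nx _] [/= Nu _] [/= Vu1 Vu2].
  by split => /=; [exact: hN|exact: subspD].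
- by move=> p [/sp].
- by move=> p [/sv].
- by apply: (cw_comp (D' := DX) (f := fst)) sc => [p []//|]; apply: cw_lin; exact: lincont_fst.
- by move=> p u [Vu _]; exact: si.
Qed.

Lemma open_oint : open oint.
Proof.
have -> : oint = `]0, 1[%classic by apply/seteqP; split => r; rewrite /= in_itv.
exact: (@interval_open R (BRight 0) (BLeft 1)).
Qed.

Lemma cint_closure : cint `<=` closure oint.
Proof.
move=> r /andP[r0 r1] B /nbhs_ballP[e /= e0 eB].
pose a : R := Num.min (1/2) (e / 2).
have a0 : 0 < a by rewrite lt_min; apply/andP; split; lra.
have a1 : a <= 1/2 by rewrite ge_min lexx.
have ae : a <= e / 2 by rewrite ge_min lexx orbT.
exists ((1 - a) * r + a / 2); split.
  apply/andP; split; first by apply: ltr_wpDl; [apply: mulr_ge0; lra|lra].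
  have : (1 - a) * r <= (1 - a) by rewrite ler_piMr//; lra.
  lra.
apply: eB; rewrite /ball /=.
have -> : r - ((1 - a) * r + a / 2) = a * (r - 1/2) by ring.
rewrite normrM (gtr0_norm a0).
have : `|r - 1/2| <= 1 by rewrite ler_norml; apply/andP; split; lra.
move=> h; apply: le_lt_trans (_ : e / 2 < e); last lra.
by apply: le_trans ae; rewrite ler_piMr// ltW.
Qed.

Lemma frame_b X (V OX DX : set X) (s : X -> R^o) : bframe V OX DX s ->
  frame (fun _ => V `*` [set: R^o]) (OX `*` oint) (DX `*` cint).
Proof.
move=> [OD DO lV cV oV _ _ _ _]; split.
- by move=> [x r] [/OD ? /= /andP[? ?]]; split => //=; apply/andP; split; apply: ltW.
- move=> [x r] [/= Dx Ir] S [[A B] [/= xA rB] AB].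
  have [y [Oy Ay]] := DO _ Dx _ xA; have [r' [? ?]] := cint_closure Ir rB.
  by exists (y, r'); split => //; apply: AB.
- by move=> _; apply: subspX.
- by move=> _; apply: closedI; apply: closed_comp => // z _; [exact: cvg_fst|exact: cvg_snd].
- move=> _ [x r] [/= Ox Ir]; have [N N0 hN] := oV x Ox.
  have [M M0 hM] := vopenT open_oint setT Ir.
  exists (N `*` M); first by exists (N, M).
  move=> [x' r'] [u1 u2] [/= ? ?] [/= ? ?] [/= ? ?] [/= ? _].
  by split => /=; [exact: hN|exact: hM].
Qed.

(** The derivative of a Bernstein polynomial is a Bernstein polynomial of difference quotients,
    whose step tends to 0 with s. So quotients are needed as a function that is continuous up to
    step 0. *)
Definition Qt X G (phi : X * R^o -> G) (dphi : (X * R^o) * (X * R^o) -> G) (p : (X * R^o) * R^o) : G :=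
  if p.2 == 0 then dphi (p.1, (0, 1)) else p.2^-1 *: (phi (p.1.1, p.1.2 + p.2) - phi p.1).

Definition QO X (OX : set X) : set ((X * R^o) * R^o) :=
  [set p | OX p.1.1 /\ (0 < p.1.2 /\ (0 < p.2 /\ p.1.2 + p.2 < 1))].
Definition QD X (DX : set X) : set ((X * R^o) * R^o) :=
  [set p | DX p.1.1 /\ (0 <= p.1.2 /\ (0 <= p.2 /\ p.1.2 + p.2 <= 1))].

(** The segment in [0,1] is contracted towards the midpoint by the factor 1 - a, which moves it into
    the open interval, and x' is replaced by a nearby point of OX. *)
Lemma lappr_int X (V OX DX : set X) (s : X -> R^o) x : bframe V OX DX s ->
  lappr ([set 0] `*` [set: R^o]) (OX `*` oint) (DX `*` cint) x.
Proof.
move=> bf; exists setT; first exact: filterT.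
move=> [x' r'] [u rho] [/= Dx' Ir'] _ [/= -> _] _ [/= _ Irr] W [[W1 W2] [/= W10 W20] W12].
have : nbhs x' [set y | W1 (y - x')] by exact: nbhs_sub.
move=> /(bf_dense bf Dx')[x1 [Ox1 Wx1]].
have /nbhs_ballP[e /= e0 eW] := W20.
pose a : R := Num.min (1/2) (e / 2).
have a0 : 0 < a by rewrite lt_min; apply/andP; split; lra.
have a1 : a <= 1/2 by rewrite ge_min lexx.
have ae : a <= e / 2 by rewrite ge_min lexx orbT.
move: Ir' Irr => /andP[r0 r1] /andP[]; rewrite /= => s0 s1.
exists (x1, (1 - a) * r' + a / 2), (0, (1 - a) * rho); split.
- apply: W12; split => //=; apply: eW; rewrite /ball /= sub0r normrN.
  have -> : (1 - a) * r' + a / 2 - r' = a * (1 / 2 - r') by ring.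
  rewrite normrM (gtr0_norm a0).
  have h : `|1 / 2 - r'| <= 1 by rewrite ler_norml; apply/andP; split; lra.
  by apply: le_lt_trans (_ : e / 2 < e); [apply: le_trans ae; rewrite ler_piMr// ltW|lra].
- apply: W12; split => /=; first by rewrite subrr; exact: nbhs_singleton.
  apply: eW; rewrite /ball /= sub0r normrN.
  have -> : (1 - a) * rho - rho = - (a * rho) by ring.
  rewrite normrN normrM (gtr0_norm a0).
  have h : `|rho| <= 1 by rewrite ler_norml; apply/andP; split; lra.
  by apply: le_lt_trans (_ : e / 2 < e); [apply: le_trans ae; rewrite ler_piMr// ltW|lra].
- by split.
- move=> t /andP[t0 t1]; split => /=; first by rewrite scaler0 addr0.
  have -> : (1 - a) * r' + a / 2 + t *: ((1 - a) * rho : R^o) = (1 - a) * (r' + t * rho) + a / 2.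
    by rewrite /GRing.scale /=; ring.
  have h0 : 0 <= r' + t * rho <= 1.
    have -> : r' + t * rho = (1 - t) * r' + t * (r' + rho) by ring.
    apply/andP; split; first by apply: addr_ge0; apply: mulr_ge0; lra.
    have : (1 - t) * r' <= (1 - t) by rewrite ler_piMr//; lra.
    have : t * (r' + rho) <= t by rewrite ler_piMr.
    lra.
  move: h0 => /andP[h0 h1]; apply/andP; split.
    by apply: ltr_wpDl; [apply: mulr_ge0; lra|lra].
  have : (1 - a) * (r' + t * rho) <= (1 - a) by rewrite ler_piMr//; lra.
  lra.
Qed.

(** Near a point with step 0 there are points with zero and with nonzero step. For the former this
    is continuity of dphi, for the latter it is [quot_near] in the direction (0, 1). *)
Lemma Qt_cw X G (V OX DX : set X) (s : X -> R^o) (phi : X * R^o -> G) dphi :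
  bframe V OX DX s -> cw (DX `*` cint) phi -> pd (V `*` setT) (OX `*` oint) phi dphi ->
  cw ((DX `*` cint) `*` (V `*` setT)) dphi -> cw (QD DX) (Qt phi dphi).
Proof.
move=> bf cphi hp cd [[x0 r0] h0] [/= Dx [r0p [h0p rh1]]].
have Qin p : QD DX p -> (DX `*` cint) p.1 /\ (DX `*` cint) (p.1.1, p.1.2 + p.2).
  move=> [Dp [p0 [q0 pq]]]; split; split => //=; apply/andP; split => //.
    by apply: le_trans pq; rewrite lerDl.
  exact: addr_ge0.
have [D1 D2] := Qin ((x0, r0), h0) (conj Dx (conj r0p (conj h0p rh1))).
have [h00|h0n] := eqVneq h0 0; last first.
  have cont : (fun p : (X * R^o) * R^o => p.2^-1 *: (phi (p.1.1, p.1.2 + p.2) - phi p.1)) @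
      within (QD DX) (nbhs ((x0, r0), h0)) --> h0^-1 *: (phi (x0, r0 + h0) - phi (x0, r0)).
    have w1 (P : (X * R^o) * R^o -> X * R^o) : continuous P -> P ((x0, r0), h0) = P ((x0, r0), h0) ->
       (forall p, QD DX p -> (DX `*` cint) (P p)) -> (DX `*` cint) (P ((x0, r0), h0)) ->
       (fun p => phi (P p)) @ within (QD DX) (nbhs ((x0, r0), h0)) --> phi (P ((x0, r0), h0)).
      move=> cP _ hP DP; apply: (cw_cvg (g := P) cphi DP).
        by rewrite near_withinE; apply: nearW => p; exact: hP.
      by apply: cvg_within_filter; exact: cP.
    apply: tvs_cvgZ.
      apply: cvg_within_filter.
      apply: (@cvg_comp _ _ _ (fun p : (X * R^o) * R^o => p.2) (fun y : R => y^-1)); first exact: cvg_snd.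
      exact: inv_continuous.
    apply: tvs_cvgB.
      apply: (w1 (fun p => (p.1.1, p.1.2 + p.2))) => //; last by move=> p /Qin[].
      apply: continuous_pair; first exact: (continuousM (@continuous_fst _ _) (@continuous_fst _ _)).
      have h1 : lincont (fun p : (X * R^o) * R^o => p.1.2 + p.2).
        have [l1 _] : lincont (fun p : (X * R^o) * R^o => p.1.2) by lincont.
        have l2 : lincont (fun p : (X * R^o) * R^o => (p.1.2, p.2)) by lincont.
        split; first by move=> a p q; rewrite l1 /= addrACA scalerDr.
        case: l2 => _ l2 p.
        apply: (@continuous_comp _ _ _ (fun p : (X * R^o) * R^o => (p.1.2, p.2)) (fun q : R^o * R^o => q.1 + q.2)).
          exact: l2.
        exact: (@add_continuous R^o).
      by case: h1.
    apply: (w1 (fun p => p.1)) => //; last by move=> p /Qin[].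
    exact: continuous_fst.
  rewrite /Qt /= (negbTE h0n); apply: cvg_trans cont; apply: near_eq_cvg.
  rewrite near_withinE.
  have : \forall p \near ((x0, r0), h0), p.2 != 0.
    have : (fun p : (X * R^o) * R^o => p.2) @ ((x0, r0), h0) --> h0 by exact: cvg_snd.
    by move=> h; apply: (h [set y | y != 0]); apply: open_nbhs_nbhs; split => //; exact: open_neq.
  by apply: filterS => p p0 _; rewrite (negbTE p0).
rewrite h00 in D2 rh1 *; rewrite /Qt /= eqxx => C hC.
have V1 : ([set (0 : X)] `*` [set: R^o]) (0, 1) by [].
have sub0 : forall u : X * R^o, ([set 0] `*` [set: R^o]) u -> (V `*` [set: R^o]) u.
  by move=> [u v] [/= -> _]; split => //; case: (bf_lin bf).
have cd' : cw ((DX `*` cint) `*` ([set 0] `*` [set: R^o])) dphi.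
  by apply: cw_sub cd => -[p u] [? /sub0].
have hp' : pd ([set 0] `*` [set: R^o]) (OX `*` oint) phi dphi by move=> p u Op /sub0; exact: hp.
have VZ (a : R) (u : X * R^o) : ([set 0] `*` [set: R^o]) u -> ([set 0] `*` [set: R^o]) (a *: u).
  by move=> [/= -> _]; rewrite scaler0.
have [N [M [r r00 [xN qM H]]]] := quot_near VZ (fr_sub (frame_b bf)) D1 V1 cphi cd' hp' (lappr_int _ bf) hC.
have n1 : nbhs (x0, r0) [set p | (DX `*` cint) p -> C (dphi (p, (0, 1)))].
  have : nbhs ((x0, r0), ((0 : X), (1 : R^o))) _ := cd' (x0, r0, (0, 1)) (conj D1 V1) C hC.
  move=> [[A B] [/= hA hB] AB]; apply: filterS hA => p Ap Dp.
  by apply: (AB (p, (0, 1))) => //; split => //=; exact: nbhs_singleton.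
suff : nbhs ((x0, r0), (0 : R^o)) [set p | QD DX p -> C (Qt phi dphi p)] by [].
exists (N `&` [set p | (DX `*` cint) p -> C (dphi (p, (0, 1)))], [set h : R^o | `|h| < r]).
  by split => /=; [exact: filterI|exact: near0_lt].
move=> [[x r'] h] [/= [Nx n1x] hr] Qp; have [Dp1 Dp2] := Qin _ Qp.
rewrite /Qt /=; case: eqP => [h0'|/eqP h0']; first exact: n1x.
have := H (x, r') (0, 1) h Dp1 Nx V1 (nbhs_singleton qM) h0' hr.
have -> : (x, r') + h *: ((0 : X), (1 : R^o)) = (x, r' + h).
  by congr (_, _); rewrite /= ?scaler0 ?addr0// /GRing.scale /= mulr1.
by apply.
Qed.

Lemma QD_frame X (V OX DX : set X) (s : X -> R^o) : bframe V OX DX s ->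
  frame (fun _ => (V `*` [set: R^o]) `*` [set (0 : R^o)]) (QO OX) (QD DX).
Proof.
move=> bf; have lV := bf_lin bf; have cV := bf_cl bf; have [V0 _] := lV.
have lV2 : subsp ((V `*` [set: R^o]) `*` [set (0 : R^o)]).
  apply: subspX; first by apply: subspX.
  by split => // a u v -> ->; rewrite scaler0 addr0.
split => //.
- by move=> p [/(bf_sub bf) ? [/ltW ? [/ltW ? /ltW ?]]]; split.
- move=> [[x r] h] [/= Dx [r0 [h0 rh]]] S [[S1 S3] [/= [[A B] [/= xA rB] AB] hS3] SS].
  have [y [Oy Ay]] := bf_dense bf Dx xA.
  have /nbhs_ballP[e /= e0 eB] := rB; have /nbhs_ballP[e' /= e0' eB'] := hS3.
  (* Both r and h are moved towards 1/3, since (1/3, 1/3) is interior to the triangle 0 <= r, 0 <=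
     h, r + h <= 1. *)
  pose a : R := Num.min (1/2) (Num.min (e / 2) (e' / 2)).
  have a0 : 0 < a by rewrite !lt_min; apply/andP; split; [lra|apply/andP; split; lra].
  have a1 : a <= 1/2 by rewrite ge_min lexx.
  have ae : a <= e / 2 by rewrite !ge_min lexx !orbT.
  have ae' : a <= e' / 2 by rewrite !ge_min lexx !orbT.
  have mv (q ee : R) : 0 <= q <= 1 -> a <= ee / 2 -> `|q - ((1 - a) * q + a / 3)| < ee.
    move=> /andP[q0 q1] aee; have -> : q - ((1 - a) * q + a / 3) = a * (q - 1/3) by ring.
    rewrite normrM (gtr0_norm a0).
    have : `|q - 1/3| <= 1 by rewrite ler_norml; apply/andP; split; lra.
    move=> hh; apply: le_lt_trans (_ : ee / 2 < ee); last by have := lt_le_trans a0 aee; lra.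
    by apply: le_trans aee; rewrite ler_piMr// ltW.
  exists ((y, (1 - a) * r + a / 3), (1 - a) * h + a / 3); split.
    split => //=; split; first by apply: ltr_wpDl; [apply: mulr_ge0; lra|lra].
    split; first by apply: ltr_wpDl; [apply: mulr_ge0; lra|lra].
    have : (1 - a) * (r + h) <= 1 - a by rewrite ler_piMr//; lra.
    rewrite mulrDr; lra.
  apply: SS; split => /=; first apply: AB; [split => //=; apply: eB|apply: eB'];
    rewrite /ball /=; apply: mv => //; apply/andP; split => //; lra.
- move=> _; apply: closedI; apply: closed_comp; try by move=> z _; [exact: cvg_fst|exact: cvg_snd].
  + by move=> z _; exact: cvg_fst.
  + apply: closedI; apply: closed_comp => // z _; [exact: cvg_fst|exact: cvg_snd].
  + by move=> z _; exact: cvg_snd.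
  + by apply: accessible_closed_set1; apply: hausdorff_accessible; exact: hausdorff_R.
- move=> _ [[x r] h] [/= Ox [r0 [h0 rh]]]; have [N N0 hN] := bf_open bf Ox.
  pose e : R := Num.min (r / 2) ((1 - r - h) / 4).
  have e0 : 0 < e by rewrite lt_min; apply/andP; split; lra.
  have er : e <= r / 2 by rewrite ge_min lexx.
  have eh : e <= (1 - r - h) / 4 by rewrite ge_min lexx orbT.
  exists ((N `*` [set q : R^o | `|q| < e]) `*` [set q : R^o | `|q| < e]).
    exists (N `*` [set q : R^o | `|q| < e], [set q : R^o | `|q| < e]) => //; split => /=; last exact: near0_lt.
    by exists (N, [set q : R^o | `|q| < e]) => //; split => //; exact: near0_lt.
  move=> [[x' r'] h'] [[u rho] q] [/= Ox' [r0' [h0' rh']]] [[/= Nx Nr] Nh] [[/= Nu Nrho] Nq] [[/= Vu _] ->].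
  split => /=; first exact: hN.
  rewrite !addr0.
  move: Nr Nrho Nh; rewrite /= !ltr_norml => /andP[? ?] /andP[? ?] /andP[? ?].
  by split; [lra|split; lra].
Qed.

(** On [QO] the step is positive and is not differentiated, so the derivative of a quotient of phi
    is a quotient of its differential. The vector becomes a parameter, which enlarges X to the
    product of X and X * R, and the induction hypothesis applies to [phi1]. *)
Lemma CW_Qt l X G (V OX DX : set X) (s : X -> R^o) (phi : X * R^o -> G) dphi :
  bframe V OX DX s ->
  CW (nseq l true) (fun _ => V `*` [set: R^o]) (OX `*` oint) (DX `*` cint) phi ->
  pd (V `*` setT) (OX `*` oint) phi dphi ->
  CW (nseq l true) (tgl (fun _ => V `*` [set: R^o]) true)
    ((OX `*` oint) `*` (V `*` setT)) ((DX `*` cint) `*` (V `*` setT)) dphi ->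
  CW (nseq l true) (fun _ => (V `*` [set: R^o]) `*` [set (0 : R^o)]) (QO OX) (QD DX) (Qt phi dphi).
Proof.
elim: l X V OX DX s phi dphi => [|l IH] X V OX DX s phi dphi bf /=; first by move=> ? ? ?; exact: (Qt_cw bf).
move=> [hphi _] hp [hd [dd [pdd hdd]]]; split; first exact: (IH _ _ _ _ _ _ _ bf hphi hp hd).
have lVT : subsp (V `*` [set: R^o]) by apply: subspX => //; exact: (bf_lin bf).
have cVT : closed (V `*` [set: R^o]) := @fr_cl _ _ _ _ _ (frame_b bf) true.
pose phi1 (q : (X * (X * R^o)) * R^o) := dphi ((q.1.1, q.2), q.1.2).
pose dphi1 (z : ((X * (X * R^o)) * R^o) * ((X * (X * R^o)) * R^o)) :=
  dd (((z.1.1.1, z.1.2), z.1.1.2), ((z.2.1.1, z.2.2), z.2.1.2)).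
pose L1 (q : (X * (X * R^o)) * R^o) := ((q.1.1, q.2), q.1.2).
have lL1 : lincont L1 by rewrite /L1; lincont.
have bf1 := bframe_prod bf lVT cVT.
have := IH _ _ _ _ _ phi1 dphi1 bf1 => IH1.
exists (fun z => Qt phi1 dphi1 (((z.1.1.1, z.2.1), z.1.1.2), z.1.2)); split.
  move=> [[x r] h] [[u rho] q] [/= Ox [r0 [h0 rh]]] [[/= Vu _] ->].
  rewrite /Qt /= gt_eqF// /phi1 /=.
  have e : \forall k \near (0 : R), h^-1 *: (phi (x + k *: u, r + k *: rho + h) - phi (x + k *: u, r + k *: rho)) =
       Qt phi dphi (((x, r), h) + k *: ((u, rho), 0)).
    by near=> k; rewrite /Qt /= scaler0 addr0 gt_eqF.
  pose ff (y : (X * R^o) * R^o) := h^-1 *: (phi (y.1.1, y.1.2 + h) - phi (y.1.1, y.1.2)).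
  have := @isd_ext _ _ _ ff (Qt phi dphi) ((x, r), h) ((u, rho), 0) _.
  apply; first by apply: filterS e => k; rewrite /ff.
  apply: isdZc.
  have O1 : (OX `*` oint) (x, r + h) by split => //=; apply/andP; split => //; exact: addr_gt0.
  have O2 : (OX `*` oint) (x, r) by split => //=; apply/andP; split => //; lra.
  have i1 := hp (x, r + h) (u, rho) O1 (conj Vu I); have i2 := hp (x, r) (u, rho) O2 (conj Vu I).
  have hB := tvs_cvgB i1 i2.
  rewrite /isd (_ : diff_quot _ _ _ = fun k => diff_quot phi (x, r + h) (u, rho) k - diff_quot phi (x, r) (u, rho) k).
    exact: hB.
  apply/funext => k.
  rewrite /diff_quot /= -scalerBr; congr (_ *: _).
  have -> : r + k *: rho + h = r + h + k *: rho by rewrite addrAC.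
  by rewrite !opprB addrACA [RHS]addrACA [- phi (x, r + h) - _]addrC.
apply: (CW_complin (L := fun z : ((X * R^o) * R^o) * ((X * R^o) * R^o) => (((z.1.1.1, z.2.1), z.1.1.2), z.1.2))
  _ _ _ _ (IH1 _ _ _)).
- lincont.
- by move=> [[[x r] h] [[u rho] q]] [/= [/= ? [? [? ?]]] [[/= ? _] _]].
- by move=> [[[x r] h] [[u rho] q]] [/= [/= ? [? [? ?]]] [[/= ? _] _]].
- by move=> c [[[x r] h] [[u rho] q]] [/= [[/= ? _] ->] [[/= ? _] _]].
- apply: (CW_complin lL1 _ _ _ hd).
  + by move=> [[x [u rho]] r] [[/= ? [/= ? _]] ?].
  + by move=> [[x [u rho]] r] [[/= ? [/= ? _]] ?].
  + by move=> c [[x [u rho]] r] [[/= ? [/= ? _]] _].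
- move=> [[x [u rho]] r] [[u' [u'' rho'']] rho'] [[/= ? [/= ? _]] ?] [[/= ? [/= ? _]] _].
  by rewrite /phi1 /dphi1 /=; apply: (isd_complin (f := dphi) lL1); exact: pdd.
- apply: (CW_complin (L := fun z : ((X * (X * R^o)) * R^o) * ((X * (X * R^o)) * R^o) =>
    (((z.1.1.1, z.1.2), z.1.1.2), ((z.2.1.1, z.2.2), z.2.1.2))) _ _ _ _ hdd).
  + lincont.
  + by move=> [[[x [u rho]] r] [[u' [u'' rho'']] rho']] [/= [[/= ? [/= ? _]] ?] [[/= ? [/= ? _]] _]].
  + by move=> [[[x [u rho]] r] [[u' [u'' rho'']] rho']] [/= [[/= ? [/= ? _]] ?] [[/= ? [/= ? _]] _]].
  + by move=> c [[[x [u rho]] r] [[u' [u'' rho'']] rho']] [/= [[/= ? [/= ? _]] _] [[/= ? [/= ? _]] _]].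
Unshelve. all: by end_near.
Qed.

End bernstein_operator.

Section bernstein_continuity.
Context {R : realType}.
Implicit Types (X Y : tvsType R) (G : tvsType R).

Lemma CW_inv_dir w X G V (O D : set X) (f : X -> G) : (forall b, subsp (V b)) ->
  cw D f -> (forall b x u, V b u -> f (x + u) = f x) -> CW w V O D f.
Proof.
move=> lV cf hf; elim: w => [//|b w IH] /=; split; first exact: IH.
exists (fun _ => 0); split; last exact: CW_cst.
move=> x v _ Vv; rewrite /isd; have -> : diff_quot f x v = fun=> 0; last exact: cvg_cst.
by apply/funext => h; rewrite /diff_quot (hf b) ?subrr ?scaler0//; exact: subspZ.
Qed.

Lemma cvgw_near (T U : topologicalType) (D : set T) (f : T -> U) (x : T) (y : U) (B : set U) :
  f @ within D (nbhs x) --> y -> nbhs y B -> nbhs x [set z | D z -> B (f z)].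
Proof. by move=> h hB; exact: (h B hB). Qed.

(** The induction needs an arbitrary bound S on the total weight: taking off the first term leaves S
    - a i, and convexity recombines the two parts. *)
Lemma wsum_cvx G (C : set G) (I : Type) (r : seq I) (a : I -> R) (z : I -> G) :
  cvx C -> C 0 -> (forall i, 0 <= a i) -> (forall i, C (z i)) -> \sum_(i <- r) a i <= 1 ->
  C (\sum_(i <- r) a i *: z i).
Proof.
move=> cC C0 a0 Cz.
suff h : forall S : R, 0 < S -> \sum_(i <- r) a i <= S -> C (S^-1 *: \sum_(i <- r) a i *: z i).
  by move=> h1; have := h 1 ltr01 h1; rewrite invr1 scale1r.
elim: r => [|i r IH] S S0; first by rewrite !big_nil scaler0.
rewrite !big_cons => hS.
have T0 : 0 <= \sum_(j <- r) a j by apply: sumr_ge0.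
have [aS|aS] := ltP (a i) S; last first.
  have e : \sum_(j <- r) a j = 0 by apply/eqP; rewrite eq_le T0 andbT; lra.
  have -> : \sum_(j <- r) a j *: z j = 0.
    clear -a0 e; elim: r e => [|j r IH]; first by rewrite !big_nil.
    rewrite !big_cons => /eqP; rewrite paddr_eq0 ?sumr_ge0// => /andP[/eqP -> /eqP/IH ->].
    by rewrite scale0r addr0.
  have -> : a i = S by lra.
  by rewrite addr0 scalerA mulVf ?gt_eqF// scale1r.
have Sa : 0 < S - a i by lra.
have := IH (S - a i) Sa; have hh : \sum_(j <- r) a j <= S - a i by lra.
move=> /(_ hh) h.
have a01 : 0 <= a i / S <= 1 by rewrite divr_ge0 ?(ltW S0)//= ler_pdivrMr// mul1r ltW.
have := cC _ _ _ (Cz i) h a01.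
congr C; rewrite scalerDr !scalerA mulrC; congr (_ + _ *: _).
by field; rewrite gt_eqF//= gt_eqF.
Qed.

Lemma cint_bound X G (DX : set X) (phi : X * R^o -> G) x0 g0 (C : set G) :
  cw (DX `*` cint) phi -> DX x0 -> nbhs (0 : G) C ->
  exists N, exists2 M : R, 0 < M & nbhs x0 N /\
    forall x r, N x -> DX x -> cint r -> C (M^-1 *: (phi (x, r) - g0)).
Proof.
move=> cphi Dx0 hC.
have cK : compact (cint : set R^o).
  have -> : (cint : set R^o) = `[0, 1]%classic by apply/seteqP; split => r; rewrite /= in_itv.
  exact: (@segment_compact R).
pose P (i : X * R^o) (r : R^o) := DX i.1 -> cint r -> C (i.2 *: (phi (i.1, r) - g0)).
have hP : forall r, (cint : set R^o) r -> \forall r' \near r & i \near nbhs (x0, (0 : R^o)), P i r'.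
  move=> r Ir.
  have : (fun q : R^o * (X * R^o) => (q.2.2 *: (phi (q.2.1, q.1) - g0))) @
     within [set q | DX q.2.1 /\ cint q.1] (nbhs (r, (x0, (0 : R^o)))) --> (0 : R^o) *: (phi (x0, r) - g0).
    apply: tvs_cvgZ.
      by apply: cvg_within_filter; apply: (cvg_comp _ _ cvg_snd cvg_snd).
    apply: tvs_cvgB; last exact: cvg_cst.
    apply: (cw_cvg (g := fun q : R^o * (X * R^o) => (q.2.1, q.1)) cphi); first by split.
      by rewrite near_withinE; apply: nearW => q [].
    apply: cvg_within_filter.
    have [_ c] : lincont (fun q : R^o * (X * R^o) => (q.2.1, q.1)) by lincont.
    exact: (c (r, (x0, 0))).
  rewrite scale0r => /(_ _ hC); rewrite /nbhs /= => -[[A B] [/= hA hB] AB].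
  exists (A, B) => // -[r' i] [/= Ar Bi] Di Ii.
  by apply: (AB (r', i)).
have [[A B] [/= hA hB] AB] := (proj1 (compact_near_coveringP _)) cK _ _ _ _ hP.
have /nbhs_ballP[e /= e0 eB] := hB.
exists A, (2 / e); first by rewrite divr_gt0.
split => // x r Ax Dx Ir; rewrite invf_div.
apply: (AB (x, e / 2)) => //; split => //; apply: eB; rewrite /ball /= sub0r normrN gtr0_norm; lra.
Qed.

(** Differentiation lowers the degree of a Bernstein operator by one. The offset c absorbs this: the
    derivative involves the operator of offset c - 1 for the same s, so c >= l leaves room for l
    derivatives. *)
Definition bdeg (c : nat) (t : R) : nat := (Num.truncn t^-1 + c)%N.

Lemma bdegE c n : bdeg c (n.+1%:R^-1) = (n.+1 + c)%N.
Proof. by rewrite /bdeg invrK natrK. Qed.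

Definition Bn X G (m : nat) (phi : X * R^o -> G) (p : X * R^o) : G :=
  \sum_(k < m.+1) bern m k p.2 *: phi (p.1, k%:R / m%:R).

Definition Bop (c : nat) X G (s : X -> R^o) (phi : X * R^o -> G) (p : X * R^o) : G :=
  if s p.1 == 0 then phi p else Bn (bdeg c (s p.1)) phi p.

Lemma node_cint m (k : 'I_m.+1) : (cint : set R^o) (k%:R / m%:R).
Proof.
case: m k => [|m] k; first by rewrite invr0 mulr0 /cint /= lexx ler01.
by rewrite /cint /= divr_ge0//= ler_pdivrMr ?ltr0n// mul1r ler_nat -ltnS.
Qed.

Lemma CW_bern w X V (O D : set X) m k (a : X -> R^o) :
  CW w V O D a -> CW w V O D (fun x => bern m k (a x) : R^o).
Proof.
move=> ha; rewrite /bern.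
have hX (b : X -> R^o) j : CW w V O D b -> CW w V O D (fun x => b x ^+ j : R^o).
  move=> hb; have -> : (fun x => b x ^+ j : R^o) = (fun x => \prod_(i < j) b x).
    by apply/funext => x; rewrite prodr_const card_ord.
  exact: CW_prod.
apply: CWM; first exact: CW_cst.
apply: CWM; apply: hX => //.
have -> : (fun x => 1 - a x : R^o) = (fun x => 1 + (-1 : R) *: a x).
  by apply/funext => x; rewrite scaleN1r.
by apply: CWD; [exact: CW_cst|apply: CWZ => //; exact: CW_cst].
Qed.

Lemma Bn_cw X G m (DX : set X) (phi : X * R^o -> G) : cw (DX `*` cint) phi ->
  cw (DX `*` cint) (Bn m phi).
Proof.
move=> cphi; apply: (@CW_sum _ [::] _ _ (fun _ => setT) setT) => k _.
apply: (@CWZ _ [::] _ _ (fun _ => setT) setT) => //=.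
  by apply: (@CW_bern [::] _ (fun _ => setT) setT) => /=; apply: cw_lin; lincont.
apply: (cw_comp (D' := DX `*` cint) (f := fun p => (p.1, k%:R / m%:R))) => //.
  by move=> [x r] [/= Dx _]; split => //=; exact: node_cint.
by apply: cw_pair; [apply: cw_lin; lincont|move=> x _; exact: cvg_cst].
Qed.

(** The nonzero values have integer reciprocals, hence are isolated from one another. *)
Lemma s_const X (V OX DX : set X) (s : X -> R^o) x0 : bframe V OX DX s -> DX x0 -> s x0 != 0 ->
  \forall x \near x0, DX x -> s x = s x0.
Proof.
move=> bf Dx0 s0.
have [s00|[n sn]] := bf_val bf Dx0; first by rewrite s00 eqxx in s0.
have h : (fun x => (s x)^-1) @ within DX (nbhs x0) --> (s x0)^-1.
  by apply: (cvg_comp s (fun y : R => y^-1) (bf_cw bf Dx0)); exact: inv_continuous.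
have s1 : \forall x \near x0, DX x -> s x != 0.
  by apply: (cvgw_near (B := [set y | y != 0]) (bf_cw bf Dx0)); apply: open_nbhs_nbhs; split => //; exact: open_neq.
have s2 : \forall x \near x0, DX x -> ball (s x0)^-1 1 (s x)^-1.
  by apply: (cvgw_near h); apply/nbhs_ballP; exists 1 => //=.
apply: filterS2 s1 s2 => x h1 h2 Dx; have := h1 Dx; have := h2 Dx; rewrite /ball /=.
have [->|[k ->]] := bf_val bf Dx; first by rewrite eqxx.
rewrite sn !invrK => hlt _; congr (_^-1).
move: hlt; rewrite ltr_norml => /andP[h3 h4].
have a1 : (k.+1%:R : R) < n.+2%:R by rewrite [n.+2%:R]mulrS; lra.
have a2 : (n.+1%:R : R) < k.+2%:R by rewrite [k.+2%:R]mulrS; lra.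
rewrite ltr_nat ltnS in a1; rewrite ltr_nat ltnS in a2.
by congr (_%:R); apply/eqP; rewrite eqn_leq a1 a2.
Qed.

(** Bernstein's argument, made uniform near a point with s = 0: nodes close to r contribute values
    of phi near g0, and the others have total weight at most 1/(2M) by [bern_far], where M scales
    all values of phi - g0 over [0,1] into C. *)
Lemma Bop_cw c X G (V OX DX : set X) (s : X -> R^o) (phi : X * R^o -> G) :
  bframe V OX DX s -> cw (DX `*` cint) phi -> cw (DX `*` cint) (Bop c s phi).
Proof.
move=> bf cphi [x0 r0] [/= Dx0 I0].
have D0 : (DX `*` cint) (x0, r0) by [].
have [s0|s0] := eqVneq (s x0) 0; last first.
  have := @Bn_cw _ _ (bdeg c (s x0)) _ _ cphi (x0, r0) D0.
  rewrite [Bop _ _ _ (x0, r0)]/Bop /= (negbTE s0); apply: cvg_trans; apply: near_eq_cvg.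
  rewrite near_withinE; have := s_const bf Dx0 s0 => hs.
  have : \forall p \near (x0, r0), DX p.1 -> s p.1 = s x0 .
    by exists ([set x | DX x -> s x = s x0], setT); [split => //; exact: filterT|move=> p []].
  by apply: filterS => p hp [/hp e _]; rewrite /Bop e (negbTE s0).
rewrite /Bop /= s0 eqxx => B hB.
pose g0 := phi (x0, r0).
have /nbhs_shift hB0 : nbhs g0 B := hB.
have [C [oC C0 cC CB]] := cvx_nbhs hB0.
have nC : nbhs (0 : G) C by exact: open_nbhs_nbhs.
have [N [M M0 [xN hM]]] := cint_bound g0 cphi Dx0 nC.
have nC2 : nbhs g0 [set z | C (2 *: (z - g0))].
  have : (fun z : G => 2 *: (z - g0)) @ g0 --> (2 : R) *: (g0 - g0).
    by apply: (@tvs_cvgZ _ _ _ _ _ (fun _ => 2)); [exact: cvg_cst|apply: tvs_cvgB; [exact: cvg_id|exact: cvg_cst]].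
  by rewrite subrr scaler0 => /(_ _ nC).
have : nbhs (x0, r0) [set p | (DX `*` cint) p -> C (2 *: (phi p - g0))] := cphi _ D0 _ nC2.
move=> -[[A E] [/= hA hE] AE].
have /nbhs_ballP[e /= e0 eE] := hE.
pose eta : R := e / 2.
have eta0 : 0 < eta by rewrite /eta; lra.
(* A degree of at least K makes the far weights at most 1/(2M), and s < 1/K forces such a degree. *)
pose K : R := 2 * M / eta ^+ 2.
have K0 : 0 < K by rewrite /K divr_gt0 ?mulr_gt0 ?exprn_gt0.
have hs : nbhs x0 [set x | DX x -> `|s x| < K^-1].
  apply: (cvgw_near (B := [set y : R^o | `|y| < K^-1]) (bf_cw bf Dx0)); rewrite s0; apply: near0_lt; by rewrite invr_gt0.
suff : nbhs (x0, r0) [set p | (DX `*` cint) p -> B (if s p.1 == 0 then phi p else Bn (bdeg c (s p.1)) phi p)] by [].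
exists (A `&` N `&` [set x | DX x -> `|s x| < K^-1], [set r | ball r0 eta r]).
  by split => /=; [apply: filterI => //; exact: filterI|apply: nbhsx_ballx].
move=> [x r] [/= [[Ax Nx] sx] rr] [/= Dx Ir].
have eB : forall z, C (z - g0) -> B z by move=> z /CB; rewrite /= addrC subrK.
case: ifPn => [_|sx0].
  apply: eB; have : C (2 *: (phi (x, r) - g0)).
    apply: (AE (x, r)) => //; split => //=; apply: eE; apply: le_ball rr; rewrite /eta; lra.
  move=> h; have := cC _ _ (1/2) h C0; rewrite scalerA scaler0 addr0 (_ : 1/2 * 2 = 1); last lra.
  by rewrite scale1r; apply; lra.
apply: eB; rewrite /Bn /=.
have [/eqP|[n sn]] := bf_val bf Dx; first by rewrite (negbTE sx0).
have sK := sx Dx; rewrite sn in sK *; rewrite bdegE addSn.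
set m := (n + c)%N.
have mK : K <= m.+1%:R.
  move: sK; rewrite gtr0_norm ?invr_gt0 ?ltr0n// ltf_pV2 ?posrE ?ltr0n// => /ltW h.
  by apply: (le_trans h); rewrite ler_nat ltnS leq_addr.
have -> : \sum_(k < m.+2) bern m.+1 k r *: phi (x, k%:R / m.+1%:R) - g0 =
   \sum_(k < m.+2) bern m.+1 k r *: (phi (x, k%:R / m.+1%:R) - g0).
  rewrite -[X in _ - X]scale1r -(bern_sum m.+1 r) scaler_suml -sumrB.
  by apply: eq_bigr => k _; rewrite scalerBr.
pose far (k : 'I_m.+2) := eta <= `|k%:R / m.+1%:R - r|.
(* The factors M and 1/2 are moved from the vectors to the weights; then all vectors lie in C and
   the weights sum to at most 1/2 + 1/2. *)
pose a (k : 'I_m.+2) := if far k then M * bern m.+1 k r else 1/2 * bern m.+1 k r.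
pose z (k : 'I_m.+2) := if far k then M^-1 *: (phi (x, k%:R / m.+1%:R) - g0) else 2 *: (phi (x, k%:R / m.+1%:R) - g0).
have -> : \sum_(k < m.+2) bern m.+1 k r *: (phi (x, k%:R / m.+1%:R) - g0) = \sum_(k < m.+2) a k *: z k.
  apply: eq_bigr => k _; rewrite /a /z; case: ifP => _; rewrite scalerA; congr (_ *: _).
    by field; rewrite gt_eqF.
  by field.
apply: wsum_cvx => //.
- by move=> k; rewrite /a; case: ifP => _; apply: mulr_ge0; rewrite ?bern_ge0//; exact: ltW.
- move=> k; rewrite /z; case: ifPn => [_|nf]; first by apply: hM => //; exact: node_cint.
  have := node_cint k => kI.
  apply: (AE (x, k%:R / m.+1%:R)) => //; split => //=; apply: eE; rewrite /ball /=.
  move: nf rr; rewrite /far -ltNge /ball /= => h1 h2.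
  rewrite -(subrK r r0) -addrA; apply: (le_lt_trans (ler_normD _ _)).
  by rewrite [ `|r - _|]distrC (splitr e); apply: ltrD.
- rewrite (bigID far) /=.
  have -> : \sum_(k < m.+2 | far k) a k = M * \sum_(k < m.+2 | far k) bern m.+1 k r.
    by rewrite mulr_sumr; apply: eq_bigr => k fk; rewrite /a fk.
  have -> : \sum_(k < m.+2 | ~~ far k) a k = 1/2 * \sum_(k < m.+2 | ~~ far k) bern m.+1 k r.
    by rewrite mulr_sumr; apply: eq_bigr => k /negbTE fk; rewrite /a fk.
  have h1 : \sum_(k < m.+2 | ~~ far k) bern m.+1 k r <= 1.
    rewrite -[X in _ <= X](bern_sum m.+1 r) [X in _ <= X](bigID far) /= lerDr.
    by apply: sumr_ge0 => k _; exact: bern_ge0.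
  have h2 := bern_far m Ir eta0.
  have h3 : (m.+1%:R * eta ^+ 2)^-1 <= (2 * M)^-1.
    rewrite lef_pV2 ?posrE ?mulr_gt0 ?exprn_gt0 ?ltr0n//.
    by rewrite -ler_pdivrMr ?exprn_gt0.
  have h4 : M * \sum_(k < m.+2 | far k) bern m.+1 k r <= 1/2.
    apply: (@le_trans _ _ (M * (2 * M)^-1)); first by rewrite ler_pM2l//; exact: le_trans h2 h3.
    by rewrite invfM mulrCA divff ?gt_eqF// mulr1 mul1r.
  lra.
Qed.

End bernstein_continuity.

Section bernstein_smooth.
Context {R : realType}.
Implicit Types (X Y : tvsType R) (G : tvsType R).

Lemma isd_sum X G (I : Type) (r : seq I) (f : I -> X -> G) x v (l : I -> G) :
  (forall i, isd (f i) x v (l i)) ->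
  isd (fun y => \sum_(i <- r) f i y) x v (\sum_(i <- r) l i).
Proof.
move=> h; elim: r => [|i r IH].
  by rewrite big_nil (_ : (fun _ => _) = fun=> 0); [exact: isd_cst|apply/funext => y; rewrite big_nil].
rewrite big_cons (_ : (fun _ => _) = fun y => f i y + \sum_(j <- r) f j y).
  exact: isdD.
by apply/funext => y; rewrite big_cons.
Qed.

Lemma isdX X (a : X -> R^o) x v da k : isd a x v da ->
  isd (fun y => a y ^+ k : R^o) x v (k%:R * a x ^+ k.-1 * da : R^o).
Proof.
move=> ha; elim: k => [|k IH]; first by rewrite !mul0r; exact: (isd_cst (1 : R^o)).
have := isdZ ha IH; rewrite (_ : (fun y => _) = fun y => a y ^+ k.+1 : R^o).
  congr (isd _ _ _ _); rewrite /GRing.scale /=; case: k {IH} => [|k] /=; first by rewrite !expr0; ring.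
  by rewrite [a x ^+ k.+1]exprS -[k.+2%:R]natr1; ring.
by apply/funext => y; rewrite exprS.
Qed.

Lemma isd_bern m k (r : R^o) : isd (fun r => bern m.+1 k r : R^o) r 1
  (m.+1%:R * ((if k is k'.+1 then bern m k' r else 0) - bern m k r) : R^o).
Proof.
have h1 : isd (fun r : R^o => 1 - r : R^o) r 1 (-1 : R^o).
  have := isdD (isd_cst (1 : R^o) r (1 : R^o)) (isdZc (a := -1) (@isd_lin _ _ _ _ r (1 : R^o) (@lincont_id _ (R^o)))).
  rewrite add0r /GRing.scale /= mulr1; congr (isd _ _ _ _).
  by apply/funext => y; rewrite mulN1r.
have h2 := isdZ (isdX (k := k) (@isd_lin _ _ _ _ r (1 : R^o) (@lincont_id _ (R^o)))) (isdX (k := (m.+1 - k)%N) h1).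
have := isdZc (a := 'C(m.+1, k)%:R) h2; congr isd; rewrite /GRing.scale /= mulr1.
have e1 : 'C(m.+1, k)%:R * (m.+1 - k)%:R = m.+1%:R * 'C(m, k)%:R :> R.
  by rewrite -!natrM; congr _%:R; rewrite mulnC -mul_bin_down.
case: k e1 {h1 h2} => [|k] e1.
  rewrite /bern !subn0 /= expr0; rewrite subn0 bin0 in e1 *.
  by rewrite bin0; ring.
have e2 : 'C(m.+1, k.+1)%:R * k.+1%:R = m.+1%:R * 'C(m, k)%:R :> R.
  by rewrite -!natrM; congr _%:R; rewrite mulnC -mul_bin_diag.
rewrite /bern /= subSS in e1 *.
have -> : (m - k).-1 = (m - k.+1)%N by rewrite subnS.
transitivity ('C(m.+1, k.+1)%:R * k.+1%:R * (r ^+ k * (1 - r) ^+ (m - k)) -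
   'C(m.+1, k.+1)%:R * (m - k)%:R * (r ^+ k.+1 * (1 - r) ^+ (m - k.+1)) : R); first ring.
by rewrite e1 e2; ring.
Qed.

Lemma bern_big m r : bern m m.+1 r = 0 :> R.
Proof. by rewrite /bern bin_small// mul0r. Qed.

(** Summation by parts: the differences pass from the weights to the values. *)
Lemma bern_parts G m r (a : nat -> G) :
  \sum_(k < m.+2) (m.+1%:R * ((if val k is k'.+1 then bern m k' r else 0) - bern m k r)) *: a k =
  \sum_(k < m.+1) bern m k r *: (m.+1%:R *: (a k.+1 - a k)) :> G.
Proof.
transitivity (m.+1%:R *: (\sum_(k < m.+2) (if val k is k'.+1 then bern m k' r else 0) *: a k -
    \sum_(k < m.+2) bern m k r *: a k)).
  rewrite -sumrB scaler_sumr; apply: eq_bigr => k _.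
  by rewrite -scalerBl scalerA.
rewrite big_ord_recl /= scale0r add0r [X in _ - X]big_ord_recr /= bern_big scale0r addr0.
rewrite -sumrB scaler_sumr; apply: eq_bigr => k _.
by rewrite /bump /= add1n -scalerBr !scalerA mulrC.
Qed.

Lemma Bn_isd X G m (phi : X * R^o -> G) x r u rho (b : 'I_m.+2 -> G) :
  (forall k : 'I_m.+2, isd phi (x, k%:R / m.+1%:R) (u, 0) (b k)) ->
  isd (Bn m.+1 phi) (x, r) (u, rho)
    (rho *: \sum_(k < m.+1) bern m k r *: (m.+1%:R *: (phi (x, k.+1%:R / m.+1%:R) - phi (x, k%:R / m.+1%:R)))
     + \sum_(k < m.+2) bern m.+1 k r *: b k).
Proof.
move=> hb.
have := @isd_sum _ _ _ (index_enum 'I_m.+2) (fun k p => bern m.+1 k p.2 *: phi (p.1, k%:R / m.+1%:R)) (x, r) (u, rho)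
  (fun k => bern m.+1 k r *: b k + (rho * (m.+1%:R * ((if val k is k'.+1 then bern m k' r else 0) - bern m k r))) *: phi (x, k%:R / m.+1%:R)).
rewrite /Bn big_split /= addrC; set S2 := \sum_(i < m.+2) (rho * _) *: _.
have -> : S2 = rho *: \sum_(k < m.+1) bern m k r *: (m.+1%:R *: (phi (x, k.+1%:R / m.+1%:R) - phi (x, k%:R / m.+1%:R))).
  rewrite -(bern_parts m r (fun k => phi (x, k%:R / m.+1%:R))) scaler_sumr.
  by apply: eq_bigr => k _; rewrite scalerA.
apply => k; apply: (@isdZ _ _ _ (fun p : X * R^o => bern m.+1 k p.2 : R^o)).
  apply: (isd_complin (L := snd) (f := fun r => bern m.+1 k r : R^o)); first by lincont.
  have := isdZv (a := rho) (@isd_bern m k r); congr isd.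
  by rewrite /GRing.scale /= mulr1.
have := hb k; rewrite /isd /diff_quot.
apply: cvg_trans; apply: near_eq_cvg; near=> h.
have -> // : (x, k%:R / m.+1%:R) + h *: (u, (0 : R^o)) = (x + h *: u, k%:R / m.+1%:R).
by congr (_, _); rewrite /= scaler0 addr0.
Unshelve. all: by end_near.
Qed.

Lemma lappr_par X (V OX DX : set X) (s : X -> R^o) x : bframe V OX DX s -> OX x.1 ->
  lappr (V `*` [set (0 : R^o)]) (OX `*` oint) (OX `*` cint) x.
Proof.
move=> bf Ox.
have [N N0 hN] := lappr_vopen (bf_lin bf) (bf_open bf) Ox.
exists (N `*` setT); first by exists (N, setT) => //; split => //; exact: filterT.
move=> [x' r'] [u q] [/= Ox' I'] [/= Nx _] [/= Vu ->] [/= Nu _] [/= Oxu _] W [[W1 W2] [/= W10 W20] W12].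
have [x1 [u1 [Wx Wu Vu1 h1]]] := hN x' u Ox' Nx Vu Nu Oxu W1 W10.
have : nbhs r' [set y | W2 (y - r')] by exact: nbhs_sub.
move=> /(cint_closure I')[r1 [I1 Wr1]].
exists (x1, r1), (u1, 0); split.
- by apply: W12.
- by apply: W12; split => //=; rewrite subrr; exact: nbhs_singleton.
- by split.
- by move=> t t01; split => /=; [exact: h1|rewrite scaler0 addr0].
Qed.

(** At s = 1/(n+1) this is 1/(n+1+c), the spacing of the nodes of the operator with offset c; as a
    rational function of s it is continuous at 0. *)
Definition hh (c : nat) (t : R^o) : R^o := t / (1 + c%:R * t).

Lemma hhE c n : hh c (n.+1%:R^-1) = (n.+1 + c)%:R^-1.
Proof.
rewrite /hh natrD.
have h1 : 0 < n.+1%:R :> R by rewrite ltr0n.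
have h2 : 0 <= c%:R :> R by rewrite ler0n.
by field; apply/andP; split; apply: lt0r_neq0 => //; lra.
Qed.

(** Induction on l. By [Bn_isd] the derivative in direction (u, rho) is rho times the operator of
    degree one less on difference quotients of phi, plus the same operator on the derivative of phi
    in direction u. Both are again of the form [Bop], the first with offset c - 1. *)
Lemma CW_Bop l c X G (V OX DX : set X) (s : X -> R^o) (phi : X * R^o -> G) :
  (l <= c)%N -> bframe V OX DX s ->
  CW (nseq l true) (fun _ => V `*` [set: R^o]) (OX `*` oint) (DX `*` cint) phi ->
  CW (nseq l true) (fun _ => V `*` [set: R^o]) (OX `*` oint) (DX `*` cint) (Bop c s phi).
Proof.
elim: l c X V OX DX s phi => [|l IH] c X V OX DX s phi lc bf /=.
  by move=> h; apply: Bop_cw bf h.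
move=> [hphi [dphi [pdphi hd]]]; split; first by apply: IH => //; exact: ltnW.
have lV := bf_lin bf; have cV := bf_cl bf; have frb := frame_b bf.
have V0 : V 0 by case: lV.
have c1 : c = c.-1.+1 by rewrite prednK//; exact: leq_trans lc.
have bf2 : bframe (V `*` V) (OX `*` V) (DX `*` V) (fun q : X * X => s q.1) by exact: bframe_prod.
(* The operator of degree m samples at k/m, whereas the quotients start at k/(m+1) = (k/m)(1 -
   1/(m+1)); rescaling r by 1 - hh corrects this. *)
pose dl (p : X * R^o) := Qt phi dphi ((p.1, p.2 * (1 - hh c (s p.1))), hh c (s p.1)).
pose phi2 (q : (X * X) * R^o) := dphi ((q.1.1, q.2), (q.1.2, 0)).
exists (fun z : (X * R^o) * (X * R^o) => z.2.2 *: Bop c.-1 s dl z.1 +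
   Bop c (fun q : X * X => s q.1) phi2 ((z.1.1, z.2.1), z.1.2)); split.
  move=> [x r] [u rho] [/= Ox Ir] [/= Vu _].
  have sx0 := bf_pos bf Ox.
  have [/eqP|[n sn]] := bf_val bf (bf_sub bf Ox); first by rewrite gt_eqF.
  pose m := (n.+1 + c.-1)%N.
  have em : (n.+1 + c)%N = m.+1 by rewrite /m addnC [in LHS]c1 addSn addnC.
  apply: (@isd_ext _ _ _ (Bn m.+1 phi)).
    by near=> h; rewrite /Bop /= (bf_inv bf); [rewrite gt_eqF// sn bdegE em|exact: subspZ].
  rewrite /Bop /= gt_eqF// !sn !bdegE em.
  (* The first and last nodes are endpoints of [0,1], where [pdphi] says nothing; in the direction
     (u, 0) the derivative exists there by density. *)
  have hb (k : 'I_m.+2) : isd phi (x, k%:R / m.+1%:R) (u, 0) (dphi (x, k%:R / m.+1%:R, (u, 0))).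
    apply: (@isd_dense _ _ _ (V `*` [set (0 : R^o)]) (OX `*` oint) (OX `*` cint)).
    - by apply: subspX => //; split => // a ? ? -> ->; rewrite scaler0 addr0.
    - move=> [y q] [/= Oy Iq]; have [N N0 hN] := bf_open bf Oy.
      exists (N `*` setT); first by exists (N, setT) => //; split => //; exact: filterT.
      by move=> [y' q'] [v e] [/= ? ?] [/= ? _] [/= ? _] [/= ? ->]; split => /=; [exact: hN|rewrite addr0].
    - by move=> [y q] [/= ? /andP[? ?]]; split => //=; apply/andP; split; exact: ltW.
    - by apply: cw_sub (CW_cw hphi) => -[y q] [/(bf_sub bf)].
    - by apply: cw_sub (CW_cw hd) => -[[y q] [v e]] [[/(bf_sub bf) ? ?] [? _]].
    - by move=> y [v e] Oy [? _]; exact: pdphi.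
    - exact: lappr_par bf _.
    - by split => //=; exact: node_cint.
    - by split.
  have := Bn_isd (r := r) (rho := rho) hb; congr (isd _ _ _ (_ *: _ + _)).
  rewrite /Bn /=; apply: eq_bigr => k _; congr (_ *: _).
  rewrite /dl /Qt /= sn hhE em.
  have m0 : 0 < m.+1%:R :> R by rewrite ltr0n.
  rewrite (gt_eqF (x := m.+1%:R^-1)) ?invr_gt0// invrK.
  have e : k%:R / m%:R * (1 - m.+1%:R^-1) = k%:R / m.+1%:R :> R.
    have [m00|m00] := posnP m.
      by move: k; rewrite m00 => k; rewrite ord1 !mul0r.
    have mm : 0 < m%:R :> R by rewrite ltr0n.
    rewrite -[m.+1%:R]natr1; field.
    by apply/andP; split; apply: lt0r_neq0 => //; lra.
  by rewrite e -[k.+1%:R]natr1 mulrDl mul1r.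
have hdl : CW (nseq l true) (fun _ => V `*` [set: R^o]) (OX `*` oint) (DX `*` cint) dl.
  have hs1 x : DX x -> [/\ 0 <= s x, 0 <= hh c (s x) & hh c (s x) <= 1].
    move=> Dx; have [->|[n ->]] := bf_val bf Dx; first by rewrite /hh mul0r lexx ler01.
    rewrite hhE invr_ge0 ler0n invr_ge0 ler0n invf_le1 ?ltr0n ?addSn//; split => //.
    by rewrite ler1n.
  have hs2 x : OX x -> 0 < hh c (s x) < 1.
    move=> Ox; have [s0|[n ->]] := bf_val bf (bf_sub bf Ox).
      by have := bf_pos bf Ox; rewrite s0 ltxx.
    rewrite hhE invr_gt0 ltr0n addSn /= invf_lt1 ?ltr0n// ltr1n ltnS addn_gt0.
    by rewrite [in (0 < c)%N]c1 orbT.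
  have chh : cw (DX `*` cint) (fun p : X * R^o => hh c (s p.1) : R^o).
    move=> [x r] [/= Dx Ir].
    have sx : (fun p : X * R^o => s p.1) @ within (DX `*` cint) (nbhs (x, r)) --> s x.
      apply: (cw_cvg (g := fst) (bf_cw bf)) => //; first by rewrite near_withinE; apply: nearW => p [].
      by apply: cvg_within_filter; exact: cvg_fst.
    have [s0 _ _] := hs1 x Dx.
    have d0 : 1 + c%:R * s x != 0.
      by apply: lt0r_neq0; have := mulr_ge0 (ler0n R c) s0; lra.
    apply: (@cvgM R _ _ _ (fun p : X * R^o => s p.1) (fun p : X * R^o => (1 + c%:R * s p.1)^-1)) => //.
    apply: (@cvgV R _ _ _ (fun p : X * R^o => 1 + c%:R * s p.1)) => //.
    apply: (@cvgD R R^o _ _ _ (fun _ => 1)); first exact: cvg_cst.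
    by apply: (@cvgM R _ _ _ (fun _ => c%:R)); [exact: cvg_cst|exact: sx].
  have lVb : forall b : bool, subsp (V `*` [set: R^o]) by move=> _; exact: fr_lin frb true.
  have hhc : CW (nseq l true) (fun _ => V `*` [set: R^o]) (OX `*` oint) (DX `*` cint) (fun p : X * R^o => hh c (s p.1) : R^o).
    by apply: CW_inv_dir => // _ [x r] [u q] [/= Vu _]; rewrite (bf_inv bf).
  apply: (CW_comp (QD_frame bf) frb _ _ _ _ (CW_Qt bf hphi pdphi hd)).
  - move=> [x r] [/= Dx /andP[r0 r1]]; have [_ h0 h1] := hs1 x Dx; split => //=.
    have a0 : 0 <= 1 - hh c (s x) by lra.
    split; first exact: mulr_ge0; split => //.
    have : r * (1 - hh c (s x)) <= 1 - hh c (s x) by rewrite ler_piMl.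
    lra.
  - move=> [x r] [/= Ox /andP[r0 r1]]; have /andP[h0 h1] := hs2 x Ox; split => //=.
    have a0 : 0 < 1 - hh c (s x) by lra.
    split; first exact: mulr_gt0; split => //.
    have : r * (1 - hh c (s x)) < 1 - hh c (s x) by rewrite gtr_pMl.
    lra.
  - move=> _ [x r] [x' r'] _ _ [/= Vx _]; split => //=.
    have -> : s x = s x' by rewrite -[x](subrK x') addrC (bf_inv bf).
    by rewrite subrr.
  - apply: CW_pair => //; apply: CW_pair; first by apply: CW_lin; lincont.
    apply: CWM; first by apply: CW_lin; lincont.
    have -> : (fun p : X * R^o => 1 - hh c (s p.1) : R^o) = (fun p => 1 + (-1 : R) *: (hh c (s p.1) : R^o)).
      by apply/funext => x; rewrite scaleN1r.
    by apply: CWD; [exact: CW_cst|apply: CWZ => //; exact: CW_cst].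
apply: CWD.
  apply: CWZ; first by apply: CW_lin; lincont.
  apply: (CW_complin (L := fst) _ _ _ _ (IH c.-1 _ _ _ _ s dl _ bf hdl)).
  - lincont.
  - by move=> z [].
  - by move=> z [].
  - by move=> _ z [].
  - by rewrite -ltnS -c1.
apply: (CW_complin (L := fun z : (X * R^o) * (X * R^o) => ((z.1.1, z.2.1), z.1.2)) _ _ _ _ (IH c _ _ _ _ _ phi2 (ltnW lc) bf2 _)).
- lincont.
- by move=> [[x r] [u q]] [/= [? ?] [? _]].
- by move=> [[x r] [u q]] [/= [? ?] [? _]].
- by move=> _ [[x r] [u q]] [/= [? ?] [? _]].
apply: (CW_complin (L := fun q : (X * X) * R^o => ((q.1.1, q.2), (q.1.2, 0))) _ _ _ _ hd).
- apply: lincont_pair; first by lincont.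
  by apply: lincont_pair; [lincont|exact: lincont0].
- by move=> [[x u] r] [/= [? ?] ?].
- by move=> [[x u] r] [/= [? ?] ?].
- by move=> ? [[x u] r] [/= [? ?] ?].
Unshelve. all: by end_near.
Qed.

End bernstein_smooth.

(** * Interpolation between consecutive operators *)

Section interpolation.
Context {R : realType}.
Implicit Types (Y : tvsType R) (G : tvsType R).

Definition Sd : set R^o := [set s | s = 0 \/ exists n : nat, s = n.+1%:R^-1].
Definition Sp : set R^o := [set s | exists n : nat, s = n.+1%:R^-1].

(** [theta n] passes from 0 for s <= 1/(n+1) to 1 for s >= 1/n. Hence for n > 0 [chi n] vanishes
    outside ]1/(n+2), 1/n[, an interval around the node 1/(n+1), while [chi 0] is 1 from s = 1 on.
    Together they form a locally finite partition of unity on s > 0. *)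
Definition theta (n : nat) (s : R) : R := smstep (n%:R * (n.+1%:R * s - 1)).
Definition chi (n : nat) (s : R) : R := theta n.+1 s - theta n s.

Lemma theta1 n s : (0 < n)%N -> s^-1 <= n%:R -> 0 < s -> theta n s = 1.
Proof.
move=> n0 sn s0; apply: smstep_ge1.
have n0' : 0 < n%:R :> R by rewrite ltr0n.
have : 1 <= n%:R * s by rewrite -ler_pdivrMr// mul1r.
by rewrite -[n.+1%:R]natr1 => h; nra.
Qed.

Lemma theta0 n s : n.+1%:R * s <= 1 -> theta n s = 0.
Proof. by move=> h; apply: smstep_le0; apply: mulr_ge0_le0 => //; lra. Qed.

Lemma chi_ge0 n s : 0 < s -> 0 <= chi n s.
Proof.
move=> s0; rewrite /chi subr_ge0; have [h|h] := leP (n.+1%:R * s) 1.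
  by rewrite theta0//; have /andP[] := smstep01 (n.+1%:R * (n.+2%:R * s - 1)).
rewrite (@theta1 n.+1)//; last by rewrite -[s^-1]mul1r ler_pdivrMr// ltW.
by have /andP[] := smstep01 (n%:R * (n.+1%:R * s - 1)).
Qed.

Lemma chi_eq0 n s : 0 < s -> s^-1 <= n%:R -> chi n s = 0.
Proof.
move=> s0 h; have n0 : (0 < n)%N by rewrite -(ltr0n R); apply: lt_le_trans h; rewrite invr_gt0.
rewrite /chi !theta1 ?subrr//; apply: le_trans h _; by rewrite ler_nat.
Qed.

Lemma chi_neq0 n s : 0 < s -> chi n s != 0 -> n.+1%:R^-1 < 2 * s.
Proof.
move=> s0; apply: contraR; rewrite -leNgt => h.
have n0 : 0 < n.+1%:R :> R by rewrite ltr0n.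
have h2 : n.+1%:R * (2 * s) <= 1 by rewrite mulrC -ler_pdivlMr// mul1r.
have e : n.+2%:R = n.+1%:R + 1 :> R by rewrite natr1.
have n1 : 1 <= n.+1%:R :> R by rewrite ler1n.
by rewrite /chi !theta0 ?subrr//; [nra|rewrite e; nra].
Qed.

Lemma chi_sum N s : 0 < s -> s^-1 <= N%:R -> \sum_(n < N) chi n s = 1.
Proof.
move=> s0 h; have N0 : (0 < N)%N by rewrite -(ltr0n R); apply: lt_le_trans h; rewrite invr_gt0.
rewrite -[RHS](theta1 N0 h s0); have : theta 0 s = 0 by rewrite /theta mul0r smstep_le0.
elim: N {h N0} => [|N IH] t0; first by rewrite big_ord0 t0.
by rewrite big_ord_recr /= IH// /chi addrC subrK.
Qed.

Lemma chi_stable G N M s (z : nat -> G) : 0 < s -> s^-1 <= N%:R -> s^-1 <= M%:R ->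
  \sum_(n < N) chi n s *: z n = \sum_(n < M) chi n s *: z n.
Proof.
move=> s0.
suff h : forall N k, s^-1 <= N%:R -> \sum_(n < N + k) chi n s *: z n = \sum_(n < N) chi n s *: z n.
  by move=> hN hM; rewrite -(h N M)// addnC h.
move=> {}N k hN; elim: k => [|k IH]; first by rewrite addn0.
rewrite addnS big_ord_recr /= IH chi_eq0// ?scale0r ?addr0//.
by apply: le_trans hN _; rewrite ler_nat leq_addr.
Qed.

(** Terms with n >= 1/s vanish, so cutting the sum at 1/s loses nothing, and near a given s > 0 one
    fixed larger bound can be used ([interpE]). *)
Definition interp Y G (F : R^o * Y -> G) (p : R^o * Y) : G :=
  if p.1 == 0 then F (0, p.2) else \sum_(n < (Num.truncn p.1^-1).+1) chi n p.1 *: F (n.+1%:R^-1, p.2).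

Lemma interpE Y G (F : R^o * Y -> G) N p : 0 < p.1 -> p.1^-1 <= N%:R ->
  interp F p = \sum_(n < N) chi n p.1 *: F (n.+1%:R^-1, p.2).
Proof.
move=> p0 hN; rewrite /interp gt_eqF//; apply: (chi_stable (fun n => F (n.+1%:R^-1, p.2))) => //.
by apply: ltW; rewrite truncnS_gt.
Qed.

Definition Rp : set R^o := [set s | 0 <= s].

Lemma CW_chi w Y V (O D : set Y) n (s : Y -> R^o) : O `<=` D ->
  CW w V O D s -> CW w V O D (fun y => chi n (s y) : R^o).
Proof.
move=> OD hs; rewrite /chi /theta.
have hz k : CW w V O D (fun y => smstep (k%:R * (k.+1%:R * s y - 1)) : R^o).
  apply: CW_smstep => //; apply: CWM; first exact: CW_cst.
  apply: CWD; last exact: CW_cst.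
  by apply: CWM => //; exact: CW_cst.
rewrite (_ : (fun y => _) = fun y => smstep (n.+1%:R * (n.+2%:R * s y - 1)) + (-1 : R^o) *: (smstep (n%:R * (n.+1%:R * s y - 1)) : R^o)).
  by apply: CWD => //; apply: CWZ => //; exact: CW_cst.
by apply/funext => y; rewrite scaleN1r.
Qed.

(** For small s > 0 the value is a convex combination of values of F at nodes 1/(n+1) < 2 s
    ([chi_neq0]), so it inherits continuity at s = 0 from F. Away from 0 the sum is locally
    finite. *)
Lemma interp_cw Y G (D : set Y) (F : R^o * Y -> G) :
  cw (Sd `*` D) F -> cw (Rp `*` D) (interp F).
Proof.
move=> cF [s0 y0] [/= s0p Dy].
have [s00|s0n] := eqVneq s0 0; last first.
  have {}s0p : 0 < s0 by rewrite lt_def s0n.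
  pose N := (Num.truncn (2 / s0)).+1.
  have hN : 2 / s0 <= N%:R by apply: ltW; rewrite truncnS_gt.
  have nn : \forall p \near (s0, y0), s0 / 2 < p.1.
    have : (fun p : R^o * Y => p.1) @ (s0, y0) --> s0 by exact: cvg_fst.
    move=> h; apply: (h [set y | s0 / 2 < y]); apply: open_nbhs_nbhs; split; last by rewrite /=; lra.
    exact: open_gt.
  have gE (p : R^o * Y) : s0 / 2 < p.1 -> interp F p = \sum_(n < N) chi n p.1 *: F (n.+1%:R^-1, p.2).
    move=> h; have p0 : 0 < p.1 by lra.
    apply: interpE => //; apply: le_trans hN; rewrite -[2]invrK -invfM lef_pV2 ?posrE//; lra.
  have cc : cw (Rp `*` D) (fun p : R^o * Y => \sum_(n < N) chi n p.1 *: F (n.+1%:R^-1, p.2)).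
    apply: (@CW_sum _ [::] _ _ (fun _ => setT) (Rp `*` D)) => n _.
    apply: (@CWZ _ [::] _ _ (fun _ => setT) (Rp `*` D)) => /=.
      by apply: (@CW_chi [::] _ (fun _ => setT) (Rp `*` D)) => //=; apply: cw_lin; lincont.
    apply: (cw_comp (D' := Sd `*` D) (f := fun p : R^o * Y => ((n.+1%:R^-1 : R^o), p.2))) => //.
      by move=> p [_ Dp]; split => //; right; exists n.
    by apply: cw_pair; [move=> x _; exact: cvg_cst|apply: cw_lin; lincont].
  rewrite gE; last by rewrite /=; lra.
  apply: cvg_trans (cc (s0, y0) (conj (ltW s0p) Dy)); apply: near_eq_cvg.
  by rewrite near_withinE; apply: filterS nn => p hp _; rewrite gE.
rewrite s00 /interp /= eqxx => B hB.
pose g0 := F (0, y0).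
have /nbhs_shift hB0 : nbhs g0 B := hB.
have [C [oC C0 cC CB]] := cvx_nbhs hB0.
have hC : nbhs g0 [set z | C (z - g0)] by apply: nbhs_sub; exact: open_nbhs_nbhs.
have D0 : (Sd `*` D) (0, y0) by split => //; left.
have : nbhs ((0 : R^o), y0) [set p | (Sd `*` D) p -> C (F p - g0)] := cF _ D0 _ hC.
move=> -[[A E] [/= hA hE] AE].
have /nbhs_ballP[e /= e0 eA] := hA.
suff : nbhs ((0 : R^o), y0) [set p | (Rp `*` D) p -> B (interp F p)] by [].
exists ([set s : R^o | `|s| < e / 2], E).
  by split => //=; apply: near0_lt; lra.
move=> [s y] [/= se Ey] [/= sp Dy'].
suff : C (interp F (s, y) - g0) by move=> /CB; rewrite /= addrC subrK.
have [->|sn] := eqVneq s 0.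
  rewrite /interp /= eqxx; apply: (AE (0, y)) => //; last by split => //; left.
  by split => //=; exact: nbhs_singleton.
have {}sp : 0 < s by rewrite lt_def sn.
pose N := (Num.truncn s^-1).+1; have hN : s^-1 <= N%:R by apply: ltW; rewrite truncnS_gt.
rewrite (@interpE _ _ _ N (s, y))//=.
have -> : \sum_(n < N) chi n s *: F (n.+1%:R^-1, y) - g0 =
   \sum_(n < N) chi n s *: (if chi n s == 0 then 0 else F (n.+1%:R^-1, y) - g0).
  rewrite -[X in _ - X]scale1r -(chi_sum sp hN) scaler_suml -sumrB.
  by apply: eq_bigr => n _; rewrite -scalerBr; case: eqP => // ->; rewrite !scale0r.
apply: wsum_cvx => //; first by move=> n; exact: chi_ge0.
  move=> n; case: ifPn => // hn; have := chi_neq0 sp hn => h2.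
  apply: (AE (n.+1%:R^-1, y)); last by split => //; right; exists n.
  split => //=; apply: eA; rewrite /ball /= sub0r normrN gtr0_norm ?invr_gt0//.
  by apply: (lt_trans h2); rewrite mulrC -ltr_pdivlMr//; move: se; rewrite /= gtr0_norm.
by rewrite chi_sum.
Qed.

(** The directions fix s, so for each s the sum is finite with constant coefficients and can be
    differentiated term by term. *)
Lemma CW_interp w Y G V (O D : set Y) (F : R^o * Y -> G) : O `<=` D ->
  CW w (fun b => [set 0] `*` V b) (Sd `*` O) (Sd `*` D) F ->
  CW w (fun b => [set 0] `*` V b) (Rp `*` O) (Rp `*` D) (interp F).
Proof.
elim: w Y V O D F => [|b w IH] Y V O D F OD /=; first exact: interp_cw.
move=> [hF [dF [pF hdF]]]; split; first exact: IH.
pose F1 (q : R^o * (Y * Y)) := dF ((q.1, q.2.1), (0, q.2.2)).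
have [lV|nlV] := pselect True; last by case: nlV.
exists (fun z => interp F1 (z.1.1, (z.1.2, z.2.2))); split.
  move=> [s y] [q u] [/= sp Oy] [/= -> Vu].
  have hh (s' : R^o) : Sd s' -> isd (fun p : R^o * Y => F (s', p.2)) (s, y) (0, u) (F1 (s', (y, u))).
    move=> Ss; have := pF (s', y) (0, u) (conj Ss Oy) (conj erefl Vu).
    apply: cvg_trans; apply: near_eq_cvg; near=> h.
    rewrite /diff_quot; congr (_ *: (F _ - _)).
    by congr (_, _); rewrite /= scaler0 addr0.
  have [s0|s0] := eqVneq s 0.
    rewrite [interp F1 _]/interp /= s0 eqxx; rewrite s0 in hh.
    apply: isd_ext (hh 0 (or_introl erefl)).
    by near=> h; rewrite /interp /= scaler0 addr0 eqxx.
  have {}sp : 0 < s by rewrite lt_def s0.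
  have hN : s^-1 <= (Num.truncn s^-1).+1%:R by apply: ltW; rewrite truncnS_gt.
  rewrite (@interpE _ _ _ (Num.truncn s^-1).+1 (s, (y, u)))//=.
  apply: (@isd_ext _ _ _ (fun p : R^o * Y => \sum_(n < (Num.truncn s^-1).+1) chi n s *: F (n.+1%:R^-1, p.2))).
    by near=> h; rewrite (@interpE _ _ _ (Num.truncn s^-1).+1) /= scaler0 addr0.
  apply: isd_sum => n; apply: isdZc; apply: hh; by right; exists n.
apply: (CW_complin (L := fun z : (R^o * Y) * (R^o * Y) => (z.1.1, (z.1.2, z.2.2)))
   _ _ _ _ (IH (Y * Y)%type (tgl V b) (O `*` V b) (D `*` V b) F1 _ _)).
- lincont.
- by move=> [[s y] [q u]] [/= [? ?] [? ?]].
- by move=> [[s y] [q u]] [/= [? ?] [? ?]].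
- by move=> c [[s y] [q u]] [/= [? ?] [? ?]].
- by move=> [y u] [/OD].
apply: (CW_complin (L := fun q : R^o * (Y * Y) => ((q.1, q.2.1), ((0 : R^o), q.2.2))) _ _ _ _ hdF).
- apply: lincont_pair; first by lincont.
  by apply: lincont_pair; [exact: lincont0|lincont].
- by move=> [s [y u]] [/= ? [? ?]].
- by move=> [s [y u]] [/= ? [? ?]].
- by move=> c [s [y u]] [/= ? [? ?]].
Unshelve. all: by end_near.
Qed.

Lemma frame_par (S : set R^o) Y V (O D : set Y) : frame V O D ->
  frame (fun b => [set (0 : R^o)] `*` V b) (S `*` O) (S `*` D).
Proof.
move=> [OD DO Vl Vc Vo].
have c0 : closed [set (0 : R^o)].
  by apply: accessible_closed_set1; apply: hausdorff_accessible; exact: hausdorff_R.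
have l0 : subsp [set (0 : R^o)] by split => // a ? ? -> ->; rewrite scaler0 addr0.
split.
- by move=> [s y] [? /OD].
- move=> [s y] [/= Ss Dy] B [[A1 A2] [/= hA1 hA2] AB].
  have [y' [Oy' Ay']] := DO _ Dy _ hA2.
  by exists (s, y'); split => //; apply: AB; split => //; exact: nbhs_singleton.
- by move=> b; exact: subspX.
- move=> b; apply: closedI; apply: closed_comp => // z _; [exact: cvg_fst|exact: cvg_snd].
- move=> b [s y] [/= Ss Oy]; have [N N0 hN] := Vo b y Oy.
  exists (setT `*` N); first by exists (setT, N) => //; split => //; exact: filterT.
  move=> [s' y'] [q u] [/= ? ?] [_ /= ?] [_ /= ?] [/= -> ?].
  by split => /=; [rewrite addr0|exact: hN].
Qed.

(* The operators are only given at the positive parameters; the value at 0 is a limit. *)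
Lemma CW_Sp w Y G V (O D : set Y) (F : R^o * Y -> G) : frame V O D ->
  CW w (fun b => [set 0] `*` V b) (Sp `*` O) (Sd `*` D) F ->
  CW w (fun b => [set 0] `*` V b) (Sd `*` O) (Sd `*` D) F.
Proof.
move=> fr; apply: CW_dense; first exact: frame_par.
  by move=> [s y] [? ?]; split => //; right.
move=> b [s y] [/= Ss Oy].
have [N N0 hN] := lappr_vopen (fr_lin fr b) (@fr_open _ _ _ _ _ fr b) Oy.
exists (setT `*` N); first by exists (setT, N) => //; split => //; exact: filterT.
move=> [s' y'] [q u] [/= Ss' Oy'] [/= _ Ny] [/= -> Vu] [/= _ Nu] [/= _ Oyu] W [[W1 W2] [/= W10 W20] W12].
have [y1 [u1 [Wy Wu Vu1 h1]]] := hN y' u Oy' Ny Vu Nu Oyu W2 W20.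
have [s1 [Ss1 W1s]] : exists s1, Sp s1 /\ W1 (s1 - s').
  case: Ss' => [->|?]; last by exists s'; split => //; rewrite subrr; exact: nbhs_singleton.
  have /nbhs_ballP[e /= e0 eW] := W10.
  exists (Num.truncn e^-1).+1%:R^-1; split; first by exists (Num.truncn e^-1).
  apply: eW; rewrite subr0 /ball /= sub0r normrN gtr0_norm ?invr_gt0 ?ltr0n//.
  by rewrite -[e]invrK ltf_pV2 ?posrE ?invr_gt0 ?ltr0n// invrK truncnS_gt.
exists (s1, y1), (0, u1); split => //.
- by apply: W12.
- by apply: W12; split => //=; rewrite subrr; exact: nbhs_singleton.
- by move=> t t01; split => /=; [rewrite scaler0 addr0|exact: h1].
Qed.

End interpolation.

(** * Bernstein operators on a box *)

Section box_operators.
Context {R : realType}.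
Implicit Types (T G : tvsType R).

(* A sequence of finite-rank smoothing operators [f |-> \sum_j beta_j f(nu_j)] on K;
   convergence in C^l is expressed as C^l-continuity in the extra parameter s,
   s = 1/(n+1) standing for the n-th operator and s = 0 for the identity. *)
Definition snum (s : R) : nat := (Num.truncn s^-1).-1.

Definition Sop E (J : nat -> finType) (beta : forall n, J n -> E -> R^o) (nu : forall n, J n -> E)
  T G (g : T * E -> G) (p : R^o * (T * E)) : G :=
  if p.1 == 0 then g p.2 else
  \sum_(j : J (snum p.1)) beta _ j p.2.2 *: g (p.2.1, nu _ j).

(** The variable in [T] is the time of the family to be smoothed, in which nothing is
    differentiated. In [sm_cw] differentiability is asked for s > 0 only; at s = 0 it follows by
    [CW_Sp]. *)
Record smoothing (l : nat) (E : tvsType R) (K O : set E) (J : nat -> finType)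
    (beta : forall n, J n -> E -> R^o) (nu : forall n, J n -> E) : Prop := Smoothing {
  sm_node : forall n j, K (nu n j);
  sm_beta : forall n j w, CW w (fun _ => setT) O K (beta n j);
  sm_cw : forall T G (I : set T) (g : T * E -> G), hausdorff_space T ->
    CW (nseq l true) (fun _ => [set 0] `*` setT) (I `*` O) (I `*` K) g ->
    CW (nseq l true) (fun _ => [set 0] `*` ([set 0] `*` setT)) (Sp `*` (I `*` O)) (Sd `*` (I `*` K))
      (Sop beta nu g) }.

Lemma snumE n : snum (n.+1%:R^-1) = n.
Proof. by rewrite /snum invrK natrK. Qed.

Lemma subsp0 (E : tvsType R) : subsp [set (0 : E)].
Proof. by split => // a ? ? -> ->; rewrite scaler0 addr0. Qed.

Lemma closed0 (E : tvsType R) : hausdorff_space E -> closed [set (0 : E)].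
Proof. by move=> h; apply: accessible_closed_set1; exact: hausdorff_accessible. Qed.

Lemma CW_postlin w (X F G : tvsType R) V (O D : set X) (L : F -> G) (f : X -> F) :
  lincont L -> CW w V O D f -> CW w V O D (fun x => L (f x)).
Proof.
move=> hL; elim: w X V O D f => [|c w IH] X V O D f /=.
  by move=> hf; apply: (@cw_comp _ _ _ _ _ setT) hf _ => //; exact: cw_lin.
move=> [hf [df [pf hdf]]]; split; first exact: IH.
exists (fun p => L (df p)); split; last exact: IH.
move=> x v Ox Vv; rewrite /isd.
have -> : diff_quot (fun x => L (f x)) x v = (fun h => L (diff_quot f x v h)).
  apply/funext => h; rewrite /diff_quot (linZ _ _ hL); congr (_ *: _).
  by rewrite -[in RHS]scaleN1r (linD _ _ hL) (linZ _ _ hL) scaleN1r.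
by apply: continuous_cvg; [case: hL => _; exact|exact: pf].
Qed.

Variables (d : nat) (a b : 'rV[R]_d).
Hypothesis ab : forall i, a ord0 i < b ord0 i.
Local Notation E := ('rV[R]_d).
Implicit Types (y : E) (i : 'I_d).

Definition box : set E := [set y | forall i, a ord0 i <= y ord0 i <= b ord0 i].
Definition obox : set E := [set y | forall i, a ord0 i < y ord0 i < b ord0 i].

Lemma lincont_coord i : lincont (fun y : E => y ord0 i : R^o).
Proof. by split; [move=> c x y; rewrite !mxE|exact: coord_continuous]. Qed.

Lemma obox_box : obox `<=` box.
Proof. by move=> y h i; have /andP[? ?] := h i; apply/andP; split; exact: ltW. Qed.

Lemma open_obox : open obox.
Proof.
rewrite openE => y hy.
suff h : forall r : seq 'I_d, nbhs (y : E) [set z : E | forall i, i \in r -> a ord0 i < z ord0 i < b ord0 i].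
  by apply: filterS (h (enum 'I_d)) => z hz i; apply: hz; rewrite mem_enum.
elim=> [|i r IH]; first exact: filterE.
have /andP[h1 h2] := hy i.
have hi : nbhs (y : E) [set z : E | a ord0 i < z ord0 i < b ord0 i].
  have [_ hc] := lincont_coord i.
  apply: (hc y [set r | a ord0 i < r < b ord0 i]).
  apply: open_nbhs_nbhs; split; last by rewrite /= h1 h2.
  have -> : [set r | a ord0 i < r < b ord0 i] = `]a ord0 i, b ord0 i[%classic.
    by apply/seteqP; split => r'; rewrite /= in_itv.
  exact: (@interval_open R (BRight _) (BLeft _)).
apply: filterS2 hi IH => z z1 z2 j; rewrite inE => /orP[/eqP ->//|]; exact: z2.
Qed.

Lemma box_closure : box `<=` closure obox.
Proof.
move=> y hy B hB; pose m : E := (1/2 : R) *: (a + b).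
have /nbhs_shift hB0 := hB.
have := scale_small (m - y) hB0 => /nbhs_ballP[e /= e0 he].
pose t := Num.min (1/2) (e / 2).
have t0 : 0 < t by rewrite lt_min; apply/andP; split; lra.
have t1 : t <= 1/2 by rewrite ge_min lexx.
have te : t <= e / 2 by rewrite ge_min lexx orbT.
exists (y + t *: (m - y)); split; last first.
  by apply: he; rewrite /ball /= sub0r normrN gtr0_norm//; lra.
move=> i; have /andP[h1 h2] := hy i; have h := ab i; rewrite /m !mxE.
by apply/andP; split; nra.
Qed.

Lemma box_interior : box° `<=` obox.
Proof.
move=> y hy i; have hd := hy; have by_ := interior_subset hy.
pose ei : E := delta_mx ord0 i.
have /nbhs_shift hB0 : nbhs y box := hy.
have h1 := scale_small ei hB0.
have /nbhs_ballP[e /= e0 he] := h1.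
have p1 : (box (y + (e / 2) *: ei)).
  by apply: he; rewrite /ball /= sub0r normrN gtr0_norm//; lra.
have p2 : (box (y + (- (e / 2)) *: ei)).
  by apply: he; rewrite /ball /= sub0r opprK gtr0_norm//; lra.
have := p1 i; have := p2 i; rewrite !mxE !eqxx /= mulr1 => /andP[? _] /andP[_ ?].
by apply/andP; split; lra.
Qed.

Definition upd y i (c : R) : E := y + (c - y ord0 i) *: delta_mx ord0 i.

Lemma updE y i c j : (upd y i c) ord0 j = if j == i then c else y ord0 j.
Proof.
rewrite /upd !mxE /=; case: eqP => [->|_]; last by rewrite mulr0 addr0.
by rewrite mulr1 addrC subrK.
Qed.

Definition unit_co i y : R := (y ord0 i - a ord0 i) / (b ord0 i - a ord0 i).
Definition of_unit i (r : R) : R := a ord0 i + (b ord0 i - a ord0 i) * r.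

Lemma of_unitK i y : of_unit i (unit_co i y) = y ord0 i.
Proof.
rewrite /of_unit /unit_co mulrC divfK; first by rewrite addrC subrK.
by rewrite subr_eq0 gt_eqF.
Qed.

Lemma upd_id y i : upd y i (of_unit i (unit_co i y)) = y.
Proof. by rewrite of_unitK /upd subrr scale0r addr0. Qed.

Lemma CW_upd w (X : tvsType R) V (O D : set X) i (f : X -> E) (r : X -> R^o) :
  CW w V O D f -> CW w V O D r -> CW w V O D (fun x => upd (f x) i (r x)).
Proof.
move=> hf hr; apply: CWD => //; apply: CWZ; last exact: CW_cst.
rewrite (_ : (fun x => _) = fun x => r x + (-1 : R^o) *: (f x ord0 i : R^o)); last first.
  by apply/funext => x; rewrite scaleN1r.
apply: CWD => //; apply: CWZ; first exact: CW_cst.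
exact: (CW_postlin (lincont_coord i) hf).
Qed.

Definition shift1 T G i (F : R^o * (T * E) -> G) (q : (R^o * (T * E)) * R^o) : G :=
  F (q.1.1, (q.1.2.1, upd q.1.2.2 i (of_unit i q.2))).

(** The Bernstein operator in the i-th coordinate. The whole point p is its parameter, and the i-th
    coordinate inside p is overwritten through [shift1]. *)
Definition Aop c i T G (F : R^o * (T * E) -> G) (p : R^o * (T * E)) : G :=
  Bop c fst (shift1 i F) (p, unit_co i p.2.2).

Lemma bframe_box T (I : set T) : hausdorff_space T ->
  bframe ([set 0] `*` ([set 0] `*` setT)) (Sp `*` (I `*` obox)) (Sd `*` (I `*` box)) (@fst R^o (T * E)).
Proof.
move=> hT.
have c0 : closed [set (0 : R^o)] by apply: closed0; exact: hausdorff_R.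
have cT := closed0 hT.
split.
- by move=> [s [t y]] [/= [n ?] [? /obox_box ?]]; split => //; right; exists n.
- move=> [s [t y]] [/= Ss [It Ky]] B [[B1 B2] [/= h1 h2] B12].
  have [[C1 C2] [/= h3 h4] C12] := h2.
  have [y' [Oy By]] := box_closure Ky h4.
  have [s' [Ss' B1s]] : exists s', Sp s' /\ B1 s'.
    case: Ss h1 => [->|Ss] h1; last by exists s; split => //; exact: nbhs_singleton.
    have /nbhs_ballP[e /= e0 eB] := h1.
    exists (Num.truncn e^-1).+1%:R^-1; split; first by exists (Num.truncn e^-1).
    apply: eB; rewrite /ball /= sub0r normrN gtr0_norm ?invr_gt0 ?ltr0n//.
    by rewrite -[e]invrK ltf_pV2 ?posrE ?invr_gt0 ?ltr0n// invrK truncnS_gt.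
  exists (s', (t, y')); split => //; apply: B12; split => //=; apply: C12.
  by split => //=; exact: nbhs_singleton.
- by apply: subspX; [exact: subsp0|apply: subspX; [exact: subsp0|]].
- apply: closedI; apply: closed_comp => //; try by move=> z _; exact: cvg_fst.
    by move=> z _; exact: cvg_snd.
  by apply: closedI; apply: closed_comp => // z _; [exact: cvg_fst|exact: cvg_snd].
- move=> [s [t y]] [/= Ss [It Oy]]; have [N N0 hN] := vopenT open_obox setT Oy.
  exists (setT `*` (setT `*` N)).
    exists (setT, setT `*` N) => //; split => //=; first exact: filterT.
    by exists (setT, N) => //; split => //=; exact: filterT.
  move=> [s' [t' y']] [s1 [t1 y1]] [/= ? [? ?]] [/= _ [_ ?]] [/= _ [_ ?]] [/= -> [-> _]].
  by rewrite /= !addr0; split => //; split => //=; exact: hN.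
- by move=> [s [t y]] [/= [n ->] _]; rewrite invr_gt0 ltr0n.
- by move=> [s [t y]] [/= Ss _].
- by apply: cw_lin; lincont.
- by move=> [s [t y]] [s1 [t1 y1]] [/= -> _]; rewrite /= addr0.
Qed.

Lemma bframe_frame (X : tvsType R) (V OX DX : set X) (s : X -> R^o) : bframe V OX DX s ->
  frame (fun _ => V) OX DX.
Proof. by case=> *; split. Qed.

Lemma CW_Aop l c i T G (I : set T) (F : R^o * (T * E) -> G) : hausdorff_space T -> (l <= c)%N ->
  CW (nseq l true) (fun _ => [set 0] `*` ([set 0] `*` setT)) (Sp `*` (I `*` obox)) (Sd `*` (I `*` box)) F ->
  CW (nseq l true) (fun _ => [set 0] `*` ([set 0] `*` setT)) (Sp `*` (I `*` obox)) (Sd `*` (I `*` box)) (Aop c i F).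
Proof.
move=> hT lc hF; have bf := bframe_box I hT; have fr := bframe_frame bf; have frb := frame_b bf.
have abi := ab i.
have abi0 : 0 < b ord0 i - a ord0 i by lra.
have hU : CW (nseq l true) (fun _ => ([set 0] `*` ([set 0] `*` setT)) `*` [set: R^o])
    ((Sp `*` (I `*` obox)) `*` oint) ((Sd `*` (I `*` box)) `*` cint) (shift1 i F).
  apply: (CW_comp fr frb _ _ _ _ hF).
  - move=> [[s [t y]] r] [/= [Ss [It Ky]] /andP[r0 r1]]; split => //; split => //= j.
    rewrite updE; case: eqP => [->|_]; last exact: Ky.
    rewrite /of_unit; apply/andP; split; nra.
  - move=> [[s [t y]] r] [/= [Ss [It Ky]] /andP[r0 r1]]; split => //; split => //= j.
    rewrite updE; case: eqP => [->|_]; last exact: Ky.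
    rewrite /of_unit; apply/andP; split; nra.
  - by move=> _ [[s [t y]] r] [[s' [t' y']] r'] _ _ [/= [/= ? [/= ? _]] _].
  - apply: CW_pair; first by apply: CW_lin; lincont.
    apply: CW_pair; first by apply: CW_lin; lincont.
    apply: CW_upd; first by apply: CW_lin; lincont.
    apply: CWD; first exact: CW_cst.
    by apply: CWM; [exact: CW_cst|apply: CW_lin; lincont].
have hB := CW_Bop lc bf hU.
apply: (CW_comp frb fr _ _ _ _ hB).
- move=> [s [t y]] [/= Ss [It Ky]]; split => //=; have /andP[h1 h2] := Ky i.
  by apply/andP; rewrite /unit_co divr_ge0 ?subr_ge0 ?(ltW abi)// ler_pdivrMr// mul1r lerD2r.
- move=> [s [t y]] [/= Ss [It Ky]]; split => //=; have /andP[h1 h2] := Ky i.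
  by apply/andP; rewrite /unit_co divr_gt0 ?subr_gt0//= ltr_pdivrMr// mul1r ltrD2r.
- by move=> _ [s [t y]] [s' [t' y']] _ _ [/= ? [/= ? _]].
- apply: CW_pair; first by apply: CW_lin; lincont.
  apply: CWM; last exact: CW_cst.
  apply: CWD; last exact: CW_cst.
  apply: CW_lin; apply: (lincont_comp (L' := fun y : E => y ord0 i : R^o)); last exact: lincont_coord.
  by lincont.
Qed.

Definition Aops c (is_ : seq 'I_d) T G (F : R^o * (T * E) -> G) := foldr (fun i F => Aop c i F) F is_.

(** Each one-dimensional operator replaces one coordinate by nodes, so a composite is a finite sum
    with a node map that forgets the coordinates treated so far; the third clause records this and
    drives the induction. *)
Lemma Aops_explicit c n (is_ : seq 'I_d) : exists (J : finType) (beta : J -> E -> R^o) (nu : J -> E -> E),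
  [/\ (forall j w, CW w (fun _ => setT) setT setT (beta j)),
      (forall j y, box y -> box (nu j y)),
      (forall j y y', (forall i, i \notin is_ -> y ord0 i = y' ord0 i) -> nu j y = nu j y') &
      forall T G (F : R^o * (T * E) -> G) t y,
        Aops c is_ F (n.+1%:R^-1, (t, y)) = \sum_j beta j y *: F (n.+1%:R^-1, (t, nu j y))].
Proof.
elim: is_ => [|i is_ [J [beta [nu [h1 h2 h3 h4]]]]].
  exists unit, (fun _ _ => 1), (fun _ y => y); split => //.
  - by move=> j w; exact: CW_cst.
  - by move=> _ y y' h; apply/rowP => i; exact: h.
  - move=> T G F t y; rewrite (bigD1 tt)//= big1 ?addr0 ?scale1r// => -[].
pose m := (n.+1 + c)%N; pose nd (k : 'I_m.+1) : R := of_unit i (k%:R / m%:R).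
have ndb (k : 'I_m.+1) : a ord0 i <= nd k <= b ord0 i.
  have := @node_cint R m k; rewrite /cint /= => /andP[? ?]; have ? := ab i; rewrite /nd /of_unit.
  by apply/andP; split; nra.
exists ('I_m.+1 * J)%type, (fun (q : 'I_m.+1 * J) y => bern m q.1 (unit_co i y) * beta q.2 (upd y i (nd q.1)) : R^o),
   (fun q y => nu q.2 (upd y i (nd q.1))); split.
- move=> [k j] w /=; have frT : frame (fun _ : bool => [set: E]) setT setT.
    have := frameT (D := [set: E]); rewrite interiorT; apply => x _; rewrite interiorT; exact: subset_closure.
  apply: CWM.
    apply: CW_bern; apply: CWM; last exact: CW_cst.
    by apply: CWD; [apply: CW_lin; exact: lincont_coord|exact: CW_cst].
  apply: (CW_comp frT frT _ _ _ _ (h1 j w)) => //.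
  by apply: CW_upd; [apply: CW_lin; lincont|exact: CW_cst].
- move=> [k j] y Ky; apply: h2 => i'; rewrite updE; case: eqP => [->|_] //.
- move=> [k j] y y' h; apply: h3 => i' hi'; rewrite !updE; case: eqP => // /eqP ne.
  by apply: h; rewrite inE negb_or ne.
- move=> T G F t y; rewrite /= /Aop /Bop /= gt_eqF ?invr_gt0 ?ltr0n// bdegE.
  rewrite /Bn -(pair_big xpredT xpredT (fun (k : 'I_m.+1) (j : J) => (bern m k (unit_co i y) * beta j (upd y i (nd k))) *:
     F (n.+1%:R^-1, (t, nu j (upd y i (nd k)))))) /=.
  apply: eq_bigr => k _; rewrite /shift1 /= h4 scaler_sumr.
  by apply: eq_bigr => j _; rewrite scalerA.
Qed.

Lemma box_smoothing l : exists (J : nat -> finType) (beta : forall n, J n -> E -> R^o) (nu : forall n, J n -> E),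
  smoothing l box obox beta nu.
Proof.
have /choice[S hS] : forall n, exists S : {J : finType & ((J -> E -> R^o) * (J -> E -> E))%type},
  [/\ (forall j w, CW w (fun _ => setT) setT setT ((projT2 S).1 j)),
      (forall j y, box y -> box ((projT2 S).2 j y)),
      (forall j y y', (forall i, i \notin enum 'I_d -> y ord0 i = y' ord0 i) -> (projT2 S).2 j y = (projT2 S).2 j y') &
      forall T G (F : R^o * (T * E) -> G) t y,
        Aops l (enum 'I_d) F (n.+1%:R^-1, (t, y)) = \sum_j (projT2 S).1 j y *: F (n.+1%:R^-1, (t, (projT2 S).2 j y))].
  by move=> n; have [J [beta [nu h]]] := Aops_explicit l n (enum 'I_d); exists (existT _ J (beta, nu)).
(* With all coordinates treated the node map is constant, so it may be evaluated at the corner a.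
   The offset l of the degrees allows for l derivatives. *)
exists (fun n => projT1 (S n)), (fun n => (projT2 (S n)).1), (fun n j => (projT2 (S n)).2 j a); split.
- move=> n j; have [_ h _ _] := hS n; apply: h => i; rewrite lexx ltW//.
- move=> n j w; have [h _ _ _] := hS n.
  exact: CW_sub (h j w).
- move=> T G I g hT hg.
  pose F0 (p : R^o * (T * E)) := g p.2.
  have h0 : CW (nseq l true) (fun _ => [set 0] `*` ([set 0] `*` setT)) (Sp `*` (I `*` obox)) (Sd `*` (I `*` box)) F0.
    apply: (CW_complin (L := snd) _ _ _ _ hg); first by lincont.
    - by move=> [s [t y]] [].
    - by move=> [s [t y]] [].
    - by move=> _ [s [t y]] [].
  have : CW (nseq l true) (fun _ => [set 0] `*` ([set 0] `*` setT)) (Sp `*` (I `*` obox)) (Sd `*` (I `*` box)) (Aops l (enum 'I_d) F0).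
    by elim: (enum 'I_d) => [//|i r IH]; exact: CW_Aop.
  apply: CW_ext; first exact: bframe_frame (bframe_box I hT).
  move=> [s [t y]] [/= Ss [It Ky]]; rewrite /Sop /=; case: Ss => [->|[n ->]].
    rewrite eqxx; elim: (enum 'I_d) => [//|i r IH].
    by rewrite /= /Aop /Bop /= eqxx /shift1 /= upd_id.
  rewrite gt_eqF ?invr_gt0 ?ltr0n// snumE; have [_ _ h3 h4] := hS n.
  rewrite h4; apply: eq_bigr => j _; rewrite (h3 j y a)// => i; by rewrite mem_enum.
Qed.

End box_operators.

(* The library's finite subcover property is restricted to pointed spaces. *)
Lemma compact_fin_cover (T : topologicalType) (K : set T) (U : T -> set T) : compact K ->
  (forall x, K x -> nbhs x (U x)) ->
  exists s : seq T, (forall x, x \in s -> K x) /\ forall x, K x -> exists2 y, y \in s & U y x.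
Proof.
move=> cK hU.
(* The finite lists of points of K, directed by inclusion, give a filter; near-covering compactness
   applied to it yields a finite subcover. *)
pose B (s : seq T) : set (seq T) := [set s' : seq T | {subset s <= s'} /\ forall x, x \in s' -> K x].
pose F := filter_from [set s : seq T | forall x, x \in s -> K x] B.
have FF : Filter F.
  apply: filter_from_filter; first by exists [::].
  move=> s1 s2 h1 h2; exists (s1 ++ s2).
    by move=> x; rewrite mem_cat => /orP[/h1|/h2].
  by move=> s' [h3 h4]; split; split => // x xs; apply: h3; rewrite mem_cat xs ?orbT.
pose P (s : seq T) (x : T) := (forall z, z \in s -> K z) /\ exists2 y, y \in s & U y x.
have hP : forall x, K x -> \forall x' \near x & s \near F, P s x'.
  move=> x Kx; exists (U x, B [:: x]).
    split => /=; first exact: hU.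
    by exists [:: x] => // z; rewrite inE => /eqP ->.
  move=> [x' s] [/= Ux [h1 h2]]; split => //; exists x => //; apply: h1; exact: mem_head.
have [s hs hB] := (proj1 (compact_near_coveringP _)) cK _ F P FF hP.
have hs' : B s s by split.
exists s; split => // x Kx; by have [_] := hB s hs' x Kx.
Qed.

(** * Locally compact spaces are finite-dimensional *)

Section locally_compact_tvs.
Context {R : realType}.
Variable (E : tvsType R).
Hypothesis hE : hausdorff_space E.

Definition comb n (f : 'I_n -> E) (v : 'rV[R]_n) : E := \sum_i v ord0 i *: f i.

Lemma lincont_comb n (f : 'I_n -> E) : lincont (comb f).
Proof.
split.
  move=> c x y; rewrite /comb scaler_sumr -big_split; apply: eq_bigr => i _.
  by rewrite !mxE scalerDl scalerA.
move=> x; rewrite /comb.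
have : cw setT (fun x : 'rV[R]_n => \sum_i x ord0 i *: f i).
  apply: (@CW_sum _ [::] _ _ (fun _ => setT) setT) => i _.
  apply: (@CWZ _ [::] _ _ (fun _ => setT) setT) => /=; last by move=> z _; exact: cvg_cst.
  by apply: cw_lin; exact: lincont_coord.
by move=> /(_ x I) h B /h; rewrite /nbhs /= /within /=; apply: filterS => z; exact.
Qed.

(** The image of the unit sphere is compact and avoids 0, so some convex neighbourhood W of 0 misses
    it; scaling towards 0 shows that no v of norm > 1 is sent into W. *)
Lemma inj_comb_bounded n (L : 'rV[R]_n -> E) : lincont L -> (forall v, L v = 0 -> v = 0) ->
  exists W, [/\ nbhs 0 W, cvx W & forall v, W (L v) -> `|v| <= 1].
Proof.
move=> hL inj.
pose S := [set v : 'rV[R]_n | `|v| = 1].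
have cS : compact S.
  apply: bounded_closed_compact.
    by exists 1; split => // M M1 v; rewrite /S /= => ->; exact: ltW.
  apply: (@closed_comp _ _ (fun v : 'rV[R]_n => `|v|) [set 1]); last exact: closed_eq.
  by move=> v _; exact: norm_continuous.
have cLS : compact (L @` S).
  by apply: continuous_compact cS; apply: continuous_subspaceT; case: hL.
have oC : open (~` (L @` S)) by rewrite openC; exact: compact_closed.
have L0 : L 0 = 0 by have := linZ 0 0 hL; rewrite !scale0r.
have n0 : nbhs (0 : E) (~` (L @` S)).
  apply: open_nbhs_nbhs; split => // -[v]; rewrite /S /= => v1 /inj v0.
  by move: v1; rewrite v0 normr0 => /eqP; rewrite eq_sym oner_eq0.
have [W [oW W0 cW WS]] := cvx_nbhs n0.
exists W; split => //; first exact: open_nbhs_nbhs.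
move=> v Wv; rewrite leNgt; apply/negP => v1.
have v0 : 0 < `|v| by apply: lt_trans v1.
apply: (WS (L (`|v|^-1 *: v))).
  rewrite (linZ _ _ hL); have := cW _ _ `|v|^-1 Wv W0; rewrite scaler0 addr0; apply.
  by rewrite invr_ge0 ltW//= invf_le1// ltW.
exists (`|v|^-1 *: v) => //; rewrite /S /= normrZ normrV ?unitfE ?gt_eqF// normr_id.
by rewrite mulVf// gt_eqF.
Qed.

Lemma compact_bounded_tvs (K W : set E) : compact K -> nbhs 0 W ->
  \forall e \near (0 : R), forall x, K x -> W (e *: x).
Proof.
move=> cK W0.
have hP : forall x, K x -> \forall x' \near x & e \near nbhs (0 : R^o), W (e *: x').
  move=> x _; have : (fun q : E * R^o => q.2 *: q.1) @ nbhs (x, (0 : R^o)) --> (0 : R^o) *: x.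
    by apply: tvs_cvgZ; [exact: cvg_snd|exact: cvg_fst].
  rewrite scale0r => /(_ _ W0) [[A B] [/= hA hB] AB].
  by exists (A, B) => // -[x' e] [/= ? ?]; exact: (AB (x', e)).
exact: ((proj1 (compact_near_coveringP _)) cK _ _ (fun e x => W (e *: x)) _ hP).
Qed.

(** Riesz's theorem. A convex neighbourhood C of 0 inside a compact set is contained in F + C/2 for
    the span F of finitely many vectors. Iterating, points of C are limits of elements of F with
    bounded coefficients, which form a compact set, so C lies in F. By scaling, F is the whole
    space. *)
Lemma locally_compact_findim (K : set E) (x0 : E) : compact K -> nbhs x0 K ->
  exists (d : nat) (L : E -> 'rV[R]_d) (L' : 'rV[R]_d -> E),
    [/\ lincont L, lincont L', cancel L L' & cancel L' L].
Proof.
move=> cK /nbhs_shift nK.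
have [C [oC C0 cC CK]] := cvx_nbhs nK.
have nC : nbhs 0 C by exact: open_nbhs_nbhs.
have [m [f0 hf0]] : exists n, exists f : 'I_n -> E, forall c, C c -> exists v u, C u /\ c = comb f v + (1/2 : R) *: u.
  have oC2 z : nbhs z [set u | C ((2 : R) *: (u - z))].
    have : (fun u => (2 : R) *: (u - z)) @ z --> (2 : R) *: (z - z).
      by apply: (@tvs_cvgZ _ _ _ _ _ (fun _ => 2)); [exact: cvg_cst|apply: tvs_cvgB; [exact: cvg_id|exact: cvg_cst]].
    by rewrite subrr scaler0 => /(_ _ nC).
  have [D' [_ hD']] := compact_fin_cover cK (fun z _ => oC2 z).
  exists (size D'), (fun i : 'I_(size D') => nth 0 D' i - x0) => c Cc.
  have [z /= zD Cz] := hD' _ (CK _ Cc).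
  have zi : (index z D' < size D')%N by rewrite index_mem.
  exists (delta_mx ord0 (Ordinal zi)), ((2 : R) *: (x0 + c - z)); split => //.
  rewrite scalerA mul1r mulVf// scale1r /comb (bigD1 (Ordinal zi))//= big1 ?addr0.
    by rewrite !mxE !eqxx scale1r nth_index// addrC addrA subrK addrC addKr.
  by move=> i ni; rewrite !mxE (negbTE ni) andbF scale0r.
(* A system of minimal length with this property is linearly independent: a nontrivial relation
   would allow one vector to be dropped. *)
pose P n := `[< exists f : 'I_n -> E, forall c, C c -> exists v u, C u /\ c = comb f v + (1/2 : R) *: u >].
have exP : exists n, P n by exists m; apply/asboolP; exists f0.
have [d /asboolP[f hf] dmin] := ex_minnP exP.
have inj v : comb f v = 0 -> v = 0.
  move=> fv0; apply/rowP => i; rewrite mxE; apply/eqP; apply: contraT => vi.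
  case: d f hf dmin v fv0 i vi => [|d] f hf dmin v fv0 i vi; first by case: i {vi}.
  have : (d.+1 <= d)%N; last by rewrite ltnn.
  apply: dmin; apply/asboolP; exists (fun j => f (lift i j)) => c /hf[w [u [Cu ->]]].
  pose w' : 'rV[R]_d.+1 := w - (w ord0 i / v ord0 i) *: v.
  have e : comb f w = comb f w'.
    have -> : w' = (- (w ord0 i / v ord0 i)) *: v + w by rewrite /w' scaleNr addrC.
    have [hl _] := lincont_comb f.
    by rewrite hl fv0 scaler0 add0r.
  exists (\row_j w' ord0 (lift i j)), u; split => //; rewrite e; congr (_ + _).
  rewrite /comb (bigD1_ord i)//= {1}/w' !mxE divfK// subrr scale0r add0r.
  by apply: eq_bigr => j _; rewrite mxE.
have hL := lincont_comb f.
have [W [nW cW Wf]] := inj_comb_bounded hL inj.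
have W0 : W 0 by exact: nbhs_singleton.
have iter k c : C c -> exists v u, C u /\ c = comb f v + ((1/2 : R) ^+ k) *: u.
  elim: k c => [|k IH] c Cc; first by exists 0, c; rewrite expr0 scale1r; split => //; rewrite /comb big1 ?add0r// => i _; rewrite mxE scale0r.
  have [v [u [Cu ->]]] := IH _ Cc; have [v' [u' [Cu' ->]]] := hf _ Cu.
  exists (((1/2 : R) ^+ k) *: v' + v), u'; split => //.
  by rewrite (linD _ _ hL) (linZ _ _ hL) scalerDr scalerA exprSr addrA [comb f v + _]addrC.
have cKx : compact ((fun z => z - x0) @` K).
  apply: continuous_compact cK; apply: continuous_subspaceT => z.
  by apply: tvs_cvgB; [exact: cvg_id|exact: cvg_cst].
have CKx c : C c -> ((fun z => z - x0) @` K) c.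
  by move=> /CK; exists (x0 + c) => //; rewrite addrC addKr.
have bdd (V : set E) : nbhs 0 V -> \forall e \near (0 : R), forall c, C c -> V (e *: c).
  move=> /(compact_bounded_tvs cKx); apply: filterS => e h c /CKx; exact: h.
have Csub c : C c -> exists v, c = comb f v.
  move=> Cc.
  have nW2 : nbhs 0 (W `&` [set u | W (- u)]).
    apply: filterI => //; have : (fun u : E => - u) @ (0 : E) --> (- 0 : E) by apply: tvs_cvgN; exact: cvg_id.
    by rewrite oppr0 => /(_ _ nW).
  have /nbhs_ballP[e /= e0 he] := bdd _ nW2.
  pose r := e / 2; have r0 : 0 < r by rewrite /r; lra.
  have hr : forall c, C c -> W (r *: c) /\ W (- (r *: c)).
    by move=> c'; apply: he; rewrite /ball /= sub0r normrN gtr0_norm// /r; lra.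
  pose B := [set v : 'rV[R]_d | `|v| <= 2 / r].
  have cB : compact B.
    apply: bounded_closed_compact.
      by exists (2 / r); split; [rewrite num_real|move=> M M1 v; rewrite /B /= => h; apply: le_trans h _; exact: ltW].
    apply: (@closed_comp _ _ (fun v : 'rV[R]_d => `|v|) [set x | x <= 2 / r]); last exact: closed_le.
    by move=> v _; exact: norm_continuous.
  have cfB : compact (comb f @` B).
    by apply: continuous_compact cB; apply: continuous_subspaceT; case: hL.
  have clB := compact_closed hE cfB.
  suff : (comb f @` B) c by case=> v _ <-; exists v.
  apply: clB => Nb /nbhs_shift nNb.
  have nN2 : nbhs 0 [set u | Nb (c - u)].
    have : (fun u : E => - u) @ (0 : E) --> (- 0 : E) by apply: tvs_cvgN; exact: cvg_id.
    by rewrite oppr0 => /(_ _ nNb).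
  have /nbhs_ballP[e' /= e0' he'] := bdd _ nN2.
  have [k hk] : exists k, (1/2 : R) ^+ k < e'.
    have : (fun k => (1/2 : R) ^+ k) @ \oo --> 0 by apply: cvg_expr; rewrite ger0_norm; lra.
    move=> /cvgrPdist_lt /(_ _ e0')[k _ hk]; exists k.
    by have := hk k (leqnn k); rewrite /= sub0r normrN ger0_norm// exprn_ge0//; lra.
  have p0 : 0 < (1/2 : R) ^+ k by rewrite exprn_gt0//; lra.
  have p1 : (1/2 : R) ^+ k <= 1 by apply: exprn_ile1; lra.
  have [v [u [Cu cE]]] := iter k c Cc.
  have vE : comb f v = c - (1/2 : R) ^+ k *: u by rewrite cE addrK.
  exists (comb f v); split; last first.
    by rewrite vE; apply: he' => //; rewrite /ball /= sub0r normrN gtr0_norm.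
  exists v => //; rewrite /B /=.
  (* The argument is the mean of r c and of a small multiple of - r u, which both lie in W; this
     bounds the coefficients by 2/r independently of k. *)
  have : W (comb f ((r / 2) *: v)).
    rewrite (linZ _ _ hL) vE scalerBr scalerA.
    have [h1 _] := hr _ Cc; have [_ h2] := hr _ Cu.
    have h3 : W (- ((1/2 : R) ^+ k *: (r *: u))).
      have := cW _ _ ((1/2 : R) ^+ k) h2 W0; rewrite scaler0 addr0 scalerN; apply.
      by rewrite ltW//=.
    have := cW _ _ (1/2) h1 h3.
    have -> : (1 / 2 : R) *: (r *: c) = (r / 2) *: c by rewrite scalerA; congr (_ *: _); field.
    have -> : (1 - 1/2) *: - ((1/2 : R) ^+ k *: (r *: u)) = - ((r / 2 * (1 / 2) ^+ k) *: u).
      by rewrite scalerN !scalerA; congr (- (_ *: _)); field.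
    by apply; lra.
  move=> /Wf; rewrite normrZ gtr0_norm ?divr_gt0// => h.
  by rewrite ler_pdivlMr//; lra.
have surj x : exists v, comb f v = x.
  have /nbhs_ballP[e /= e0 he] := scale_small x nC.
  have h : C ((e / 2) *: x) by apply: he; rewrite /ball /= sub0r normrN gtr0_norm; lra.
  have [v hv] := Csub _ h; exists ((e / 2)^-1 *: v).
  by rewrite (linZ _ _ hL) -hv scalerA mulVf ?scale1r// gt_eqF//; lra.
have /choice[L hLf] := surj.
have inj2 v w : comb f v = comb f w -> v = w.
  move=> h; apply/eqP; rewrite -subr_eq0; apply/eqP; apply: inj.
  by rewrite -scaleN1r addrC (proj1 hL) h scaleN1r addNr.
exists d, L, (comb f); split => //; last by move=> v; apply: inj2; rewrite hLf.
have Ladd (c : R) x y : L (c *: x + y) = c *: L x + L y.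
  by apply: inj2; rewrite (proj1 hL) !hLf.
split => // x B /nbhs_ballP[e /= e0 eB].
have : nbhs x [set z | W ((2 / e) *: (z - x))].
  have : (fun z : E => (2 / e) *: (z - x)) @ x --> (2 / e) *: (x - x).
    by apply: (@tvs_cvgZ _ _ _ _ _ (fun _ => 2 / e)); [exact: cvg_cst|apply: tvs_cvgB; [exact: cvg_id|exact: cvg_cst]].
  by rewrite subrr scaler0 => /(_ _ nW).
apply: filterS => z /= Wz; apply: eB.
rewrite mx_norm_ball /ball_ /=.
have : W (comb f ((2 / e) *: (L z - L x))).
  rewrite (linZ _ _ hL) (_ : comb f _ = z - x)//.
  by rewrite -[L z - L x]addrC -scaleN1r (proj1 hL) !hLf scaleN1r addrC.
move=> /Wf; rewrite normrZ gtr0_norm ?divr_gt0// distrC => h.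
have := ler_wpM2l (ltW e0) h; rewrite mulr1 mulrA (_ : e * (2 / e) = 2) => [h2|]; last by field; rewrite gt_eqF.
have := normr_ge0 (L x - L z); case: (ltgtP `|L x - L z| 0) => [|? _|-> _ //]; first by move=> ? ?; lra.
lra.
Qed.

End locally_compact_tvs.

(** * Partition-of-unity operators on a compact set *)

Section partition_operators.
Context {R : realType}.

Lemma Sd_isol (s0 : R^o) : Sd s0 -> s0 != 0 -> \forall s \near s0, Sd s -> s = s0.
Proof.
move=> [->|[n sn]]; first by rewrite eqxx.
rewrite sn => _; have p0 : 0 < n.+1%:R^-1 :> R by rewrite invr_gt0 ltr0n.
have h1 : \forall s \near (n.+1%:R^-1 : R^o), 0 < s.
  by apply: (open_nbhs_nbhs (conj (open_gt (y := 0)) _)).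
have h2 : \forall s \near (n.+1%:R^-1 : R^o), `|n.+1%:R - s^-1| < 1.
  have : (fun s : R => s^-1) @ (n.+1%:R^-1 : R) --> ((n.+1%:R^-1)^-1 : R) by apply: inv_continuous; rewrite gt_eqF.
  rewrite invrK => h; apply: (h [set y | `|n.+1%:R - y| < 1]); apply/nbhs_ballP; exists 1 => //=.
apply: filterS2 h1 h2 => s s0' hs [s00|[k sk]]; first by rewrite s00 ltxx in s0'.
rewrite sk; congr (_^-1); move: hs; rewrite sk invrK ltr_norml => /andP[h3 h4].
have a1 : (k.+1%:R : R) < n.+2%:R by rewrite [n.+2%:R]mulrS; lra.
have a2 : (n.+1%:R : R) < k.+2%:R by rewrite [k.+2%:R]mulrS; lra.
rewrite ltr_nat ltnS in a1; rewrite ltr_nat ltnS in a2.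
by congr (_%:R); apply/eqP; rewrite eqn_leq a1 a2.
Qed.

Variables (E : tvsType R) (d : nat) (L : E -> 'rV[R]_d) (L' : 'rV[R]_d -> E).
Hypotheses (hL : lincont L) (hL' : lincont L') (LK : cancel L L').

Lemma LBK y z : z + L' (L y - L z) = y.
Proof.
have -> : L y - L z = (-1 : R) *: L z + L y by rewrite scaleN1r addrC.
by rewrite (linD _ _ hL') (linZ _ _ hL') !LK scaleN1r addrA subrr add0r.
Qed.

(* a smooth bump around z, of size about 1/r *)
Definition bump (r : R) (z y : E) : R^o :=
  \prod_(i < d) smstep (2 - (r * (L y ord0 i - L z ord0 i)) ^+ 2).

Lemma CW_bump w V (O D : set E) r z : O `<=` D -> CW w V O D (bump r z).
Proof.
move=> OD; apply: CW_prod => i _; apply: CW_smstep => //.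
have h : CW w V O D (fun y => r * (L y ord0 i - L z ord0 i) : R^o).
  apply: CWM; first exact: CW_cst.
  apply: CWD; last exact: CW_cst.
  by apply: CW_lin; apply: (lincont_comp (L' := fun y : 'rV[R]_d => y ord0 i : R^o)) => //; exact: lincont_coord.
rewrite (_ : (fun y => _) = fun y => 2 + (-1 : R^o) *: ((r * (L y ord0 i - L z ord0 i)) * (r * (L y ord0 i - L z ord0 i)) : R^o)).
  by apply: CWD; [exact: CW_cst|apply: CWZ; [exact: CW_cst|exact: CWM]].
by apply/funext => y; rewrite scaleN1r expr2.
Qed.

Lemma bump_ge0 r z y : 0 <= bump r z y.
Proof. by apply: prodr_ge0 => i _; have /andP[] := smstep01 (2 - (r * (L y ord0 i - L z ord0 i)) ^+ 2). Qed.

Lemma bump1 r z y : (forall i, `|r * (L y ord0 i - L z ord0 i)| <= 1) -> bump r z y = 1.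
Proof.
move=> h; apply: big1 => i _; apply: smstep_ge1.
have h2 : (r * (L y ord0 i - L z ord0 i)) ^+ 2 <= 1 by rewrite -real_normK ?num_real// exprn_ile1.
lra.
Qed.

Lemma bump_neq0 r z y i : 0 < r -> bump r z y != 0 -> `|L y ord0 i - L z ord0 i| < 2 / r.
Proof.
move=> r0 h; have : 0 < 2 - (r * (L y ord0 i - L z ord0 i)) ^+ 2.
  rewrite ltNge; apply: contra h => h; apply/eqP.
  by rewrite /bump (bigD1 i)//= smstep_le0// mul0r.
rewrite subr_gt0 -real_normK ?num_real// normrM (gtr0_norm r0) => h2.
rewrite ltr_pdivlMr// mulrC ltNge; apply/negP => h3.
have : 2 ^+ 2 <= (r * `|L y ord0 i - L z ord0 i|) ^+ 2 by rewrite lerXn2r// nnegrE// (le_trans _ h3).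
lra.
Qed.

Lemma bump_near r z : 0 < r -> \forall y \near z, bump r z y = 1.
Proof.
move=> r0; have nb : nbhs (L z) (ball (L z) r^-1).
  by apply: nbhsx_ballx; rewrite invr_gt0.
have hh : nbhs z (fun y => ball (L z) r^-1 (L y)) := hL.2 z _ nb.
apply: filterS hh => y /= [_ h]; apply: bump1 => i.
have := h ord0 i; rewrite /ball /= distrC => {}h.
by rewrite normrM (gtr0_norm r0) mulrC -ler_pdivlMr// div1r ltW.
Qed.

Lemma bump_small (z : E) (N : set E) : nbhs z N ->
  exists2 r, 0 < r & forall y, bump r z y != 0 -> N y.
Proof.
move=> /nbhs_shift nN.
have L0 : L' 0 = 0 by have := linZ 0 0 hL'; rewrite !scale0r.
have : nbhs (0 : 'rV[R]_d) [set v | N (z + L' v)].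
  have h : nbhs (L' 0) [set u | N (z + u)] by rewrite L0.
  exact: (hL'.2 0 _ h).
move=> /nbhs_ballP[e /= e0 he]; exists (2 / e); first by rewrite divr_gt0.
move=> y hy; have := he (L y - L z).
rewrite /= LBK; apply; split => //= i j.
rewrite ord1 /ball /= !mxE sub0r normrN.
have := bump_neq0 j (divr_gt0 _ e0) hy; rewrite ltr0n => /(_ isT).
by rewrite invf_div mulrC divfK.
Qed.

(** Bumps of radius about 1/(n+1) around finitely many points of K are normalized to a partition of
    unity. At each point the operator is a convex combination of values at nodes nearby, which gives
    convergence in C^0. *)
Lemma partition_smoothing (K O : set E) : compact K -> O `<=` K ->
  exists (J : nat -> finType) (beta : forall n, J n -> E -> R^o) (nu : forall n, J n -> E),
  smoothing 0 K O beta nu.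
Proof.
move=> cK OK.
have cb r z : cw setT (bump r z) by exact: (@CW_bump [::] (fun _ => setT) setT setT).
have /choice[s hs] : forall n : nat, exists s : seq E, (forall x, x \in s -> K x) /\
    forall x, K x -> exists2 z, z \in s & bump n.+1%:R z x = 1.
  by move=> n; apply: (compact_fin_cover cK) => x _; apply: bump_near; rewrite ltr0n.
pose nu n (j : 'I_(size (s n))) : E := nth 0 (s n) j.
pose sm n y := \sum_(j < size (s n)) bump n.+1%:R (nu n j) y.
have sm0 n y : K y -> 0 < sm n y.
  move=> Ky; have [_ /(_ y Ky)[z zs bz]] := hs n.
  have zi : (index z (s n) < size (s n))%N by rewrite index_mem.
  rewrite /sm (bigD1 (Ordinal zi))//= /nu /= nth_index// bz.
  by apply: ltr_pwDl => //; apply: sumr_ge0 => j _; exact: bump_ge0.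
pose beta n (j : 'I_(size (s n))) (y : E) : R^o := bump n.+1%:R (nu n j) y * (sm n y)^-1.
have hbeta n j w V : CW w V O K (beta n j).
  apply: CWM; first exact: CW_bump.
  apply: CW_inv => // [x Kx|]; first by rewrite gt_eqF// sm0.
  by apply: CW_sum => k _; exact: CW_bump.
have beta_ge0 n j y : K y -> 0 <= beta n j y.
  by move=> Ky; rewrite mulr_ge0 ?bump_ge0// invr_ge0 ltW// sm0.
have beta1 n y : K y -> \sum_j beta n j y = 1.
  by move=> Ky; rewrite -mulr_suml mulfV// gt_eqF// sm0.
have nuK n j : K (nu n j) by apply: (hs n).1; exact: mem_nth.
exists (fun n => 'I_(size (s n)) : finType), beta, nu; split => //.
move=> T G I g hT /= cg [s0 [t0 y0]] [/= Ss [It Ky]].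
have [s00|s0n] := eqVneq s0 0; last first.
  have cc : cw (Sd `*` (I `*` K)) (fun p : R^o * (T * E) => \sum_j beta (snum s0) j p.2.2 *: g (p.2.1, nu (snum s0) j)).
    apply: (@CW_sum _ [::] _ _ (fun _ => setT) setT) => j _.
    apply: (@CWZ _ [::] _ _ (fun _ => setT) setT) => /=.
      apply: (cw_comp (D' := K) (f := fun p : R^o * (T * E) => p.2.2)) => [p [_ []]//||].
        by apply: cw_lin; lincont.
      exact: (hbeta _ j [::] (fun _ => setT)).
    apply: (cw_comp (D' := I `*` K) (f := fun p : R^o * (T * E) => (p.2.1, nu (snum s0) j))) => // [p [_ [? _]]|].
      by split => //=; exact: nuK.
    by apply: cw_pair; [apply: cw_lin; lincont|move=> x _; exact: cvg_cst].
  rewrite [Sop _ _ _ _]/Sop /= (negbTE s0n).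
  apply: cvg_trans (cc (s0, (t0, y0)) (conj Ss (conj It Ky))); apply: near_eq_cvg.
  rewrite near_withinE; have hn := Sd_isol Ss s0n.
  have : \forall p \near (s0, (t0, y0)), Sd p.1 -> p.1 = s0.
    by exists ([set s | Sd s -> s = s0], setT); [split => //; exact: filterT|move=> p []].
  by apply: filterS => p hp [/hp e _]; rewrite /Sop e (negbTE s0n).
rewrite s00 /Sop /= eqxx => B hB.
pose g0 := g (t0, y0).
have /nbhs_shift hB0 : nbhs g0 B := hB.
have [C [oC C0 cC CB]] := cvx_nbhs hB0.
have hC : nbhs g0 [set z | C (z - g0)] by apply: nbhs_sub; exact: open_nbhs_nbhs.
have : nbhs (t0, y0) [set p | (I `*` K) p -> C (g p - g0)] := cg (t0, y0) (conj It Ky) _ hC.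
move=> -[[A N] [/= hA hN] AN].
have /nbhs_shift hN0 := hN.
have L0 : L' 0 = 0 by have := linZ 0 0 hL'; rewrite !scale0r.
have : nbhs (0 : 'rV[R]_d) [set v | N (y0 + L' v)].
  have h : nbhs (L' 0) [set u | N (y0 + u)] by rewrite L0.
  exact: (hL'.2 0 _ h).
move=> /nbhs_ballP[e /= e0 he].
have hy : nbhs y0 [set y | ball (L y0) (e / 2) (L y)].
  apply: (hL.2 y0 (ball (L y0) (e / 2))); apply: nbhsx_ballx; lra.
suff : nbhs ((0 : R^o), (t0, y0)) [set p | (Sd `*` (I `*` K)) p -> B (Sop beta nu g p)] by [].
exists ([set s : R^o | `|s| < e / 4], A `*` (N `&` [set y | ball (L y0) (e / 2) (L y)])).
  split => /=; first by apply: near0_lt; lra.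
  by exists (A, N `&` [set y | ball (L y0) (e / 2) (L y)]) => //; split => //=; exact: filterI.
move=> [s' [t y]] [/= se [At [Ny by_]]] [/= Ss' [It' Ky']].
suff : C (Sop beta nu g (s', (t, y)) - g0) by move=> /CB; rewrite /= addrC subrK.
rewrite /Sop /=; case: Ss' se => [->|[n ->]] se; first by rewrite eqxx; apply: (AN (t, y)).
rewrite gt_eqF ?invr_gt0 ?ltr0n// snumE.
have -> : \sum_j beta n j y *: g (t, nu n j) - g0 =
   \sum_j beta n j y *: (if beta n j y == 0 then 0 else g (t, nu n j) - g0).
  rewrite -[X in _ - X]scale1r -(beta1 n y Ky') scaler_suml -sumrB.
  by apply: eq_bigr => j _; rewrite -scalerBr; case: eqP => // ->; rewrite !scale0r.
apply: wsum_cvx => //; [by move=> j; exact: beta_ge0| |by rewrite beta1].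
move=> j; case: ifPn => // bj; apply: (AN (t, nu n j)) => //; split => //=.
have b0 : bump n.+1%:R (nu n j) y != 0 by apply: contraNneq bj; rewrite /beta => ->; rewrite mul0r.
have := he (L (nu n j) - L y0).
rewrite /= LBK; apply; split => //= i k.
rewrite ord1 /ball /= !mxE sub0r normrN.
have h1 := bump_neq0 k (ltr0Sn R n) b0.
have := by_.2 ord0 k; rewrite /ball /= => h2.
have -> : L (nu n j) ord0 k - L y0 ord0 k = - ((L y0 ord0 k - L y ord0 k) + (L y ord0 k - L (nu n j) ord0 k)).
  by rewrite addrA subrK opprB.
rewrite normrN; apply: (le_lt_trans (ler_normD _ _)).
have : 2 / n.+1%:R < e / 2.
  have q0 : 0 < n.+1%:R^-1 :> R by rewrite invr_gt0 ltr0n.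
  move: se q0; rewrite /=; move: (n.+1%:R^-1 : R) => q + q0.
  by rewrite gtr0_norm// => se; move: (se : q < e / 4) => {}se; lra.
by move=> h3; rewrite (splitr e); apply: ltrD => //; exact: lt_trans h3.
Qed.

End partition_operators.

(** * Families of maps between manifolds *)

Section nice_spaces.
Context {R : realType}.
Implicit Types M N : charted_space R.

(* What is used of rough C^oo-manifolds. Unlike [rough_manifold None], these
   properties do not require the space to be Hausdorff and pass to the tangent space. *)
Record nice M : Prop := Nice {
  n_hmod : forall i, hausdorff_space (model M i);
  n_open : forall i, open (dom M i);
  n_cover : forall x, exists i, dom M i x;
  n_inj : forall i x y, dom M i x -> dom M i y -> chart M i x = chart M i y -> x = y;
  n_nbhs : forall i x (X : set M), dom M i x -> (nbhs x X <->
    exists2 P, nbhs (chart M i x) P & forall x', dom M i x' -> P (chart M i x') -> X x');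
  n_reg : forall i, regular_set (chart_im M i);
  n_trans : forall i j w, CW w (fun _ => setT) (rep_dom (@id M) i j)° (rep_dom (@id M) i j)
    (chart_rep (@id M) i j);
  n_int : forall i j x, dom M i x -> dom M j x -> (chart_im M i)° (chart M i x) ->
    (chart_im M j)° (chart M j x) }.

Lemma regular_openI (E : topologicalType) (D P : set E) : regular_set D -> open P -> regular_set (D `&` P).
Proof.
move=> rD oP x [Dx Px] B xB.
have xP : nbhs x P by exact: open_nbhs_nbhs.
have [y [Dy [By Py]]] := rD x Dx _ (filterI xB xP).
exists y; split => //; rewrite interiorI; split => //.
by move: oP; rewrite openE; apply.
Qed.

Lemma chart_repE M N (f : M -> N) i j x : nice M -> dom M i x -> dom N j (f x) ->
  chart_rep f i j (chart M i x) = chart N j (f x).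
Proof.
move=> nM ix jfx; rewrite /chart_rep; case: xgetP => [z _ [x' [ix' _ e <-]]|].
  by rewrite (n_inj nM ix' ix e).
by move=> /(_ (chart N j (f x))) []; exists x.
Qed.

Lemma chart_nbhsP M i x (X : set M) : nice M -> nbhs x X -> dom M i x ->
  exists P, [/\ open P, P (chart M i x) & forall x', dom M i x' -> P (chart M i x') -> X x'].
Proof.
move=> nM nX ix; have [P nP hP] := (n_nbhs nM X ix).1 nX.
exists P°; split; [exact: open_interior|exact: nP|].
by move=> x' ix' /interior_subset; exact: hP.
Qed.

Lemma chart_cvg M i x : nice M -> dom M i x -> chart M i @ x --> chart M i x.
Proof. by move=> nM ix P nP; apply/(n_nbhs nM _ ix); exists P. Qed.

Lemma chart_int M i x (X : set M) : nice M -> nbhs x X -> dom M i x ->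
  (chart_im M i)° (chart M i x) -> (chart M i @` (X `&` dom M i))° (chart M i x).
Proof.
move=> nM nX ix h; have [P [oP Px hP]] := chart_nbhsP nM nX ix.
apply: filterS (filterI h (open_nbhs_nbhs (conj oP Px))) => y [[x' ix' <-] Py].
by exists x' => //; split => //; exact: hP.
Qed.

Lemma chart_im_sub M i (X : set M) : X `<=` dom M i -> chart M i @` X `<=` chart_im M i.
Proof. by move=> h _ [x /h ix <-]; exists x. Qed.

Lemma chart_image_open M i (X : set M) : nice M -> open X -> X `<=` dom M i ->
  exists2 P, open P & chart M i @` X = chart_im M i `&` P.
Proof.
move=> nM oX Xi.
exists (\bigcup_(P in [set P | open P /\ forall x', dom M i x' -> P (chart M i x') -> X x']) P).
  by apply: bigcup_open => P [].
apply/seteqP; split => [_ [x Xx <-]|_ [[x ix <-] [P [oP hP] Px]]].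
  split; first by exists x => //; exact: Xi.
  have [P [oP Px hP]] := chart_nbhsP nM (open_nbhs_nbhs (conj oX Xx)) (Xi _ Xx).
  by exists P.
by exists x => //; exact: hP.
Qed.

Lemma chart_regular M i (X : set M) : nice M -> open X -> X `<=` dom M i -> regular_set (chart M i @` X).
Proof.
move=> nM oX Xi; have [P oP ->] := chart_image_open nM oX Xi.
by apply: regular_openI => //; exact: n_reg.
Qed.

Lemma chart_intE M i (X : set M) x : nice M -> open X -> X `<=` dom M i -> X x ->
  (chart M i @` X)° (chart M i x) <-> (chart_im M i)° (chart M i x).
Proof.
move=> nM oX Xi Xx; split; first exact: (interiorS (chart_im_sub Xi)).
move=> h; have := chart_int nM (open_nbhs_nbhs (conj oX Xx)) (Xi _ Xx) h.
by rewrite (_ : X `&` dom M i = X)//; apply/seteqP; split => [y []//|y Xy]; split => //; exact: Xi.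
Qed.

Lemma formal_interiorP M x i : nice M -> dom M i x ->
  formal_interior M x <-> (chart_im M i)° (chart M i x).
Proof. by move=> nM ix; split => [|h j jx]; [exact|exact: (n_int nM ix jx h)]. Qed.

Lemma CW_constV (E F : tvsType R) w w' (V0 O D : set E) (f : E -> F) : size w = size w' ->
  CW w (fun _ => V0) O D f -> CW w' (fun _ => V0) O D f.
Proof.
elim: w w' E V0 O D f => [|b w IH] [|b' w'] //= E V0 O D f [sw] [hf [df [pf hdf]]].
by split; [exact: IH hf|exists df; split => //; exact: IH hdf].
Qed.

Lemma nice_of_rough M : rough_manifold None M -> nice M.
Proof.
move=> [hM hmod [odom cov] hch htr].
have inj i x y : dom M i x -> dom M i y -> chart M i x = chart M i y -> x = y.
  by move=> ix iy; have [_ h _ _] := hch i; apply: h; rewrite inE.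
have nb i x (X : set M) : dom M i x -> (nbhs x X <->
    exists2 P, nbhs (chart M i x) P & forall x', dom M i x' -> P (chart M i x') -> X x').
  move=> ix; have [cc _ oo _] := hch i; split.
    move=> nX; have nXi : nbhs x (X `&` dom M i) by apply: filterI => //; apply: open_nbhs_nbhs.
    have [||P oP hP] := oo ((X `&` dom M i)°); first exact: open_interior.
      by apply: subset_trans (@interior_subset _ _) _; exact: subIsetr.
    have cP : (chart M i @` (X `&` dom M i)°) (chart M i x) by exists x.
    exists P; first by apply: open_nbhs_nbhs; split => //; move: cP; rewrite hP => -[].
    move=> x' ix' Px'; have : (chart_im M i `&` P) (chart M i x') by split => //; exists x'.
    rewrite -hP => -[x'' /interior_subset[Xx'' ix'']] e.
    by rewrite -(inj i _ _ ix'' ix' e).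
  move=> [P nP hP].
  have : nbhs x (fun z => dom M i z -> P (chart M i z)) := (subspace_continuousP _ _).1 cc x ix P nP.
  have ixn : nbhs x (dom M i) by apply: open_nbhs_nbhs.
  by apply: filterS2 ixn => z iz /(_ iz); exact: hP.
have rdE i j : exists2 P, open P & rep_dom (@id M) i j = chart_im M i `&` P.
  have [_ _ oo _] := hch i; apply: (oo (dom M i `&` dom M j)); first exact: openI.
  exact: subIsetl.
split => //.
- move=> x; have [i _ ix] : (\bigcup_i dom M i) x by rewrite cov.
  by exists i.
- by move=> i; have [] := hch i.
- move=> i j w; have [h _] := htr i j; have [P oP e] := rdE i j.
  have rD : regular_set (rep_dom (@id M) i j).
    by rewrite e; apply: regular_openI => //; have [] := hch i.
  by apply: (CW_constV (w := nseq (size w) true)); [rewrite size_nseq|exact: is_C_CW h _].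
- move=> i j x ix jx hi; have [_ h] := htr i j; have [P oP e] := rdE i j.
  have : (rep_dom (@id M) j i)° (chart M j x).
    apply: h => //; have : rep_dom (@id M) i j (chart M i x) by exists x.
    by rewrite e interiorI => -[_ Px]; split => //; apply: open_nbhs_nbhs.
  by apply: interiorS; move=> _ [y [jy _] <-]; exists y.
Qed.

End nice_spaces.

Section families.
Context {R : realType}.
Variable (T : tvsType R).
Hypothesis hT : hausdorff_space T.
Implicit Types M N : charted_space R.
Implicit Types (J I : set T) (a b : bool -> bool) (ws : set (seq bool)).

(* directions: a and b tell whether the letter c differentiates in the parameter
   and in the space variable *)
Definition md a b (E : tvsType R) (c : bool) : set (T * E) :=
  (if a c then setT else [set 0]) `*` (if b c then setT else [set 0]).

Lemma subsp_if (E : tvsType R) (c : bool) : subsp (if c then [set: E] else [set 0]).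
Proof. by case: c => //; exact: subsp0. Qed.

Lemma closed_if (E : tvsType R) (c : bool) : hausdorff_space E -> closed (if c then [set: E] else [set 0]).
Proof. by move=> hE; case: c; [exact: closedT|exact: closed0]. Qed.

Lemma frame_md a b (E : tvsType R) J (O D : set E) : hausdorff_space E ->
  (forall c, a c -> open J) -> open O -> O `<=` D -> D `<=` closure O ->
  frame (md a b (E := E)) (J `*` O) (J `*` D).
Proof.
move=> hE hJ oO OD DO; split.
- by move=> [t y] [? /OD].
- move=> [t y] [/= Jt Dy] B [[A1 A2] [/= h1 h2] AB].
  have [z [Oz Az]] := DO _ Dy _ h2; exists (t, z); split => //; apply: AB; split => //.
  exact: nbhs_singleton.
- by move=> c; apply: subspX; exact: subsp_if.
- move=> c; apply: closedI.
    by apply: closed_comp; [move=> z _; exact: cvg_fst|exact: closed_if].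
  by apply: closed_comp; [move=> z _; exact: cvg_snd|exact: closed_if].
- move=> c; have vJ : vopen (if a c then [set: T] else [set 0]) J.
    case: ifP => [/hJ oJ|_]; first exact: vopenT.
    by move=> x Jx; exists setT; [exact: filterT|move=> x' u Jx' _ _ ->; rewrite addr0].
  have vO : vopen (if b c then [set: E] else [set 0]) O by case: ifP => _; exact: vopenT.
  move=> [t y] [/= Jt Oy]; have [A hA Ap] := vJ t Jt; have [B hB Bp] := vO y Oy.
  exists (A `*` B); first by exists (A, B).
  by move=> [t' y'] [u v] [/= ? ?] [/= ? ?] [/= ? ?] [/= ? ?]; split => /=; [exact: Ap|exact: Bp].
Qed.

Definition lrep J I a b M N (H : T -> M -> N) i j (X : set M) (w : seq bool) :=
  CW w (md a b (E := model M i)) ((J `&` I) `*` (chart M i @` X)°) ((J `&` I) `*` (chart M i @` X))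
    (fun p => chart_rep (H p.1) i j p.2).

Definition lgood_at J a b ws M N (H : T -> M -> N) i j t0 x0 := exists (X : set M) I,
  [/\ open X, X x0, X `<=` dom M i, open I & I t0] /\
  (forall t x, J t -> I t -> X x -> dom N j (H t x)) /\
  (forall w, ws w -> lrep J I a b H i j X w).

(** Stated for some pair of charts, so that a construction only has to exhibit convenient ones;
    [lgood_charts] passes to all others. *)
Definition lgood J a b ws M N (H : T -> M -> N) t0 x0 := exists i j, lgood_at J a b ws H i j t0 x0.

Lemma lgood_shrink J a b ws M N (H : T -> M -> N) i j t0 x0 X0 I0 :
  open X0 -> X0 x0 -> open I0 -> I0 t0 -> lgood_at J a b ws H i j t0 x0 ->
  exists X I, [/\ open X, X x0 & X `<=` X0 `&` dom M i] /\ [/\ open I, I t0 & I `<=` I0] /\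
  (forall t x, J t -> I t -> X x -> dom N j (H t x)) /\
  (forall w, ws w -> lrep J I a b H i j X w).
Proof.
move=> oX0 X0x oI0 I0t [X [I [[oX Xx Xi oI It] [h1 h2]]]].
exists (X0 `&` X), (I0 `&` I); split; last split; last split.
- by split => // [|x [? /Xi]//]; exact: openI.
- by split; [exact: openI|split|move=> t []].
- by move=> t x Jt [_ ?] [_ ?]; exact: h1.
- move=> w /h2; apply: CW_sub => //.
    move=> [t y] [/= [Jt [_ It']] hy]; split => //; move: hy; apply: interiorS.
    by move=> _ [x [_ ?] <-]; exists x.
    by move=> [t y] [/= [Jt [_ It']] [x [_ ?] <-]]; split => //; exists x.
  by move=> c p.
Qed.

Lemma lrep_frame J I a b M i (X : set M) : nice M -> open X -> X `<=` dom M i -> open I ->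
  (forall c, a c -> open J) ->
  frame (md a b (E := model M i)) ((J `&` I) `*` (chart M i @` X)°) ((J `&` I) `*` (chart M i @` X)).
Proof.
move=> nM oX Xi oI hJ; apply: frame_md.
- exact: n_hmod.
- by move=> c /hJ oJ; exact: openI.
- exact: open_interior.
- exact: interior_subset.
- exact: chart_regular.
Qed.

Lemma lrep_cvg J I a b M N (H : T -> M -> N) i j X w t0 x0 : nice M -> nice N ->
  open X -> X x0 -> X `<=` dom M i -> open I -> I t0 -> J t0 ->
  (forall t x, J t -> I t -> X x -> dom N j (H t x)) -> lrep J I a b H i j X w ->
  (fun p : T * M => H p.1 p.2) @ within (J `*` setT) (nbhs (t0, x0)) --> H t0 x0.
Proof.
move=> nM nN oX Xx Xi oI It Jt hd /CW_cw hw B.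
have jH : dom N j (H t0 x0) by exact: hd.
have ix := Xi _ Xx.
move=> /(n_nbhs nN _ jH)[P nP hP].
have D0 : ((J `&` I) `*` (chart M i @` X)) (t0, chart M i x0) by split => //; exists x0.
have : nbhs (t0, chart M i x0) [set p | ((J `&` I) `*` (chart M i @` X)) p -> P (chart_rep (H p.1) i j p.2)].
  by apply: (hw _ D0); rewrite /= chart_repE.
move=> -[[A C] [/= hA hC] AC].
suff : nbhs (t0, x0) [set p | (J `*` setT) p -> B (H p.1 p.2)] by [].
exists (A `&` I, X `&` (chart M i @^-1` C)).
  split => /=; first by apply: filterI => //; exact: open_nbhs_nbhs.
  by apply: filterI; [exact: open_nbhs_nbhs|exact: (chart_cvg nM ix)].
move=> [t x] [/= [At It'] [Xx' Cx]] [/= Jt' _].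
apply: hP; first exact: hd.
have := AC (t, chart M i x) (conj At Cx); rewrite /= chart_repE//; last 2 first.
- exact: Xi.
- exact: hd.
by apply; split => //; exists x.
Qed.

Lemma lgood_cvg J a b ws w M N (H : T -> M -> N) t0 x0 : nice M -> nice N -> ws w -> J t0 ->
  lgood J a b ws H t0 x0 ->
  (fun p : T * M => H p.1 p.2) @ within (J `*` setT) (nbhs (t0, x0)) --> H t0 x0.
Proof.
move=> nM nN hw Jt [i [j [X [I [[oX Xx Xi oI It] [h1 h2]]]]]].
exact: (lrep_cvg nM nN oX Xx Xi oI It Jt h1 (h2 w hw)).
Qed.

(** Derivatives exist only over interiors, so a family can be composed with a change of charts of N
    only if interior points go to interior points. *)
Definition ipres J M N (H : T -> M -> N) :=
  forall t x, J t -> formal_interior M x -> formal_interior N (H t x).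

Lemma chart_rep_id M i j x : nice M -> dom M i x -> dom M j x ->
  chart_rep (@id M) i j (chart M i x) = chart M j x.
Proof. by move=> nM ix jx; rewrite (chart_repE (f := @id M)). Qed.

(** The chain rule with the transition maps of M and of N. Both compositions need interior points to
    stay interior; this comes from [n_int] on the side of M and from [ipres] on the side of N. *)
Lemma lgood_charts J a b ws w0 M N (H : T -> M -> N) i' j' t0 x0 : nice M -> nice N ->
  (forall c, a c -> open J) -> ipres J H -> ws w0 -> J t0 ->
  dom M i' x0 -> dom N j' (H t0 x0) ->
  lgood J a b ws H t0 x0 -> lgood_at J a b ws H i' j' t0 x0.
Proof.
move=> nM nN hJ hi hw0 Jt i'x j'H lg; have cvgH := lgood_cvg nM nN hw0 Jt lg.
have [i [j la]] := lg.
have nj : nbhs (H t0 x0) (dom N j') by apply: open_nbhs_nbhs; split => //; exact: n_open.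
have : nbhs (t0, x0) [set p | (J `*` setT) p -> dom N j' (H p.1 p.2)] := cvgH _ nj.
move=> -[[A C] [/= hA hC] AC].
have [X [I [[oX Xx Xi] [[oI It IA] [hd hl]]]]] : exists X I, [/\ open X, X x0 & X `<=` (C° `&` dom M i') `&` dom M i] /\ [/\ open I, I t0 & I `<=` A°] /\
  (forall t x, J t -> I t -> X x -> dom N j (H t x)) /\ (forall w, ws w -> lrep J I a b H i j X w).
  apply: lgood_shrink la => //.
  - by apply: openI; [exact: open_interior|exact: n_open].
  - exact: open_interior.
have X1 : X `<=` dom M i by move=> x /Xi[].
have X2 : X `<=` dom M i' by move=> x /Xi[[]].
have hd' t x : J t -> I t -> X x -> dom N j' (H t x).
  move=> Jt' It' Xx'; apply: (AC (t, x)) => //; split => /=.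
    by apply: interior_subset; exact: IA.
  by have [[/interior_subset ? _] _] := Xi _ Xx'.
exists X, I; split; [split => //|split => // w hw].
have fr' := lrep_frame b nM oX X2 oI hJ; have fr := lrep_frame b nM oX X1 oI hJ.
have int_iff x : X x -> (chart M i' @` X)° (chart M i' x) -> formal_interior M x.
  by move=> Xx' h; apply/(formal_interiorP nM (X2 _ Xx')); move: h => /(chart_intE nM oX X2 Xx').
pose g (p : T * model M i') := (p.1, chart_rep (@id M) i' i p.2).
have hg : CW w (md a b (E := model M i')) ((J `&` I) `*` (chart M i' @` X)°) ((J `&` I) `*` (chart M i' @` X)) g.
  apply: CW_pair; first by apply: CW_lin; exact: lincont_fst.
  apply: (CW_complin (L := snd) _ _ _ _ (n_trans nM i' i w)) => //; first exact: lincont_snd.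
    move=> [t y] [_ /=]; apply: interiorS => _ [x Xx' <-]; exists x => //; split; [exact: X2|exact: X1].
  by move=> [t y] [_ /= [x Xx' <-]]; exists x => //; split; [exact: X2|exact: X1].
have h1 : CW w (md a b (E := model M i')) ((J `&` I) `*` (chart M i' @` X)°) ((J `&` I) `*` (chart M i' @` X))
    (fun p => chart_rep (H (g p).1) i j (g p).2).
  apply: (CW_comp fr fr' _ _ _ hg (hl w hw)).
  - move=> [t y] [/= [Jt' It'] [x Xx' <-]]; rewrite /g /= chart_rep_id//; [|exact: X2|exact: X1].
    by split => //; exists x.
  - move=> [t y] [/= [Jt' It'] hy]; have [x Xx' e] := interior_subset hy.
    rewrite /g /= -e chart_rep_id//; [|exact: X2|exact: X1].
    split => //=; apply/(chart_intE nM oX X1 Xx'); apply/formal_interiorP => //; first exact: X1.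
    by apply: int_iff => //; rewrite e.
  - move=> c [t1 y1] [t2 y2] _ _ [/= h3 h4]; split => //=; case: ifP h4 => // _ /eqP.
    by rewrite /= subr_eq0 => /eqP ->; rewrite subrr.
have rD : regular_set (rep_dom (@id N) j j').
  by rewrite /rep_dom; apply: chart_regular; [exact: nN|apply: openI; exact: n_open|move=> ? []].
have h2 : CW w (md a b (E := model M i')) ((J `&` I) `*` (chart M i' @` X)°) ((J `&` I) `*` (chart M i' @` X))
    (fun p => chart_rep (@id N) j j' (chart_rep (H (g p).1) i j (g p).2)).
  apply: (CW_comp (frameT rD) fr' _ _ _ h1 (n_trans nN j j' w)) => //.
  - move=> [t y] [/= [Jt' It'] [x Xx' <-]]; rewrite /g /= chart_rep_id//; [|exact: X2|exact: X1].
    rewrite chart_repE//; [|exact: X1|exact: hd].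
    by exists (H t x) => //; split; [exact: hd|exact: hd'].
  - move=> [t y] [/= [Jt' It'] hy]; have [x Xx' e] := interior_subset hy.
    rewrite /g /= -e chart_rep_id//; [|exact: X2|exact: X1].
    rewrite chart_repE//; [|exact: X1|exact: hd].
    have fi : formal_interior N (H t x) by apply: hi => //; apply: int_iff => //; rewrite e.
    have := chart_int nN (X := dom N j') _ (hd _ _ Jt' It' Xx') (fi _ (hd _ _ Jt' It' Xx')).
    rewrite /rep_dom setIC; apply; apply: open_nbhs_nbhs; split; [exact: n_open|exact: hd'].
apply: CW_ext h2 => // -[t y] [/= [Jt' It'] [x Xx' <-]]; rewrite /g /= chart_rep_id//; [|exact: X2|exact: X1].
rewrite chart_repE//; [|exact: X1|exact: hd].
rewrite chart_rep_id//; [|exact: hd|exact: hd'].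
by rewrite chart_repE//; [exact: X2|exact: hd'].
Qed.

Lemma lgood_ext J a b ws M N (H H' : T -> M -> N) t0 x0 (X0 : set M) (I0 : set T) : nice M ->
  (forall c, a c -> open J) -> nbhs x0 X0 -> nbhs t0 I0 ->
  (forall t x, J t -> I0 t -> X0 x -> H t x = H' t x) ->
  lgood J a b ws H t0 x0 -> lgood J a b ws H' t0 x0.
Proof.
move=> nM hJ nX nI e [i [j la]]; exists i, j.
have [X [I [[oX Xx Xi] [[oI It IA] [hd hl]]]]] := lgood_shrink (@open_interior _ X0) nX (@open_interior _ I0) nI la.
have e' t x : J t -> I t -> X x -> H t x = H' t x.
  by move=> Jt It' Xx'; apply: e => //; apply: interior_subset; [exact: IA|have [] := Xi _ Xx'].
have X1 : X `<=` dom M i by move=> x /Xi[].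
exists X, I; split; [split => //|split].
  by move=> t x Jt It' Xx'; rewrite -e'//; exact: hd.
move=> w /hl; apply: CW_ext; first exact: lrep_frame.
move=> [t y] [/= [Jt It'] [x Xx' <-]].
have h1 := hd _ _ Jt It' Xx'; rewrite chart_repE//; last exact: X1.
by rewrite chart_repE ?e'//; [exact: X1|rewrite -e'].
Qed.

End families.

(** * From regularity of families to RC-maps, and restriction to subsets *)

Section conversions.
Context {R : realType}.
Implicit Types M N : charted_space R.

Lemma nbhs_set_type (T : topologicalType) (A : set T) (x : set_type A) (X : set (set_type A)) :
  nbhs x X <-> exists2 Y, nbhs (set_val x) Y & forall z : set_type A, Y (set_val z) -> X z.
Proof.
split.
  rewrite nbhsE => -[B [oB Bx] BX]; case: oB Bx BX => O oO <- Bx BX; exists O.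
    by exists O => //; split.
  by move=> z Oz; exact: BX.
move=> [Y nY YX].
have h : nbhs x (fun z : set_type A => Y (set_val z)) := @initial_continuous _ _ (set_val : set_type A -> T) x _ nY.
by apply: filterS h => z; exact: YX.
Qed.

(** Makes each piece of a Whitney cover a space of its own. At an interior point of a chart image of
    the piece, A is a neighbourhood of the point because charts are injective, so [n_int] reduces to
    that of M. *)
Lemma nice_restr M (A : set M) : nice M -> regular_set A -> nice (restr M A).
Proof.
move=> nM rA.
have imE i : chart_im (restr M A) i = chart M i @` (A `&` dom M i).
  apply/seteqP; split => [_ [x ix <-]|_ [x [Ax ix] <-]].
    by exists (set_val x) => //; split => //; exact: set_valP.
  by exists (SigSub (mem_set Ax)).
have rim (D P : set M) i : open P -> D = A `&` P -> P `<=` dom M i -> regular_set (chart M i @` D).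
  move=> oP -> Pi _ [x [Ax Px] <-] B nB.
  have ix := Pi _ Px.
  have nX : nbhs x (P `&` (chart M i @^-1` B°)).
    apply: filterI; first exact: open_nbhs_nbhs.
    by apply: (chart_cvg nM ix); apply: open_nbhs_nbhs; split; [exact: open_interior|exact: nB].
  have [x' [Ax' [Px' Bx']]] := rA x Ax _ nX.
  have oAP : open (A° `&` P) by apply: openI => //; exact: open_interior.
  have APi : A° `&` P `<=` dom M i by move=> y [_ /Pi].
  have Ix' : (chart M i @` (A° `&` P)) (chart M i x') by exists x'.
  have [y [Iy By]] := chart_regular nM oAP APi Ix' (B := B°) (open_nbhs_nbhs (conj (@open_interior _ B) Bx')).
  exists y; split; last exact: interior_subset.
  by move: Iy; apply: interiorS => _ [z [/interior_subset ? ?] <-]; exists z.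
split.
- exact: (n_hmod nM).
- move=> i; rewrite openE => x ix; apply/nbhs_set_type; exists (dom M i) => //.
  by apply: open_nbhs_nbhs; split => //; exact: n_open.
- by move=> x; have [i ix] := n_cover nM (set_val x); exists i.
- by move=> i x y ix iy e; apply: val_inj; exact: (n_inj nM ix iy e).
- move=> i x X ix; split.
    move=> /nbhs_set_type[Y nY YX]; have [P nP hP] := (n_nbhs nM Y ix).1 nY.
    by exists P => // x' ix' Px'; apply: YX; exact: hP.
  move=> [P nP hP]; apply/nbhs_set_type; exists ((chart M i @^-1` P) `&` dom M i).
    apply: filterI; first exact: (chart_cvg nM ix).
    by apply: open_nbhs_nbhs; split => //; exact: n_open.
  by move=> z [Pz iz]; exact: hP.
- by move=> i; rewrite imE; apply: (rim _ (dom M i)) => //; exact: n_open.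
- move=> i j w; have rdE : rep_dom (@id (restr M A)) i j = chart M i @` (A `&` (dom M i `&` dom M j)).
    apply/seteqP; split => [_ [x [ix jx] <-]|_ [x [Ax [ix jx]] <-]].
      by exists (set_val x) => //; split => //; exact: set_valP.
    by exists (SigSub (mem_set Ax)).
  have rD : regular_set (rep_dom (@id (restr M A)) i j).
    rewrite rdE; apply: (rim _ (dom M i `&` dom M j) i); [|by []|by move=> ? []].
    by apply: openI; exact: (n_open nM).
  have sub : rep_dom (@id (restr M A)) i j `<=` rep_dom (@id M) i j.
    by rewrite rdE => _ [x [_ ?] <-]; exists x.
  apply: (CW_ext (f := chart_rep (@id M) i j)); first exact: frameT.
    move=> y; rewrite rdE => -[x [Ax [ix jx]] <-]; rewrite chart_rep_id//.
    rewrite /chart_rep; case: xgetP => [z _ [x' [ix' _ e <-]]|].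
      by rewrite -(n_inj nM (x := set_val x') (y := x) ix' ix e).
    by move=> /(_ (chart M j x)) []; exists (SigSub (mem_set Ax)).
  by apply: CW_sub (n_trans nM i j w) => //; exact: interiorS.
- move=> i j x ix jx; rewrite !imE => hi.
  have nA : nbhs (set_val x) A.
    have h : nbhs (set_val x) (fun y => (chart M i @` (A `&` dom M i)) (chart M i y)) := @chart_cvg R M i (set_val x) nM ix _ hi.
    have ni : nbhs (set_val x) (dom M i) by apply: open_nbhs_nbhs; split => //; exact: n_open.
    apply: filterS (filterI h ni) => y [[z [Az iz] e] iy].
    by rewrite -(n_inj nM iz iy e).
  apply: (@chart_int R M j (set_val x) A nM nA jx); apply: (@n_int R M nM i j (set_val x) ix jx).
  by apply: interiorS hi => _ [y [_ iy] <-]; exists y.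
Qed.

Lemma CW_subw w (E F : tvsType R) V V' (O D O' D' : set E) (f : E -> F) :
  O' `<=` O -> D' `<=` D -> (forall b, b \in w -> V' b `<=` V b) -> CW w V O D f -> CW w V' O' D' f.
Proof.
elim: w E V V' O D O' D' f => [|b w IH] E V V' O D O' D' f OO DD VV /=; first exact: cw_sub.
have VVb : V' b `<=` V b by apply: VV; exact: mem_head.
have VVw c : c \in w -> V' c `<=` V c by move=> cw; apply: VV; rewrite inE cw orbT.
move=> [hf [df [hd hdf]]]; split; first exact: IH hf.
exists df; split; first by move=> x v /OO Ox /VVb Vv; exact: hd.
apply: IH hdf => [[x v] [/OO ? /VVb ?]//|[x v] [/DD ? /VVb ?]//|c cw [u v] [/(VVw _ cw) ? /VVb ?]//].
Qed.

Lemma regular_loc (E : topologicalType) (D : set E) :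
  (forall x, D x -> exists P, [/\ open P, P x & regular_set (D `&` P)]) -> regular_set D.
Proof.
move=> h x Dx B nB; have [P [oP Px rP]] := h x Dx.
have [y [Iy By]] := rP x (conj Dx Px) B nB.
by exists y; split => //; apply: interiorS Iy => z [].
Qed.

Lemma interiorX (E F : topologicalType) (A : set E) (B : set F) p :
  (A `*` B)° p -> A° p.1 /\ B° p.2.
Proof.
move=> [[A1 B1] [/= h1 h2] AB]; have [? ?] := (nbhs_singleton h1, nbhs_singleton h2); split.
  by apply: filterS h1 => x A1x; have [] := AB (x, p.2) (conj A1x (nbhs_singleton h2)).
by apply: filterS h2 => x B1x; have [] := AB (p.1, x) (conj (nbhs_singleton h1) B1x).
Qed.

Section fixed_parameter.
Variable (T : tvsType R).
Hypothesis hT : hausdorff_space T.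
Implicit Types (J : set T) (a b : bool -> bool) (ws : set (seq bool)).

Lemma isC_lgood (l : Defs.order) J a b ws w0 M N (H : T -> M -> N) t0 i j (S : set M)
    (g : model M i -> model N j) : nice M -> nice N ->
  (forall c, a c -> open J) -> ipres J H -> J t0 -> ws w0 ->
  b true -> (forall n, le_order n l -> ws (nseq n true)) ->
  open S -> S `<=` dom M i -> (forall x, S x -> dom N j (H t0 x)) ->
  (forall x, S x -> g (chart M i x) = chart N j (H t0 x)) ->
  (forall x, S x -> lgood J a b ws H t0 x) ->
  is_C l (chart M i @` S) g.
Proof.
move=> nM nN hJ hi Jt hw0 bt hws oS Si Sj gE lg.
have rS := chart_regular nM oS Si.
apply: CW_is_C => //; first exact: n_hmod.
move=> n ln; apply: CW_glue (frameT rS) _; first exact: n_hmod.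
move=> _ [x Sx <-].
have la := lgood_charts hT nM nN hJ hi hw0 Jt (Si _ Sx) (Sj _ Sx) (lg _ Sx).
have [X [I [[oX Xx Xi] [[oI It IA] [hd hl]]]]] := lgood_shrink oS Sx (@openT T) (I : setT t0) la.
have Xi' : X `<=` dom M i by move=> y /Xi[].
have XS : X `<=` S by move=> y /Xi[].
have [P oP hP] := chart_image_open nM oX Xi'.
have Px : P (chart M i x).
  by have : (chart M i @` X) (chart M i x) by [exists x]; rewrite hP => -[].
have DP : chart M i @` S `&` P `<=` chart M i @` X.
  by move=> y [Sy Py]; rewrite hP; split => //; exact: chart_im_sub Si _ Sy.
have OP : (chart M i @` S)° `&` P `<=` (chart M i @` X)°.
  have oSP : open ((chart M i @` S)° `&` P) by apply: openI => //; exact: open_interior.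
  move=> y hy; apply: (filterS (P := (chart M i @` S)° `&` P)); last exact: open_nbhs_nbhs.
  by move=> z [/interior_subset Sz Pz]; exact: DP.
exists P; split => //.
have frS := frame_open (frameT rS) oP.
apply: (CW_ext (f := fun y => chart_rep (H t0) i j y)) => //.
  move=> y [[x' Sx' <-] _]; rewrite gE// chart_repE//; [exact: Si|exact: Sj].
have frX := lrep_frame hT b nM oX Xi' oI hJ.
apply: (CW_subw (V := fun _ => setT) (O := (chart M i @` X)°) (D := chart M i @` X)) => //.
have frXT := frameT (chart_regular nM oX Xi').
have h0 : subsp [set (0 : T)] := @subsp0 _ _.
(* only the letter true occurs, so both letters may be given the same directions *)
have hl' : CW (nseq n true) (fun _ => [set 0] `*` setT) ((J `&` I) `*` (chart M i @` X)°) ((J `&` I) `*` (chart M i @` X))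
    (fun p => chart_rep (H p.1) i j p.2).
  apply: CW_subw (hl _ (hws _ ln)) => // c; rewrite mem_nseq => /andP[_ /eqP ->] [t y] [/= -> _].
  by rewrite /md bt; split => //=; case: ifP.
have frX' : frame (fun _ : bool => [set (0 : T)] `*` [set: model M i]) ((J `&` I) `*` (chart M i @` X)°) ((J `&` I) `*` (chart M i @` X)).
  apply: (@frame_md R T hT (fun _ => false) (fun _ => true)) => //; first exact: n_hmod.
  - exact: open_interior.
  - exact: interior_subset.
  - exact: chart_regular.
apply: (CW_comp (f := fun p => chart_rep (H p.1) i j p.2) (g := fun y : model M i => (t0, y)) frX' frXT _ _ _ _ hl').
- by move=> y Dy; split.
- by move=> y Dy; split.
- by move=> c y1 y2 _ _ _; rewrite /= subrr; split.
- by apply: CW_pair; [exact: CW_cst|apply: CW_lin; exact: lincont_id].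
Qed.

Lemma RC_lgood (l : Defs.order) J a b ws w0 M N (H : T -> M -> N) t0 (Y : set M) : nice M -> nice N ->
  (forall c, a c -> open J) -> ipres J H -> J t0 -> ws w0 ->
  b true -> (forall n, le_order n l -> ws (nseq n true)) -> open Y ->
  (forall x, Y x -> lgood J a b ws H t0 x) ->
  RC l (restr_map (H t0) Y) /\ (Y = setT -> RC l (H t0)).
Proof.
move=> nM nN hJ hi Jt hw0 bt hws oY lg.
have cH x : Y x -> {for x, continuous (H t0)}.
  move=> Yx B nB; have := lgood_cvg nM nN hw0 Jt (lg _ Yx) nB.
  move=> -[[A C] [/= hA hC] AC]; apply: filterS hC => y Cy.
  by apply: (AC (t0, y)); split => //=; exact: nbhs_singleton.
have oS i j : open (Y `&` dom M i `&` H t0 @^-1` dom N j).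
  rewrite openE => x [[Yx ix] jx]; apply: filterI.
    by apply: filterI; apply: open_nbhs_nbhs; split => //; exact: n_open.
  by apply: cH => //; apply: open_nbhs_nbhs; split => //; exact: n_open.
split; last move=> YT; split.
- move=> x; apply: continuous_comp; first exact: initial_continuous.
  by apply: cH; exact: set_valP.
- move=> x fx; apply: hi => // i ix; apply: interiorS (fx i ix).
  by move=> _ [y iy <-]; exists (set_val y).
- move=> i j; have -> : rep_dom (restr_map (H t0) Y) i j = chart M i @` (Y `&` dom M i `&` H t0 @^-1` dom N j).
    apply/seteqP; split => [_ [x [ix jx] <-]|_ [x [[Yx ix] jx] <-]].
      by exists (set_val x) => //; split => //; split => //; exact: set_valP.
    by exists (SigSub (mem_set Yx)).
  apply: (isC_lgood nM nN hJ hi Jt hw0 bt hws (oS i j)) => //.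
  + by move=> x [[]].
  + by move=> x [].
  + move=> x [[Yx ix] jx]; rewrite /chart_rep; case: xgetP => [z _ [x' [ix' _ e <-]]|].
      by rewrite /restr_map (n_inj nM (x := set_val x') (y := x) ix' ix e).
    by move=> /(_ (chart N j (H t0 x))) []; exists (SigSub (mem_set Yx)).
  + by move=> x [[Yx ix] jx]; exact: lg.
- by move=> x; apply: cH; rewrite YT.
- by move=> x fx; exact: hi.
- move=> i j; have -> : rep_dom (H t0) i j = chart M i @` (Y `&` dom M i `&` H t0 @^-1` dom N j).
    by rewrite YT setTI.
  apply: (isC_lgood nM nN hJ hi Jt hw0 bt hws (oS i j)) => //.
  + by move=> x [[]].
  + by move=> x [].
  + by move=> x [[Yx ix] jx]; exact: chart_repE.
  + by move=> x [[Yx ix] jx]; exact: lg.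
Qed.

Lemma lgood_cst J a b ws M N (f : M -> N) (t0 : T) (x0 : M) (l : Defs.order) (Y : set M) : nice M -> nice N ->
  (forall c, a c -> open J) ->
  (forall (E F : tvsType R) (D : set E) (g : E -> F), hausdorff_space E -> hausdorff_space F -> regular_set D ->
    (forall n, le_order n l -> CW (nseq n true) (fun _ => setT) D° D g) ->
    forall w, ws w -> CW w (fun c => if b c then setT else [set 0]) D° D g) ->
  open Y -> Y x0 -> RC l (restr_map f Y) -> lgood J a b ws (fun _ => f) t0 x0.
Proof.
move=> nM nN hJ hws oY Yx [cf hif hC].
have cfx : {for x0, continuous f}.
  move=> B nB; have [Z nZ hZ] := (nbhs_set_type (SigSub (mem_set Yx)) _).1 (cf (SigSub (mem_set Yx)) B nB).
  have nY : nbhs x0 Y by exact: open_nbhs_nbhs.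
  by apply: filterS (filterI nZ nY) => y [Zy Yy]; exact: (hZ (SigSub (mem_set Yy))).
have [i ix] := n_cover nM x0; have [j jx] := n_cover nN (f x0).
have rdE : rep_dom (restr_map f Y) i j = chart M i @` (Y `&` dom M i `&` f @^-1` dom N j).
  apply/seteqP; split => [_ [x [ix' jx'] <-]|_ [x [[Yx' ix'] jx'] <-]].
    by exists (set_val x) => //; split => //; split => //; exact: set_valP.
  by exists (SigSub (mem_set Yx')).
have cfY x : Y x -> {for x, continuous f}.
  move=> Yx' B nB; have [Z nZ hZ] := (nbhs_set_type (SigSub (mem_set Yx')) _).1 (cf (SigSub (mem_set Yx')) B nB).
  have nY : nbhs x Y by exact: open_nbhs_nbhs.
  by apply: filterS (filterI nZ nY) => y [Zy Yy]; exact: (hZ (SigSub (mem_set Yy))).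
have oX : open (Y `&` dom M i `&` f @^-1` dom N j).
  rewrite openE => x [[Yx' ix'] jx']; apply: filterI.
    by apply: filterI; apply: open_nbhs_nbhs; split => //; exact: n_open.
  by apply: cfY => //; apply: open_nbhs_nbhs; split => //; exact: n_open.
set X := Y `&` dom M i `&` f @^-1` dom N j in rdE oX.
have Xi : X `<=` dom M i by move=> x [[]].
have rX := chart_regular nM oX Xi.
exists i, j, X, setT; split; [by split => //; exact: openT|split].
  by move=> t x _ _ [].
move=> w hw.
have h n : le_order n l -> CW (nseq n true) (fun _ => setT) (chart M i @` X)° (chart M i @` X) (chart_rep f i j).
  move=> ln; have hc := hC i j; rewrite rdE in hc.
  have := is_C_CW (@n_hmod _ _ nN j) rX hc ln; apply: CW_ext; first exact: frameT.
  move=> _ [x [[Yx' ix'] jx'] <-]; rewrite chart_repE// /chart_rep.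
  case: xgetP => [z _ [x' [ix'' _ e <-]]|].
    by rewrite /restr_map (n_inj nM (x := set_val x') (y := x) ix'' ix' e).
  by move=> /(_ (chart N j (f x))) []; exists (SigSub (mem_set Yx')).
have h2 := hws _ _ _ _ (@n_hmod _ _ nM i) (@n_hmod _ _ nN j) rX h w hw.
by apply: (CW_complin (L := snd) _ _ _ _ h2); [exact: lincont_snd|move=> p []|move=> p []|move=> c p []].
Qed.

End fixed_parameter.
End conversions.

Section two_variables.
Context {R : realType}.
Implicit Types M N : charted_space R.
Implicit Types (J : set R^o) (a b : bool -> bool) (ws : set (seq bool)) (S : set R).

Lemma frame_Vprod (E1 E2 : tvsType R) (D1 : set E1) (D2 : set E2) : hausdorff_space E1 -> hausdorff_space E2 ->
  regular_set D1 -> regular_set D2 -> frame (@Vprod R E1 E2) (D1° `*` D2°) (D1 `*` D2).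
Proof.
move=> h1 h2 r1 r2; split.
- by move=> [x y] [/= /interior_subset ? /interior_subset ?].
- move=> [x y] [/= Dx Dy] B [[A1 A2] [/= hA1 hA2] AB].
  have [x' [? ?]] := r1 x Dx _ hA1; have [y' [? ?]] := r2 y Dy _ hA2.
  by exists (x', y'); split => //; exact: AB.
- by case; apply: subspX => //; exact: subsp0.
- case; apply: closedI.
  + by apply: closed_comp; [move=> z _; exact: cvg_fst|exact: closed0].
  + by apply: closed_comp; [move=> z _; exact: cvg_snd|exact: closedT].
  + by apply: closed_comp; [move=> z _; exact: cvg_fst|exact: closedT].
  + by apply: closed_comp; [move=> z _; exact: cvg_snd|exact: closed0].
- have vT (E : tvsType R) (O : set E) : open O -> vopen setT O by move=> oO; exact: vopenT.
  move=> c; have oO : open (D1° `*` D2°) by apply: openX; exact: open_interior.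
  move=> x Ox; have [N N0 hN] := vT _ _ oO x Ox.
  by exists N => // x' u Ox' Nx Nu _; exact: hN.
Qed.

Lemma cvg_sets J M N (H : R^o -> M -> N) t0 x0 (Q : topologicalType) (q0 : Q) (ft : Q -> R^o) (fx : Q -> M) :
  (fun p : R^o * M => H p.1 p.2) @ within (J `*` setT) (nbhs (t0, x0)) --> H t0 x0 ->
  (forall q, J (ft q)) -> ft @ q0 --> t0 -> fx @ q0 --> x0 ->
  (fun q => H (ft q) (fx q)) @ q0 --> H t0 x0.
Proof.
move=> h hJ ct cx B nB; have : nbhs (t0, x0) [set p | (J `*` setT) p -> B (H p.1 p.2)] := h B nB.
move=> -[[A C] [/= hA hC] AC].
have hA' : nbhs q0 (fun q => A (ft q)) := ct _ hA.
have hC' : nbhs q0 (fun q => C (fx q)) := cx _ hC.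
suff : nbhs q0 (fun q => B (H (ft q) (fx q))) by [].
apply: filterS (filterI hA' hC') => q [Aq Cq].
exact: (AC (ft q, fx q) (conj Aq Cq) (conj (hJ q) I)).
Qed.

Lemma glue_nbhd M i (S X : set M) x : nice M -> open X -> X x -> X `<=` S -> S `<=` dom M i ->
  exists P, [/\ open P, P (chart M i x), chart M i @` S `&` P `<=` chart M i @` X,
    chart_im M i `&` P = chart M i @` X & (chart M i @` S)° `&` P `<=` (chart M i @` X)°].
Proof.
move=> nM oX Xx XS Si.
have Xi : X `<=` dom M i by exact: subset_trans XS Si.
have [P oP hP] := chart_image_open nM oX Xi.
have Px : P (chart M i x).
  by have : (chart M i @` X) (chart M i x) by [exists x]; rewrite hP => -[].
have DP : chart M i @` S `&` P `<=` chart M i @` X.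
  by move=> y [Sy Py]; rewrite hP; split => //; exact: chart_im_sub Si _ Sy.
exists P; split => // y hy.
have oSP : open ((chart M i @` S)° `&` P) by apply: openI => //; exact: open_interior.
apply: (filterS (P := (chart M i @` S)° `&` P)); last exact: open_nbhs_nbhs.
by move=> z [/interior_subset Sz Pz]; exact: DP.
Qed.

Lemma RC2_lgood (k l : Defs.order) J a b ws w0 S M N (H : R^o -> M -> N) : nice M -> nice N ->
  (forall c, a c -> open J) -> ipres J H -> ws w0 -> S `<=` J -> regular_set S ->
  (forall n m, le_order m k -> le_order n l -> ws (nseq n true ++ nseq m false)) ->
  b true -> (forall m, le_order m k -> (0 < m)%N -> a false) ->
  (forall t x, S t -> lgood J a b ws H t x) ->
  RC2 k l (fun p : restr (real_line R) S * M => H (set_val p.1) p.2).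
Proof.
move=> nM nN hJ hi hw0 SJ rS hws bt af lg; split.
- move=> [s x]; have Ss : S (set_val s) by exact: set_valP.
  apply: (cvg_sets (J := J) (t0 := set_val s) (x0 := x) (ft := fun p : set_type S * M => set_val p.1) (fx := snd)).
  + exact: (lgood_cvg nM nN hw0 (SJ _ Ss) (lg _ x Ss)).
  + by move=> q; apply: SJ; exact: set_valP.
  + apply: (@cvg_comp _ _ _ fst (set_val : set_type S -> R)); first exact: cvg_fst.
    exact: (@initial_continuous _ _ (set_val : set_type S -> R)).
  + exact: cvg_snd.
- by move=> s x _ fx; apply: hi => //; apply: SJ; exact: set_valP.
- move=> [] i j O1 O2 oO1 oO2 _ O2i Oj.
  have [P1 oP1 eP1] : exists2 P : set R, open P & O1 = set_val @^-1` P.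
    by case: oO1 => P oP <-; exists P.
  set D1 := chart (restr (real_line R) S) tt @` O1; set D2 := chart M i @` O2.
  have D1E : D1 = S `&` P1.
    rewrite /D1 eP1; apply/seteqP; split => [_ [s Ps <-]|t [St Pt]].
      by split => //; exact: set_valP.
    by exists (SigSub (mem_set St)).
  have rD1 : regular_set D1 by rewrite D1E; exact: regular_openI.
  have rD2 : regular_set D2 by exact: chart_regular.
  have hR : hausdorff_space (R^o : tvsType R) by exact: hausdorff_R.
  have fr := frame_Vprod hR (@n_hmod _ _ nM i) rD1 rD2.
  apply: CW_is_C2 => //; first exact: n_hmod.
  move=> m n mk nl; apply: (CW_glue _ fr); first exact: n_hmod.
  move=> [t _] [/= D1t [x O2x <-]].
  have St : S t by move: D1t; rewrite D1E => -[].
  have D1O (t' : R) : D1 t' -> exists2 s, O1 s & set_val s = t' by move=> [s ? <-]; exists s.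
  have OjH t' x' : D1 t' -> O2 x' -> dom N j (H t' x').
    by move=> /D1O[s O1s <-] O2x'; exact: (Oj (s, x')).
  have la := lgood_charts hR nM nN hJ hi hw0 (SJ _ St) (O2i _ O2x) (OjH _ _ D1t O2x) (lg t x St).
  have [X [I [[oX Xx Xi] [[oI It _] [hd hl]]]]] := lgood_shrink oO2 O2x (@openT R^o) (I : setT t) la.
  have XO : X `<=` O2 by move=> y /Xi[].
  have [P [oP Px DP _ OP]] := glue_nbhd nM oX Xx XO O2i.
  exists (I `*` P); split => //; first exact: openX.
  apply: (CW_ext (f := fun p => chart_rep (H p.1) i j p.2)); first by apply: frame_open => //; exact: openX.
    move=> [t' y] [[/= D1t' [x' O2x' <-]] _].
    have [s O1s es] := D1O _ D1t'.
    rewrite chart_repE//; [|exact: O2i|exact: OjH].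
    rewrite /chart_rep; case: xgetP => [z _ [[s' x''] [[_ /= ix''] _ [e1 e2] <-]]|].
      by rewrite (n_inj nM ix'' (O2i _ O2x') e2) -e1.
    move=> /(_ (chart N j (H t' x'))) []; exists (s, x'); rewrite /= es; split => //.
    + by split => //; exact: O2i.
    + exact: OjH.
  apply: CW_subw (hl _ (hws n m mk nl)).
  + move=> [t' y] [/= [/interior_subset D1t' D2y] [It' Py]]; split => /=; last exact: OP.
    by split => //; apply: SJ; move: D1t'; rewrite D1E => -[].
  + move=> [t' y] [/= [D1t' D2y] [It' Py]]; split => /=; last exact: DP.
    by split => //; apply: SJ; move: D1t'; rewrite D1E => -[].
  + move=> c; rewrite mem_cat !mem_nseq => /orP[/andP[_ /eqP ->]|/andP[m0 /eqP ->]] [u v] [/= hu hv].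
      by rewrite /md bt; split => //=; rewrite hu; case: ifP.
    by rewrite /md (af _ mk m0); split => //=; rewrite hv; case: ifP.
Qed.

(** The domain of the chart representation, where H t x lies in a chart of N, is not a product. Its
    regularity and the derivatives are checked locally, on boxes I0 x P where it coincides with S x
    [chart_im M i]. *)
Lemma RC_prod_lgood J S M N (Y : set M) (H : R^o -> M -> N) : nice M -> nice N -> open J ->
  ipres J H -> S `<=` J -> regular_set S -> open Y ->
  (forall t x, S t -> Y x -> lgood J (fun _ => true) (fun _ => true) setT H t x) ->
  RC None (fun p : prod_space (restr (real_line R) S) (restr M Y) => H (set_val p.1) (set_val p.2)).
Proof.
move=> nM nN oJ hi SJ rS oY lg; split.
- move=> [s x]; have Ss : S (set_val s) by exact: set_valP.
  apply: (cvg_sets (J := J) (t0 := set_val s) (x0 := set_val x) (ft := fun p : set_type S * set_type Y => set_val p.1)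
    (fx := fun p : set_type S * set_type Y => set_val p.2)).
  + exact: (lgood_cvg nM nN (I : setT [::]) (SJ _ Ss) (lg _ _ Ss (set_valP x))).
  + by move=> q; apply: SJ; exact: set_valP.
  + apply: (@cvg_comp _ _ _ fst (set_val : set_type S -> R)); first exact: cvg_fst.
    exact: (@initial_continuous _ _ (set_val : set_type S -> R)).
  + apply: (@cvg_comp _ _ _ snd (set_val : set_type Y -> M)); first exact: cvg_snd.
    exact: (@initial_continuous _ _ (set_val : set_type Y -> M)).
- move=> [s x] fx; apply: hi; first by apply: SJ; exact: set_valP.
  move=> i ix; have := fx (tt, i) (conj I ix).
  move=> /(interiorS (B := setT `*` chart_im M i)) h.
  have [|_ //] := interiorX (p := (set_val s : R^o, chart M i (set_val x))) (h _).
  by move=> _ [[s' x'] [_ ix'] <-]; split => //; exists (set_val x').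
- move=> [[] i] j; set f := fun p : prod_space _ _ => _.
  set D := rep_dom f (tt, i) j.
  have hR : hausdorff_space (R^o : tvsType R) by exact: hausdorff_R.
  have DE p : D p <-> exists t x, [/\ S t, Y x, dom M i x, dom N j (H t x) & p = (t, chart M i x)].
    split => [[[s x] [[_ ix] jx] <-]|[t [x [St Yx ix jx ->]]]].
      by exists (set_val s), (set_val x); split => //; exact: set_valP.
    by exists (SigSub (mem_set St), SigSub (mem_set Yx)).
  have loc p : D p -> exists I (X : set M) (P : set (model M i)), [/\ [/\ open I, I p.1, open P & P p.2],
      X `<=` Y `&` dom M i, (forall t x, J t -> I t -> X x -> dom N j (H t x)),
      chart_im M i `&` P = chart M i @` X & forall w, lrep J I (fun _ => true) (fun _ => true) H i j X w].
    move=> /DE[t [x [St Yx ix jx ->]]].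
    have la := lgood_charts hR nM nN (fun _ _ => oJ) hi (I : setT [::]) (SJ _ St) ix jx (lg t x St Yx).
    have [X [I0 [[oX Xx Xi] [[oI It _] [hd hl]]]]] := lgood_shrink oY Yx (@openT R^o) (I : setT t) la.
    have Xi' : X `<=` dom M i by move=> y /Xi[].
    have [P [oP Px _ eP _]] := glue_nbhd nM oX Xx Xi' (@subset_refl _ (dom M i)).
    by exists I0, X, P; split => // w; exact: hl.
  have DP p I0 (X : set M) (P : set (model M i)) : (I0 `*` P) p -> X `<=` Y `&` dom M i -> chart_im M i `&` P = chart M i @` X ->
      (forall t x, J t -> I0 t -> X x -> dom N j (H t x)) ->
      (D p <-> S p.1 /\ chart_im M i p.2).
    move=> [/= Ip Pp] Xi eP hd; split.
      by move=> /DE[t [x [St Yx ix jx ->]]]; split => //=; exists x.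
    move=> [Sp cp]; have : (chart_im M i `&` P) p.2 by [].
    rewrite eP => -[x Xx e]; apply/DE; have [Yx ix] := Xi _ Xx.
    exists p.1, x; split => //; first by apply: hd => //; exact: SJ.
    by case: (p) e => ? ? /= ->.
  have rSC : regular_set (S `*` chart_im M i).
    move=> [t y] [/= St cy] B [[A1 A2] [/= h1 h2] AB].
    have [t' [It' At']] := rS t St _ h1; have [y' [Iy' Ay']] := n_reg nM cy h2.
    exists (t', y'); split; last exact: AB.
    by exists (S°, (chart_im M i)°); [split => /=; apply: open_nbhs_nbhs; split => //; exact: open_interior|
      move=> [u v] [/= /interior_subset ? /interior_subset ?]].
  have rD : regular_set D.
    apply: regular_loc => p Dp; have [I0 [X [P [[oI Ip oP Pp] Xi hd eP _]]]] := loc p Dp.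
    exists (I0 `*` P); split => //; first exact: openX.
    have -> : D `&` (I0 `*` P) = (S `*` chart_im M i) `&` (I0 `*` P).
      apply/seteqP; split => q [q1 q2]; split => //; first by have [h _] := DP q _ _ _ q2 Xi eP hd; exact: h.
      by have [_ h] := DP q _ _ _ q2 Xi eP hd; exact: h.
    by apply: regular_openI => //; exact: openX.
  apply: CW_is_C => //; first exact: n_hmod.
  move=> n _; apply: (CW_glue _ (frameT rD)); first exact: n_hmod.
  move=> p Dp; have [I0 [X [P [[oI Ip oP Pp] Xi hd eP hl]]]] := loc p Dp.
  have oIP : open (I0 `*` P) by exact: openX.
  exists (I0 `*` P); split => //.
  apply: (CW_ext (f := fun p => chart_rep (H p.1) i j p.2)); first exact: frame_open (frameT rD) oIP.
    move=> q [/DE[t [x [St Yx ix jx ->]]] _]; rewrite chart_repE//=.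
    rewrite /chart_rep; case: xgetP => [z _ [[s' x''] [[_ /= ix''] _ [e1 e2] <-]]|].
      by rewrite /f /= (n_inj nM (x := set_val x'') (y := x) ix'' ix e2) -e1.
    by move=> /(_ (chart N j (H t x))) []; exists (SigSub (mem_set St), SigSub (mem_set Yx)).
  have sub : D `&` (I0 `*` P) `<=` (J `&` I0) `*` (chart M i @` X).
    move=> q [Dq IPq]; have [h _] := DP q _ _ _ IPq Xi eP hd; have [Sq cq] := h Dq.
    case: IPq => Iq Pq; split => /=; first by split => //; exact: SJ.
    by have : (chart_im M i `&` P) q.2 by []; rewrite eP.
  apply: CW_sub (hl (nseq n true)) => //.
    move=> q [Dq IPq]; have oDIP : open (D° `&` (I0 `*` P)) by apply: openI => //; exact: open_interior.
    have : (((J `&` I0) `*` (chart M i @` X))°) q.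
      apply: (filterS (P := D° `&` (I0 `*` P))); last exact: open_nbhs_nbhs.
      by move=> z [/interior_subset ? ?]; exact: sub.
    by move=> /interiorX[/interior_subset ? ?].
Qed.

Lemma regular_cint : regular_set [set t : R | 0 <= t <= 1].
Proof.
have oi : (oint : set R) `<=` [set t : R | 0 <= t <= 1]°.
  move=> t ht; apply: (filterS (P := oint)); last exact: open_nbhs_nbhs (conj (@open_oint R) ht).
  by move=> s /andP[? ?]; apply/andP; split; exact: ltW.
by move=> t ht B nB; have [s [/oi ? ?]] := @cint_closure R t ht B nB; exists s.
Qed.

Lemma regular_ocint : regular_set [set t : R | 0 < t <= 1].
Proof.
have oi : (oint : set R) `<=` [set t : R | 0 < t <= 1]°.
  move=> t ht; apply: (filterS (P := oint)); last exact: open_nbhs_nbhs (conj (@open_oint R) ht).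
  by move=> s /andP[? ?]; apply/andP; split => //; exact: ltW.
move=> t /andP[t0 t1] B nB.
have [|s [/oi ? ?]] := @cint_closure R t _ B nB; first by apply/andP; split => //; exact: ltW.
by exists s.
Qed.

End two_variables.

(** * Tangent maps and the C^l-topology *)

Section tangent_spaces.
Context {R : realType}.
Implicit Types M N : charted_space R.

(** Identifies the limit in [ext_derive] with any continuous differential given near x; regularity
    of D makes the filter proper, so that the limit is unique. *)
Lemma ext_deriveE (E F : tvsType R) (D P : set E) (f : E -> F) (df : E * E -> F) x v :
  hausdorff_space F -> regular_set D -> open P -> P x -> D x ->
  pd setT (D° `&` P) f df -> cw ((D `&` P) `*` setT) df ->
  ext_derive D f x v = df (x, v).
Proof.
move=> hF rD oP Px Dx hp cdf; rewrite /ext_derive /tvs_lim.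
have PF : ProperFilter (within D° (nbhs x)).
  by apply: within_nbhs_proper; exact: rD.
have cv : dir_derive f x' v @[x' --> within D° (nbhs x)] --> df (x, v).
  have h : df (x', v) @[x' --> within (D° `&` P) (nbhs x)] --> df (x, v).
    apply: (cw_cvg (g := fun x' => (x', v)) cdf); first by split.
      by rewrite near_withinE; apply: nearW => y [/interior_subset ? ?].
    by apply: cvg_within_filter; apply: cvg_pair; [exact: cvg_id|exact: cvg_cst].
  move=> B nB; have hh : nbhs x (fun x' => (D° `&` P) x' -> B (df (x', v))) := h B nB.
  have nP : nbhs x P by exact: open_nbhs_nbhs.
  suff : nbhs x (fun x' => D° x' -> B (dir_derive f x' v)) by [].
  apply: filterS2 nP hh => y Py hy Oy.
  by rewrite (dir_derive_isd hF (hp y v (conj Oy Py) I)); exact: hy.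
case: xgetP => [y _ yl|/(_ (df (x, v)))]; last by move=> /(_ cv).
exact: (cvg_unique _ yl cv).
Qed.

Lemma CW_ext_derive w (E F : tvsType R) (D : set E) (f : E -> F) : hausdorff_space F -> regular_set D ->
  CW (true :: w) (fun _ => setT) D° D f ->
  pd setT D° f (fun p => ext_derive D f p.1 p.2) /\
  CW w (fun _ => setT) (D° `*` setT) (D `*` setT) (fun p : E * E => ext_derive D f p.1 p.2).
Proof.
move=> hF rD [hf [df [pf hdf]]].
have e x v : D x -> ext_derive D f x v = df (x, v).
  move=> Dx; apply: (ext_deriveE (P := setT)) => //; first exact: openT.
    by move=> y u [Oy _] _; exact: pf.
  by rewrite setIT; exact: (CW_cw hdf).
split; first by move=> x v Ox _; rewrite e; [exact: pf|exact: interior_subset].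
apply: (CW_sub (V := tgl (fun _ => setT) true) (O := D° `*` setT) (D := D `*` setT)) => //.
apply: (CW_ext (f := df)) hdf; first exact: (frame_lift true (frameT rD)).
by move=> [x v] [/= Dx _]; rewrite e.
Qed.

(** The chain rule up to non-interior points: the interior case is [isd_comp], and the composite
    differential extends continuously. P lets the identity f = h o g hold only near x, as happens
    for overlaps of charts. *)
Lemma ext_derive_comp (E F G : tvsType R) (D D1 : set E) (D2 : set F) (f : E -> G) (g : E -> F) (h : F -> G) (P : set E) x v :
  hausdorff_space F -> hausdorff_space G -> regular_set D -> regular_set D1 -> regular_set D2 ->
  open P -> P x -> D x -> D `&` P `<=` D1 ->
  CW [:: true] (fun _ => setT) D1° D1 g -> CW [:: true] (fun _ => setT) D2° D2 h ->
  (forall y, D y -> P y -> D2 (g y)) -> (forall y, D° y -> P y -> D2° (g y)) ->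
  (forall y, D y -> P y -> f y = h (g y)) ->
  ext_derive D f x v = ext_derive D2 h (g x) (ext_derive D1 g x v).
Proof.
move=> hF hG rD rD1 rD2 oP Px Dx DD1 cg ch gD gO fE.
have [pg cdg] := CW_ext_derive hF rD1 cg; have [ph cdh] := CW_ext_derive hG rD2 ch.
have [cg0 _] := cg; have [ch0 _] := ch.
have DO : D° `&` P `<=` D1°.
  have oDP : open (D° `&` P) by apply: openI => //; exact: open_interior.
  move=> y hy; apply: (filterS (P := D° `&` P)); last exact: open_nbhs_nbhs.
  by move=> z [/interior_subset Dz Pz]; exact: DD1.
have oDP : open (D° `&` P) by apply: openI => //; exact: open_interior.
apply: (ext_deriveE (P := P) (df := fun p => ext_derive D2 h (g p.1) (ext_derive D1 g p.1 p.2))) => //.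
  move=> y u [Oy Py] _.
  have near_DP : \forall k \near (0 : R), (D° `&` P) (y + k *: u).
    by apply: (vopen_near (V := setT)) => //; exact: vopenT.
  have fr2 := frameT rD2.
  apply: (@isd_ext _ _ _ (fun z => h (g z))).
    by apply: filterS near_DP => k [/interior_subset Dk Pk]; rewrite fE.
  have hq : \forall k \near (0 : R)^', setT (g (y + k *: u) - g y) /\ D2° (g (y + k *: u)).
    by apply: nbhs_dnbhs; apply: filterS near_DP => k [Dk Pk]; split => //; exact: gO.
  have c1 : cw D2° h by apply: cw_sub ch0; exact: interior_subset.
  have c2 : cw (D2° `*` setT) (fun p : F * F => ext_derive D2 h p.1 p.2).
    by apply: cw_sub cdh => -[z1 z2] [/= /interior_subset ? _].
  have [_ hh] := @isd_comp _ _ _ _ setT D2° h (fun p => ext_derive D2 h p.1 p.2) g y u (ext_derive D1 g y u)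
    (fr_lin fr2 true) (@fr_cl _ _ _ _ _ fr2 true) (@fr_open _ _ _ _ _ fr2 true) c1 c2
    ph (gO _ Oy Py) (pg _ _ (DO _ (conj Oy Py)) I) hq.
  exact: hh.
apply: (cw_comp (D' := D2 `*` setT) (f := fun p : E * E => (g p.1, ext_derive D1 g p.1 p.2))) cdh.
  by move=> [y u] [/= [Dy Py] _]; split => //=; exact: gD.
apply: cw_pair.
  apply: (cw_comp (D' := D1) (f := fst)) cg0; last by apply: cw_lin; exact: lincont_fst.
  by move=> [y u] [/= [Dy Py] _]; exact: DD1.
by apply: cw_sub cdg => -[y u] [/= [Dy Py] _]; split => //=; exact: DD1.
Qed.

Lemma ext_derive_id (E : tvsType R) (D : set E) (f : E -> E) x v : hausdorff_space E -> regular_set D -> D x ->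
  (forall y, D y -> f y = y) -> ext_derive D f x v = v.
Proof.
move=> hE rD Dx fE; rewrite (ext_deriveE (P := setT) (df := snd))//; first exact: openT.
- move=> y u [Oy _] _; apply: (@isd_ext _ _ _ id); last by apply: isd_lin; exact: lincont_id.
  have : \forall k \near (0 : R), D° (y + k *: u).
    by apply: (vopen_near (V := setT)) => //; apply: vopenT; exact: open_interior.
  by apply: filterS => k /interior_subset Dk; rewrite fE.
- by apply: cw_lin; exact: lincont_snd.
Qed.

Section tangent_of_nice.
Variable M : charted_space R.
Hypothesis nM : nice M.

Definition dtrans i j (y : model M i) (v : model M i) : model M j :=
  ext_derive (rep_dom (@id M) i j) (chart_rep (@id M) i j) y v.

Lemma rep_dom_reg i j : regular_set (rep_dom (@id M) i j).
Proof. by apply: chart_regular; [exact: nM|apply: openI; exact: (n_open nM)|move=> ? []]. Qed.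

Lemma rep_dom_int i j x : dom M i x -> dom M j x -> (chart_im M i)° (chart M i x) ->
  (rep_dom (@id M) i j)° (chart M i x).
Proof.
move=> ix jx h; rewrite /rep_dom setIC; apply: chart_int => //.
by apply: open_nbhs_nbhs; split => //; exact: n_open.
Qed.

Lemma dtrans_id i x v : dom M i x -> dtrans i (chart M i x) v = v.
Proof.
move=> ix; apply: ext_derive_id; [exact: n_hmod|exact: rep_dom_reg|by exists x|].
by move=> _ [y [iy _] <-]; exact: chart_rep_id.
Qed.

Lemma dtrans_comp i j k x v : dom M i x -> dom M j x -> dom M k x ->
  dtrans k (chart M j x) (dtrans j (chart M i x) v) = dtrans k (chart M i x) v.
Proof.
move=> ix jx kx; rewrite -{1}(chart_rep_id (i := i) (j := j) nM)//; symmetry.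
have oX : open (dom M i `&` (dom M j `&` dom M k)) by repeat (apply: openI; try exact: n_open).
have [P oP hP] := chart_image_open nM oX (@subIsetl _ _ _).
have Dik : rep_dom (@id M) i k `&` P `<=` chart M i @` (dom M i `&` (dom M j `&` dom M k)).
  by rewrite hP => y [[z [iz _] <-] Pz]; split => //; exists z.
have Pi (y : M) : (dom M i `&` (dom M j `&` dom M k)) y -> P (chart M i y).
  by move=> hy; have : (chart M i @` (dom M i `&` (dom M j `&` dom M k))) (chart M i y) by [exists y]; rewrite hP => -[].
apply: (ext_derive_comp (P := P)); try exact: n_hmod; try exact: rep_dom_reg => //; try exact: n_trans.
- by [].
- by apply: Pi.
- by exists x.
- by move=> y /Dik[z [iz [jz _]] <-]; exists z.
- by move=> y Dy Py; have [z [iz [jz kz]] <-] := Dik _ (conj Dy Py); rewrite chart_rep_id//; exists z.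
- move=> y Dy Py; have [z [iz [jz kz]] e] := Dik _ (conj (interior_subset Dy) Py).
  rewrite -e chart_rep_id//; apply: rep_dom_int => //; apply: (n_int nM (i := i)) => //.
  by rewrite e; apply: interiorS Dy => _ [z' [? _] <-]; exists z'.
- by move=> y Dy Py; have [z [iz [jz kz]] <-] := Dik _ (conj Dy Py); rewrite !chart_rep_id.
Qed.

Lemma dtrans0 i j x : dom M i x -> dom M j x -> dtrans j (chart M i x) 0 = 0.
Proof.
move=> ix jx; have fr := frameT (@rep_dom_reg i j).
have ct := n_trans nM i j [:: true]; have [pf cdf] := CW_ext_derive (@n_hmod _ _ nM j) (@rep_dom_reg i j) ct.
have Dx : rep_dom (@id M) i j (chart M i x) by exists x.
have h := @CW_dlin R true [::] _ _ _ _ _ _ _ (chart M i x) 1 0 0 (@n_hmod _ _ nM j) fr (CW_cw ct) pf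
  (cdf : CW [::] (tgl (fun _ => setT) true) _ _ _) Dx I I.
move: h; rewrite !scale1r addr0 /= => /eqP; rewrite -subr_eq0 opprD addrA subrr sub0r oppr_eq0 => /eqP.
by [].
Qed.

(** A tangent vector is determined by its coordinate in a single chart ([tangent_tvec]); this is the
    family of all its coordinates. *)
Definition tvec i (x : M) (v : model M i) : forall j, model M j :=
  fun j => if pselect (dom M j x) then dtrans j (chart M i x) v else 0.

Lemma tvecE i x v j : dom M j x -> tvec x v j = dtrans j (chart M i x) v.
Proof. by rewrite /tvec; case: pselect. Qed.

Lemma tvec_tangent i x v : dom M i x -> tangent_vector x (tvec (i := i) x v).
Proof.
move=> ix; left; split; first by move=> j njx; rewrite /tvec; case: pselect.
move=> j k jx kx; rewrite !tvecE//; symmetry.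
exact: dtrans_comp.
Qed.

Lemma tangent_tvec i x w : tangent_vector x w -> dom M i x -> w = tvec x (w i).
Proof.
move=> [[h0 h1]|->] ix; apply: functional_extensionality_dep => j; rewrite /tvec; case: pselect => jx //.
- exact: h1.
- exact: h0.
- by rewrite dtrans0.
Qed.

Definition tpoint i x (v : model M i) (ix : dom M i x) : tangent M :=
  exist _ (x, tvec x v) (tvec_tangent v ix).

Lemma tpoint_chart i x v (ix : dom M i x) : chart (tangent M) i (tpoint v ix) = (chart M i x, v).
Proof. by rewrite /= tvecE// dtrans_id. Qed.

Lemma tangent_inj (p q : tangent M) i : dom M i (sval p).1 -> (sval p).1 = (sval q).1 ->
  (sval p).2 i = (sval q).2 i -> p = q.
Proof.
case: p q => [[x w] hw] [[x' w'] hw'] /= ix e; move: hw'; rewrite -e => hw' e2.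
have h1 := @tangent_tvec i x w hw ix; have h2 := @tangent_tvec i x w' hw' ix.
have ee : w = w' by transitivity (tvec x (w i)) => //; rewrite e2; symmetry.
move: hw'; rewrite -ee => hw'; congr exist; exact: Prop_irrelevance.
Qed.

Lemma tangent_im i : chart_im (tangent M) i = chart_im M i `*` setT.
Proof.
apply/seteqP; split => [_ [p ip <-]|[y v] [[x ix /= <-] _]].
  by split => //=; exists (sval p).1.
by exists (tpoint v ix) => //; exact: tpoint_chart.
Qed.

Lemma tangent_im_int i p : (chart_im (tangent M) i)° p <-> (chart_im M i)° p.1.
Proof.
rewrite tangent_im; split; first by move=> /interiorX[].
by move=> h; exists (chart_im M i, setT) => //; split => //; exact: filterT.
Qed.

Lemma tangent_rep_dom i j : rep_dom (@id (tangent M)) i j = rep_dom (@id M) i j `*` setT.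
Proof.
apply/seteqP; split => [_ [p [ip jp] <-]|[y v] [[x [ix jx] /= <-] _]].
  by split => //=; exists (sval p).1.
by exists (tpoint v ix); [split|exact: tpoint_chart].
Qed.

Lemma tangent_chart_inj i (p q : tangent M) : dom (tangent M) i p -> dom (tangent M) i q ->
  chart (tangent M) i p = chart (tangent M) i q -> p = q.
Proof. by move=> ip iq [e1 e2]; apply: (tangent_inj ip) => //; exact: (n_inj nM ip iq e1). Qed.

Lemma tangent_coord (p : tangent M) i j : dom M i (sval p).1 -> dom M j (sval p).1 ->
  (sval p).2 j = dtrans j (chart M i (sval p).1) ((sval p).2 i).
Proof.
case: p => [[x w] hw] /= ix jx; have h1 := @tangent_tvec i x w hw ix.
have -> : w j = tvec x (w i) j by rewrite -h1.
by rewrite tvecE.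
Qed.

Lemma tangent_nbhs i (p : tangent M) (X : set (tangent M)) : dom (tangent M) i p -> (nbhs p X <->
    exists2 P, nbhs (chart (tangent M) i p) P &
      forall p', dom (tangent M) i p' -> P (chart (tangent M) i p') -> X p').
Proof.
(* The topology is given by a subbase, so the filter F of neighbourhoods in the chart i only has to
   contain the subbasic sets around p. These come from arbitrary charts j, and the claim is
   continuity of the coordinate change. *)
move=> ip; pose F : set_system (tangent M) := fun X => exists2 P, nbhs (chart (tangent M) i p) P &
      forall p', dom (tangent M) i p' -> P (chart (tangent M) i p') -> X p'.
have FF : Filter F.
  split; first by exists setT => //; exact: filterT.
    move=> A B [P nP hP] [Q nQ hQ]; exists (P `&` Q); first exact: filterI.
    by move=> q iq [? ?]; split; [exact: hP|exact: hQ].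
  by move=> A B AB [P nP hP]; exists P => // q iq Pq; apply: AB; exact: hP.
split; last first.
  move=> [P nP hP]; rewrite nbhsE.
  exists [set q | dom M i (sval q).1 /\ P° (chart M i (sval q).1, (sval q).2 i)].
    split; last by split => //; exact: nP.
    exists [set [set q | dom M i (sval q).1 /\ P° (chart M i (sval q).1, (sval q).2 i)]]; last first.
      by rewrite predeqE => ?; split=> [[_ ->]|] //; eexists.
    move=> _ ->; exists [fset [set q : tangent_bundle M | dom M i (sval q).1 /\ P° (chart M i (sval q).1, (sval q).2 i)]]%fset.
      by move=> z /fset1P ->; apply/mem_set; exists i, P°; split => //; exact: open_interior.
    rewrite predeqE => q; split => [h|hq z /= /fset1P -> //].
    apply: (h [set q | dom M i (sval q).1 /\ P° (chart M i (sval q).1, (sval q).2 i)]); exact/fset1P.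
  by move=> q [iq /interior_subset Pq]; exact: hP.
rewrite nbhsE => -[_ [[B sB <-] [C BC Cp]] BX].
suff FC : F C by apply: (filterS _ FC) => q Cq; apply: BX; exists C.
have [D sD IDeC] := sB _ BC; rewrite -IDeC; apply: filter_bigI => Z DZ.
have /set_mem[j [Q [oQ eZ]]] := sD _ DZ.
have Zp : Z p by move: Cp; rewrite -IDeC => /(_ _ DZ).
rewrite eZ in Zp *; case: Zp => jp Qp.
have ct := n_trans nM i j [:: true].
have [pf cdf] := CW_ext_derive (@n_hmod _ _ nM j) (@rep_dom_reg i j) ct.
have cpair : cw (rep_dom (@id M) i j `*` setT) (fun z : model M i * model M i => (chart_rep (@id M) i j z.1, dtrans j z.1 z.2)).
  apply: cw_pair => //; apply: (cw_comp (D' := rep_dom (@id M) i j) (f := fst)) (CW_cw ct); first by move=> z [].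
  by apply: cw_lin; exact: lincont_fst.
have Dp : (rep_dom (@id M) i j `*` setT) (chart (tangent M) i p) by split => //=; exists (sval p).1.
have nQ : nbhs (chart_rep (@id M) i j (chart M i (sval p).1), dtrans j (chart M i (sval p).1) ((sval p).2 i)) Q.
  by apply: open_nbhs_nbhs; split => //; rewrite chart_rep_id// -tangent_coord.
pose W : set (model M i * model M i) := fun z => (rep_dom (@id M) i j `*` setT) z -> Q (chart_rep (@id M) i j z.1, dtrans j z.1 z.2).
have nW : nbhs (chart (tangent M) i p) W := cpair _ Dp _ nQ.
have nj : nbhs (sval p).1 (dom M j) by apply: open_nbhs_nbhs; split => //; exact: n_open.
have [P1 nP1 hP1] := (n_nbhs nM _ ip).1 nj.
exists (W `&` [set z | P1 z.1]).
  apply: filterI => //; exact: (@cvg_fst _ _ (nbhs (chart M i (sval p).1)) (nbhs ((sval p).2 i)) _ _ nP1).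
move=> q iq [Wq P1q]; have jq : dom M j (sval q).1 by exact: hP1.
split => //; have := Wq (conj _ I); rewrite /= chart_rep_id// -tangent_coord//; apply.
by exists (sval q).1.
Qed.

Lemma nice_tangent : nice (tangent M).
Proof.
split.
- move=> i [a1 a2] [b1 b2] h; have hi := @n_hmod _ _ nM i; congr (_, _); apply: hi => A B nA nB.
    have [||[z1 z2] [[Az _] [Bz _]]] := h (A `*` setT) (B `*` setT).
    + by exists (A, setT) => //; split => //; exact: filterT.
    + by exists (B, setT) => //; split => //; exact: filterT.
    by exists z1.
  have [||[z1 z2] [[_ Az] [_ Bz]]] := h (setT `*` A) (setT `*` B).
  + by exists (setT, A) => //; split => //; exact: filterT.
  + by exists (setT, B) => //; split => //; exact: filterT.
  by exists z2.
- move=> i; rewrite openE => p ip; apply/(tangent_nbhs _ ip); exists setT => //; exact: filterT.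
- by move=> p; have [i ip] := n_cover nM (sval p).1; exists i.
- exact: tangent_chart_inj.
- by move=> i p X ip; exact: tangent_nbhs.
- move=> i; rewrite tangent_im => -[y v] [/= cy _] B [[B1 B2] [/= h1 h2] B12].
  have [y' [Iy' By']] := n_reg nM cy h1; exists (y', v); split; last first.
    by apply: B12; split => //; exact: nbhs_singleton.
  by exists (chart_im M i, setT) => //; split => //; exact: filterT.
- move=> i j w; rewrite tangent_rep_dom.
  have e : (rep_dom (@id M) i j `*` setT)° = (rep_dom (@id M) i j)° `*` [set: model M i].
    apply/seteqP; split => [p /interiorX[]//|p [h _]].
    by exists (rep_dom (@id M) i j, setT) => //; split => //; exact: filterT.
  have rD := @rep_dom_reg i j.
  have [pf cdf] := CW_ext_derive (@n_hmod _ _ nM j) rD (n_trans nM i j (true :: w)).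
  apply: (CW_ext (f := fun z : model M i * model M i => (chart_rep (@id M) i j z.1, dtrans j z.1 z.2))).
  + have := frame_lift true (frameT rD); rewrite e => -[h1 h2 h3 h4 h5]; split => //.
    by move=> c z Oz; have [Nz hN1 hN2] := h5 c z Oz; exists Nz => // z' u h6 h7 h8 _; exact: hN2.
  + move=> [y v] [[x [ix jx] /= <-] _]; rewrite chart_rep_id//.
    rewrite /chart_rep; case: xgetP => [z _ [q [iq jq e1 <-]]|].
      move: e1 => /= [e1 <-]; have ex := n_inj nM iq ix e1.
      by rewrite /= ex (@tangent_coord q i j)// -ex.
    move=> /(_ (chart M j x, dtrans j (chart M i x) v)) []; exists (tpoint v ix); split => //.
      exact: tpoint_chart.
    by rewrite /= tvecE.
  + rewrite e; apply: CW_pair => //.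
    by apply: (CW_complin (L := fst) _ _ _ _ (n_trans nM i j w)) => [|p []|p []|]//; exact: lincont_fst.
- by move=> i j p ip jp; rewrite !tangent_im_int; exact: (n_int nM).
Qed.

End tangent_of_nice.
End tangent_spaces.

Section tangent_families.
Context {R : realType}.
Implicit Types M N : charted_space R.

Definition wsT (l : nat) : set (seq bool) := fun w => exists2 n, (n <= l)%N & w = nseq n true.

Section tangent_map_of.
Variables (M N : charted_space R) (f : M -> N).
Hypotheses (nM : nice M) (nN : nice N) (hf : RC (Some 1%N) f).
Local Notation D i j := (rep_dom f i j).
Local Notation rep i j := (chart_rep f i j).

Lemma rep_open i j : open (dom M i `&` f @^-1` dom N j).
Proof.
have [cf _ _] := hf; apply: openI; first exact: (n_open nM).
by apply: open_comp; [move=> z _; exact: cf|exact: (n_open nN)].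
Qed.

Lemma rep_reg i j : regular_set (D i j).
Proof. by apply: chart_regular; [exact: nM|exact: rep_open|move=> ? []]. Qed.

Lemma rep_CW i j : CW [:: true] (fun _ => setT) (D i j)° (D i j) (rep i j).
Proof. by have [_ _ hC] := hf; apply: (is_C_CW (l := Some 1%N) (n := 1)) (hC i j) _ => //; [exact: n_hmod|exact: rep_reg]. Qed.

Lemma rep_int i j x : dom M i x -> dom N j (f x) -> formal_interior M x ->
  (D i j)° (chart M i x).
Proof.
move=> ix jx fx; rewrite /rep_dom setIC; apply: chart_int => //; last exact: fx.
by have [cf _ _] := hf; apply: cf; apply: open_nbhs_nbhs; split => //; exact: n_open.
Qed.

Lemma int_rep i j x : dom M i x -> (D i j)° (chart M i x) -> formal_interior M x.
Proof.
by move=> ix h; apply/(formal_interiorP nM ix); apply: interiorS h => _ [y [iy _] <-]; exists y.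
Qed.

Definition drep i j (x : M) (v : model M i) : model N j := ext_derive (D i j) (rep i j) (chart M i x) v.

Lemma drep_source i' i j x v : dom M i x -> dom M i' x -> dom N j (f x) ->
  drep j x (dtrans i (chart M i' x) v) = drep (i := i') j x v.
Proof.
move=> ix i'x jx; rewrite /drep /dtrans -{1}(chart_rep_id (i := i') (j := i) nM)//; symmetry.
have [P oP hP] := chart_image_open nM (openI (@n_open _ _ nM i') (@n_open _ _ nM i)) (@subIsetl _ _ _).
have Pi y : dom M i' y -> dom M i y -> P (chart M i' y).
  by move=> h1 h2; have : (chart M i' @` (dom M i' `&` dom M i)) (chart M i' y) by [exists y]; rewrite hP => -[].
have Di y : D i' j y -> P y -> exists z, [/\ dom M i' z, dom M i z, dom N j (f z) & chart M i' z = y].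
  move=> [z [iz jz] <-] Pz; have : (chart M i' @` (dom M i' `&` dom M i)) (chart M i' z) by rewrite hP; split => //; exists z.
  by move=> [z' [h1 h2] e]; exists z'; rewrite (n_inj nM h1 iz e) in h2 *.
apply: (ext_derive_comp (P := P)).
- exact: n_hmod.
- exact: n_hmod.
- exact: rep_reg.
- exact: rep_dom_reg.
- exact: rep_reg.
- by [].
- exact: Pi.
- by exists x.
- by move=> y [Dy Py]; have [z [h1 h2 _ <-]] := Di _ Dy Py; exists z.
- exact: n_trans.
- exact: rep_CW.
- by move=> y Dy Py; have [z [h1 h2 h3 <-]] := Di _ Dy Py; rewrite chart_rep_id//; exists z.
- move=> y Dy Py; have [z [h1 h2 h3 e]] := Di _ (interior_subset Dy) Py.
  rewrite -e chart_rep_id//; apply: rep_int => //; apply: (int_rep h1 (j := j)); by rewrite e.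
- by move=> y Dy Py; have [z [h1 h2 h3 <-]] := Di _ Dy Py; rewrite chart_rep_id// !chart_repE.
Qed.

Lemma drep_target i j j' x v : dom M i x -> dom N j (f x) -> dom N j' (f x) ->
  dtrans j' (chart N j (f x)) (drep (i := i) j x v) = drep j' x v.
Proof.
move=> ix jx j'x; rewrite /drep /dtrans -{1}(chart_repE (f := f) (i := i) (j := j) nM)//; symmetry.
have [P oP hP] := chart_image_open nM (@rep_open i j) (@subIsetl _ _ _).
have Pi y : dom M i y -> dom N j (f y) -> P (chart M i y).
  by move=> h1 h2; have : (chart M i @` (dom M i `&` f @^-1` dom N j)) (chart M i y) by [exists y]; rewrite hP => -[].
have Di y : D i j' y -> P y -> exists z, [/\ dom M i z, dom N j (f z), dom N j' (f z) & chart M i z = y].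
  move=> [z [iz jz] <-] Pz; have : (chart M i @` (dom M i `&` f @^-1` dom N j)) (chart M i z) by rewrite hP; split => //; exists z.
  by move=> [z' [h1 h2] e]; exists z; rewrite (n_inj nM h1 iz e) in h2 *.
apply: (ext_derive_comp (P := P)).
- exact: n_hmod.
- exact: n_hmod.
- exact: rep_reg.
- exact: rep_reg.
- exact: rep_dom_reg.
- by [].
- exact: Pi.
- by exists x.
- by move=> y [Dy Py]; have [z [h1 h2 h3 <-]] := Di _ Dy Py; exists z.
- exact: rep_CW.
- exact: n_trans.
- by move=> y Dy Py; have [z [h1 h2 h3 <-]] := Di _ Dy Py; rewrite chart_repE//; exists (f z).
- move=> y Dy Py; have [z [h1 h2 h3 e]] := Di _ (interior_subset Dy) Py.
  rewrite -e chart_repE//; apply: rep_dom_int => //.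
  have [_ hi _] := hf; apply: (hi z _ j h2); apply: (int_rep h1 (j := j')); by rewrite e.
- by move=> y Dy Py; have [z [h1 h2 h3 <-]] := Di _ Dy Py; rewrite !chart_repE// chart_rep_id.
Qed.

(** [tangent_map] picks its value by [xget]. A value exists because coordinates prescribed through
    one pair of charts satisfy the relations for all others, by [drep_source] and [drep_target]. *)
Lemma tangent_mapP p : (sval (tangent_map f p)).1 = f (sval p).1 /\
  forall i j, dom M i (sval p).1 -> dom N j (f (sval p).1) ->
    (sval (tangent_map f p)).2 j = drep j (sval p).1 ((sval p).2 i).
Proof.
rewrite /tangent_map; set Q := (X in xget _ X).
suff [q Qq] : exists q, Q q by case: xgetP => [q' _ [h1 h2]|/(_ q)].
have [i ix] := n_cover nM (sval p).1; have [j jx] := n_cover nN (f (sval p).1).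
exists (tpoint nN (drep j (sval p).1 ((sval p).2 i)) jx); split => // i' j' i'x j'x.
rewrite /= tvecE// drep_target// -/(drep j' (sval p).1 ((sval p).2 i')).
by rewrite (tangent_coord nM i'x ix) drep_source.
Qed.

End tangent_map_of.

Section tangent_family.
Variable (T : tvsType R).
Hypothesis hT : hausdorff_space T.
Variables (J : set T).

Definition lgoodA l M N (H : T -> M -> N) t x :=
  lgood J (fun _ => false) (fun _ => true) (wsT l) H t x.

Lemma RC_lgoodA l n M N (H : T -> M -> N) t : nice M -> nice N -> ipres J H -> J t -> (n <= l)%N ->
  (forall x, lgoodA l H t x) -> RC (Some n) (H t).
Proof.
move=> nM nN hi Jt nl lg.
have hJ (c : bool) : false -> open J by [].
have [_ h] := @RC_lgood R T hT (Some n) J (fun _ => false) (fun _ => true) (wsT l) [::] M N H t setT nM nN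
  hJ hi Jt (ex_intro2 _ _ 0%N (leq0n l) erefl) erefl
  (fun m (mn : (m <= n)%N) => ex_intro2 _ _ m (leq_trans mn nl) erefl) (@openT _) (fun x _ => lg x).
exact: h.
Qed.

(** In charts the tangent map of H t is (y, v) |-> (H_t(y), dH_t(y, v)). Its second part is the
    differential of the family with zero time component, so one order of differentiability is used
    up. *)
Lemma tangent_family l M N (H : T -> M -> N) : nice M -> nice N -> ipres J H ->
  (forall t x, J t -> lgoodA l.+1 H t x) ->
  (forall t p, J t -> lgoodA l (fun t => tangent_map (H t)) t p) /\
  ipres J (fun t => tangent_map (H t)).
Proof.
move=> nM nN hi lg.
have hRC t : J t -> RC (Some 1%N) (H t).
  by move=> Jt; apply: (RC_lgoodA nM nN hi Jt (ltn0Sn l)) => x; exact: lg.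
have nTM := nice_tangent nM; have nTN := nice_tangent nN.
have hJ (c : bool) : false -> open J by [].
split; last first.
  move=> t p Jt fp j jq; have [e1 _] := tangent_mapP nM nN (hRC t Jt) p.
  have [i ip] := n_cover nM (sval p).1.
  apply/(tangent_im_int nN); rewrite /=; move: jq; rewrite /= e1 => jq.
  apply: (hi t _ Jt _ j jq); apply/(formal_interiorP nM ip).
  by have := fp i ip; rewrite (tangent_im_int nM).
move=> t0 p0 Jt0; have [i [j [X [I0 [[oX Xx Xi oI It] [hd hl]]]]]] := lg t0 (sval p0).1 Jt0.
pose TX := [set p : tangent M | X (sval p).1].
have TXE : chart (tangent M) i @` TX = (chart M i @` X) `*` setT.
  apply/seteqP; split => [_ [p Xp <-]|[y v] [[x Xx' /= <-] _]].
    by split => //=; exists (sval p).1.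
  by exists (tpoint nM v (Xi _ Xx')) => //; exact: tpoint_chart.
have oTX : open TX.
  rewrite openE => p Xp; apply/(tangent_nbhs nM _ (Xi _ Xp)).
  have [P [oP Px hP]] := chart_nbhsP nM (open_nbhs_nbhs (conj oX Xp)) (Xi _ Xp).
  exists [set z | P z.1]; last by move=> q iq Pq; exact: hP.
  by exists (P, setT) => [|z []]//; split; [exact: open_nbhs_nbhs|exact: filterT].
exists i, j, TX, I0; split; first by split => // p Xp; exact: Xi.
have TH1 t p : J t -> (sval (tangent_map (H t) p)).1 = H t (sval p).1.
  by move=> Jt; have [] := tangent_mapP nM nN (hRC t Jt) p.
split; first by move=> t p Jt It' Xp; rewrite /= TH1//; exact: hd.
move=> _ [n nl ->].
have hw : wsT l.+1 (true :: nseq n true) by exists n.+1.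
have [hF [dF [pF hdF]]] : lrep J I0 (fun _ => false) (fun _ => true) H i j X (true :: nseq n true) := hl _ hw.
have dFE t x v : J t -> I0 t -> X x -> drep (H t) j x v = dF ((t, chart M i x), (0, v)).
  move=> Jt It' Xx'.
  have Xix := Xi _ Xx'.
  have DX : chart M i @` X `<=` rep_dom (H t) i j by move=> _ [y Xy <-]; exists y => //; split; [exact: Xi|exact: hd].
  have [P oP hP] := chart_image_open nM oX Xi.
  have Px : P (chart M i x) by have : (chart M i @` X) (chart M i x) by [exists x]; rewrite hP => -[].
  have DP y : rep_dom (H t) i j y -> P y -> (chart M i @` X) y.
    by move=> [z [iz _] <-] Pz; rewrite hP; split => //; exists z.
  apply: (@ext_deriveE _ _ _ _ P _ (fun z : model M i * model M i => dF ((t, z.1), (0, z.2)))) => //.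
  - exact: n_hmod.
  - exact: (rep_reg nM nN (hRC t Jt)).
  - by apply: DX; exists x.
  - move=> y u [Oy Py] _.
    have Oy' : (chart M i @` X)° y.
      have oDP : open ((rep_dom (H t) i j)° `&` P) by apply: openI => //; exact: open_interior.
      apply: (filterS (P := (rep_dom (H t) i j)° `&` P)); last exact: open_nbhs_nbhs.
      by move=> z [/interior_subset Dz Pz]; exact: DP.
    have := pF (t, y) (0, u) (conj (conj Jt It') Oy') (conj erefl I).
    apply: cvg_trans; apply: near_eq_cvg; near=> k.
    by rewrite /diff_quot /= scaler0 addr0.
  - apply: (cw_comp (D' := ((J `&` I0) `*` (chart M i @` X)) `*` md (fun _ => false) (fun _ => true) (E := model M i) true)
      (f := fun z : model M i * model M i => ((t, z.1), ((0 : T), z.2)))) (CW_cw hdF).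
      by move=> [y u] [/= [Dy Py] _]; split => //; split => //=; exact: DP.
    apply: cw_pair; apply: cw_pair; try by move=> z _; exact: cvg_cst.
      by apply: cw_lin; exact: lincont_fst.
    by apply: cw_lin; exact: lincont_snd.
have TOE : (chart (tangent M) i @` TX)° `<=` (chart M i @` X)° `*` setT.
  by rewrite TXE => z /interiorX[].
have TDE z : (chart (tangent M) i @` TX) z -> (chart M i @` X) z.1 by rewrite TXE => -[].
have frT := lrep_frame hT (fun _ => true) (J := J) nTM oTX (fun p (Xp : TX p) => Xi _ Xp : dom (tangent M) i p) oI hJ.
apply: (CW_ext (f := fun z : T * (model M i * model M i) =>
   (chart_rep (H z.1) i j z.2.1, dF ((z.1, z.2.1), (0, z.2.2))))) => //.
  move=> [t yv] [/= [Jt It'] [p Xp <-]] /=; rewrite chart_repE//; [|exact: Xi|exact: hd].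
  have jH : dom N j (H t (sval p).1) by exact: hd.
  have [e1 e2] := tangent_mapP nM nN (hRC t Jt) p.
  rewrite (chart_repE (f := tangent_map (H t)) (i := i) (j := j) (x := p) nTM); last 2 first.
  - exact: Xi.
  - by rewrite /= e1.
  by rewrite /= e1 (e2 i)//; [rewrite dFE|exact: Xi].
apply: CW_pair.
  apply: (CW_complin (L := fun z : T * (model M i * model M i) => (z.1, z.2.1)) _ _ _ _ hF).
  - by lincont.
  - by move=> [t z] [/= ? /TOE[? _]].
  - by move=> [t z] [h1 /TDE h2].
  - by move=> c [t z] [/= ? _].
apply: (CW_complin (L := fun z : T * (model M i * model M i) => ((z.1, z.2.1), (0, z.2.2))) _ _ _ _ hdF).
- apply: lincont_pair; first by lincont.
  by apply: lincont_pair; [exact: lincont0|lincont].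
- by move=> [t z] [/= ? /TOE[? _]]; split.
- by move=> [t z] [h1 /TDE h2]; split.
- by move=> c [t z] [/= ? _]; split.
Unshelve. all: by end_near.
Qed.

Lemma nice_iter_tangent n M : nice M -> nice (iter_tangent n M).
Proof. by move=> nM; elim: n => //= n; exact: nice_tangent. Qed.

Lemma iter_tangent_family n l M N (H : T -> M -> N) : nice M -> nice N -> ipres J H ->
  (forall t x, J t -> lgoodA (n + l) H t x) ->
  (forall t p, J t -> lgoodA l (fun t => iter_tangent_map n (H t)) t p) /\
  ipres J (fun t => iter_tangent_map n (H t)).
Proof.
move=> nM nN hi lg; elim: n l lg => [|n IH] l lg; first by split.
have [h1 h2] := IH l.+1 (fun t x Jt => eq_ind _ (fun k => lgoodA k H t x) (lg t x Jt) _ (addSnnS n l)).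
by apply: tangent_family => //; exact: nice_iter_tangent.
Qed.

(** The iterated tangent maps of a C^{0,l} family are jointly continuous in parameter and point, and
    over a compact set of points this continuity is uniform. So the family is continuous into the
    compact-open C^l-topology. *)
Lemma family_compact_open l M N (H : T -> M -> N) (W : set (compact_open_C l M N)) t0 :
  nice M -> nice N -> ipres J H -> (forall t x, J t -> lgoodA l H t x) -> J t0 ->
  nbhs (H t0 : compact_open_C l M N) W -> \forall t \near t0, J t -> W (H t).
Proof.
move=> nM nN hi lg Jt0; rewrite nbhsE => -[B [oB Bt0] BW]; case: oB Bt0 BW => O oO <- Bt0 BW.
suff : nbhs t0 (fun t => J t -> O (@jets R l M N (H t))) by apply: filterS => t h Jt; apply: BW; exact: h.
suff h : (fun t => @jets R l M N (H t)) @ within J (nbhs t0) --> @jets R l M N (H t0).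
  by apply: (h O); apply: open_nbhs_nbhs; split.
apply/cvg_sup => j U [V [[Wj oWj <-] WH] WU].
have jl : (j <= l)%N by rewrite -ltnS.
have := @iter_tangent_family j (l - j) M N H nM nN hi; rewrite subnKC// => /(_ lg)[h1 h2].
suff h : (fun t => iter_tangent_map j (H t) : {compact-open, iter_tangent j M -> iter_tangent j N}) @ within J (nbhs t0)
    --> (iter_tangent_map j (H t0) : {compact-open, iter_tangent j M -> iter_tangent j N}).
  have hW : nbhs t0 (fun t => J t -> Wj (iter_tangent_map j (H t))) := h Wj (open_nbhs_nbhs (conj oWj WH)).
  suff : nbhs t0 (fun t => J t -> U (@jets R l M N (H t))) by [].
  by apply: filterS hW => t hW Jt; apply: WU; exact: hW.
apply/compact_open_cvgP => K Q cK oQ KQ.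
have hP : forall p, K p -> \forall p' \near p & t \near within J (nbhs t0), Q (iter_tangent_map j (H t) p').
  move=> p Kp; have Qp : Q (iter_tangent_map j (H t0) p) by apply: KQ; exists p.
  have := lgood_cvg (nice_iter_tangent j nM) (nice_iter_tangent j nN) (ex_intro2 _ _ 0%N (leq0n (l - j)) erefl : wsT (l - j) [::])
    Jt0 (h1 t0 p Jt0) (open_nbhs_nbhs (conj oQ Qp)).
  move=> -[[A C] [/= hA hC] AC]; exists (C, J `&` A).
    by split => //=; apply: filterS hA => t At Jt.
  by move=> [p' t] [/= Cp' [Jt At]]; exact: (AC (t, p') (conj At Cp') (conj Jt I)).
have FF : Filter (within J (nbhs t0)) by exact: within_filter.
have h : nbhs t0 (fun t => J t -> K `<=` (fun p => Q (iter_tangent_map j (H t) p))) :=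
  (proj1 (compact_near_coveringP _)) cK _ _ (fun t p => Q (iter_tangent_map j (H t) p)) FF hP.
suff : nbhs t0 (fun t => J t -> iter_tangent_map j (H t) @` K `<=` Q) by [].
by apply: filterS h => t h Jt _ [p Kp <-]; exact: h.
Qed.

End tangent_family.
End tangent_families.

(** * Smoothing a section near a point *)

Section bundle_models.
Context {R : realType}.
Implicit Types M N F : charted_space R.

Lemma hausdorffX (E1 E2 : topologicalType) : hausdorff_space E1 -> hausdorff_space E2 -> hausdorff_space (E1 * E2)%type.
Proof.
move=> h1 h2 [a1 a2] [b1 b2] h; congr (_, _); [apply: h1|apply: h2] => A B nA nB.
  have [||[z1 z2] [[Az _] [Bz _]]] := h (A `*` setT) (B `*` setT).
  - by exists (A, setT) => //; split => //; exact: filterT.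
  - by exists (B, setT) => //; split => //; exact: filterT.
  by exists z1.
have [||[z1 z2] [[_ Az] [_ Bz]]] := h (setT `*` A) (setT `*` B).
- by exists (setT, A) => //; split => //; exact: filterT.
- by exists (setT, B) => //; split => //; exact: filterT.
by exists z2.
Qed.

Variables (M N : charted_space R) (pi : N -> M).

(* A local trivialization of the bundle written in a chart i of M and a chart j
   of N: cj is the fibre coordinate, and Phi recovers a point of the bundle from
   its base point and its fibre coordinate. *)
Record bmodel (i : idx M) (j : idx N) (G : tvsType R) (Tube : set N) (cj : model N j -> G)
    (Phi : model M i * G -> model N j) (B : set (model M i * G)) : Prop := BModel {
  bm_hG : hausdorff_space G;
  bm_open : open Tube;
  bm_j : Tube `<=` dom N j;
  bm_i : forall z, Tube z -> dom M i (pi z);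
  bm_c : forall w, CW w (fun _ => setT) (chart N j @` Tube)° (chart N j @` Tube) cj;
  bm_regB : regular_set B;
  bm_Phi : forall w, CW w (fun _ => setT) B° B Phi;
  bm_cB : forall z, Tube z -> B (chart M i (pi z), cj (chart N j z)) /\
    Phi (chart M i (pi z), cj (chart N j z)) = chart N j z;
  bm_BPhi : forall x g, dom M i x -> B (chart M i x, g) -> exists z,
    [/\ Tube z, pi z = x, chart N j z = Phi (chart M i x, g) &
        formal_interior M x -> formal_interior N z];
  bm_Bim : forall p, B p -> chart_im M i p.1;
  bm_Bopen : forall p, B p -> exists P, [/\ open P, P p & forall q, P q -> chart_im M i q.1 -> B q] }.

(** A local trivialization restricted to charts. The fibre has no boundary, so the image of its
    chart is open and B is open relative to [chart_im M i] x G: small changes of the fibre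
    coordinate stay in B, even over boundary points of M. *)
Lemma bmodel_exists z0 i : nice M -> nice N -> smooth_fibre_bundle pi -> dom M i (pi z0) ->
  exists j G Tube cj Phi B, Tube z0 /\ @bmodel i j G Tube cj Phi B.
Proof.
move=> nM nN [_ [cpi _ _] _ hloc] ix0.
have [U [oU Ux [F [[rF oF] [th [th' [thK th'K [cth _ hth] [cth' ith' hth'] hpi]]]]]]] := hloc (pi z0).
have nF := nice_of_rough rF.
have [j jz] := n_cover nN z0.
have Uz0 : (pi @^-1` U) z0 by [].
pose zz0 : restr N (pi @^-1` U) := SigSub (mem_set Uz0).
have [k kf] := n_cover nF (th zz0).2.
have oNU : open (pi @^-1` U) by apply: open_comp => // *; exact: cpi.
pose A' := [set z : restr N (pi @^-1` U) | [/\ dom N j (set_val z), dom M i (pi (set_val z)) & dom F k (th z).2]].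
pose Tube : set N := set_val @` A'.
have domE (z : restr N (pi @^-1` U)) : dom (prod_space (restr M U) F) (i, k) (th z) <->
    dom M i (pi (set_val z)) /\ dom F k (th z).2.
  by split => [[/= h1 h2]|[h1 h2]]; split => //=; [rewrite -hpi|rewrite hpi].
have Tj : Tube `<=` dom N j by move=> _ [z [h1 h2 h3] <-].
have oT : open Tube.
  rewrite openE => _ [z [h1 h2 h3] <-].
  have n3 : nbhs z (fun z => dom F k (th z).2).
    have := cth z; move=> /(_ [set p | dom F k p.2]); apply.
    exists (setT, dom F k) => [|p []//]; split; first exact: filterT.
    by apply: open_nbhs_nbhs; split => //; exact: (n_open nF).
  have [Y nY hY] := (nbhs_set_type _ _).1 n3.
  have nU : nbhs (set_val z) (pi @^-1` U) by apply: open_nbhs_nbhs; split => //; exact: (set_valP z).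
  have nj : nbhs (set_val z) (dom N j) by apply: open_nbhs_nbhs; split => //; exact: (n_open nN).
  have ni : nbhs (set_val z) (pi @^-1` dom M i).
    by apply: cpi; apply: open_nbhs_nbhs; split => //; exact: (n_open nM).
  apply: filterS (filterI (filterI nY nU) (filterI nj ni)) => z' [[Yz' Uz'] [jz' iz']].
  by exists (SigSub (mem_set Uz')) => //; split => //; exact: hY.
pose A := chart N j @` Tube.
have AE : rep_dom th j (i, k) = A.
  apply/seteqP; split => [_ [z [jz' /domE[h1 h2]] <-]|_ [_ [z [h1 h2 h3] <-] <-]].
    by exists (set_val z) => //; exists z.
  by exists z => //; split => //; exact/domE.
have thE z : A' z -> chart_rep th j (i, k) (chart N j (set_val z)) = (chart M i (pi (set_val z)), chart F k (th z).2).
  move=> [h1 h2 h3]; rewrite /chart_rep; case: xgetP => [y _ [z' [jz' _ e <-]]|].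
    have -> : z' = z by apply: val_inj; exact: (n_inj nN jz' h1 e).
    by rewrite /= hpi.
  by move=> /(_ (chart M i (pi (set_val z)), chart F k (th z).2)) []; exists z; split => //; [exact/domE|rewrite /= hpi].
have rA : regular_set A by exact: chart_regular.
pose cj (y : model N j) : model F k := (chart_rep th j (i, k) y).2.
have hG := @n_hmod _ _ nF k.
pose B := rep_dom th' (i, k) j.
pose Phi : model M i * model F k -> model N j := chart_rep th' (i, k) j.
have BE x f : dom M i (set_val x) -> dom F k f -> dom N j (set_val (th' (x, f))) ->
    B (chart M i (set_val x), chart F k f) /\ Phi (chart M i (set_val x), chart F k f) = chart N j (set_val (th' (x, f))).
  move=> ix kf' jx; split; first by exists (x, f).
  rewrite /Phi /chart_rep; case: xgetP => [y _ [[x' f'] [[/= ix' kf''] jx' [e1 e2] <-]]|].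
    have -> : x' = x by apply: val_inj; exact: (n_inj nM ix' ix e1).
    by rewrite (n_inj nF kf'' kf' e2).
  by move=> /(_ (chart N j (set_val (th' (x, f))))) []; exists (x, f).
have Bim p : B p -> chart_im M i p.1 by move=> [[x f] [[/= ix kf'] _] <-]; exists (set_val x).
have Bopen p : B p -> exists P, [/\ open P, P p & forall q, P q -> chart_im M i q.1 -> B q].
  move=> [[x f] [[/= ix kf'] jx] <-].
  have : nbhs (x, f) (fun q => dom N j (set_val (th' q))).
    have nD : nbhs (th' (x, f)) (dom (restr N (pi @^-1` U)) j).
      by apply/nbhs_set_type; exists (dom N j) => //; apply: open_nbhs_nbhs; split => //; exact: (n_open nN).
    exact: (cth' (x, f) _ nD).
  move=> -[[X Y] [/= nX nY] XY].
  have [Z nZ hZ] := (nbhs_set_type _ _).1 nX.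
  have nU : nbhs (set_val x) U by apply: open_nbhs_nbhs; split => //; exact: (set_valP x).
  have [P1 nP1 hP1] := (n_nbhs nM _ ix).1 (filterI nZ nU).
  have [P2 nP2 hP2] := (n_nbhs nF _ kf').1 nY.
  have nim : nbhs (chart F k f) (chart_im F k) by apply: open_nbhs_nbhs; split; [exact: oF|exists f].
  exists (P1° `*` (P2 `&` chart_im F k)°); split.
  - by apply: openX; exact: open_interior.
  - by split => //=; exact: (filterI nP2 nim).
  - move=> [y g] [/= /interior_subset P1y /interior_subset[P2g [f' kf'' ef]]] [x' ix' ex].
    rewrite -ex in P1y *; have [Zx' Ux'] := hP1 _ ix' P1y.
    exists (SigSub (mem_set Ux'), f') => //; last by rewrite /= ef.
    split => //=; apply: (XY (SigSub (mem_set Ux'), f')); split => /=.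
      exact: (hZ (SigSub (mem_set Ux'))).
    by apply: hP2 => //; rewrite ef.
have rB : regular_set B.
  apply: regular_loc => p Bp; have [P [oP Pp hP]] := Bopen p Bp; exists P; split => //.
  have -> : B `&` P = (chart_im M i `*` setT) `&` P.
    apply/seteqP; split => [q [Bq Pq]|q [[cq _] Pq]]; split => //; last exact: hP.
    by split => //; exact: Bim.
  apply: regular_openI => // -[y g] [/= cy _] Q [[Q1 Q2] [/= h1 h2] Q12].
  have [y' [Iy' Qy']] := n_reg nM cy h1; exists (y', g); split; last first.
    by apply: Q12; split => //; exact: nbhs_singleton.
  by exists (chart_im M i, setT) => //; split => //; exact: filterT.
exists j, (model F k), Tube, cj, Phi, B; split; first by exists zz0.
split => //.
- by move=> _ [z [h1 h2 h3] <-].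
- move=> w; apply: (CW_postlin (L := snd)); first exact: lincont_snd.
  have := hth j (i, k); rewrite AE => hc.
  apply: (CW_constV (w := nseq (size w) true)); first by rewrite size_nseq.
  apply: (is_C_CW (l := None)) hc _ => //.
  by apply: hausdorffX => //; exact: (n_hmod nM).
- move=> w; apply: (CW_constV (w := nseq (size w) true)); first by rewrite size_nseq.
  by apply: (is_C_CW (l := None)) (hth' (i, k) j) _ => //; exact: (n_hmod nN).
- move=> _ [z Az <-]; have [h1 h2 h3] := Az.
  rewrite /cj thE//=.
  have e : th' (th z) = z by exact: thK.
  have [x [f ex]] : exists x f, th z = (x, f) by case: (th z) => x f; exists x, f.
  have hx : set_val x = pi (set_val z) by rewrite -hpi ex.
  have := BE x f; rewrite hx -ex e => hh.
  by rewrite ex in h3 *; exact: hh.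
- move=> x g ix [[x' f] [[/= ix' kf'] jx] [e1 e2]].
  have ex := n_inj nM ix' ix e1.
  have [_ hPhi] := BE x' f ix' kf' jx.
  exists (set_val (th' (x', f))).
  have e3 : pi (set_val (th' (x', f))) = x by rewrite -hpi th'K.
  split => //.
  + exists (th' (x', f)) => //; split => //; first by rewrite e3.
    by rewrite th'K.
  + by rewrite -hPhi ex e2.
  + move=> fx j' jj; apply: (interiorS _ (ith' (x', f) _ j' jj)).
      by move=> _ [y jy <-]; exists (set_val y).
    move=> [i' k'] [/= ix'' kf'']; rewrite ex in ix'' *.
    have nU : nbhs x U by rewrite -ex; apply: open_nbhs_nbhs; split => //; exact: (set_valP x').
    exists (chart M i' @` (U `&` dom M i'), chart_im F k').
      split => /=; first by apply: (chart_int nM nU ix''); exact: fx.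
      by apply: open_nbhs_nbhs; split; [exact: oF|exists f].
    move=> [y g'] [/= [y' [Uy' iy'] <-] [f' kf3 <-]].
    by exists (SigSub (mem_set Uy'), f').
Qed.

End bundle_models.

Section smoothing_step.
Context {R : realType}.

Definition I2 : set R^o := [set t | 0 <= t <= 2].
Definition J2 : set R^o := [set t | 0 < t < 2].

Lemma open_J2 : open J2.
Proof.
rewrite (_ : J2 = `]0, 2[%classic); first exact: (@interval_open R (BRight _) (BLeft _)).
by apply/seteqP; split => t; rewrite /= in_itv.
Qed.

Lemma compact_I2 : compact I2.
Proof.
rewrite (_ : I2 = `[0, 2]%classic); first exact: segment_compact.
by apply/seteqP; split => t; rewrite /= in_itv.
Qed.

Lemma J2_convex (t s r : R) : J2 t -> J2 (t + s) -> 0 <= r <= 1 -> J2 (t + r * s).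
Proof.
rewrite /J2 /= => /andP[a1 a2] /andP[a3 a4] /andP[r0 r1].
have -> : t + r * s = (1 - r) * t + r * (t + s) by ring.
have [r2|/ltW r2] := leP r (1 / 2).
  have h1 : 0 <= (1 / 2 - r) * t by rewrite mulr_ge0// ?subr_ge0// ltW.
  have h2 : 0 <= r * (t + s) by rewrite mulr_ge0// ltW.
  have h3 : 0 <= (1 / 2 - r) * (2 - t) by rewrite mulr_ge0 ?subr_ge0// ltW.
  have h4 : 0 <= r * (2 - (t + s)) by rewrite mulr_ge0 ?subr_ge0// ltW.
  by apply/andP; split; lra.
have h1 : 0 <= (1 - r) * t by rewrite mulr_ge0 ?subr_ge0// ltW.
have h2 : 0 <= (r - 1 / 2) * (t + s) by rewrite mulr_ge0 ?subr_ge0// ltW.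
have h3 : 0 <= (1 - r) * (2 - t) by rewrite mulr_ge0 ?subr_ge0// ltW.
have h4 : 0 <= (r - 1 / 2) * (2 - (t + s)) by rewrite mulr_ge0 ?subr_ge0// ltW.
by apply/andP; split; lra.
Qed.

Lemma J2_I2 : J2 `<=` I2.
Proof. by move=> t /andP[h1 h2]; apply/andP; split; exact: ltW. Qed.

Variables (E G : tvsType R) (l : nat) (K O : set E) (J : nat -> finType).
Variables (beta : forall n, J n -> E -> R^o) (nu : forall n, J n -> E) (h : E -> R^o).
Hypotheses (hE : hausdorff_space E) (hG : hausdorff_space G).
Hypotheses (sm : smoothing l K O beta nu) (oO : open O) (OK : O `<=` K) (KO : K `<=` closure O).
Hypothesis (hh : forall w, CW w (fun _ => setT) O K h).

Definition Sg (g : R^o * E -> G) (q : R^o * (R^o * E)) : G := interp (Sop beta nu g) q.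
Definition gg (g : R^o * E -> G) (q : R^o * (R^o * E)) : G := g q.2 + h q.2.2 *: (Sg g q - g q.2).

Lemma gg0 g t y : gg g (0, (t, y)) = g (t, y).
Proof. by rewrite /gg /Sg /interp /= eqxx /Sop /= eqxx subrr scaler0 addr0. Qed.

Lemma gg_h0 g q : h q.2.2 = 0 -> gg g q = g q.2.
Proof. by rewrite /gg => ->; rewrite scale0r addr0. Qed.

Lemma CW_comb w (X : tvsType R) V (OX DX : set X) (u v : X -> G) (k : X -> R^o) :
  CW w V OX DX u -> CW w V OX DX v -> CW w V OX DX k -> CW w V OX DX (fun x => u x + k x *: (v x - u x)).
Proof.
move=> hu hv hk; apply: CWD => //; apply: CWZ => //; apply: CWD => //.
rewrite (_ : (fun x => - u x) = fun x => (-1 : R^o) *: u x); last by apply/funext => x; rewrite scaleN1r.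
by apply: CWZ => //; exact: CW_cst.
Qed.

Lemma CW_h (T : tvsType R) w V (JT : set T) : CW w V (JT `*` O) (JT `*` K) (fun p => h p.2).
Proof.
apply: (CW_complin (L := snd) _ _ _ _ (hh w)); first exact: lincont_snd.
- by move=> x [].
- by move=> x [].
- by [].
Qed.

Lemma CW_gg (g : R^o * E -> G) :
  CW (nseq l true) (md (fun _ => false) (fun _ => true) (E := E)) (I2 `*` O) (I2 `*` K) g ->
  CW (nseq l true) (fun _ => [set 0] `*` ([set 0] `*` setT)) (Rp `*` (I2 `*` O)) (Rp `*` (I2 `*` K)) (gg g).
Proof.
move=> hg.
have hg2 : CW (nseq l true) (fun _ => [set 0] `*` ([set 0] `*` setT)) (Rp `*` (I2 `*` O)) (Rp `*` (I2 `*` K)) (fun q : R^o * (R^o * E) => g q.2).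
  apply: (CW_complin (L := snd) _ _ _ _ hg); first exact: lincont_snd.
  - by move=> x [].
  - by move=> x [].
  - by move=> c x [].
apply: CW_comb => //.
  apply: (CW_interp (V := fun _ => [set 0] `*` setT)).
    by move=> [t y] [/= ? /OK].
  apply: CW_Sp.
    have := @frame_md R R^o hausdorff_R (fun _ => false) (fun _ => true) E I2 O K hE.
    by apply.
  exact: (sm_cw sm hausdorff_R hg).
apply: (CW_complin (L := snd) (V := fun _ => setT) (O := I2 `*` O) (D := I2 `*` K)) (CW_h _ _ _); first exact: lincont_snd.
- by move=> x [].
- by move=> x [].
- by [].
Qed.

(** The node y may lie outside O, where time derivatives are not given; they extend from O to K by
    [CW_dense]. Convexity of ]0,2[ keeps the approximating time segments inside it. *)
Lemma CW_node (g : R^o * E -> G) y w : K y ->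
  (forall k, CW (nseq k false) (md negb id (E := E)) (J2 `*` O) (J2 `*` K) g) ->
  CW w (fun _ => setT) J2 J2 (fun t => g (t, y)).
Proof.
move=> Ky hg; apply: (CW_constV (w := nseq (size w) false)); first by rewrite size_nseq.
have frK : frame (fun _ : bool => [set: R^o] `*` [set (0 : E)]) (J2 `*` K) (J2 `*` K).
  split => //.
  - exact: subset_closure.
  - by move=> _; apply: subspX; [|exact: subsp0].
  - move=> _; apply: closedI; first by apply: closed_comp => // z _; exact: cvg_fst.
    by apply: closed_comp; [move=> z _; exact: cvg_snd|exact: closed0].
  - move=> _ [t z] [/= Jt Kz]; have [N N0 hN] := vopenT open_J2 setT Jt.
    exists (N `*` setT); first by exists (N, setT) => //; split => //; exact: filterT.
    move=> [t' z'] [s v] [/= Jt' Kz'] [/= h1 _] [/= h2 _] [_ /= ->].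
    by rewrite addr0; split => //=; exact: hN.
have frJ : frame (fun _ : bool => [set: R^o]) J2 J2.
  split => //; first exact: subset_closure.
  by move=> _; exact: vopenT open_J2 setT.
have h1 : CW (nseq (size w) false) (fun _ => setT `*` [set (0 : E)]) (J2 `*` O) (J2 `*` K) g.
  apply: (CW_subw _ _ _ (hg (size w))) => // c; rewrite mem_nseq => /andP[_ /eqP ->].
  by move=> [s v] [].
have h2 : CW (nseq (size w) false) (fun _ => setT `*` [set (0 : E)]) (J2 `*` K) (J2 `*` K) g.
  apply: (CW_dense (O1 := J2 `*` O)) => //; first by move=> [t z] [/= ? /OK].
  move=> _ [t z] _; exists setT; first exact: filterT.
  move=> [t' z'] [s v] [/= Jt' Kz'] _ [_ /= v0] _ [/= Js _] W W0.
  have [[W1 W2] [/= n1 n2] W12] := W0.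
  have [z1 [Oz1 Wz1]] : exists z1, O z1 /\ W2 (z1 - z').
    apply: (KO Kz').
    exact: nbhs_sub.
  exists (t', z1), (s, v); split => //=.
  - by apply: W12; split => //=; rewrite subrr; exact: nbhs_singleton.
  - by rewrite subrr; exact: nbhs_singleton.
  - move=> r r01; rewrite v0 scaler0 addr0; split => //=.
    exact: J2_convex.
apply: (CW_comp (g := fun t => (t, y)) frK frJ _ _ _ _ h2) => //.
- by move=> _ t1 t2 _ _ _; split => //=; rewrite subrr.
- by apply: CW_pair; [apply: CW_lin; exact: lincont_id|exact: CW_cst].
Qed.

Lemma frame_J2 : frame (fun _ => setT) (J2 `*` O) (J2 `*` K).
Proof.
have fr := @frame_md R R^o hausdorff_R (fun _ => true) (fun _ => true) E J2 O K hE.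
have {}fr := fr (fun _ _ => open_J2) oO OK KO.
by split; [exact: fr_sub fr|exact: fr_dense fr|by []|by move=> _; exact: closedT|move=> _; apply: vopenT; apply: openX => //; exact: open_J2].
Qed.

(* Near a point with t > 0 the sum defining the smoothed map is finite, and only the
   values at finitely many nodes enter, which depend smoothly on t. *)
Lemma CW_Sg (g : R^o * E -> G) (e : R) w : 0 < e ->
  (forall k, CW (nseq k false) (md negb id (E := E)) (J2 `*` O) (J2 `*` K) g) ->
  CW w (fun _ => setT) (J2 `*` O) (J2 `*` K) (fun p => Sg g (e * p.1, p)).
Proof.
move=> e0 hg; apply: CW_glue => //; first exact: frame_J2.
move=> [t0 y0] [/= /andP[t00 t02] Ky0].
pose N : set (R^o * E) := [set t : R^o | t0 / 2 < t] `*` setT.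
have oN : open N.
  apply: openX; last exact: openT.
  by have := @open_gt R (t0 / 2).
exists N; split => //; first by split => //=; lra.
pose n0 := (Num.truncn (e * (t0 / 2))^-1).+1.
have ht : 0 < e * (t0 / 2) by apply: mulr_gt0 => //; lra.
apply: (CW_ext (f := fun p : R^o * E => \sum_(n < n0) (chi n (e * p.1) : R^o) *:
   (\sum_(j : J n) (beta j p.2 : R^o) *: g (p.1, nu j)))).
- by apply: frame_open => //; exact: frame_J2.
- move=> [t y] [[/= /andP[h1 h2] Ky] [/= h3 _]].
  rewrite /Sg (interpE _ (N := n0))//=.
  + by apply: eq_bigr => n _; rewrite /Sop /= gt_eqF ?invr_gt0 ?ltr0n// snumE.
  + exact: mulr_gt0.
  + apply: le_trans (ltW (truncnS_gt _)); rewrite lef_pV2 ?posrE// ?mulr_gt0//.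
    by rewrite ler_pM2l// ltW.
- apply: CW_sum => n _; apply: CWZ.
    apply: CW_chi; first by move=> [t y] [[/= ? /OK ?] ?].
    by apply: CWM; [exact: CW_cst|apply: CW_lin; exact: lincont_fst].
  apply: CW_sum => j _; apply: CWZ.
    apply: (CW_complin (L := snd) _ _ _ _ (sm_beta sm j w)) => //; first exact: lincont_snd.
      by move=> x [[]].
    by move=> x [[]].
  apply: (CW_complin (L := fst) _ _ _ _ (CW_node w (sm_node sm j) hg)) => //; first exact: lincont_fst.
    by move=> x [[]].
  by move=> x [[]].
Qed.

End smoothing_step.

Section reparametrization.
Context {R : realType}.
Variables (T T' : tvsType R) (M N : charted_space R).
Hypotheses (hT : hausdorff_space T) (hT' : hausdorff_space T') (nM : nice M).

(** Nothing is differentiated in the parameter here, so a continuous change of parameter is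
    harmless. *)
Lemma lgoodA_reparam (J : set T) (J' : set T') (psi : T' -> T) l (H : T -> M -> N) t x :
  J' t -> (forall s, J' s -> J (psi s)) -> cw J' psi ->
  lgoodA J l H (psi t) x -> lgoodA J' l (fun s => H (psi s)) t x.
Proof.
move=> Jt hJ cpsi [i [j [X [I [[oX Xx Xi oI It] [h1 h2]]]]]].
have nI : nbhs t [set s | J' s -> I (psi s)].
  by apply: (cvgw_near (cpsi _ Jt)); exact: open_nbhs_nbhs.
exists i, j, X, [set s | J' s -> I (psi s)]°; split; last split.
- by split => //; exact: open_interior.
- by move=> s y Js /interior_subset Is Xy; apply: h1 => //; [exact: hJ|exact: Is].
move=> w ww; have /= hw := h2 w ww.
have fr := lrep_frame (a := fun _ => false) hT (fun _ => true) nM oX Xi oI (fun c => False_rect _ \o notF).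
apply: (CW_comp (g := fun p : T' * model M i => (psi p.1, p.2)) (fr J) _ _ _ _ _ hw).
- by apply: lrep_frame => //; exact: open_interior.
- by move=> [s y] [/= [Js /interior_subset Is] Xy]; split => //; split; [exact: hJ|exact: Is].
- by move=> [s y] [/= [Js /interior_subset Is] Xy]; split => //; split; [exact: hJ|exact: Is].
- move=> c [s y] [s' y'] _ _ [/= /eqP e _]; split => //=.
  by move: e; rewrite subr_eq0 => /eqP ->; rewrite subrr.
- apply: CW_pair; last by apply: CW_lin; exact: lincont_snd.
  apply: CW_inv_dir.
  + by move=> c; apply: subspX; [exact: subsp0|].
  + apply: (cw_comp (D' := J') (f := fst) (g := psi)) => //; first by move=> [s y] [[]].
    by apply: cw_lin; exact: lincont_fst.
  + by move=> c [s y] [s' y'] [/= -> _]; rewrite addr0.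
Qed.

End reparametrization.

Section families_of_sections.
Context {R : realType}.
Variables (M N : charted_space R) (pi : N -> M) (l : nat).

Definition wsB : set (seq bool) := fun w => exists n k, (n <= l)%N /\ w = nseq n true ++ nseq k false.

Definition goodC (H : R^o -> M -> N) t x := lgood J2 (fun _ => true) (fun _ => true) setT H t x.

(* C^{0,l} on [0,2], C^{oo,l} on ]0,2[ *)
Record section_family (H : R^o -> M -> N) : Prop := SectionFamily {
  sf_A : forall t x, I2 t -> lgoodA I2 l H t x;
  sf_B : forall t x, J2 t -> lgood J2 negb id wsB H t x;
  sf_int : ipres I2 H;
  sf_pi : forall t x, I2 t -> pi (H t x) = x }.

Definition P2 : set (R^o * R^o) := [set e : R^o | 0 <= e <= 1] `*` I2.

(** HH e is a deformation of strength e, supported in Lb, which keeps the start t = 0 fixed and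
    creates smoothness over L' for 0 < t < 2. The strength is left free because gluing must shrink
    it to respect further open conditions, which regularity in (e, t) on [P2] makes possible. [Tube]
    is the region where fibre coordinates are available. *)
Definition deformable (Lb L' : set M) (Tube : set N) := forall H, section_family H ->
  (forall t x, I2 t -> Lb x -> Tube (H t x)) ->
  exists HH : R^o -> R^o -> M -> N,
  [/\ forall t x, I2 t -> HH 0 t x = H t x,
      forall e x, HH e 0 x = H 0 x,
      forall e t x, I2 t -> ~ Lb x -> HH e t x = H t x,
      ipres P2 (fun p => HH p.1 p.2) /\ (forall p x, P2 p -> lgoodA P2 l (fun p => HH p.1 p.2) p x) &
      forall e, 0 < e <= 1 -> section_family (HH e) /\
        forall t x, J2 t -> goodC H t x \/ L' x -> goodC (HH e) t x].

End families_of_sections.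

(** * The deformation in one bundle chart *)

Section local_step.
Context {R : realType}.
Variables (M N : charted_space R) (pi : N -> M).
Hypotheses (nM : nice M) (nN : nice N).
Variables (i : idx M) (j : idx N) (G : tvsType R) (Tube : set N) (cj : model N j -> G)
  (Phi : model M i * G -> model N j) (B : set (model M i * G)).
Hypothesis bm : bmodel pi Tube cj Phi B.
Variables (K O : set (model M i)) (X : set M).
Hypotheses (oO : open O) (OK : O `<=` K) (KO : K `<=` closure O) (Kim : K `<=` chart_im M i).
Hypotheses (oX : open X) (Xi : X `<=` dom M i) (XK : forall x, X x -> K (chart M i x))
  (IO : K° `<=` O).
Let Lb : set M := [set x | dom M i x /\ K (chart M i x)].
Implicit Types (T : tvsType R).

Definition fib (T : tvsType R) (H : T -> M -> N) (p : T * model M i) : G := cj (chart_rep (H p.1) i j p.2).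

Lemma fibE T (H : T -> M -> N) t x : dom M i x -> Tube (H t x) -> fib H (t, chart M i x) = cj (chart N j (H t x)).
Proof. by move=> ix Tx; rewrite /fib /= chart_repE//; exact: (bm_j bm). Qed.

Lemma CW_fib T (J : set T) (a b : bool -> bool) (ws : set (seq bool)) w0 (H : T -> M -> N) : hausdorff_space T ->
  (forall c, a c -> open J) -> ipres J H -> ws w0 ->
  (forall t x, J t -> Lb x -> Tube (H t x)) -> (forall t x, J t -> Lb x -> lgood J a b ws H t x) ->
  forall w, ws w -> CW w (md a b (E := model M i)) (J `*` O) (J `*` K) (fib H).
Proof.
move=> hT hJ hi hw0 hTube hl w ww.
have fr : frame (md a b (E := model M i)) (J `*` O) (J `*` K).
  by apply: frame_md => //; exact: (n_hmod nM).
have LbE y : K y -> exists2 x, Lb x & chart M i x = y.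
  by move=> Ky; have [x ix e] := Kim Ky; exists x => //; split => //; rewrite e.
have h1 : CW w (md a b (E := model M i)) (J `*` O) (J `*` K) (fun p => chart_rep (H p.1) i j p.2).
  apply: CW_glue => //; first exact: (n_hmod nN).
  move=> [t0 y0] [/= Jt0 Ky0]; have [x0 Lx0 ex0] := LbE _ Ky0.
  have Tx0 := hTube _ _ Jt0 Lx0.
  have := lgood_charts hT nM nN hJ hi hw0 Jt0 Lx0.1 (bm_j bm Tx0) (hl _ _ Jt0 Lx0).
  move=> [X1 [I [[oX1 X1x X1i oI It] [hd hr]]]].
  have [P [oP Px hP imP _]] := glue_nbhd nM oX1 X1x X1i (@subset_refl _ (dom M i)).
  exists (I `*` P); split; [exact: openX|by split => //=; rewrite -ex0|].
  apply: (CW_sub _ _ _ (hr w ww)).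
  - move=> [t y] [[/= Jt Oy] [/= It' Py]]; split => //=.
    apply: filterS (filterI (open_nbhs_nbhs (conj oO Oy)) (open_nbhs_nbhs (conj oP Py))) => z [Oz Pz].
    by rewrite -imP; split => //; apply: Kim; exact: OK.
  - move=> [t y] [[/= Jt Ky] [/= It' Py]]; split => //=.
    by have : (chart_im M i `&` P) y; [split => //; exact: Kim|rewrite imP].
  - by move=> c p.
have rT : regular_set (chart N j @` Tube).
  by apply: chart_regular => //; [exact: (bm_open bm)|exact: (bm_j bm)].
apply: (CW_comp (frameT rT) fr _ _ _ h1 (bm_c bm w)) => //.
- move=> [t y] [/= Jt Ky]; have [x Lx <-] := LbE _ Ky.
  have Tx := hTube _ _ Jt Lx.
  by rewrite chart_repE//; [exists (H t x)|exact: Lx.1|exact: (bm_j bm)].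
- move=> [t y] [/= Jt Oy]; have [x Lx e] := LbE _ (OK Oy).
  have Tx := hTube _ _ Jt Lx; rewrite -e chart_repE//; [|exact: Lx.1|exact: (bm_j bm)].
  have fx : formal_interior M x.
    apply/(formal_interiorP nM Lx.1); rewrite e.
    by apply: filterS (open_nbhs_nbhs (conj oO Oy)) => z /OK /Kim.
  have := chart_int nN (open_nbhs_nbhs (conj (bm_open bm) Tx)) (bm_j bm Tx) (hi _ _ Jt fx _ (bm_j bm Tx)).
  by apply: interiorS => _ [z [Tz _] <-]; exists z.
Qed.

Lemma chart_XO (X1 : set M) : X1 `<=` X -> (chart M i @` X1)° `<=` O.
Proof.
move=> h y hy; apply: IO; apply: interiorS hy => _ [x X1x <-].
by apply: XK; exact: h.
Qed.

Lemma lift_lgood T (J I : set T) (a b : bool -> bool) (ws : set (seq bool)) (H' : T -> M -> N) (ga : T * model M i -> G) t0 x0 (X1 : set M) :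
  hausdorff_space T -> (forall c, a c -> open J) ->
  open X1 -> X1 x0 -> X1 `<=` X -> open I -> I t0 ->
  (forall t x, J t -> I t -> X1 x -> [/\ B (chart M i x, ga (t, chart M i x)), Tube (H' t x) &
     chart N j (H' t x) = Phi (chart M i x, ga (t, chart M i x))]) ->
  (forall w, ws w -> CW w (md a b (E := model M i)) ((J `&` I) `*` (chart M i @` X1)°) ((J `&` I) `*` (chart M i @` X1)) ga) ->
  lgood J a b ws H' t0 x0.
Proof.
move=> hT hJ oX1 X1x X1X oI It hB hC.
have X1i : X1 `<=` dom M i by move=> x /X1X /Xi.
exists i, j, X1, I; split; [by split|split].
  by move=> t x Jt It' X1x'; have [_ /(bm_j bm)] := hB _ _ Jt It' X1x'.
move=> w ww; have fr := lrep_frame hT b nM oX1 X1i oI hJ.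
apply: (CW_ext (f := fun p => Phi (p.2, ga p)) fr).
  move=> [t y] [/= [Jt It'] [x Xx <-]]; have [_ Tx e] := hB _ _ Jt It' Xx.
  by rewrite -e chart_repE//; [exact: X1i|exact: (bm_j bm)].
apply: (CW_comp (frameT (bm_regB bm)) fr _ _ _ _ (bm_Phi bm w)) => //.
- by move=> [t y] [/= [Jt It'] [x Xx <-]]; have [] := hB _ _ Jt It' Xx.
- move=> [t y] [/= [Jt It'] hy]; have [x Xx e] := interior_subset hy.
  have [By _ _] := hB _ _ Jt It' Xx; rewrite e in By.
  have [P [oP Pp hP]] := bm_Bopen bm By.
  have oQ : open (P `&` ((chart M i @` X1)° `*` setT)).
    by apply: openI => //; apply: openX; [exact: open_interior|exact: openT].
  apply: filterS (open_nbhs_nbhs (conj oQ (conj Pp (conj hy Logic.I)))) => q [Pq [/interior_subset[x' Xx' ex'] _]].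
  by apply: hP => //; rewrite -ex'; exists x' => //; exact: X1i.
- by apply: CW_pair; [apply: CW_lin; exact: lincont_snd|exact: hC].
Qed.

(** A point of the bundle is recovered by choice from its value in the chart j; injectivity of the
    chart makes it unique ([newH_in]). *)
Definition newH (f : M -> N) (ga : model M i -> G) (x : M) : N :=
  if `[< X x >] then xget (f x) [set z | [/\ Tube z, pi z = x & chart N j z = Phi (chart M i x, ga (chart M i x))]]
  else f x.

Lemma newH_out f ga x : ~ X x -> newH f ga x = f x.
Proof. by move=> h; rewrite /newH; case: asboolP. Qed.

Lemma newH_in f ga x : X x -> B (chart M i x, ga (chart M i x)) ->
  [/\ Tube (newH f ga x), pi (newH f ga x) = x,
      chart N j (newH f ga x) = Phi (chart M i x, ga (chart M i x)) &
      formal_interior M x -> formal_interior N (newH f ga x)].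
Proof.
move=> Xx Bx; have [z [h1 h2 h3 h4]] := bm_BPhi bm (Xi Xx) Bx.
rewrite /newH; case: asboolP => // _; case: xgetP => [z' _ [k1 k2 k3]|/(_ z) []//].
have -> : z' = z by apply: (n_inj nN (bm_j bm k1) (bm_j bm h1)); rewrite k3 h3.
by [].
Qed.

Lemma newH_id f ga x : Tube (f x) -> pi (f x) = x -> ga (chart M i x) = cj (chart N j (f x)) ->
  newH f ga x = f x.
Proof.
move=> Tx px e; rewrite /newH; case: asboolP => // Xx.
have [h1 h2] := bm_cB bm Tx; rewrite px -e in h1 h2.
case: xgetP => [z' _ [k1 k2 k3]|/(_ (f x)) []//].
by apply: (n_inj nN (bm_j bm k1) (bm_j bm Tx)); rewrite k3 h2.
Qed.

Variables (l : nat) (J : nat -> finType).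
Variables (beta : forall n, J n -> model M i -> R^o) (nu : forall n, J n -> model M i) (h : model M i -> R^o).
Variable (S : set M).
Hypotheses (sm : smoothing l K O beta nu) (hh : forall w, CW w (fun _ => setT) O K h).
Hypotheses (cS : closed S) (SX : S `<=` X) (hS : forall x, Lb x -> h (chart M i x) != 0 -> S x).

Definition stp (H : R^o -> M -> N) (e : R) (t : R^o) : M -> N :=
  newH (H t) (fun y => gg beta nu h (fib H) (e, (t, y))).

Lemma XLb : X `<=` Lb.
Proof. by move=> x Xx; split; [exact: Xi|exact: XK]. Qed.

Variable (H : R^o -> M -> N).
Hypotheses (hTube : forall t x, I2 t -> Lb x -> Tube (H t x)) (hpi : forall t x, I2 t -> pi (H t x) = x).

Lemma stp0 t x : I2 t -> stp H 0 t x = H t x.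
Proof.
move=> It; have [Xx|nX] := pselect (X x); last by rewrite /stp newH_out.
by apply: newH_id; [exact: hTube (XLb Xx)|exact: hpi|rewrite gg0 fibE//; [exact: Xi|exact: hTube (XLb Xx)]].
Qed.

Lemma stp_notS e t x : I2 t -> ~ S x -> stp H e t x = H t x.
Proof.
move=> It nS; have [Xx|nX] := pselect (X x); last by rewrite /stp newH_out.
have h0 : h (chart M i x) = 0 by apply/eqP; apply: contra_notT nS => /hS; apply; exact: XLb.
apply: newH_id; [exact: hTube (XLb Xx)|exact: hpi|].
by rewrite gg_h0//= fibE//; [exact: Xi|exact: hTube (XLb Xx)].
Qed.

(** A point outside X has a neighbourhood missing the closed set S, where the cut-off vanishes and
    nothing changes. So regularity only has to be supplied over X. *)
Lemma stp_lgood T (JT : set T) (a b : bool -> bool) (ws : set (seq bool)) (e : T -> R) (ta : T -> R^o) p0 x0 :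
  hausdorff_space T -> (forall c, a c -> open JT) -> (forall p, JT p -> I2 (ta p)) ->
  (forall p y, JT p -> K y -> B (y, gg beta nu h (fib H) (e p, (ta p, y)))) ->
  lgood JT a b ws (fun p => H (ta p)) p0 x0 ->
  (X x0 -> exists X1 I, [/\ open X1, X1 x0, X1 `<=` X, open I & I p0] /\
    forall w, ws w -> CW w (md a b (E := model M i)) ((JT `&` I) `*` (chart M i @` X1)°) ((JT `&` I) `*` (chart M i @` X1))
      (fun p => gg beta nu h (fib H) (e p.1, (ta p.1, p.2)))) ->
  lgood JT a b ws (fun p => stp H (e p) (ta p)) p0 x0.
Proof.
move=> hT hJ hta hB hg hX; have [Xx|nX] := pselect (X x0).
  have [X1 [I [ [op1 X1x X1X oI It] hC]]] := hX Xx.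
  apply: (lift_lgood hT hJ op1 X1x X1X oI It (ga := fun p => gg beta nu h (fib H) (e p.1, (ta p.1, p.2)))) => //.
  move=> p x Jp Ip X1x'; have Xx' := X1X _ X1x'.
  have Bx := hB _ _ Jp (XK Xx'); split => //.
    by have [] := newH_in (H (ta p)) (ga := fun y => gg beta nu h (fib H) (e p, (ta p, y))) Xx' Bx.
  by have [] := newH_in (H (ta p)) (ga := fun y => gg beta nu h (fib H) (e p, (ta p, y))) Xx' Bx.
apply: (lgood_ext (X0 := ~` S) (I0 := setT) hT nM hJ _ _ _ hg).
- by apply: open_nbhs_nbhs; split; [exact: closed_openC|move=> /SX].
- exact: filterT.
- by move=> p x Jp _ nS; rewrite stp_notS//; exact: hta.
Qed.

Lemma stp_pi e t x : I2 t -> (forall y, K y -> B (y, gg beta nu h (fib H) (e, (t, y)))) -> pi (stp H e t x) = x.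
Proof.
move=> It hB; have [Xx|nX] := pselect (X x); last by rewrite /stp newH_out//; exact: hpi.
by have [] := newH_in (H t) (ga := fun y => gg beta nu h (fib H) (e, (t, y))) Xx (hB _ (XK Xx)).
Qed.

Lemma stp_int e t x : (forall y, K y -> B (y, gg beta nu h (fib H) (e, (t, y)))) ->
  (formal_interior M x -> formal_interior N (H t x)) ->
  formal_interior M x -> formal_interior N (stp H e t x).
Proof.
move=> hB hi fx; have [Xx|nX] := pselect (X x); last by rewrite /stp newH_out//; exact: hi.
by have [_ _ _] := newH_in (H t) (ga := fun y => gg beta nu h (fib H) (e, (t, y))) Xx (hB _ (XK Xx)); exact.
Qed.

Hypotheses (cK : compact K) (hH : section_family pi l H).
Variable (L' : set M).
Hypotheses (oL' : open L') (L'X : L' `<=` X) (hL' : forall x, L' x -> h (chart M i x) = 1).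

Let hE := @n_hmod _ _ nM i.
Let hG := bm_hG bm.
Let gH := gg beta nu h (fib H).

Lemma CW_gH : CW (nseq l true) (fun _ => [set 0] `*` ([set 0] `*` setT)) (Rp `*` (I2 `*` O)) (Rp `*` (I2 `*` K)) gH.
Proof.
apply: (CW_gg hE sm oO OK KO hh).
apply: (CW_fib (ws := wsT l) (w0 := nseq l true)) => //.
- exact: (sf_int hH).
- by exists l.
- by move=> t x It _; exact: (sf_A hH).
- by exists l.
Qed.

(** At e = 0 the deformed coordinate is the old one and lies in B. Since B is relatively open and
    [0,2] x K is compact, one bound on e serves all times and points. *)
Lemma B_small : exists2 e1 : R, 0 < e1 & forall e t y, 0 <= e <= e1 -> I2 t -> K y -> B (y, gH (e, (t, y))).
Proof.
have hc : near_covering (I2 `*` K : set (R^o * model M i)).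
  by apply/compact_near_coveringP; apply: compact_setX => //; exact: compact_I2.
pose Q (e : R^o) (p : R^o * model M i) := 0 <= e -> I2 p.1 -> K p.2 -> B (p.2, gH (e, p)).
have : \forall e \near (0 : R^o), I2 `*` K `<=` Q e.
  apply: (hc _ (nbhs (0 : R^o)) Q) => -[t0 y0] [/= It0 Ky0].
  have [x0 ix0 ex0] := Kim Ky0.
  have Lx0 : Lb x0 by split => //; rewrite ex0.
  have Tx0 := hTube It0 Lx0.
  have e0 : gH (0, (t0, y0)) = cj (chart N j (H t0 x0)) by rewrite /gH gg0 -ex0 fibE.
  have [By _] := bm_cB bm Tx0; rewrite (hpi _ It0) ex0 -e0 in By.
  have [P [oP Pp hP]] := bm_Bopen bm By.
  have cg : cw (Rp `*` (I2 `*` K)) (fun q : R^o * (R^o * model M i) => (q.2.2, gH q)).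
    have := CW_pair (w := [::]) (f := fun q : R^o * (R^o * model M i) => q.2.2) (g := gH)
      (V := fun _ => setT) (O := setT) (D := Rp `*` (I2 `*` K)).
    apply; first by apply: cw_lin; lincont.
    by have := CW_cw CW_gH.
  have D0 : (@Rp R `*` (I2 `*` K)) (0, (t0, y0)) by split => //=; rewrite /Rp /= lexx.
  have := cvgw_near (cg _ D0) (open_nbhs_nbhs (conj oP Pp)).
  move=> -[[A C] [/= nA nC] AC]; exists (C, A) => //= -[[t y] e] [/= Cty Ae] e00 It Ky.
  apply: hP; last by exact: Kim.
  exact: (AC (e, (t, y))).
move=> /nbhs_ballP[r /= r0 hr]; exists (r / 2); first lra.
move=> e t y /andP[e00 e1] It Ky; apply: (hr e _ (t, y)) => //.
by rewrite /ball /= sub0r normrN ger0_norm//; lra.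
Qed.

Lemma local_deformation : exists HH : R^o -> R^o -> M -> N,
  [/\ forall t x, I2 t -> HH 0 t x = H t x,
      forall e x, HH e 0 x = H 0 x,
      forall e t x, I2 t -> ~ Lb x -> HH e t x = H t x,
      ipres P2 (fun p => HH p.1 p.2) /\ (forall p x, P2 p -> lgoodA P2 l (fun p => HH p.1 p.2) p x) &
      forall e, 0 < e <= 1 -> section_family pi l (HH e) /\
        forall t x, J2 t -> goodC H t x \/ L' x -> goodC (HH e) t x].
Proof.
(* Halved because the smoothing parameter will be e1 e t with e <= 1 and t <= 2. *)
have [e1' e1p hB'] := B_small; pose e1 := e1' / 2; have e10 : 0 < e1 by rewrite /e1; lra.
have I20 : I2 (0 : R^o) by rewrite /I2 /= lexx ler0n.
have hB (e t : R) y : 0 <= e <= 1 -> I2 t -> K y -> B (y, gH (e1 * e * t, (t, y))).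
  move=> /andP[h1 h2] It Ky; apply: hB' => //; case/andP: It => h3 h4.
  have h5 : 0 <= e1 * e by apply: mulr_ge0 => //; exact: ltW.
  rewrite mulr_ge0//=; apply: (@le_trans _ _ (e1 * e * 2)); first exact: ler_wpM2l.
  by have : e1 * e <= e1 * 1; [apply: ler_wpM2l => //; exact: ltW|rewrite /e1; lra].
(* The parameter e1 e t vanishes for e = 0 and for t = 0, where the family must not change, and is
   positive as soon as both e and t are. *)
pose HH (e t : R^o) := stp H (e1 * e * t) t.
have hA p x : P2 p -> lgoodA P2 l (fun p => HH p.1 p.2) p x.
  move=> Pp; have [Pe Pt] := Pp; apply: (stp_lgood (e := fun p : R^o * R^o => e1 * p.1 * p.2) (ta := snd)) => //.
  - by move=> q [].
  - by move=> [e t] y [/= ? ?]; exact: hB.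
  - apply: (lgoodA_reparam _ _ nM (J := I2) (T := R^o)) => //.
    + by move=> q [].
    + by apply: cw_lin; exact: lincont_snd.
    + exact: (sf_A hH).
  - move=> Xx; exists X, setT; split; first by split => //; exact: openT.
    move=> w [n nl ->]; apply: (CW_catl (w' := nseq (l - n) true)); rewrite -nseqD subnKC//.
    have frE : frame (fun _ : bool => [set (0 : R^o)] `*` ([set (0 : R^o)] `*` [set: model M i])) (Rp `*` (I2 `*` O)) (Rp `*` (I2 `*` K)).
      apply: (frame_par Rp (V := fun _ => [set (0 : R^o)] `*` [set: model M i])).
      have := @frame_md R R^o hausdorff_R (fun _ => false) (fun _ => true) _ I2 O K hE.
      by apply.
    apply: (CW_comp (g := fun q : (R^o * R^o) * model M i => ((e1 * q.1.1 * q.1.2 : R^o), (q.1.2, q.2))) frE _ _ _ _ _ CW_gH).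
    + apply: (lrep_frame (a := fun _ => false) _ (fun _ => true) nM oX Xi _ _) => //; exact: openT.
    + move=> [[e t] y] [[[/= /andP[e0 e11] It] _] [/= z Xz <-]]; split => /=.
        by case/andP: It => t0 _; rewrite /Rp /= mulr_ge0// mulr_ge0// ltW.
      by split => //=; exact: XK.
    + move=> [[e t] y] [[[/= /andP[e0 e11] It] _] /= hy]; split => /=.
        by case/andP: It => t0 _; rewrite /Rp /= mulr_ge0// mulr_ge0// ltW.
      by split => //=; exact: (chart_XO (@subset_refl _ X)).
    + move=> _ [[e t] y] [[e' t'] y'] _ _ [/= [h1 h2] _]; split => /=; last split => //=.
        have -> : e = e' by move/eqP: h1; rewrite subr_eq0 => /eqP.
        have -> : t = t' by move/eqP: h2; rewrite subr_eq0 => /eqP.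
        by rewrite subrr.
    + apply: CW_pair; last by apply: CW_lin; lincont.
      apply: CWM; last by apply: CW_lin; lincont.
      by apply: CWM; [exact: CW_cst|apply: CW_lin; lincont].
have hi : ipres P2 (fun p => HH p.1 p.2).
  move=> [e t] x [/= He It]; apply: stp_int => [y Ky|]; first exact: hB.
  exact: (sf_int hH).
exists HH; split => //.
- by move=> t x It; rewrite /HH mulr0 mul0r stp0.
- by move=> e x; rewrite /HH mulr0 stp0.
- by move=> e t x It nL; rewrite /HH stp_notS// => /SX /XLb.
move=> e e01; have e0 : 0 < e by case/andP: e01.
have e01' : 0 <= e <= 1 by case/andP: e01 => /ltW -> ->.
have hS' w : CW w (fun _ => setT) (J2 `*` O) (J2 `*` K) (fun p => Sg beta nu (fib H) ((e1 * e) * p.1, p)).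
  apply: (CW_Sg hE hG sm oO OK KO); first exact: mulr_gt0.
  move=> k; apply: (CW_fib (ws := wsB l) (w0 := [::])) => //.
  - by move=> _ _; exact: open_J2.
  - by move=> t x /J2_I2; exact: (sf_int hH).
  - by exists 0%N, 0%N.
  - by move=> t x /J2_I2; exact: hTube.
  - by move=> t x Jt _; exact: (sf_B hH).
  - by exists 0%N, k.
have subX X1 w V (I : set R^o) : X1 `<=` X -> CW w V (J2 `*` O) (J2 `*` K) (fun p => Sg beta nu (fib H) ((e1 * e) * p.1, p)) ->
   CW w V ((J2 `&` I) `*` (chart M i @` X1)°) ((J2 `&` I) `*` (chart M i @` X1)) (fun p => Sg beta nu (fib H) ((e1 * e) * p.1, p)).
  move=> X1X; apply: CW_sub.
  - by move=> [t y] [[/= Jt _] hy]; split => //=; exact: (chart_XO X1X).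
  - by move=> [t y] [[/= Jt _] [z Xz <-]]; split => //=; apply: XK; exact: X1X.
  - by move=> c p.
have subh X1 w V (I : set R^o) : X1 `<=` X -> CW w V ((J2 `&` I) `*` (chart M i @` X1)°) ((J2 `&` I) `*` (chart M i @` X1)) (fun p => h p.2).
  move=> X1X; apply: (CW_sub _ _ _ (CW_h hh w V J2)).
  - by move=> [t y] [[/= Jt _] hy]; split => //=; exact: (chart_XO X1X).
  - by move=> [t y] [[/= Jt _] [z Xz <-]]; split => //=; apply: XK; exact: X1X.
  - by move=> c p.
have hstp (a b : bool -> bool) (ws : set (seq bool)) t x : (forall c, a c -> open (@J2 R)) -> J2 t -> lgood J2 a b ws H t x ->
    (X x -> exists X1 I, [/\ open X1, X1 x, X1 `<=` X, open I & I t] /\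
    forall w, ws w -> CW w (md a b (E := model M i)) ((J2 `&` I) `*` (chart M i @` X1)°) ((J2 `&` I) `*` (chart M i @` X1))
      (fun p => gH (e1 * e * p.1, p))) ->
    lgood J2 a b ws (HH e) t x.
  move=> hJ Jt hl hX; apply: (stp_lgood (e := fun t : R^o => e1 * e * t) (ta := fun t => t)) => //.
  - exact: J2_I2.
  - by move=> s y /J2_I2; exact: hB.
split; first split.
- move=> t x It.
  apply: (@lgoodA_reparam R (R^o * R^o)%type R^o M N _ _ nM P2 I2 (fun t => (e, t)) l (fun p => HH p.1 p.2) t x) => //.
  + have := CW_pair (w := [::]) (f := fun _ : R^o => (e : R^o)) (g := fun t : R^o => t)
      (V := fun _ => setT) (O := setT) (D := I2).
    by apply; [exact: CW_cst|apply: cw_lin; exact: lincont_id].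
  + exact: hA.
- move=> t x Jt; apply: hstp => //; [by move=> _ _; exact: open_J2|exact: (sf_B hH)|].
  move=> Xx; exists X, setT; split; first by split => //; exact: openT.
  move=> w ww; apply: CW_comb.
  + apply: (CW_sub (O := J2 `*` O) (D := J2 `*` K) (V := md negb id (E := model M i))).
    * by move=> [s y] [[/= Js _] hy]; split => //=; exact: (chart_XO (@subset_refl _ X)).
    * by move=> [s y] [[/= Js _] [z Xz <-]]; split => //=; exact: XK.
    * by move=> c p.
    * apply: (CW_fib (ws := wsB l) (w0 := [::])) => //.
      - by move=> _ _; exact: open_J2.
      - by move=> s z /J2_I2; exact: (sf_int hH).
      - by exists 0%N, 0%N.
      - by move=> s z /J2_I2; exact: hTube.
      - by move=> s z Js _; exact: (sf_B hH).
  + by apply: subX => //; exact: (CW_sub _ _ _ (hS' w)).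
  + exact: subh.
- by move=> t x It; apply: (hi (e, t)).
- by move=> t x It; apply: stp_pi => // y Ky; exact: hB.
move=> t x Jt hor; have It := J2_I2 Jt.
have oJ2 c : (fun _ : bool => true) c -> open (@J2 R) by move=> _; exact: open_J2.
have hJi : ipres J2 H by move=> s z /J2_I2; exact: (sf_int hH).
(* Off L' smoothness is inherited, which requires both the old coordinate and its smoothed version
   to be smooth in (t, x). On L' the cut-off is 1 and the old coordinate drops out of the
   formula. *)
have [L'x|nL'] := pselect (L' x); last first.
  have gC : goodC H t x by case: hor.
  apply: hstp => // Xx; have Tx := hTube It (XLb Xx).
  have := lgood_charts (@hausdorff_R R) nM nN oJ2 hJi (w0 := [::]) Logic.I Jt (Xi Xx) (bm_j bm Tx) gC.
  move=> /(lgood_shrink oX Xx open_J2 Jt)[X1 [I [[oX1 X1x X1X] [[oI It' IJ] [hd hr]]]]].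
  have X1X' : X1 `<=` X by move=> z /X1X[].
  have X1i : X1 `<=` dom M i by move=> z /X1X[].
  exists X1, I; split; first by split.
  move=> w _; apply: CW_comb.
  + have rT : regular_set (chart N j @` Tube).
      by apply: chart_regular => //; [exact: (bm_open bm)|exact: (bm_j bm)].
    have fr := lrep_frame (@hausdorff_R R) (fun _ => true) nM oX1 X1i oI oJ2.
    apply: (CW_comp (frameT rT) fr _ _ _ (hr w Logic.I) (bm_c bm w)) => //.
    * move=> [s y] [[/= Js Is] [z Xz <-]]; have Tz := hTube (J2_I2 Js) (XLb (X1X' _ Xz)).
      by rewrite chart_repE//; [exists (H s z)|exact: X1i|exact: (bm_j bm)].
    * move=> [s y] [[/= Js Is] hy]; have [z Xz ez] := interior_subset hy.
      have Tz := hTube (J2_I2 Js) (XLb (X1X' _ Xz)).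
      rewrite -ez chart_repE//; [|exact: X1i|exact: (bm_j bm)].
      have fz : formal_interior M z.
        apply/(formal_interiorP nM (X1i _ Xz)); rewrite ez.
        by move: hy; apply: interiorS => _ [z' Xz' <-]; exists z' => //; exact: X1i.
      have := chart_int nN (open_nbhs_nbhs (conj (bm_open bm) Tz)) (bm_j bm Tz) (hJi _ _ Js fz _ (bm_j bm Tz)).
      by apply: interiorS => _ [z' [Tz' _] <-]; exists z'.
  + by apply: subX => //; exact: (CW_sub _ _ _ (hS' w)).
  + exact: subh.
have Xx := L'X L'x.
apply: (lift_lgood (J := J2) (I := setT) (X1 := L') (ga := fun p => gH (e1 * e * p.1, p))) => //.
- exact: openT.
- move=> s z Js _ L'z; have Xz := L'X L'z.
  have hBs : B (chart M i z, gH (e1 * e * s, (s, chart M i z))) by apply: hB (XK Xz) => //; exact: J2_I2.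
  by have [] := newH_in (H s) (ga := fun y => gH (e1 * e * s, (s, y))) Xz hBs.
- move=> w _; have L'i : L' `<=` dom M i by move=> z /L'X /Xi.
  apply: (CW_ext (f := fun p => Sg beta nu (fib H) ((e1 * e) * p.1, p))).
  + by apply: lrep_frame => //; exact: openT.
  + by move=> [s y] [_ [z L'z /= <-]]; rewrite /gH /gg /= hL'// scale1r addrC subrK.
  + by apply: subX => //; exact: (CW_sub _ _ _ (hS' w)).
Qed.

End local_step.

(** * Compact sets that carry smoothing operators *)

Section windows.
Context {R : realType}.

Lemma cutoff (E : tvsType R) d (L : E -> 'rV[R]_d) L' y0 (Q : set E) : lincont L -> lincont L' -> cancel L L' -> nbhs y0 Q ->
  exists (h : E -> R^o) (S0 L0 : set E),
  [/\ forall w V (O D : set E), O `<=` D -> CW w V O D h, closed S0 /\ S0 `<=` Q,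
      forall y, h y != 0 -> S0 y, [/\ open L0, L0 y0 & L0 `<=` S0] & forall y, L0 y -> h y = 1].
Proof.
move=> hL hL' LK nQ; have [C nC CQ] := @uniform_regular E y0 Q nQ.
have [r r0 hr] := bump_small hL' LK nC.
have h1 : nbhs y0 [set y | bump L r y0 y = 1] := bump_near hL y0 r0.
exists (bump L r y0), (closure C), [set y | bump L r y0 y = 1]°; split.
- by move=> w V O D OD; exact: CW_bump.
- by split => //; exact: closed_closure.
- by move=> y /hr; exact: subset_closure.
- split; [exact: open_interior|exact: h1|].
  by move=> y /interior_subset /= e; apply: subset_closure; apply: hr; rewrite e oner_neq0.
- by move=> y /interior_subset.
Qed.

(* A compact set K in V on which maps can be smoothed, together with a cut-off function h
   which is 1 near y0; relative to V, the sets L0, S0, X0 and K are successively larger. *)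
Definition window l (E : tvsType R) (V : set E) (y0 : E) (P : set E) :=
  exists (K O X0 S0 L0 : set E) (h : E -> R^o) (J : nat -> finType)
    (beta : forall n, J n -> E -> R^o) (nu : forall n, J n -> E),
  [/\ smoothing l K O beta nu, open O /\ O `<=` K, K `<=` closure O, K° `<=` O & compact K] /\
  [/\ K `<=` V `&` P, open X0 /\ V `&` X0 `<=` K, closed S0 /\ S0 `<=` X0, [/\ open L0, L0 y0 & L0 `<=` X0] &
    [/\ forall w, CW w (fun _ => setT) O K h, forall y, h y != 0 -> S0 y & forall y, L0 y -> h y = 1]].

Lemma box_compact d (a b : 'rV[R]_d) : compact (box a b).
Proof.
have := @rV_compact R d (fun i => `[a ord0 i, b ord0 i]%classic) (fun i => @segment_compact R _ _).
by congr compact; apply/seteqP; split => y h i; have := h i; rewrite /= in_itv.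
Qed.

Lemma rV_ball d (y0 : 'rV[R]_d) (Q : set 'rV[R]_d) : nbhs y0 Q ->
  exists2 e : R, 0 < e & forall y : 'rV[R]_d, (forall i, `|y ord0 i - y0 ord0 i| <= e) -> Q y.
Proof.
move=> /nbhs_ballP[e /= e0 he]; exists (e / 2); first lra.
move=> y hy; apply: he; split => //= i j.
by rewrite ord1 /ball /= distrC; apply: le_lt_trans (hy j) _; lra.
Qed.

(** K is a box of half-width e around y0, cut at the walls of the quadrant; a' is its lower corner
    before cutting. The open box between a' and b meets V inside K, so a cut-off supported in it may
    stay nonzero on the walls. *)
Lemma corner_window l (E : tvsType R) (V : set E) y0 P : corner_set V -> V y0 -> nbhs y0 P -> window l V y0 P.
Proof.
move=> cV; case: cV y0 P => d m O' md oO' y0 P [Oy qy] nP.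
have [e e0 he] := rV_ball (filterI (open_nbhs_nbhs (conj oO' Oy)) nP).
pose a : 'rV[R]_d := \row_i (if (i < m)%N then Num.max 0 (y0 ord0 i - e) else y0 ord0 i - e).
pose a' : 'rV[R]_d := \row_i (y0 ord0 i - e).
pose b : 'rV[R]_d := \row_i (y0 ord0 i + e).
have a'a i : a' ord0 i <= a ord0 i by rewrite !mxE; case: ifP => // _; rewrite le_max lexx orbT.
have ab i : a ord0 i < b ord0 i.
  by rewrite !mxE; case: ifP => [im|_]; [rewrite gt_max; have := qy i im|]; lra.
have [J [beta [nu sm]]] := box_smoothing ab l.
have ny : nbhs (y0 : 'rV[R]_d) (obox a' b).
  by apply: open_nbhs_nbhs; split; [exact: open_obox|move=> i; rewrite !mxE; apply/andP; split; lra].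
have [h [S0 [L0 [h1 [h2 h2'] h3 [h4 h5 h6] h7]]]] := cutoff (@lincont_id R _) (@lincont_id R _) (fun x => erefl) ny.
exists (box a b), (obox a b), (obox a' b), S0, L0, h, J, beta, nu; split; split => //.
- by split; [exact: open_obox|exact: obox_box].
- exact: box_closure.
- exact: box_interior.
- exact: box_compact.
- move=> y hy; have hq (i : 'I_d) : (i < m)%N -> 0 <= y ord0 i.
    by move=> im; have /andP[+ _] := hy i; rewrite !mxE im ge_max => /andP[].
  have [Oy' Py'] : O' y /\ P y.
    apply: he => i; have /andP[] := hy i; have := a'a i; rewrite !mxE => k1 k2 k3.
    by rewrite ler_norml; apply/andP; split; lra.
  by [].
- split; first exact: open_obox.
  move=> y [[_ qy'] hy] i; have /andP[] := hy i; rewrite !mxE => k1 k2.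
  rewrite (ltW k2) andbT; case: ifP => [im|_]; last exact: ltW.
  by rewrite ge_max qy'// ltW.
- by split => // y /h6 /h2'.
- by split => // w; apply: h1; exact: obox_box.
Qed.

(** K is the closure of an open set, so it lies in the closure of its interior, which serves as O;
    regularity of V ensures that K contains all of V near y0. As C is compact with nonempty
    interior, E is finite-dimensional and has bump functions. *)
Lemma compact_window (E : tvsType R) (V : set E) y0 (P P' C : set E) : hausdorff_space E -> regular_set V ->
  V y0 -> compact C -> C `<=` V `&` P -> open P' -> P' y0 -> V `&` P' `<=` C -> window 0 V y0 P.
Proof.
move=> hE rV Vy cC CV oP' P'y VC.
have clC : closed C := compact_closed hE cC.
pose O1 := V° `&` P'; have oO1 : open O1 by apply: openI => //; exact: open_interior.
have O1C : O1 `<=` C by move=> y [/interior_subset ? ?]; exact: VC.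
pose K := closure O1; have KC : K `<=` C by rewrite [X in _ `<=` X]((closure_id C).1 clC); exact: closure_subset.
have VK : V `&` P' `<=` K.
  move=> y [Vy' P'y'] B nB; have [z [Vz [P'z Bz]]] := rV _ Vy' _ (filterI (open_nbhs_nbhs (conj oP' P'y')) nB).
  by exists z.
have cK : compact K by apply: subclosed_compact cC KC; exact: closed_closure.
have [z [[Vz P'z] _]] := VK _ (conj Vy P'y) setT filterT.
have nC : nbhs z C by apply: filterS O1C _; apply: open_nbhs_nbhs.
have [d [L [L' [hL hL' LK _]]]] := locally_compact_findim hE cC nC.
have [h [S0 [L0 [h1 [h2 h2'] h3 [h4 h5 h6] h7]]]] := cutoff hL hL' LK (open_nbhs_nbhs (conj oP' P'y)).
have KO : K° `<=` K by exact: interior_subset.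
have [J [beta [nu sm]]] := partition_smoothing hL hL' LK cK KO.
exists K, K°, P', S0, L0, h, J, beta, nu; split; split => //.
- by split => //; exact: open_interior.
- apply: closure_subset => y Oy; apply: (filterS (@subset_closure _ O1)).
  exact: open_nbhs_nbhs.
- by move=> y /KC /CV.
- by split => // y /h6 /h2'.
- by split => // w; exact: h1.
Qed.

End windows.

Section local_deformations.
Context {R : realType}.
Variables (M N : charted_space R) (pi : N -> M) (l : nat) (sigma : M -> N).
Hypotheses (nM : nice M) (nN : nice N) (hpi : smooth_fibre_bundle pi).
Hypotheses (hM : hausdorff_space M) (csig : continuous sigma) (psig : forall x, pi (sigma x) = x).
Hypothesis hwin : forall i y0 P (C P' : set (model M i)), chart_im M i y0 -> nbhs y0 P ->
  compact C -> C `<=` chart_im M i `&` P -> open P' -> P' y0 -> chart_im M i `&` P' `<=` C ->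
  window l (chart_im M i) y0 P.
Hypothesis lcM : locally_compact [set: M].

Lemma chart_compact i (K : set (model M i)) : compact K -> K `<=` chart_im M i ->
  compact [set x | dom M i x /\ K (chart M i x)].
Proof.
move=> cK Ki; have [[y0 Ky0]|K0] := pselect (exists y, K y); last first.
  rewrite (_ : [set x | _] = set0); first exact: compact0.
  by apply/seteqP; split => // x [_ Kx]; apply: K0; exists (chart M i x).
have [x0 ix0 _] := Ki _ Ky0.
pose inv y := xget x0 [set x | dom M i x /\ chart M i x = y].
have invE x : dom M i x -> inv (chart M i x) = x.
  move=> ix; rewrite /inv; case: xgetP => [z _ [iz e]|/(_ x)[]//].
  exact: (n_inj nM iz ix e).
have -> : [set x | dom M i x /\ K (chart M i x)] = inv @` K.
  apply/seteqP; split => [x [ix Kx]|_ [y Ky <-]]; first by exists (chart M i x); rewrite ?invE.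
  by have [x ix ex] := Ki _ Ky; rewrite -ex invE//; split => //; rewrite ex.
apply: continuous_compact => //.
apply/subspace_continuousP => y Ky; have [x ix ex] := Ki _ Ky => B nB.
have {}nB : nbhs x B by rewrite -(invE _ ix) ex.
have [P nP hP] := (n_nbhs nM _ ix).1 nB.
suff : nbhs y (fun z => K z -> B (inv z)) by [].
rewrite -ex.
apply: filterS nP => z Pz /Ki[x' ix' ex']; rewrite -ex' invE//; apply: hP => //; by rewrite ex'.
Qed.

(** The window is taken in one chart, inside the part P where the points stay in W and sigma stays
    in the tube of a bundle chart; local compactness of M provides the compact set C that is
    required for the case l = 0. *)
Lemma locally_deformable x0 W : nbhs x0 W -> exists Lb L' Tube,
  [/\ deformable pi l Lb L' Tube, Lb `<=` W /\ compact Lb, open L' /\ L' x0, L' `<=` Lb &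
      open Tube /\ forall x, Lb x -> Tube (sigma x)].
Proof.
move=> nW; have [i ix0] := n_cover nM x0.
have ps0 : dom M i (pi (sigma x0)) by rewrite psig.
have [j [G [Tube [cj [Phi [B [Tz0 bm]]]]]]] := bmodel_exists nM nN hpi ps0.
have nT : nbhs x0 (sigma @^-1` Tube) by apply: csig; apply: open_nbhs_nbhs; split => //; exact: (bm_open bm).
have ni : nbhs x0 (dom M i) by apply: open_nbhs_nbhs; split => //; exact: (n_open nM).
have [P nP hP] := (n_nbhs nM _ ix0).1 (filterI nW nT).
have [C1 nC1 [cC1 clC1]] : exists2 C, nbhs x0 C & compact C /\ closed C.
  by have := @lcM x0 Logic.I; rewrite withinET.
have nX : nbhs x0 (dom M i `&` (chart M i @^-1` P°)).
  by apply: filterI => //; apply: (chart_cvg nM ix0); exact: nbhs_interior.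
have [C2 nC2 C2X] := compact_regular hM cC1 nC1 nX.
have cC : compact (C1 `&` closure C2) by apply: compact_closedI => //; exact: closed_closure.
have C2i : C1 `&` closure C2 `<=` dom M i by move=> x [_ /C2X[]].
have cim : compact (chart M i @` (C1 `&` closure C2)).
  apply: continuous_compact => //; apply/subspace_continuousP => x /C2i ix.
  by apply: cvg_within_filter; exact: (chart_cvg nM ix).
have [P' [oP' P'x hP']] := chart_nbhsP nM (filterI nC1 nC2) ix0.
have [K [Ow [X0 [S0 [L0 [h [J [beta [nu [[sm [opO OK] KO IO cK] [KP [oX0 VX0] [cS0 SX0] [oL0 L0y L0X] [hh h0 h1]]]]]]]]]]]] :
    window l (chart_im M i) (chart M i x0) P.
  apply: (hwin (C := chart M i @` (C1 `&` closure C2)) (P' := P')) => //.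
  - by exists x0.
  - move=> _ [x [C1x C2x] <-]; have [ix /interior_subset Px] := C2X _ C2x.
    by split => //; exists x.
  - move=> _ [[x ix <-] P'x']; have [? ?] := hP' _ ix P'x'.
    by exists x => //; split => //; exact: subset_closure.
have Ki : K `<=` chart_im M i by move=> y /KP[].
pose Lb : set M := [set x | dom M i x /\ K (chart M i x)].
have open_pre (Q : set (model M i)) : open Q -> open [set x | dom M i x /\ Q (chart M i x)].
  move=> oQ; rewrite openE => x [ix Qx]; apply: filterI.
    by apply: open_nbhs_nbhs; split => //; exact: (n_open nM).
  by apply: (chart_cvg nM ix); exact: open_nbhs_nbhs.
pose X : set M := [set x | dom M i x /\ X0 (chart M i x)].
have XK x : X x -> K (chart M i x) by move=> [ix Xx]; apply: VX0; split => //; exists x.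
pose S : set M := [set x | dom M i x /\ (K `&` S0) (chart M i x)].
have cS : closed S.
  apply: compact_closed => //; apply: chart_compact; first exact: compact_closedI.
  by move=> y [/Ki].
pose L' : set M := [set x | dom M i x /\ L0 (chart M i x)].
have hLW x : Lb x -> W x /\ Tube (sigma x) by move=> [ix Kx]; have [_ Px] := KP _ Kx; exact: hP.
exists Lb, L', Tube; split.
- move=> H hH hT; apply: (local_deformation nM nN bm opO OK KO Ki (open_pre _ oX0) _ XK IO sm hh cS _ _ hT (sf_pi hH) cK hH (open_pre _ oL0)).
  + by move=> x [].
  + by move=> x [ix [_ /SX0]].
  + by move=> x [ix Kx] /h0.
  + by move=> x [ix /L0X].
  + by move=> x [_ /h1].
- by split; [move=> x /hLW[]|exact: chart_compact].
- by split => //; exact: open_pre.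
- by move=> x [ix L0x]; split => //; apply: XK; split => //; exact: L0X.
- by split; [exact: (bm_open bm)|move=> x /hLW[]].
Qed.

End local_deformations.

(** * Gluing the local deformations *)

Section gluing_deformations.
Context {R : realType}.
Variables (M N : charted_space R) (pi : N -> M) (l : nat).
Hypothesis nM : nice M.

Lemma deformable0 Tube : deformable pi l set0 set0 Tube.
Proof.
move=> H hH _; exists (fun _ => H); split => //.
- split; first by move=> p x [_ /= h]; exact: (sf_int hH).
  move=> p x Pp; have [_ It] := Pp.
  apply: (@lgoodA_reparam R R^o (R^o * R^o)%type M N _ _ nM I2 P2 snd l H p x) => //.
  + by move=> q [].
  + by apply: cw_lin; exact: lincont_snd.
  + exact: (sf_A hH).
- by move=> e _; split => // t x _ [].
Qed.

Variables (Lb L' : nat -> set M) (Tube : nat -> set N) (Q : nat -> set (M -> N)) (Sp : nat -> set M).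
Hypothesis hdef : forall n, deformable pi l (Lb n) (L' n) (Tube n).
Hypothesis hlf : forall x : M, exists2 W, nbhs x W & exists n0, forall n, (n0 <= n)%N -> forall y, W y -> ~ Lb n y.
Hypothesis hSp : forall n, exists n0, forall k, (n0 <= k)%N -> forall y, Sp n y -> ~ Lb k y.
Hypothesis hSp' : forall k, exists n0, forall n, (n0 <= n)%N -> forall y, Lb k y -> ~ Sp n y.
Hypothesis hQ : forall n f f', (forall x, Sp n x -> f x = f' x) -> Q n f -> Q n f'.
Hypothesis hQo : forall n (HH : R^o * R^o -> M -> N) p, ipres P2 HH -> (forall p x, P2 p -> lgoodA P2 l HH p x) ->
  P2 p -> Q n (HH p) -> \forall p' \near p, P2 p' -> Q n (HH p').
Hypothesis hQT : forall n f, Q n f -> forall x, Lb n x -> Tube n (f x).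

Definition admissible (H : R^o -> M -> N) := section_family pi l H /\ forall n t, I2 t -> Q n (H t).

Definition next k (H H' : R^o -> M -> N) :=
  [/\ forall t x, I2 t -> ~ Lb k x -> H' t x = H t x, forall x, H' 0 x = H 0 x &
      forall t x, J2 t -> goodC H t x \/ L' k x -> goodC H' t x].

(** A change over Lb k affects [Q n] for finitely many n only, by [hSp']. Each of these is an open
    condition along the family and holds at e = 0; by compactness of [0,2] it holds for all small e
    uniformly in t. So one e > 0 serves them all. *)
Lemma next_exists k H : admissible H -> exists2 H', admissible H' & next k H H'.
Proof.
move=> [hH hq]; have hT t x : I2 t -> Lb k x -> Tube k (H t x) by move=> It; apply: hQT; exact: hq.
have [HH [h0 h1 h2 [h3 h4] h5]] := hdef hH hT.
have [n0 hn0] := hSp' k.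
have near0 n : \forall e \near (0 : R^o), 0 <= e <= 1 -> forall t, I2 t -> Q n (HH e t).
  pose P (e t : R^o) := 0 <= e <= 1 -> I2 t -> Q n (HH e t).
  have hc : near_covering (@I2 R) by apply/compact_near_coveringP; exact: compact_I2.
  have : \forall e \near (0 : R^o), I2 `<=` P e.
    apply: (hc _ (nbhs (0 : R^o)) P) => t0 It0.
    have P0 : @P2 R (0, t0) by split => //=; rewrite lexx ler01.
    have q0 : Q n (HH 0 t0) by apply: (hQ (f := H t0)); [move=> x _; rewrite h0|exact: hq].
    have := hQo (HH := fun p => HH p.1 p.2) h3 h4 P0 q0.
    move=> -[[B1 B2] [/= nB1 nB2] B12]; exists (B2, B1) => //= -[t e] [/= Bt Be] e01 It.
    exact: (B12 (e, t)).
  by apply: filterS => e he e01 t It; exact: he.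
have nearn m : \forall e \near (0 : R^o), 0 <= e <= 1 -> forall n, (n < m)%N -> forall t, I2 t -> Q n (HH e t).
  elim: m => [|m IH]; first by apply: filterE => e _ n.
  apply: filterS2 IH (near0 m) => e e1 e2 e01 n; rewrite ltnS leq_eqVlt => /orP[/eqP ->|nm]; [exact: e2|exact: e1].
have /nbhs_ballP[r /= r0 hr] := nearn n0.
pose e : R := Num.min 1 (r / 2).
have e0 : 0 < e by rewrite lt_min ltr01 /=; lra.
have e1 : e <= 1 by rewrite ge_min lexx.
have er : e <= r / 2 by rewrite ge_min lexx orbT.
have e01 : 0 < e <= 1 by rewrite e0.
have [k1 k2] := h5 e e01.
exists (HH e); last by split => // t x; exact: h2.
split => // n t It; have [nn0|n0n] := ltnP n n0.
  apply: hr => //; last by rewrite (ltW e0).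
  by rewrite /ball /= sub0r normrN gtr0_norm//; lra.
apply: (hQ (f := H t)); last exact: hq.
by move=> x Sx; rewrite h2// => Lx; exact: (hn0 n n0n x).
Qed.

Variable (H0 : R^o -> M -> N).
Hypothesis hH0 : admissible H0.

(** The deformations are performed in the order of k. Near each point only finitely many of them
    change anything, so the sequence is stationary there and H takes the eventual value. Every
    property is local in x or concerns a single [Sp n], hence is read off at a finite stage. *)
Lemma global_family : exists H, [/\ admissible H,
  forall t x, I2 t -> (forall n, ~ Lb n x) -> H t x = H0 t x, forall x, H 0 x = H0 0 x &
  forall t x, J2 t -> goodC H0 t x \/ (exists n, L' n x) -> goodC H t x].
Proof.
have /choice[st hst] : forall kH : nat * {H | admissible H}, exists H' : {H | admissible H}, next kH.1 (sval kH.2) (sval H').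
  by move=> [k [H aH]]; have [H' aH' nH'] := next_exists k aH; exists (exist _ H' aH').
pose hs := fix hs k : {H | admissible H} := if k is k'.+1 then st (k', hs k') else exist _ H0 hH0.
have hss k : next k (sval (hs k)) (sval (hs k.+1)) := hst (k, hs k).
have stat n0 x : (forall n, (n0 <= n)%N -> ~ Lb n x) -> forall k t, (n0 <= k)%N -> I2 t -> sval (hs k) t x = sval (hs n0) t x.
  move=> hn k t nk It; rewrite -(subnKC nk); elim: (k - n0)%N => [|m IH]; first by rewrite addn0.
  by rewrite addnS; have [-> //] := hss (n0 + m)%N; apply: hn; rewrite leq_addr.
have stC k k' t x : (k <= k')%N -> J2 t -> goodC (sval (hs k)) t x -> goodC (sval (hs k')) t x.
  move=> kk Jt g; rewrite -(subnKC kk); elim: (k' - k)%N => [|m IH]; first by rewrite addn0.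
  by rewrite addnS; have [_ _ h] := hss (k + m)%N; apply: h => //; left.
have /choice[nx hnx] : forall x, exists n0, forall n, (n0 <= n)%N -> ~ Lb n x.
  by move=> x; have [W nW [n0 h]] := hlf x; exists n0 => n hn; apply: h => //; exact: nbhs_singleton.
pose H (t : R^o) (x : M) := sval (hs (nx x)) t x.
have HE n0 x t k : (forall n, (n0 <= n)%N -> ~ Lb n x) -> I2 t -> (n0 <= k)%N -> H t x = sval (hs k) t x.
  move=> hn It nk; pose m := maxn k (nx x).
  have -> : H t x = sval (hs m) t x by rewrite /H (stat _ _ (hnx x) m)// leq_maxr.
  by rewrite (stat _ _ hn m)// ?(stat _ _ hn k)//; apply: (leq_trans nk); rewrite leq_maxl.
have I20 : I2 (0 : R^o) by rewrite /I2 /= lexx ler0n.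
have hs0 k x : sval (hs k) 0 x = H0 0 x.
  by elim: k => // k IH; have [_ -> _] := hss k.
have loc (x : M) : exists2 W, nbhs x W & exists n0, forall k t y, (n0 <= k)%N -> I2 t -> W y -> sval (hs k) t y = H t y.
  have [W nW [n0 h]] := hlf x; exists W => //; exists n0 => k t y nk It Wy.
  by rewrite (HE n0 y t k)// => n hn; exact: h.
exists H; split.
- split; last first.
    move=> n t It; have [n0 hn] := hSp n.
    apply: (hQ (f := sval (hs n0) t)); last by have [_] := svalP (hs n0); exact.
    by move=> x Sx; rewrite (HE n0 x t n0)// => k hk; exact: hn.
  split.
  + move=> t x It; have [W nW [n0 h]] := loc x; have [hf _] := svalP (hs n0).
    apply: (lgood_ext (X0 := W) (I0 := setT) _ nM _ nW filterT _ (sf_A hf x It)) => //.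
    by move=> s y Is _ Wy; exact: h.
  + move=> t x Jt; have [W nW [n0 h]] := loc x; have [hf _] := svalP (hs n0).
    apply: (lgood_ext (X0 := W) (I0 := setT) _ nM _ nW filterT _ (sf_B hf x Jt)) => //.
      by move=> _ _; exact: open_J2.
    by move=> s y Js _ Wy; apply: h => //; exact: J2_I2.
  + by move=> t x It; have [hf _] := svalP (hs (nx x)); exact: (sf_int hf).
  + by move=> t x It; have [hf _] := svalP (hs (nx x)); exact: (sf_pi hf).
- by move=> t x It hn; rewrite (HE 0%N x t 0%N).
- by move=> x; exact: hs0.
- move=> t x Jt hor; have [W nW [n0 h]] := loc x.
  have [k nk gk] : exists2 k, (n0 <= k)%N & goodC (sval (hs k)) t x.
    case: hor => [g|[n L'x]].
      by exists n0 => //; apply: (stC 0%N).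
    exists (maxn n0 n.+1); first exact: leq_maxl.
    apply: (stC n.+1) => //; first exact: leq_maxr.
    by have [_ _ h'] := hss n; apply: h' => //; right.
  apply: (lgood_ext (X0 := W) (I0 := setT) _ nM _ nW filterT _ gk) => //.
    by move=> _ _; exact: open_J2.
  by move=> s y Js _ Wy; apply: h => //; exact: J2_I2.
Qed.

End gluing_deformations.

(** * Whitney neighbourhoods and locally finite collections of deformations *)

Section restrictions.
Context {R : realType}.
Implicit Types M N : charted_space R.

Lemma chart_im_restr M (A : set M) i : chart_im (restr M A) i `<=` chart_im M i.
Proof. by move=> _ [y iy <-]; exists (set_val y). Qed.

Lemma formal_interior_restr M (A : set M) (x : restr M A) :
  formal_interior (restr M A) x -> formal_interior M (set_val x).
Proof. by move=> h i ix; exact: (interiorS (@chart_im_restr M A i) (h i ix)). Qed.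

Lemma continuous_set_val (T : topologicalType) (A : set T) : continuous (set_val : set_type A -> T).
Proof. by move=> x B nB; apply/nbhs_set_type; exists B. Qed.

Lemma RC_restrT l M N (f : M -> N) : RC l f -> RC l (restr_map f setT).
Proof.
move=> [cf hi hC]; split.
- by move=> x; apply: (@continuous_comp _ _ _ (set_val : set_type setT -> M) f); [exact: continuous_set_val|exact: cf].
- by move=> x /formal_interior_restr; exact: hi.
move=> i j.
have e1 : rep_dom (restr_map f setT) i j = rep_dom f i j.
  apply/seteqP; split => [_ [x [/= ix jx] <-]|_ [x [/= ix jx] <-]]; first by exists (set_val x).
  by exists (SigSub (mem_set (I : [set: M] x))).
have e2 : chart_rep (restr_map f setT) i j = chart_rep f i j.
  apply/funext => y; rewrite /chart_rep; congr xget; apply/seteqP; split => [z [x [? ? ? ?]]|z [x [? ? ? ?]]].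
    by exists (set_val x).
  by exists (SigSub (mem_set (I : [set: M] x))).
by rewrite e1 e2; exact: hC.
Qed.

Lemma lgoodA_restr (T : tvsType R) (J : set T) l M N (H : T -> M -> N) (A : set M) t (x : set_type A) :
  hausdorff_space T -> nice M -> regular_set A ->
  lgoodA J l H t (set_val x) -> lgoodA J l (fun p => restr_map (H p) A) t (x : restr M A).
Proof.
move=> hT nM rA [i [j [X [I [[oX Xx Xi oI It] [h1 h2]]]]]].
have nMA := nice_restr nM rA.
pose X' : set (restr M A) := set_val @^-1` X.
have oX' : open X' by apply: open_comp => // z _; exact: continuous_set_val.
have X'i : X' `<=` dom (restr M A) i by move=> z; exact: Xi.
have X'X : chart (restr M A) i @` X' `<=` chart M i @` X by move=> _ [z Xz <-]; exists (set_val z).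
exists i, j, X', I; split; [by split|split]; first by move=> s z Js Is Xz; exact: h1.
move=> w /h2 hw; apply: (CW_ext (f := fun p => chart_rep (H p.1) i j p.2)).
- exact: (lrep_frame (a := fun _ => false) hT (fun _ => true) nMA oX' X'i oI).
- move=> [s y] [[Js Is] [z Xz /= <-]].
  by rewrite (chart_repE (f := restr_map (H s) A) nMA (X'i _ Xz) (h1 _ _ Js Is Xz)) (chart_repE nM (Xi _ Xz) (h1 _ _ Js Is Xz)).
apply: CW_sub hw.
- by move=> [s y] [/= ? hy]; split => //; exact: (interiorS X'X hy).
- by move=> [s y] [/= ? hy]; split => //; exact: X'X.
- by move=> c p.
Qed.

End restrictions.

Section whitney.
Context {R : realType}.
Variables (M N : charted_space R) (l : nat).

(** A neighbourhood in the box topology contains a product of open conditions, so that staying in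
    Omega is ensured by conditions on the relatively compact pieces one by one. *)
Lemma whitney_pieces (S Omega : set (M -> N)) (sigma : M -> N) : whitney_nbhd l S sigma Omega ->
  exists (Mn : nat -> set M) (W : forall n, set (compact_open_C l (restr M (Mn n)) N)),
  [/\ whitney_cover Mn, forall n, open (W n) /\ W n (restr_map sigma (Mn n)) &
      forall f, S f -> (forall n, W n (restr_map f (Mn n))) -> Omega f].
Proof.
move=> [_ [Mn hMn h]].
have {}h : nbhs (sigma : whitney l N Mn) (fun f => S f -> Omega f) by exact: h.
move: h; rewrite nbhsE /= => -[B [oB Bx] BX]; case: oB Bx BX => Ob oO <- Bx BX.
have [W [hW1 hW2]] := (oO : box_open Ob) _ Bx.
exists Mn, W; split => //.
by move=> f Sf hf; apply: BX => //; exact: hW2.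
Qed.

Lemma finite_bound (A : set nat) : finite_set A -> exists n0, forall n, A n -> (n < n0)%N.
Proof.
move=> /finite_seqP[s ->]; exists (\max_(i <- s) i).+1 => n /= ns.
by rewrite ltnS; exact: (@leq_bigmax_seq _ s xpredT (fun i => i) n).
Qed.

Lemma lf_compact (T : topologicalType) (F : nat -> set T) (C : set T) : compact C ->
  (forall x : T, exists2 W, nbhs x W & exists n0, forall n, (n0 <= n)%N -> forall y, W y -> ~ F n y) ->
  exists n0, forall n, (n0 <= n)%N -> forall y, C y -> ~ F n y.
Proof.
move=> cC h.
have hc : forall x : T, exists p : set T * nat, nbhs x p.1 /\ forall n, (p.2 <= n)%N -> forall y, p.1 y -> ~ F n y.
  by move=> x; have [W nW [n0 hn]] := h x; exists (W, n0).
have [W hW] := choice hc.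
have [s [_ hs]] := compact_fin_cover (U := fun x => (W x).1) cC (fun x _ => (hW x).1).
exists (\max_(x <- s) (W x).2) => n hn y Cy; have [x xs Wy] := hs _ Cy.
have [_ hx] := hW x; apply: hx => //; apply: leq_trans hn.
exact: (@leq_bigmax_seq _ s xpredT (fun x => (W x).2) x).
Qed.

End whitney.

Section smoothing_sections.
Context {R : realType}.
Variables (M N : charted_space R) (pi : N -> M) (l : nat) (sigma : M -> N).
Hypotheses (nM : nice M) (nN : nice N).
Hypothesis hsig : sections (Some l) pi sigma.

Lemma sections_family H t : section_family pi l H -> I2 t -> sections (Some l) pi (H t).
Proof.
move=> hH It; split; last by move=> x; exact: (sf_pi hH).
apply: (RC_lgoodA (@hausdorff_R R) (l := l) nM nN (sf_int hH) It) => //.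
by move=> x; exact: (sf_A hH).
Qed.

Lemma constant_family : section_family pi l (fun _ => sigma).
Proof.
have [rs ps] := hsig; have rsT := RC_restrT rs; have [_ hi _] := rs; split.
- move=> t x It.
  apply: (@lgood_cst R R^o I2 (fun _ => false) (fun _ => true) (wsT l) M N sigma t x (Some l) setT) => //; last exact: openT.
  by move=> E F D g _ _ _ hg w [n nl ->]; exact: hg.
- move=> t x Jt.
  apply: (@lgood_cst R R^o J2 negb id (wsB l) M N sigma t x (Some l) setT) => //; [by move=> _ _; exact: open_J2| |exact: openT].
  move=> E F D g hE hF rD hg w [n [k [nl ->]]].
  apply: CW_cst_dir => //.
    have [OD DO _ _ _] := frameT rD; split => //.
    + by move=> c; exact: subsp_if.
    + by move=> c; exact: closed_if.
    + by move=> c; apply: vopenT; exact: open_interior.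
  apply: (CW_subw _ _ _ (hg n nl)) => // c; rewrite mem_nseq => /andP[_ /eqP ->].
- by move=> t x _; exact: hi.
- by move=> t x _; exact: ps.
Qed.

Lemma constant_goodC t x (Y : set M) : J2 t -> open Y -> Y x -> smooth_on sigma Y -> goodC (fun _ => sigma) t x.
Proof.
move=> Jt oY Yx hY.
apply: (@lgood_cst R R^o J2 (fun _ => true) (fun _ => true) setT M N sigma t x None Y) => //; first by move=> _ _; exact: open_J2.
move=> E F D g hE hF rD hg w _; apply: (CW_constV (w := nseq (size w) true)); first by rewrite size_nseq.
exact: hg.
Qed.

Lemma smooth_on_goodC (H : R^o -> M -> N) t (Y : set M) : ipres I2 H -> J2 t -> open Y -> (forall x, Y x -> goodC H t x) ->
  smooth_on (H t) Y.
Proof.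
move=> hi Jt oY hY.
have := @RC_lgood R R^o (@hausdorff_R R) None J2 (fun _ => true) (fun _ => true) setT [::] M N H t Y nM nN.
move=> h; have [] // := h _ _ Jt I erefl _ oY hY; first by move=> _ _; exact: open_J2.
by move=> s x /J2_I2; exact: hi.
Qed.

Lemma tube_near (K : set M) (Tube : set N) (HH : R^o * R^o -> M -> N) p : compact K -> open Tube ->
  (forall p x, P2 p -> lgoodA P2 l HH p x) -> P2 p -> (forall x, K x -> Tube (HH p x)) ->
  \forall p' \near p, P2 p' -> forall x, K x -> Tube (HH p' x).
Proof.
move=> cK oT hg Pp hT; pose Q (p' : R^o * R^o) (x : M) := P2 p' -> Tube (HH p' x).
have hc : near_covering K by apply/compact_near_coveringP.
have : \forall p' \near p, K `<=` Q p'.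
  apply: (hc _ (nbhs p) Q) => x Kx.
  have hT2 : hausdorff_space (R^o * R^o)%type by apply: hausdorffX; exact: hausdorff_R.
  have w0 : wsT l [::] by exists 0%N.
  have := lgood_cvg nM nN w0 Pp (hg p x Pp).
  move=> /cvgw_near /(_ (open_nbhs_nbhs (conj oT (hT _ Kx)))) -[[B1 B2] [/= nB1 nB2] B12].
  exists (B2, B1) => //= -[y p'] [/= By Bp'] Pp'.
  by exact: (B12 (p', y)).
by apply: filterS => p' h Pp' x Kx; exact: h.
Qed.

Variables (Mn : nat -> set M) (W : forall n, set (compact_open_C l (restr M (Mn n)) N)).
Arguments W : clear implicits.
Hypotheses (hMn : whitney_cover Mn) (hW : forall n : nat, open (W n) /\ W n (restr_map sigma (Mn n))).
Variables (U B : set M).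
Hypotheses (oU : open U) (cB : closed B) (BU : B `<=` U).
Hypothesis hloc : forall (x0 : M) Y, nbhs x0 Y -> exists Lb L' Tube,
  [/\ deformable pi l Lb L' Tube, Lb `<=` Y /\ compact Lb, open L' /\ L' x0, L' `<=` Lb &
      open Tube /\ forall x, Lb x -> Tube (sigma x)].

Let lfM (x : M) : exists2 Y, nbhs x Y & exists n0, forall n, (n0 <= n)%N -> forall y, Y y -> ~ Mn n y.
Proof.
have [_ _ _ h] := hMn; have [Y nY /finite_bound[n0 hn]] := h x; exists Y => //; exists n0 => n nn y Yy My.
by have := hn n (ex_intro _ y (conj Yy My)); rewrite ltnNge nn.
Qed.

Let lfcM (x : M) : exists2 Y, nbhs x Y & exists n0, forall n, (n0 <= n)%N -> forall y, Y y -> ~ closure (Mn n) y.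
Proof.
have [Y nY [n0 hn]] := lfM x; exists Y°; first exact: nbhs_interior.
exists n0 => n nn y Yy cy; have [z [Mz Yz]] := cy _ Yy.
exact: (hn n nn z).
Qed.

Let cMn n : compact (closure (Mn n)).
Proof. by have [_ h _ _] := hMn; rewrite -precompactE; exact: h. Qed.

Let meets (m n : nat) := exists y, closure (Mn m) y /\ closure (Mn n) y.

(** Only finitely many pieces come near x, and those whose closure misses x can be avoided. A
    support chosen inside such a Y around a point x of the closure of M_n meets M_m only if the
    closures of M_m and M_n meet; this bounds the indices that interact. *)
Lemma star_nbhd (x : M) : exists2 Y, nbhs x Y & forall m y, Y y -> Mn m y -> closure (Mn m) x.
Proof.
have [Y nY [n0 hn]] := lfM x.
have h (k : nat) : exists2 Z, nbhs x Z & forall m y, (m < k)%N -> Z y -> Mn m y -> closure (Mn m) x.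
  elim: k => [|k [Z nZ hZ]]; first by exists setT => //; exact: filterT.
  have [cx|ncx] := pselect (closure (Mn k) x).
    exists Z => // m y; rewrite ltnS leq_eqVlt => /orP[/eqP -> //|mk]; exact: hZ.
  exists (Z `&` ~` closure (Mn k)).
    apply: filterI => //; apply: open_nbhs_nbhs; split => //.
    by apply: closed_openC; exact: closed_closure.
  move=> m y; rewrite ltnS leq_eqVlt => /orP[/eqP ->|mk] [Zy ny] My; last exact: (hZ m y).
  by case: ny; exact: subset_closure.
have [Z nZ hZ] := h n0; exists (Y `&` Z); first exact: filterI.
move=> m y [Yy Zy] My; have [mn|nm] := ltnP m n0; first exact: (hZ m y).
by case: (hn m nm y).
Qed.

Let item := (set M * set M * set N)%type.
Let item0 : item := (set0, set0, setT).

Let item_ok n (p : item) : Prop :=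
  [/\ deformable pi l p.1.1 p.1.2 p.2, compact p.1.1 /\ open p.1.2,
      open p.2 /\ (forall x, p.1.1 x -> p.2 (sigma x)), p.1.1 `<=` U &
      forall m y, p.1.1 y -> Mn m y -> meets m n].

(** A finite cover of the compact set [closure (Mn n)] and B by the sets L' of local deformations.
    Beyond the end of the list [nth] returns the trivial item, which is deformable as well. *)
Lemma items n : exists s : seq item, (forall a, item_ok n (nth item0 s a)) /\
  forall x, closure (Mn n) x -> B x -> exists2 a, (a < size s)%N & (nth item0 s a).1.2 x.
Proof.
have hc : forall x : M, exists p : item, (closure (Mn n) `&` B) x -> item_ok n p /\ p.1.2 x.
  move=> x; have [[Mx Bx]|nx] := pselect ((closure (Mn n) `&` B) x); last by exists item0.
  have [Y nY hY] := star_nbhd x.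
  have nU : nbhs x U by apply: open_nbhs_nbhs; split => //; exact: BU.
  have [Lb [L' [Tube [h1 [h2 h3] [h4 h5] h6 [h7 h8]]]]] := hloc (filterI nY nU).
  exists (Lb, L', Tube) => _; split => //; split => //=; first by move=> y /h2[].
  by move=> m y Ly My; exists x; split => //; apply: (hY m y) => //; have [] := h2 _ Ly.
have [f hf] := choice hc.
have cK : compact (closure (Mn n) `&` B) by exact: compact_closedI.
have hn x : (closure (Mn n) `&` B) x -> nbhs x (f x).1.2.
  by move=> /hf[[_ [_ opx] _ _ _] h]; exact: open_nbhs_nbhs.
have [s [sK hs]] := compact_fin_cover (U := fun x => (f x).1.2) cK hn.
exists (map f s); split.
  move=> a; have [sa|sa] := ltnP a (size s).
    case: s sK hs sa => [//|x0 s] sK hs sa.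
    by rewrite (nth_map x0)//; have [] := hf (nth x0 (x0 :: s) a) (sK _ (mem_nth _ sa)).
  rewrite nth_default ?size_map//; split => //.
  - exact: deformable0.
  - by split; [exact: compact0|exact: open0].
  - by split => //; exact: openT.
move=> x Mx Bx; have [y ys fy] := hs x (conj Mx Bx).
exists (index y s); first by rewrite size_map index_mem.
by rewrite (nth_map y) ?index_mem// nth_index.
Qed.

Lemma smoothing_family : exists (H : R^o -> M -> N) (L : set M),
  [/\ section_family pi l H,
      forall t, I2 t -> forall n, W n (restr_map (H t) (Mn n)),
      forall t x, I2 t -> ~ U x -> H t x = sigma x, H 0 = sigma &
      [/\ open L, B `<=` L & forall t x, J2 t -> goodC (fun _ => sigma) t x \/ L x -> goodC H t x]].
Proof.
have [s hs] := choice items.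
(* All pairs (n, a) are enumerated through their codes; a code of no pair, or of a pair beyond the
   end of a list, gives the trivial item with empty support. *)
pose it k : item := if @pickle_inv (nat * nat)%type k is Some na then nth item0 (s na.1) na.2 else item0.
have itok k : (exists na, it k = nth item0 (s na.1) na.2 /\ (na.2 < size (s na.1))%N /\ k = choice.pickle na) \/ it k = item0.
  rewrite /it; case: pickle_inv (@pickle_invK (nat * nat)%type k) => [na /= e|_]; last by right.
  have [h|h] := ltnP na.2 (size (s na.1)); last by right; rewrite nth_default.
  by left; exists na.
have it_ok k : exists n, item_ok n (it k).
  case: (itok k) => [[na [-> _]]|->]; first by exists na.1; exact: (hs na.1).1.
  by exists 0%N; have := (hs 0%N).1 (size (s 0%N)); rewrite nth_default.
pose Lb k := (it k).1.1; pose L' k := (it k).1.2; pose Tube k := (it k).2.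
have cLb k : compact (Lb k) by have [n [_ []]] := it_ok k.
have oTube k : open (Tube k) by have [n [_ _ []]] := it_ok k.
have LbU k : Lb k `<=` U by have [n [_ _ _]] := it_ok k.
have [rMn _ covM _] := hMn.
have hb : forall m : nat, exists b, forall n, (b <= n)%N -> ~ meets m n.
  move=> m; have [b hb] := lf_compact (@cMn m) lfcM; exists b => n bn [y [y1 y2]].
  exact: (hb n bn y).
have [b {}hb] := choice hb.
have lfL : forall x : M, exists2 Y, nbhs x Y & exists n0, forall k, (n0 <= k)%N -> forall y, Y y -> ~ Lb k y.
  move=> x; have [Y nY [n1 hn1]] := lfM x; exists Y => //.
  (* A support through y in Y belongs to a list n such that the closures of M_n and of some M_m
     containing y meet. Then m < n1 and so n < bm, and only finitely many codes remain. *)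
  pose bm := (\max_(m < n1) b m)%N.
  exists (\max_(n < bm) \max_(a < size (s n)) choice.pickle (n : nat, a : nat)).+1 => k hk y Yy Ly.
  case: (itok k) => [[[n a] /= [e [sa ek]]]|e]; last by move: Ly; rewrite /Lb e.
  have [m [_ My]] : exists m, True /\ Mn m y.
    have : (\bigcup_n (Mn n)°) y by rewrite covM.
    by move=> [m _ /interior_subset My]; exists m.
  have mn1 : (m < n1)%N by rewrite ltnNge; apply/negP => h; exact: (hn1 m h y).
  have [_ _ _ _ hmeet] := (hs n).1 a; rewrite -e in hmeet.
  have nb : (n < bm)%N.
    rewrite ltnNge; apply/negP => h; apply: (hb m n) (hmeet m y Ly My).
    by apply: leq_trans h; exact: (@leq_bigmax_cond _ xpredT (fun m : 'I_n1 => b m) (Ordinal mn1)).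
  move: hk; rewrite ltnNge => /negP; apply; rewrite ek.
  apply: leq_trans (@leq_bigmax_cond _ xpredT (fun n : 'I_bm => \max_(a < size (s n)) choice.pickle (n : nat, a : nat))%N (Ordinal nb) erefl).
  exact: (@leq_bigmax_cond _ xpredT (fun a : 'I_(size (s n)) => choice.pickle (n, a : nat)) (Ordinal sa)).
pose Sp n := Mn n `|` Lb n.
(* Besides the condition on M_n that ensures membership in Omega, [Q n] keeps the family in the tube
   over Lb n, so that the n-th deformation is still applicable after the earlier ones. *)
pose Q n (f : M -> N) := W n (restr_map f (Mn n)) /\ forall x, Lb n x -> Tube n (f x).
have [H [[hH hQ] h1 h2 h3]] : exists H, [/\ admissible pi l Q H,
    forall t x, I2 t -> (forall n, ~ Lb n x) -> H t x = sigma x, forall x, H 0 x = sigma x &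
    forall t x, J2 t -> goodC (fun _ => sigma) t x \/ (exists n, L' n x) -> goodC H t x].
  apply: (global_family nM (Lb := Lb) (L' := L') (Tube := Tube) (Q := Q) (Sp := Sp) _ _ _ _ _ _ _ (H0 := fun _ => sigma)) => //.
  - by move=> n; have [m []] := it_ok n.
  - move=> n; have [n1 hn1] := lf_compact (@cMn n) lfL; have [n2 hn2] := lf_compact (cLb n) lfL.
    exists (maxn n1 n2) => k; rewrite geq_max => /andP[k1 k2] y [My|Ly]; last exact: hn2.
    by apply: hn1 => //; exact: subset_closure.
  - move=> k; have [n1 hn1] := lf_compact (cLb k) lfM; have [n2 hn2] := lf_compact (cLb k) lfL.
    exists (maxn n1 n2) => n; rewrite geq_max => /andP[k1 k2] y Ly [My|Ly'].
      exact: (hn1 n k1 y).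
    exact: (hn2 n k2 y).
  - move=> n f f' e [w t]; split; last by move=> x Lx; rewrite -e; [exact: t|right].
    have -> : restr_map f' (Mn n) = restr_map f (Mn n); last exact: w.
    by apply/funext => x; rewrite /restr_map e//; left; exact: (set_valP x).
  - move=> n HH p hi hg Pp [w t].
    have hT2 : hausdorff_space (R^o * R^o)%type by apply: hausdorffX; exact: hausdorff_R.
    have nMn := nice_restr nM (rMn n).
    have n1 : \forall p' \near p, P2 p' -> W n (restr_map (HH p') (Mn n)).
      apply: (family_compact_open hT2 (l := l) (H := fun p' => restr_map (HH p') (Mn n) : restr M (Mn n) -> N) nMn nN) => //.
      + by move=> p' x Pp' /formal_interior_restr; exact: hi.
      + by move=> p' x Pp'; apply: lgoodA_restr => //; exact: hg.
      + by apply: open_nbhs_nbhs; split => //; have [] := hW n.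
    have n2 := tube_near (cLb n) (oTube n) hg Pp t.
    by apply: filterS2 n1 n2 => p' p1 p2 Pp'; split; [exact: p1|exact: p2].
  - by move=> n f [_].
  - split; first exact: constant_family.
    move=> n t _; split; first by have [] := hW n.
    by have [m [_ _ [_]]] := it_ok n.
exists H, (\bigcup_n L' n); split => //.
- by move=> t It n; have [] := hQ n t It.
- by move=> t x It nU; apply: h1 => // n /LbU.
- by apply/funext => x; exact: h2.
- split.
  + by apply: bigcup_open => k _; have [n [_ []]] := it_ok k.
  + move=> x Bx; have : (\bigcup_n (Mn n)°) x by rewrite covM.
    move=> [n _ /interior_subset Mx].
    have [a sa ax] := (hs n).2 x (subset_closure Mx) Bx.
    by exists (choice.pickle (n, a)) => //; rewrite /L' /it pickleK_inv.
  + by move=> t x Jt [g|[n _ L'x]]; apply: h3 => //; [left|right; exists n].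
Qed.

End smoothing_sections.

Theorem theorem1p18 (R : realType) (l : nat) (M N : charted_space R)
    (pi : N -> M) (sigma : M -> N) (Omega : set (M -> N)) (U A : set M)
    (hM : if l == 0%N then rough_manifold None M else manifold_with_corners M)
    (hMs : sigma_compact M)
    (hMl : locally_compact [set: M])
    (hpi : smooth_fibre_bundle pi)
    (hsigma : sections (Some l) pi sigma)
    (hOmega : whitney_nbhd l (sections (Some l) pi) sigma Omega)
    (hU : open U)
    (hA : closed A)
    (hAU : exists V : set M, [/\ open V, A `\` U `<=` V & smooth_on sigma V]) :
  let Vreg := smooth_locus sigma in
  let I01 : set R := `[0, 1]%classic in
  let J01 : set R := `]0, 1]%classic in
  exists (tau : M -> N) (H : R -> M -> N) (W : set M),
    Omega tau /\
    {within I01 `*` [set: M], continuous (fun p : R * M => H p.1 p.2)} /\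
    H 0 = sigma /\ H 1 = tau /\
    (forall t, I01 t -> Omega (H t)) /\
    (forall t, I01 t -> forall x, ~ U x -> H t x = sigma x) /\
    (forall t, I01 t -> smooth_on (H t) Vreg) /\
    (open W /\ A `<=` W /\ forall t, J01 t -> smooth_on (H t) W) /\
    RC2 (Some 0%N) (Some l)
      (fun p : restr (real_line R) I01 * M => H (set_val p.1) p.2) /\
    RC2 None (Some l)
      (fun p : restr (real_line R) J01 * M => H (set_val p.1) p.2) /\
    RC None
      (fun p : prod_space (restr (real_line R) J01) (restr M (Vreg `|` W)) =>
         H (set_val p.1) (set_val p.2)).
Proof.
move=> Vreg I01 J01.
have rM : rough_manifold None M by case: (l == 0%N) hM => // -[].
have nM := nice_of_rough rM; have [hausM _ _ _ _] := rM.
have [rN _ _ _] := hpi; have nN := nice_of_rough rN.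
have [[csig _ _] psig] := hsigma.
have [V [oV AV hV]] := hAU.
have [Mn [W [hMn hW hOm]]] := whitney_pieces hOmega.
have hwin i y0 P (C P' : set (model M i)) : chart_im M i y0 -> nbhs y0 P ->
    compact C -> C `<=` chart_im M i `&` P -> open P' -> P' y0 -> chart_im M i `&` P' `<=` C ->
    window l (chart_im M i) y0 P.
  (* The alternative on M decides the operators: partitions of unity for l = 0, Bernstein operators
     at corners for l > 0. *)
  move=> Vy nP cC CP oP' Py PC; move: hM; case: (l =P 0%N) => [->|_] hM'.
    exact: (compact_window (@n_hmod _ _ nM i) (@n_reg _ _ nM i) Vy cC CP oP' Py PC).
  by apply: corner_window => //; have [_] := hM'.
(* Where A meets V the section is already smooth. What remains to be treated is closed and contained
   in U, so all supports can be kept inside U. *)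
have cB : closed (A `\` V) by apply: closedI => //; exact: open_closedC.
have BU : A `\` V `<=` U by move=> x [Ax nVx]; have [//|nU] := pselect (U x); case: nVx; apply: AV.
have [H [L [hH hQ hHU hH0 [oL BL hC]]]] := smoothing_family nM nN hsigma hMn hW hU cB BU
  (fun x0 Y nY => locally_deformable nM nN hpi hausM csig psig hwin hMl nY).
have II t : I01 t -> @I2 R t by rewrite /I01 /I2 /= in_itv /= => /andP[h1 h2]; apply/andP; split => //; lra.
have JJ t : J01 t -> @J2 R t by rewrite /J01 /J2 /= in_itv /= => /andP[h1 h2]; apply/andP; split => //; lra.
have JI t : J01 t -> I01 t by rewrite /J01 /I01 /= !in_itv /= => /andP[/ltW -> ->].
have I1 : I01 1 by rewrite /I01 /= in_itv /= ler01 lexx.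
have OmH t : I01 t -> Omega (H t).
  by move=> It; apply: hOm; [exact: (sections_family nM nN hH (II _ It))|move=> n; exact: hQ (II _ It) n].
have oVreg : open Vreg by apply: bigcup_open => Y [].
have VregC t x : J2 t -> Vreg x -> goodC H t x.
  move=> Jt [Y [oY hY] Yx]; apply: hC => //; left.
  exact: (constant_goodC nM nN Jt oY Yx hY).
have LC t x : J2 t -> L x -> goodC H t x by move=> Jt Lx; apply: hC => //; right.
have VVreg : V `<=` Vreg by move=> x Vx; exists V.
have J21 : @J2 R 1 by rewrite /J2 /= ltr01 /=; lra.
have smH t Y : J2 t -> open Y -> (forall x, Y x -> goodC H t x) -> smooth_on (H t) Y.
  by move=> Jt oY hY; exact: (smooth_on_goodC nM nN (sf_int hH) Jt oY hY).
(* At t = 0 condition (b) concerns sigma itself. Its smoothness on the union [Vreg] is obtained by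
   gluing, with sigma viewed as a constant family. *)
have smsig : smooth_on sigma Vreg.
  apply: (smooth_on_goodC (H := fun _ => sigma) nM nN (sf_int (constant_family nM nN hsigma)) J21 oVreg).
  by move=> x [Y [oY hY] Yx]; exact: (constant_goodC nM nN J21 oY Yx hY).
have oW : open (V `|` L) by exact: openU.
have VLC t x : J2 t -> (V `|` L) x -> goodC H t x.
  by move=> Jt [/VVreg|]; [exact: VregC|exact: LC].
(* W consists of V, where the smoothness of sigma is preserved, and of L, where smoothness is
   created. *)
exists (H 1), H, (V `|` L); split; first exact: OmH.
split.
  apply/subspace_continuousP => -[t x] [/= It _].
  have w0 : wsT l [::] by exists 0%N.
  have h := lgood_cvg nM nN w0 (II _ It) (sf_A hH x (II _ It)).
  move=> B nB; have hn := cvgw_near h nB.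
  suff : nbhs (t, x) [set p | (I01 `*` [set: M]) p -> B (H p.1 p.2)] by [].
  by apply: filterS hn => -[s y] hB [/= Is _]; apply: hB; split => //; exact: II.
split; first exact: hH0.
split; first by [].
split; first exact: OmH.
split; first by move=> t It x nU; apply: hHU => //; exact: II.
split.
  move=> t; rewrite /I01 /= in_itv /= => /andP[]; rewrite le_eqVlt => /orP[/eqP <- _|t0 t1].
    by rewrite hH0.
  have Jt : J01 t by rewrite /J01 /= in_itv /= t0.
  by apply: smH => //; [exact: JJ|move=> x; apply: VregC; exact: JJ].
split.
  split => //; split; last by move=> t Jt; apply: smH => //; [exact: JJ|move=> x; apply: VLC; exact: JJ].
  by move=> x Ax; have [Vx|nV] := pselect (V x); [left|right; exact: BL].
split.
  apply: (@RC2_lgood R (Some 0%N) (Some l) I2 (fun _ => false) (fun _ => true) (wsT l) [::] I01 M N H) => //.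
  - exact: (sf_int hH).
  - by exists 0%N.
  - exact: regular_cint.
  - by move=> n m; rewrite /= leqn0 => /eqP -> nl; exists n => //; rewrite cats0.
  - by move=> [|m].
  - by move=> t x It; apply: (sf_A hH); exact: II.
split.
  apply: (@RC2_lgood R None (Some l) J2 negb id (wsB l) [::] J01 M N H) => //.
  - by move=> _ _; exact: open_J2.
  - by move=> t x /J2_I2; exact: (sf_int hH).
  - by exists 0%N, 0%N.
  - exact: regular_ocint.
  - by move=> n m _ nl; exists n, m.
  - by move=> t x Jt; apply: (sf_B hH); exact: JJ.
apply: (@RC_prod_lgood R J2 J01 M N (Vreg `|` (V `|` L)) H) => //.
- exact: open_J2.
- by move=> t x /J2_I2; exact: (sf_int hH).
- exact: regular_ocint.
- exact: openU.
- by move=> t x Jt [Vx|Wx]; [apply: VregC|apply: VLC] => //; exact: JJ.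
Qed.
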